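(* Let $\underline{\mathcal F}$ be an abelian $\tau$-sheaf over $\mathbb F_s$ of characteristic different from $\infty$ (i.e. $\varepsilon\neq\infty$). If $\underline{\mathcal F}$ is semisimple, then $\underline{\mathcal F}\otimes_{\mathbb F_s}\mathbb F_{s'}$ is semisimple for every finite field extension $\mathbb F_{s'}/\mathbb F_s$. The same is true for pure Anderson motives: if $\underline M$ is a semisimple pure Anderson motive over $\mathbb F_s$, then $\underline M\otimes_{\mathbb F_s}\mathbb F_{s'}$ is semisimple for every finite extension $\mathbb F_{s'}/\mathbb F_s$.
   Context: Setting. $C$ is a smooth projective geometrically irreducible curve over the finite field $\mathbb F_q$, $\infty\in C(\mathbb F_q)$ a fixed point, $A=\Gamma(C\setminus\{\infty\},\mathcal O_C)$, $Q=\mathrm{Quot}(A)$. For a field $L\supset\mathbb F_q$: $C_L=C\times_{\mathbb F_q}L$, $A_L=A\otimes_{\mathbb F_q}L$, $\sigma=\mathrm{id}_C\times\mathrm{Spec}(\mathrm{Frob}_q)$ on $C_L$ ($\mathrm{Frob}_q:x\mapsto x^q$ on $L$), $\sigma^*$ the induced endomorphism $a\otimes b\mapsto a\otimes b^q$ of $A_L$, and $\sigma^*M=M\otimes_{A_L,\sigma^*}A_L$ for an $A_L$-module $M$. Abelian $\tau$-sheaves. Fix a morphism $c:\mathrm{Spec}\,L\to C$; let $\mathcal J$ be the ideal sheaf on $C_L$ of the graph of $c$, and $\varepsilon=c(\mathrm{Spec}\,L)\in C$ the characteristic point. An abelian $\tau$-sheaf $\underline{\mathcal F}=(\mathcal F_i,\Pi_i,\tau_i)_{i\in\mathbb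 Z}$ of rank $r$, dimension $d$ and characteristic $c$ over $L$ consists of locally free sheaves $\mathcal F_i$ of rank $r$ on $C_L$ and injective $\mathcal O_{C_L}$-morphisms $\Pi_i:\mathcal F_i\to\mathcal F_{i+1}$, $\tau_i:\sigma^*\mathcal F_i\to\mathcal F_{i+1}$ such that $\Pi_{i+1}\circ\tau_i=\tau_{i+1}\circ\sigma^*\Pi_i$; there are integers $k,l>0$ with $ld=kr$ such that $\Pi_{i+l-1}\circ\cdots\circ\Pi_i$ identifies $\mathcal F_i$ with $\mathcal F_{i+l}(-k\cdot\infty)\subset\mathcal F_{i+l}$ for all $i$; $\mathrm{coker}\,\Pi_i$ has $L$-dimension $d$; $\mathrm{coker}\,\tau_i$ has $L$-dimension $d$ and is annihilated by $\mathcal J^d$. A morphism $f:\underline{\mathcal F}\to\underline{\mathcal F}'$ (same characteristic) is a family $f_i:\mathcal F_i\to\mathcal F'_i$ commuting with the $\Pi$'s and $\tau$'s; it is surjective (injective) if all $f_i$ are; it is an isogeny if it is injective and both sides have the same rank and dimension. $\underline{\mathcal F}(D)$ is obtained by tensoring with $\mathcal O(D)$, for a divisor $D$ on $C$. A quasi-isogeny $\underline{\mathcal F}\to\underline{\mathcal F}'$ is an isogeny $\underline{\mathcal F}\to\underline{\mathcal F}'(D)$ for some effective divisor $D$. Pure Anderson motives. Fix an $\mathbb F_q$-homomorphism $c^*:A\to L$ and let $J=(a\otimes1-1\otimes c^*(a):a\in A)\subset A_L$. A pure Anderson motive $\underline M=(M,\tau)$ of rank $r$, dimension $d$ and characteristic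 $c^*$ over $L$ is a locally free $A_L$-module $M$ of rank $r$ with an injective $A_L$-homomorphism $\tau:\sigma^*M\to M$ such that $\mathrm{coker}\,\tau$ has $L$-dimension $d$ and is annihilated by $J^d$, and $M$ extends to a locally free sheaf $\mathcal M$ of rank $r$ on $C_L$ such that for some integers $k,l>0$ the map $\tau^l=\tau\circ\sigma^*\tau\circ\cdots\circ(\sigma^* )^{l-1}\tau$ induces an isomorphism of stalks $(\sigma^* )^l\mathcal M_\infty\to\mathcal M(k\cdot\infty)_\infty$. Morphisms are $A_L$-homomorphisms $f:M\to M'$ with $f\circ\tau=\tau'\circ\sigma^*f$. A quasi-isogeny is an element of $\mathrm{Hom}(\underline M,\underline M')\otimes_AQ$ that has an inverse in $\mathrm{Hom}(\underline M',\underline M)\otimes_AQ$. For both kinds of objects: factor objects are targets of surjective morphisms; an object is simple if it is non-zero and has no factor objects other than $0$ and itself (up to isomorphism); it is semisimple if it is quasi-isogenous to a finite direct sum of simple objects. For a field extension $L'/L$, base change $\otimes_LL'$ is pullback of all data along $C_{L'}\to C_L$ (resp. $A_L\to A_{L'}$). *)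

(* Defs.v *)
From HB Require Import structures.
From mathcomp Require Import all_boot all_order all_algebra.
From mathcomp Require Import boolp classical_sets functions cardinality.

Set Implicit Arguments.
Unset Strict Implicit.
Unset Printing Implicit Defensive.

Import Order.TTheory GRing.Theory Num.Theory.

Local Open Scope classical_set_scope.
Local Open Scope ring_scope.

(* A regular projective curve X over a field F is given by its function field
  E.  Its points are the valuation rings of E containing F: a point is
  identified with its local ring inside E, the generic point being E itself.
  The nonempty open subsets are the complements of finite sets of closed
  points.  If phi : E -> E' is the map of function fields induced by a
  dominant morphism X' -> X, then the point P of X' is sent to phi @^-1` P.

  A locally free sheaf of rank r on X is regarded as a subsheaf of its
  (constant) sheaf of rational sections, for which an E-basis is chosen.  So it
  is a family of P-submodules of E^r, the stalks, indexed by the closed points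
  P, and the sections over an open U are the elements of E^r lying in the
  stalks at all P in U.  An O_X-linear map between two such sheaves is then a
  matrix over E carrying stalks into stalks.  Matrices act on row vectors on
  the right, so the product f *m g stands for the composite "f, then g".
  Likewise a locally free module over a domain with fraction field E is
  regarded as a submodule of E^r. *)

Section Modules.
Variable E : fieldType.

Definition lspan (V : lmodType E) (R : set E) (S : set V) : set V :=
  [set v | exists n (a : 'I_n -> E) (s : 'I_n -> V),
     (forall i, R (a i) /\ S (s i)) /\ v = \sum_i a i *: s i].

Definition ideal_span (R S : set E) : set E := lspan (V := E^o) R S.

Definition submodule (V : lmodType E) (R : set E) (M : set V) : Prop :=
  [/\ M 0,
      (forall u v, M u -> M v -> M (u + v)) &
      (forall a v, R a -> M v -> M (a *: v))].

Definition free_on (R : set E) r (B : 'M[E]_r) : set 'rV[E]_r :=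
  [set v | exists2 a : 'rV[E]_r, (forall j, R (a 0 j)) & v = a *m B].

Definition mximg r r' (f : 'M[E]_(r, r')) (S : set 'rV[E]_r) :
  set 'rV[E]_r' := (fun v => v *m f) @` S.

Definition mxinj_on r r' (f : 'M[E]_(r, r')) (S : set 'rV[E]_r) : Prop :=
  forall v, S v -> v *m f = 0 -> v = 0.

(* J ^ d kills W / V, for W a module and V a submodule of it *)
Definition power_kills (V : lmodType E) (J : set E) (d : nat) (W0 W : set V) :
  Prop :=
  forall (x : 'I_d -> E) (v : V),
    (forall i, J (x i)) -> W v -> W0 ((\prod_i x i) *: v).

(* M is a locally free R-module of rank r: the localisations M_f, for f in a
   finite family generating the unit ideal of R, are free of rank r over R_f *)
Definition locally_free_module (R : set E) r (M : set 'rV[E]_r) : Prop :=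
  submodule R M /\
  exists n (f : 'I_n -> E),
    [/\ forall i, R (f i),
        (exists2 a : 'I_n -> E, forall i, R (a i) & \sum_i a i * f i = 1) &
        forall i, exists2 B : 'M[E]_r, B \in unitmx &
          forall v : 'rV[E]_r,
            (exists m : nat, M (f i ^+ m *: v)) <->
            (exists m : nat, free_on R B (f i ^+ m *: v))].

End Modules.

Section Points.
Variables (F E : fieldType) (iota : {rmorphism F -> E}).

Definition curve_point (P : set E) : Prop :=
  [/\ forall a, P (iota a),
      (forall x y, P x -> P y -> P (x - y)),
      (forall x y, P x -> P y -> P (x * y)) &
      (forall x, P x \/ P x^-1)].

Definition closed_point (P : set E) : Prop := curve_point P /\ exists x, ~ P x.

Definition max_ideal (P : set E) : set E :=
  [set x | P x /\ (x = 0 \/ ~ P x^-1)].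

Definition uniformizer (P : set E) (t : E) : Prop :=
  [/\ max_ideal P t, t != 0 & forall x, max_ideal P x -> P (x / t)].

Definition rational_point (P : set E) : Prop :=
  closed_point P /\ forall x, P x -> exists a, max_ideal P (x - iota a).

(* E / F is finitely generated of transcendence degree 1 *)
Definition is_function_field : Prop :=
  exists x : E,
    (forall p : {poly F}, (map_poly iota p).[x] = 0 -> p = 0) /\
    exists n (b : 'I_n -> E), forall y : E,
      exists (den : {poly F}) (num : 'I_n -> {poly F}),
        den != 0 /\
        y * (map_poly iota den).[x] =
          \sum_i (map_poly iota (num i)).[x] * b i.

Definition exact_constants : Prop :=
  forall (y : E) (p : {poly F}), p != 0 -> (map_poly iota p).[y] = 0 ->
    exists a, y = iota a.

Definition sheaf r := set E -> set 'rV[E]_r.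

Definition locally_free r (M : sheaf r) : Prop :=
  forall P, closed_point P ->
    exists (U : set (set E)) (B : 'M[E]_r),
      [/\ U P, finite_set [set Q | closed_point Q /\ ~ U Q],
          B \in unitmx &
          forall Q, closed_point Q -> U Q -> M Q = free_on Q B].

Definition sheaf_hom r r' (M : sheaf r) (M' : sheaf r') (f : 'M[E]_(r, r')) :
  Prop := forall P, closed_point P -> mximg f (M P) `<=` M' P.

Definition sheaf_inj r r' (M : sheaf r) (f : 'M[E]_(r, r')) : Prop :=
  forall P, closed_point P -> mxinj_on f (M P).

Definition sheaf_image_eq r r' (M : sheaf r) (M' : sheaf r')
  (f : 'M[E]_(r, r')) : Prop :=
  forall P, closed_point P -> mximg f (M P) = M' P.

(* the F-vector space W / W0 has dimension d *)
Definition has_codim (V : lmodType E) (W0 W : set V) (d : nat) : Prop :=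
  exists w : 'I_d -> V,
    [/\ forall i, W (w i),
        (forall v, W v ->
           exists a : 'I_d -> F, W0 (v - \sum_i iota (a i) *: w i)) &
        (forall a : 'I_d -> F,
           W0 (\sum_i iota (a i) *: w i) -> forall i, a i = 0)].

(* the cokernel of f : M -> M' is a torsion sheaf; its F-dimension is the sum
   of the dimensions of its stalks, which vanish outside of the P j *)
Definition sheaf_coker_dim r r' (M : sheaf r) (M' : sheaf r')
  (f : 'M[E]_(r, r')) (d : nat) : Prop :=
  exists n (P : 'I_n -> set E) (m : 'I_n -> nat),
    [/\ injective P,
        (forall j, closed_point (P j) /\
           has_codim (mximg f (M (P j))) (M' (P j)) (m j)),
        (forall Q, closed_point Q -> (forall j, Q <> P j) ->
           mximg f (M Q) = M' Q) &
        d = (\sum_j m j)%N].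

End Points.

(* Pullback along the morphism of curves inducing phi on function fields; for
   M locally free, the stalk at P of the pullback, M_(phi @^-1` P) (x) P, is
   the P-submodule of E'^r generated by the image of M_(phi @^-1` P) *)
Definition pullback (E E' : fieldType) (phi : {rmorphism E -> E'}) r
  (M : sheaf E r) : sheaf E' r :=
  fun P => lspan P (map_mx phi @` M (phi @^-1` P)).

(* M (x)_{R, phi} R', where phi maps R into R' *)
Definition extend_scalars (E E' : fieldType) (phi : {rmorphism E -> E'})
  (R' : set E') r (M : set 'rV[E]_r) : set 'rV[E']_r :=
  lspan R' (map_mx phi @` M).

(* exact_constants expresses that C is geometrically irreducible; as k is
   perfect, regular and smooth mean the same *)
Record curve (k : fieldType) := Curve {
  Q_of :> fieldType;
  const : {rmorphism k -> Q_of};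
  curve_function_field : is_function_field const;
  curve_exact_constants : exact_constants const;
  oo : set Q_of;
  oo_rational : rational_point const oo }.

Arguments oo {k c}.
Arguments const {k c}.

(* The function field of C_L = C x_k L for L / k finite is Q (x)_k L; the
   fields fun_gen and fun_disj say that Q (x)_k L -> fun_L is bijective.
   sigma is the comorphism of id_C x Spec(Frob_q). *)
Record base_curve (k : finFieldType) (C : curve k) (L : finFieldType) :=
  BaseCurve {
  fun_L :> fieldType;
  iL : {rmorphism k -> L};
  jQ : {rmorphism C -> fun_L};
  jL : {rmorphism L -> fun_L};
  fun_comm : forall a, jQ (const a) = jL (iL a);
  fun_gen : forall y, exists n (x : 'I_n -> C) (b : 'I_n -> L),
    y = \sum_i jQ (x i) * jL (b i);
  fun_disj : forall n (b : 'I_n -> L),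
    (forall a : 'I_n -> k, \sum_i iL (a i) * b i = 0 -> forall i, a i = 0) ->
    forall x : 'I_n -> C, \sum_i jQ (x i) * jL (b i) = 0 ->
      forall i, x i = 0;
  sigma : {rmorphism fun_L -> fun_L};
  sigma_Q : forall x, sigma (jQ x) = jQ x;
  sigma_L : forall b, sigma (jL b) = jL (b ^+ #|k|) }.

Arguments iL {k C L}.
Arguments jQ {k C L}.
Arguments jL {k C L}.
Arguments sigma {k C L}.

Record base_ext (k : finFieldType) (C : curve k) (L L' : finFieldType)
  (X : base_curve C L) (X' : base_curve C L') := BaseExt {
  ext_L : {rmorphism L -> L'};
  ext_L_k : forall a, ext_L (iL X a) = iL X' a;
  ext_fun : {rmorphism X -> X'};
  ext_fun_Q : forall x, ext_fun (jQ X x) = jQ X' x;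
  ext_fun_L : forall b, ext_fun (jL X b) = jL X' (ext_L b) }.

Section Setting.
Variables (k : finFieldType) (C : curve k).

Definition ring_A : set C :=
  [set x | forall P, closed_point (@const k C) P -> P <> oo -> P x].

Definition divisor (D : set C -> int) : Prop :=
  finite_set [set P | closed_point (@const k C) P /\ D P <> 0].

Definition effective (D : set C -> int) : Prop :=
  forall P, closed_point (@const k C) P -> 0 <= D P.

Definition div_oo (m : int) : set C -> int :=
  fun P => if `[< P = oo >] then m else 0.

(* the stalk at P of O_C(D), with sections of valuation >= - D P *)
Definition O_div (D : set C -> int) (P : set C) : set C :=
  [set x | exists t u, [/\ uniformizer P t, P u & x = u * t ^ (- D P)]].

Variables (L : finFieldType) (X : base_curve C L).

Let cl (P : set X) := closed_point (jL X) P.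

Definition over_oo (P : set X) : Prop := jQ X @^-1` P = oo.

Definition ring_AL : set X :=
  ideal_span (range (jL X)) (jQ X @` ring_A).

Definition twist (D : set C -> int) r (M : sheaf X r) : sheaf X r :=
  fun P => lspan P
    [set w | exists x v,
       [/\ O_div D (jQ X @^-1` P) x, M P v & w = jQ X x *: v]].

(* c is a homomorphism of k-algebras on the subring R of Q; its values outside
   of R are irrelevant *)
Definition hom_on (R : set C) (c : C -> L) : Prop :=
  [/\ forall a, c (const a) = iL X a,
      (forall x y, R x -> R y -> c (x - y) = c x - c y) &
      (forall x y, R x -> R y -> c (x * y) = c x * c y)].

(* A k-morphism Spec L -> C is a point eps with a local homomorphism of its
   local ring to L *)
Definition sheaf_char (eps : set C) (c : C -> L) : Prop :=
  [/\ curve_point (@const k C) eps, hom_on eps c &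
      forall x, eps x -> c x = 0 -> max_ideal eps x].

Definition graph_gens (R : set C) (c : C -> L) : set X :=
  [set y | exists2 x, R x & y = jQ X x - jL X (c x)].

(* The ideal sheaf of the graph of (eps, c): over an affine open Spec B of C
   containing eps it is generated by the b (x) 1 - 1 (x) c(b), b in B, and
   outside of the fibre over eps it is the structure sheaf *)
Definition graph_ideal (eps : set C) (c : C -> L) (P : set X) : set X :=
  [set y | P y /\
     (jQ X @^-1` P = eps -> ideal_span P (graph_gens eps c) y)].

Definition motive_char (c : C -> L) : Prop := hom_on ring_A c.

Definition motive_ideal (c : C -> L) : set X :=
  ideal_span ring_AL (graph_gens ring_A c).

Record tsheaf := TSheaf {
  ts_rk : nat;
  ts_dim : nat;
  ts_F : int -> sheaf X ts_rk;
  ts_Pi : int -> 'M[X]_ts_rk;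
  ts_tau : int -> 'M[X]_ts_rk }.

Arguments ts_F : clear implicits.
Arguments ts_Pi : clear implicits.
Arguments ts_tau : clear implicits.

Fixpoint Pi_comp (F : tsheaf) (i : int) (l : nat) : 'M[X]_(ts_rk F) :=
  if l is l'.+1 then Pi_comp F i l' *m ts_Pi F (i + l'%:Z) else 1%:M.

Definition abelian_tsheaf (eps : set C) (c : C -> L) (F : tsheaf) : Prop :=
  let r := ts_rk F in let d := ts_dim F in
  let sF i := pullback (sigma X) (ts_F F i) in
  [/\ forall i, locally_free (jL X) (ts_F F i),
      forall i,
        [/\ sheaf_hom (jL X) (ts_F F i) (ts_F F (i + 1)) (ts_Pi F i),
            sheaf_inj (jL X) (ts_F F i) (ts_Pi F i),
            sheaf_hom (jL X) (sF i) (ts_F F (i + 1)) (ts_tau F i),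
            sheaf_inj (jL X) (sF i) (ts_tau F i) &
            ts_tau F i *m ts_Pi F (i + 1) =
              map_mx (sigma X) (ts_Pi F i) *m ts_tau F (i + 1)],
      (exists m l : nat,
        [/\ (0 < m)%N, (0 < l)%N, (l * d = m * r)%N &
            forall i,
              sheaf_image_eq (jL X) (ts_F F i)
                (twist (div_oo (- m%:Z)) (ts_F F (i + l%:Z)))
                (Pi_comp F i l)]),
      (forall i,
        sheaf_coker_dim (jL X) (ts_F F i) (ts_F F (i + 1)) (ts_Pi F i) d) &
      (forall i,
        sheaf_coker_dim (jL X) (sF i) (ts_F F (i + 1)) (ts_tau F i) d /\
        forall P, cl P ->
          power_kills (graph_ideal eps c P) d
            (mximg (ts_tau F i) (sF i P)) (ts_F F (i + 1) P))].

Definition ts_hom (F G : tsheaf) (f : int -> 'M[X]_(ts_rk F, ts_rk G)) :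
  Prop :=
  forall i,
    [/\ sheaf_hom (jL X) (ts_F F i) (ts_F G i) (f i),
        ts_Pi F i *m f (i + 1) = f i *m ts_Pi G i &
        ts_tau F i *m f (i + 1) = map_mx (sigma X) (f i) *m ts_tau G i].

Definition ts_surj (F G : tsheaf) (f : int -> 'M[X]_(ts_rk F, ts_rk G)) :
  Prop := forall i, sheaf_image_eq (jL X) (ts_F F i) (ts_F G i) (f i).

Definition ts_inj (F G : tsheaf) (f : int -> 'M[X]_(ts_rk F, ts_rk G)) :
  Prop := forall i, sheaf_inj (jL X) (ts_F F i) (f i).

Definition ts_isogeny (F G : tsheaf) (f : int -> 'M[X]_(ts_rk F, ts_rk G)) :
  Prop :=
  [/\ ts_hom f, ts_inj f, ts_rk F = ts_rk G & ts_dim F = ts_dim G].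

Definition ts_iso (F G : tsheaf) : Prop :=
  exists (f : int -> 'M[X]_(ts_rk F, ts_rk G))
         (g : int -> 'M[X]_(ts_rk G, ts_rk F)),
    [/\ ts_hom f, ts_hom g &
        forall i, f i *m g i = 1%:M /\ g i *m f i = 1%:M].

Definition ts_twist (D : set C -> int) (F : tsheaf) : tsheaf :=
  TSheaf (ts_dim F) (fun i => twist D (ts_F F i)) (ts_Pi F) (ts_tau F).

Definition ts_quasi_isogenous (F G : tsheaf) : Prop :=
  exists D (f : int -> 'M[X]_(ts_rk F, ts_rk (ts_twist D G))),
    [/\ divisor D, effective D & ts_isogeny f].

Definition ts_zero : tsheaf :=
  @TSheaf 0 0 (fun _ _ => setT) (fun _ => 1%:M) (fun _ => 1%:M).

Definition ts_add (F G : tsheaf) : tsheaf :=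
  @TSheaf (ts_rk F + ts_rk G) (ts_dim F + ts_dim G)
    (fun i P => [set v | ts_F F i P (lsubmx v) /\ ts_F G i P (rsubmx v)])
    (fun i => block_mx (ts_Pi F i) 0 0 (ts_Pi G i))
    (fun i => block_mx (ts_tau F i) 0 0 (ts_tau G i)).

Definition ts_sum n (S : 'I_n -> tsheaf) : tsheaf :=
  \big[ts_add/ts_zero]_(j < n) S j.

Definition ts_simple (eps : set C) (c : C -> L) (F : tsheaf) : Prop :=
  [/\ abelian_tsheaf eps c F, ts_rk F <> 0%N &
      forall (G : tsheaf) (f : int -> 'M[X]_(ts_rk F, ts_rk G)),
        abelian_tsheaf eps c G -> ts_hom f -> ts_surj f ->
        ts_rk G = 0%N \/ ts_iso G F].

Definition ts_semisimple (eps : set C) (c : C -> L) (F : tsheaf) : Prop :=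
  abelian_tsheaf eps c F /\
  exists n (S : 'I_n -> tsheaf),
    [/\ forall j, ts_simple eps c (S j),
        abelian_tsheaf eps c (ts_sum S) &
        ts_quasi_isogenous F (ts_sum S)].

Record motive := Motive {
  mo_rk : nat;
  mo_dim : nat;
  mo_M : set 'rV[X]_mo_rk;
  mo_tau : 'M[X]_mo_rk }.

Arguments mo_M : clear implicits.
Arguments mo_tau : clear implicits.

(* tau o s(tau) o ... o s^(l-1)(tau), for s the pullback along sigma *)
Fixpoint tau_pow (M : motive) (l : nat) : 'M[X]_(mo_rk M) :=
  if l is l'.+1 then map_mx (sigma X) (tau_pow M l') *m mo_tau M else 1%:M.

Definition pure_motive (c : C -> L) (M : motive) : Prop :=
  let r := mo_rk M in let d := mo_dim M in
  let sM := extend_scalars (sigma X) ring_AL (mo_M M) in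
  [/\ locally_free_module ring_AL (mo_M M),
      mximg (mo_tau M) sM `<=` mo_M M /\ mxinj_on (mo_tau M) sM,
      has_codim (jL X) (mximg (mo_tau M) sM) (mo_M M) d,
      power_kills (motive_ideal c) d (mximg (mo_tau M) sM) (mo_M M) &
      exists N : sheaf X r,
        [/\ locally_free (jL X) N,
            mo_M M = [set v | forall P, cl P -> ~ over_oo P -> N P v] &
            exists m l : nat,
              [/\ (0 < m)%N, (0 < l)%N &
                  forall P, cl P -> over_oo P ->
                    let slN := iter l (pullback (sigma X) (r := r)) N in
                    mxinj_on (tau_pow M l) (slN P) /\
                    mximg (tau_pow M l) (slN P) =
                      twist (div_oo m%:Z) N P]]].

Definition mo_hom (M N : motive) (f : 'M[X]_(mo_rk M, mo_rk N)) : Prop :=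
  mximg f (mo_M M) `<=` mo_M N /\
  mo_tau M *m f = map_mx (sigma X) f *m mo_tau N.

Definition mo_surj (M N : motive) (f : 'M[X]_(mo_rk M, mo_rk N)) : Prop :=
  mximg f (mo_M M) = mo_M N.

Definition mo_iso (M N : motive) : Prop :=
  exists (f : 'M[X]_(mo_rk M, mo_rk N)) (g : 'M[X]_(mo_rk N, mo_rk M)),
    [/\ mo_hom f, mo_hom g, f *m g = 1%:M & g *m f = 1%:M].

(* f lies in Hom(M, N) (x)_A Q; since Hom(M, N) is torsion free, this is the
   set of fractions h / a with h in Hom(M, N) and a in A nonzero *)
Definition mo_qhom (M N : motive) (f : 'M[X]_(mo_rk M, mo_rk N)) : Prop :=
  exists a : C, [/\ ring_A a, a != 0 & mo_hom (jQ X a *: f)].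

Definition mo_quasi_isogenous (M N : motive) : Prop :=
  exists (f : 'M[X]_(mo_rk M, mo_rk N)) (g : 'M[X]_(mo_rk N, mo_rk M)),
    [/\ mo_qhom f, mo_qhom g, f *m g = 1%:M & g *m f = 1%:M].

Definition mo_zero : motive := @Motive 0 0 setT 1%:M.

Definition mo_add (M N : motive) : motive :=
  @Motive (mo_rk M + mo_rk N) (mo_dim M + mo_dim N)
    [set v | mo_M M (lsubmx v) /\ mo_M N (rsubmx v)]
    (block_mx (mo_tau M) 0 0 (mo_tau N)).

Definition mo_sum n (S : 'I_n -> motive) : motive :=
  \big[mo_add/mo_zero]_(j < n) S j.

Definition mo_simple (c : C -> L) (M : motive) : Prop :=
  [/\ pure_motive c M, mo_rk M <> 0%N &
      forall (N : motive) (f : 'M[X]_(mo_rk M, mo_rk N)),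
        pure_motive c N -> mo_hom f -> mo_surj f ->
        mo_rk N = 0%N \/ mo_iso N M].

Definition mo_semisimple (c : C -> L) (M : motive) : Prop :=
  pure_motive c M /\
  exists n (S : 'I_n -> motive),
    [/\ forall j, mo_simple c (S j),
        pure_motive c (mo_sum S) &
        mo_quasi_isogenous M (mo_sum S)].

End Setting.

Arguments ts_F {k C L X} F i P : rename.
Arguments ts_Pi {k C L X} F i : rename.
Arguments ts_tau {k C L X} F i : rename.
Arguments ring_AL {k C L} X _.
Arguments mo_M {k C L X} M : rename.
Arguments mo_tau {k C L X} M : rename.

Section BaseChange.
Variables (k : finFieldType) (C : curve k) (L L' : finFieldType).
Variables (X : base_curve C L) (X' : base_curve C L') (e : base_ext X X').

Definition ts_base_change (F : tsheaf X) : tsheaf X' :=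
  TSheaf (ts_dim F)
    (fun i => pullback (ext_fun e) (ts_F F i))
    (fun i => map_mx (ext_fun e) (ts_Pi F i))
    (fun i => map_mx (ext_fun e) (ts_tau F i)).

Definition mo_base_change (M : motive X) : motive X' :=
  Motive (mo_dim M)
    (extend_scalars (ext_fun e) (ring_AL X') (mo_M M))
    (map_mx (ext_fun e) (mo_tau M)).

End BaseChange.

(* Main.v *)
(* Over the generic point of C_L an object of either kind becomes a Frobenius module: E^r with
   the semilinear map v |-> sigma(v) T, E being the function field of C_L.  The image of an
   object under a surjection of Frobenius modules is again an object, so simplicity can be tested
   on the generic module, and quasi-isogenies are the isomorphisms of generic modules.  For
   tau-sheaves the point is that the two cokernels of the image still have the same dimension;
   for motives, that the sections of the image of a sheaf are the image of its sections.

   Semisimplicity of generic modules is preserved by Galois descent.  If T is simple over E and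
   p is a minimal quotient of its base change to E', the intersection of the kernels of the Galois
   conjugates of p is Galois stable, hence defined over E, hence zero.  So the base change embeds
   into a sum of simple modules, and discarding superfluous summands gives an isomorphism. *)

(* Degrees of divisors are replaced by one principle: a function without poles is a unit at every
   point ([regular_isu]), a consequence of Chevalley's extension theorem. Applied to a quotient of
   norms of determinants, it compares the two dimensions of an image of a tau-sheaf. Here
   [eps <> oo] enters: it separates the support of coker tau from that of coker Pi. For motives the
   same principle, combined with purity, supplies a function in A with a pole at infinity
   ([pure_pole]). With it poles can be cleared on the affine curve, and an ideal without zeros
   contains 1. Elements of a constant extension are handled through coordinates in a basis of the
   finite field. The invertible Moore matrix recovers the coordinates linearly from the Galois
   conjugates; this one formula yields regular coordinates, the sections of a pullback and the
   descent of stable subspaces. Objects are first normalised: all F_i are placed in one generic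
   stalk, where the Pi_i become inclusions and the tau_i a single matrix ([chain]), so that a
   generic quotient is realised by taking images of all stalks. *)
Require Import Defs.
From HB Require Import structures.
From mathcomp Require Import all_boot all_order all_algebra.
From mathcomp Require Import boolp classical_sets functions cardinality.
From mathcomp Require Import finfield ring.

Set Implicit Arguments.
Unset Strict Implicit.
Unset Printing Implicit Defensive.

Import Order.TTheory GRing.Theory Num.Theory.

Local Open Scope classical_set_scope.
Local Open Scope ring_scope.

(** * Valuation rings *)

Section Subring.
Variable E : fieldType.
Implicit Types (R P I : set E) (x y : E).

Definition subring R :=
  [/\ R 1, forall x y, R x -> R y -> R (x - y) &
      forall x y, R x -> R y -> R (x * y)].

Lemma sr1 R : subring R -> R 1. Proof. by case. Qed.
Lemma srB R x y : subring R -> R x -> R y -> R (x - y).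
Proof. by case=> _ h _; exact: h. Qed.
Lemma srM R x y : subring R -> R x -> R y -> R (x * y).
Proof. by case=> _ _; apply. Qed.
Lemma sr0 R : subring R -> R 0.
Proof. by move=> h; rewrite -(subrr 1); apply: srB => //; apply: sr1. Qed.
Lemma srN R x : subring R -> R x -> R (- x).
Proof. by move=> h Rx; rewrite -sub0r; apply: srB => //; apply: sr0. Qed.
Lemma srD R x y : subring R -> R x -> R y -> R (x + y).
Proof. by move=> h Rx Ry; rewrite -(opprK y); apply: srB => //; apply: srN. Qed.
Lemma srX R x n : subring R -> R x -> R (x ^+ n).
Proof.
move=> h Rx; elim: n => [|n IH]; first by rewrite expr0; apply: sr1.
by rewrite exprS; apply: srM.
Qed.
Lemma sr_sum R (J : Type) (r : seq J) (p : pred J) (f : J -> E) :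
  subring R -> (forall i, p i -> R (f i)) -> R (\sum_(i <- r | p i) f i).
Proof.
by move=> h Rf; elim/big_ind: _ => //; [apply: sr0 | move=> *; apply: srD].
Qed.
Lemma sr_prod R (J : Type) (r : seq J) (p : pred J) (f : J -> E) :
  subring R -> (forall i, p i -> R (f i)) -> R (\prod_(i <- r | p i) f i).
Proof.
by move=> h Rf; elim/big_ind: _ => //; [apply: sr1 | move=> *; apply: srM].
Qed.

Definition valring P := subring P /\ forall x, P x \/ P x^-1.

Lemma vr_sub P : valring P -> subring P.
Proof. by case. Qed.

Lemma vr_inv P x : valring P -> ~ P x -> P x^-1.
Proof. by case=> _ /(_ x) []. Qed.

Lemma mi_sub P x : max_ideal P x -> P x. Proof. by case. Qed.

Lemma mi0 P : subring P -> max_ideal P 0.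
Proof. by move=> h; split; [apply: sr0 | left]. Qed.

Lemma mi_unit P x : P x -> ~ max_ideal P x -> x != 0 /\ P x^-1.
Proof.
move=> Px nm; split; first by apply: contra_notN nm => /eqP x0; split=> //; left.
by apply: contrapT => nP; apply: nm; split=> //; right.
Qed.

Lemma unit_nmi P x : x != 0 -> P x^-1 -> ~ max_ideal P x.
Proof. by move=> /eqP x0 Px' [_ []]. Qed.

Lemma mi1 P : subring P -> ~ max_ideal P 1.
Proof. by move=> h; apply: unit_nmi; rewrite ?oner_eq0 // invr1; apply: sr1. Qed.

Lemma mi_inv P x : valring P -> ~ P x -> max_ideal P x^-1.
Proof.
move=> vP nP; split; first exact: vr_inv.
by right; rewrite invrK.
Qed.

Lemma inv_mi P x : x != 0 -> max_ideal P x -> ~ P x^-1.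
Proof. by move=> /eqP x0 [_ []]. Qed.

Lemma miMl P a x : subring P -> P a -> max_ideal P x -> max_ideal P (a * x).
Proof.
move=> h Pa [Px mx]; split; first exact: srM.
have [->|a0] := eqVneq a 0; first by left; rewrite mul0r.
case: mx => [->|mx]; first by left; rewrite mulr0.
have [->|x0] := eqVneq x 0; first by left; rewrite mulr0.
right=> Pax; apply: mx.
have -> : x^-1 = a * (a * x)^-1 by field; apply/andP.
exact: srM.
Qed.

Lemma miMr P a x : subring P -> P a -> max_ideal P x -> max_ideal P (x * a).
Proof. by move=> *; rewrite mulrC; apply: miMl. Qed.

Lemma miN P x : subring P -> max_ideal P x -> max_ideal P (- x).
Proof.
move=> h mx; rewrite -mulN1r; apply: miMl => //; apply: srN => //; exact: sr1.
Qed.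

Lemma miD P x y : valring P -> max_ideal P x -> max_ideal P y ->
  max_ideal P (x + y).
Proof.
move=> vP; wlog h : x y / P (x / y) => [W|] mx my.
  have [->|x0] := eqVneq x 0; first by rewrite add0r.
  have [h|h] := pselect (P (x / y)); first exact: W.
  rewrite addrC; apply: W => //.
  by have := vr_inv vP h; rewrite invf_div.
have [->|y0] := eqVneq y 0; first by rewrite addr0.
have -> : x + y = (x / y + 1) * y by field.
by apply: miMl => //; [apply: vr_sub|apply: srD => //; [apply: vr_sub| apply: sr1; apply: vr_sub]].
Qed.

Lemma miB P x y : valring P -> max_ideal P x -> max_ideal P y ->
  max_ideal P (x - y).
Proof. by move=> vP mx my; apply: miD => //; apply: miN => //; apply: vr_sub. Qed.

Lemma mi_sum P (J : Type) (r : seq J) (p : pred J) (f : J -> E) :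
  valring P -> (forall i, p i -> max_ideal P (f i)) ->
  max_ideal P (\sum_(i <- r | p i) f i).
Proof.
move=> vP mf; elim/big_ind: _ => //; first by apply: mi0; apply: vr_sub.
by move=> *; apply: miD.
Qed.

Lemma miMp P x y : valring P -> max_ideal P (x * y) -> P x -> P y ->
  max_ideal P x \/ max_ideal P y.
Proof.
move=> vP mxy Px Py; apply: contrapT => /not_orP[n1 n2].
have [x0 Px'] := mi_unit Px n1; have [y0 Py'] := mi_unit Py n2.
apply: unit_nmi mxy; first by rewrite mulf_neq0.
by rewrite invfM; apply: srM => //; apply: vr_sub.
Qed.

Lemma miX P x n : valring P -> P x -> max_ideal P (x ^+ n) -> max_ideal P x.
Proof.
move=> vP Px; elim: n => [|n IH]; first by rewrite expr0 => /mi1 []; apply: vr_sub.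
by rewrite exprS => /miMp []//; apply: srX => //; apply: vr_sub.
Qed.

Lemma mulXV x m n : x != 0 -> (m <= n)%N -> x ^+ m * x^-1 ^+ n = x^-1 ^+ (n - m).
Proof.
move=> x0 mn; rewrite -{1}(subnKC mn) exprD mulrA -exprMn divff //.
by rewrite expr1n mul1r.
Qed.

(** Valuation rings are integrally closed; a leading coefficient that is a unit at [P] serves as
    well as 1. If [x] were outside [P], its inverse would lie in the maximal ideal, and division of
    the equation by [x ^+ n] would put [a n] there as well. *)
Lemma int_closed P n (a : nat -> E) x : valring P -> (forall i, P (a i)) ->
  ~ max_ideal P (a n) -> \sum_(i < n.+1) a i * x ^+ i = 0 -> P x.
Proof.
move=> vP Pa nm e; apply: contrapT => nP.
have mx := mi_inv vP nP; have sP := vr_sub vP.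
have x0 : x != 0 by apply: contra_notN nP => /eqP->; apply: sr0.
apply: nm; rewrite (_ : a n = - \sum_(i < n) a i * x^-1 ^+ (n - i.+1) * x^-1).
  apply: miN => //; apply: mi_sum => // i _; apply: miMl => //.
  by apply: srM => //; apply: srX => //; apply: mi_sub mx.
move/(congr1 (fun z => z * x^-1 ^+ n)): e; rewrite mul0r big_ord_recr /=.
rewrite mulrDl -[X in _ + X]mulrA -exprMn divff // expr1n mulr1 addrC => /eqP.
rewrite addr_eq0 => /eqP ->; congr (- _); rewrite mulr_suml; apply: eq_bigr => i _.
rewrite -!mulrA -exprSr -subSn // subSS; congr (_ * _).
exact: mulXV (ltnW (ltn_ord i)).
Qed.

End Subring.
#[local] Hint Resolve vr_sub : core.

Section Span.
Variables (E : fieldType) (V : lmodType E).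
Implicit Types (R : set E) (S M : set V).

Lemma lspan_mem R S v : R 1 -> S v -> lspan R S v.
Proof.
move=> R1 Sv; exists 1, (fun _ => 1), (fun _ => v); split=> //.
by rewrite big_ord1 scale1r.
Qed.

Lemma lspan_submod R S : subring R -> submodule R (lspan R S).
Proof.
move=> sR; split.
- by exists 0, (fun _ => 0), (fun _ => 0); split; [case | rewrite big_ord0].
- move=> _ _ [n [a [s [h ->]]]] [m [b [t [h' ->]]]].
  exists (n + m)%N, (fun i : 'I_(n + m) => match fintype.split i with inl i => a i | inr j => b j end),
     (fun i : 'I_(n + m) => match fintype.split i with inl i => s i | inr j => t j end); split.
    by move=> i; case: fintype.split.
  by rewrite big_split_ord; congr (_ + _); apply: eq_bigr => i _;
    [have := unsplitK (inl i : 'I_n + 'I_m) | have := unsplitK (inr i : 'I_n + 'I_m)] => /= ->.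
- move=> x _ Rx [n [a [s [h ->]]]].
  exists n, (fun i => x * a i), s; split.
    by move=> i; have [? ?] := h i; split=> //; apply: srM.
  by rewrite scaler_sumr; apply: eq_bigr => i _; rewrite scalerA.
Qed.

Lemma submod_sum R M (J : Type) (r : seq J) (p : pred J) (f : J -> V) :
  submodule R M -> (forall i, p i -> M (f i)) -> M (\sum_(i <- r | p i) f i).
Proof. by case=> M0 MD _ h; elim/big_ind: _. Qed.
Arguments submod_sum {R M J r p f}.

Lemma lspan_min R S M : submodule R M -> S `<=` M -> lspan R S `<=` M.
Proof.
move=> sM SM _ [n [a [s [h ->]]]]; apply: (submod_sum sM) => i _.
by case: sM => _ _; apply; case: (h i) => // _ /SM.
Qed.

Lemma lspan_mono R R' S S' : R `<=` R' -> S `<=` S' -> lspan R S `<=` lspan R' S'.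
Proof.
move=> h1 h2 _ [n [a [s [h ->]]]]; exists n, a, s; split=> // i.
by have [/h1 ? /h2 ?] := h i.
Qed.

Lemma lspan_id R M : R 1 -> submodule R M -> lspan R M = M.
Proof.
move=> R1 sM; apply/seteqP; split; first exact: lspan_min.
by move=> v Mv; apply: lspan_mem.
Qed.

End Span.
Arguments submod_sum {E V R M J r p f}.

(** * Chevalley's extension theorem *)

Section Chevalley.
Variable E : fieldType.
Implicit Types (S R I : set E) (x y : E).

Let polyrel (A : set E) n x :=
  exists2 a : nat -> E, forall i, A (a i) & \sum_(i < n) a i * x ^+ i = 1.

(** The relation for [x] is multiplied by [1 - b 0], and its top term is rewritten by the relation
    for [x^-1] multiplied by [a n.+1 * x ^+ n.+1]; one degree is gained. The two relations have the
    same length, which padding by zeros permits. *)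
Lemma polyrel_reduce S (A : set E) n x : subring S ->
  submodule (V := E^o) S A -> A `<=` S ->
  x != 0 -> polyrel A n.+2 x -> polyrel A n.+2 x^-1 -> polyrel A n.+1 x.
Proof.
move=> sS [A0 AD AM] AS x0 [a Aa ea] [b Ab eb].
exists (fun i => (if i == 0%N then b 0%N else 0) +
   ((1 - b 0%N) * a i + b (n.+1 - i)%N * a n.+1)).
  move=> i; apply: (AD); first by case: ifP.
  apply: AD; last by apply: AM => //; apply: AS.
  by apply: AM => //; apply: srB; rewrite ?AS //; first exact: sr1; apply: AS.
under eq_bigr do rewrite mulrDl mulrDl.
rewrite !big_split /= big_ord_recl /= expr0 mulr1 big1 ?addr0; last first.
  by move=> i _; rewrite mul0r.
have e1 : \sum_(i < n.+1) (1 - b 0%N) * a i * x ^+ i = (1 - b 0%N) * (1 - a n.+1 * x ^+ n.+1).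
  have -> : 1 - a n.+1 * x ^+ n.+1 = \sum_(i < n.+1) a i * x ^+ i.
    by rewrite -[in LHS]ea big_ord_recr /= addrK.
  rewrite mulr_sumr.
  by apply: eq_bigr => i _; rewrite mulrA.
have e2 : \sum_(i < n.+1) b (n.+1 - i)%N * a n.+1 * x ^+ i = a n.+1 * x ^+ n.+1 * (1 - b 0%N).
  have -> : 1 - b 0%N = \sum_(i < n.+1) b i.+1 * x^-1 ^+ i.+1.
    by rewrite -[in LHS]eb big_ord_recl /= expr0 mulr1 addrC addKr.
  rewrite mulr_sumr.
  rewrite (reindex_inj rev_ord_inj) /=; apply: eq_bigr => i _.
  rewrite subSS subSn; last by rewrite leq_subr.
  rewrite subKn; last by rewrite -ltnS.
  have /(mulXV (n := n.+1) (m := i.+1)) : x^-1 != 0 by rewrite invr_eq0.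
  rewrite invrK subSS => <- //.
  by ring.
by rewrite e1 e2; ring.
Qed.

Lemma polyrel_absurd S (A : set E) n x : subring S ->
  submodule (V := E^o) S A -> A `<=` S -> ~ A 1 ->
  x != 0 -> polyrel A n.+1 x -> polyrel A n.+1 x^-1 -> False.
Proof.
move=> sS sA AS nA x0; elim: n => [|n IH] h1 h2.
  case: h1 => a Aa; rewrite big_ord1 expr0 mulr1 => e; apply: nA; rewrite -e; exact: Aa.
apply: IH; first exact: (polyrel_reduce sS sA AS x0 h1 h2).
by apply: (polyrel_reduce sS sA AS _ h2); rewrite ?invrK // invr_eq0.
Qed.

Let adjoin S x : set E := [set y | exists2 p : {poly E}, forall i, S p`_i & y = p.[x]].

Lemma adjoin_subring S x : subring S -> subring (adjoin S x).
Proof.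
move=> sS; split.
- exists 1 => [i|]; last by rewrite hornerC.
  by rewrite coefC; case: ifP => _; [apply: sr1|apply: sr0].
- move=> _ _ [p Sp ->] [q Sq ->]; exists (p - q); last by rewrite !hornerE.
  by move=> i; rewrite coefB; apply: srB.
- move=> _ _ [p Sp ->] [q Sq ->]; exists (p * q); last by rewrite hornerM.
  by move=> i; rewrite coefM; apply: sr_sum => // j _; apply: srM.
Qed.

(** All large lengths are allowed, by padding with zero coefficients, so that relations for [x] and
    for [x^-1] can be brought to a common length. *)
Lemma adjoin_polyrel S I x : subring S -> ideal_span (adjoin S x) I 1 ->
  exists n, forall m, (n <= m)%N -> polyrel (ideal_span S I) m x.
Proof.
move=> sS [n [a [s [h e]]]].
have /(_ _)/cid2 h' : forall i, exists2 p : {poly E}, forall j, S p`_j & a i = p.[x].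
  by move=> i; case: (h i) => -[p Sp ->] _; exists p.
pose p i := s2val (h' i).
have Sp i : forall j, S (p i)`_j by rewrite /p; case: (h' i).
have ep i : a i = (p i).[x] by rewrite /p; case: (h' i).
exists (\max_(i < n) size (p i))%N => m mm.
exists (fun j => \sum_i (p i)`_j * s i) => [j|].
  have [h0 hD hM] := lspan_submod (V := E^o) I sS.
  apply: (submod_sum (V := E^o) (And3 h0 hD hM)) => i _; apply: hM => //.
  by apply: lspan_mem; [apply: sr1 | case: (h i)].
rewrite e; under eq_bigr do rewrite mulr_suml.
rewrite exchange_big /=; apply: eq_bigr => i _.
have le : (size (p i) <= m)%N.
  by apply: leq_trans mm; exact: (@leq_bigmax _ (fun i => size (p i))).
rewrite ep /GRing.scale /= (horner_coef_wide _ le) mulr_suml.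
by apply: eq_bigr => j _; rewrite mulrAC.
Qed.

(** A ring maximal among those containing [R] in which [I] generates a proper ideal is a valuation
    ring: if it contained neither [x] nor [x^-1], adjoining either would produce a relation for 1,
    and reduction of degrees would bring these down to 1 in the ideal itself. *)
Theorem chevalley R I : subring R -> I `<=` R -> ~ ideal_span R I 1 ->
  exists P, [/\ valring P, R `<=` P & I `<=` max_ideal P].
Proof.
move=> sR IR nR.
pose good S := [/\ subring S, R `<=` S & ~ ideal_span S I 1].
have [S [gS maxS]] : exists S, good S /\ forall S', S `<` S' -> ~ good S'.
  have [|A [hA maxA]] := @Zorn_bigcup E [set S | S = set0 \/ good S].
    move=> F FP tot.
    have [[S0 [FS0 n0]]|h0] := pselect (exists S, F S /\ S <> set0); last first.
      left; apply/seteqP; split=> // x [S FS Sx]; apply: h0; exists S; split=> // S0.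
      by rewrite S0 in Sx.
    have gS0 : good S0 by case: (FP _ FS0).
    have gF S : F S -> S !=set0 -> good S.
      by move=> FS [x Sx]; case: (FP _ FS) => // S0'; move: Sx; rewrite S0'.
    right; have dir x y : (\bigcup_(X in F) X) x -> (\bigcup_(X in F) X) y ->
        exists S, [/\ F S, good S, S x & S y].
      move=> [S FS Sx] [T FT Ty]; case: (tot _ _ FS FT) => ST.
        by exists T; split=> //; [apply: gF => //; exists y | exact: ST].
      by exists S; split=> //; [apply: gF => //; exists x | exact: ST].
    split.
    - split.
      + by exists S0 => //; case: gS0 => s *; apply: sr1.
      + move=> x y hx hy; have [S [FS [sS _ _] Sx Sy]] := dir _ _ hx hy.
        by exists S => //; apply: srB.
      + move=> x y hx hy; have [S [FS [sS _ _] Sx Sy]] := dir _ _ hx hy.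
        by exists S => //; apply: srM.
    - by move=> x Rx; exists S0 => //; case: gS0 => _ /(_ _ Rx).
    - move=> [n [a [s [h e]]]].
      have [S [FS gS Sa]] : exists S, [/\ F S, good S & forall i, S (a i)].
        have {e} : forall i, (\bigcup_(X in F) X) (a i) by move=> i; case: (h i).
        elim: n a {s h} => [|n IH] a h; first by exists S0; split=> // -[].
        have [S [FS gS Sa]] := IH (fun i => a (lift ord0 i)) (fun i => h _).
        have [T [FT gT Ta _]] := dir _ _ (h ord0) (h ord0).
        have [ST|TS] := tot _ _ FS FT.
          exists T; split=> // i; case: (unliftP ord0 i) => [j ->|-> //].
          exact: ST.
        exists S; split=> // i; case: (unliftP ord0 i) => [j ->|->]; first exact: Sa.
        exact: TS.
      case: gS => _ _; apply; exists n, a, s; split=> // i; split=> //.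
      by case: (h i).
  have gR : good R by split.
  case: hA => [A0|gA]; last by exists A; split=> // B AB gB; apply: (maxA B) => //; right.
  case: (maxA R); last by right.
  rewrite A0; split=> // h; have /h // : R 1 by apply: sr1.
have [sS RS nS] := gS.
exists S; split=> //.
  split=> // x; apply: contrapT => /not_orP[n1 n2].
  have x0 : x != 0 by apply: contra_notN n1 => /eqP->; apply: sr0.
  have key z : ~ S z -> exists n, forall m, (n <= m)%N -> polyrel (ideal_span S I) m z.
    move=> nz; apply: adjoin_polyrel => //; apply: contrapT => nn.
    case: (maxS (adjoin S z)).
      split.
        move=> y Sy; exists y%:P; last by rewrite hornerC.
        by move=> i; rewrite coefC; case: ifP => // _; apply: sr0.
      move=> h; apply: nz; apply: h; exists 'X; last by rewrite hornerX.
      by move=> i; rewrite coefX; case: eqP => _; [apply: sr1 | apply: sr0].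
    split=> //; first exact: adjoin_subring.
    move=> y Ry; exists y%:P; last by rewrite hornerC.
    by move=> i; rewrite coefC; case: ifP => // _; [apply: RS| apply: sr0].
  have [n hn] := key _ n1; have [m hm] := key _ n2.
  apply: (@polyrel_absurd S (ideal_span S I) (n + m)%N x) => //.
  - exact: (lspan_submod (V := E^o)).
  - apply: (@lspan_min _ E^o); last by move=> y /IR /RS.
    by split; [apply: sr0 | move=> *; apply: srD | move=> *; apply: srM].
  - by apply: hn; rewrite ltnW // ltnS leq_addr.
  - by apply: hm; rewrite ltnW // ltnS leq_addl.
move=> x Ix; split; first by apply: RS; apply: IR.
have [->|x0] := eqVneq x 0; [by left|right] => Sx; apply: nS.
exists 1, (fun _ => x^-1), (fun _ => x); split=> //.
by rewrite big_ord1 /GRing.scale /= mulVf.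
Qed.

End Chevalley.

(** * Places of a function field *)

Section FunctionField.
Variables (F E : fieldType) (iota : {rmorphism F -> E}).
Implicit Types (P Q : set E) (x y z : E) (f g : {poly F}).

Local Notation ev f x := (map_poly iota f).[x].

Definition transc x := forall f, ev f x = 0 -> f = 0.

(** Finiteness of the degree of [E] over F(x), with denominators cleared so that only values of
    polynomials at [x] occur. *)
Definition depdt x := exists N, forall z : 'I_N -> E, exists f : 'I_N -> {poly F},
  (exists i, f i != 0) /\ \sum_i ev (f i) x * z i = 0.

Lemma curve_valring P : curve_point iota P -> valring P.
Proof. by case=> h1 h2 h3 h4; split=> //; split=> //; rewrite -(rmorph1 iota). Qed.

Lemma closed_valring P : closed_point iota P -> valring P.
Proof. by case=> /curve_valring. Qed.

Lemma closed_curve P : closed_point iota P -> curve_point iota P.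
Proof. by case. Qed.
#[local] Hint Resolve curve_valring closed_valring closed_curve : core.

Lemma curve_const P a : curve_point iota P -> P (iota a).
Proof. by case. Qed.

Lemma curve_const_mi P a : curve_point iota P -> max_ideal P (iota a) -> a = 0.
Proof.
move=> cP; have [->//|a0] := eqVneq a 0; case=> _ [/eqP|].
  by rewrite fmorph_eq0 (negPf a0).
by case; rewrite -fmorphV; apply: curve_const.
Qed.

Lemma closed_mi P : closed_point iota P -> exists2 u, u != 0 & max_ideal P u.
Proof.
move=> cP; have [_ [y ny]] := cP; exists y^-1; last by apply: mi_inv => //; apply: closed_valring.
rewrite invr_eq0; apply: contra_notN ny => /eqP->; apply: sr0; apply: vr_sub.
exact: closed_valring.
Qed.

Lemma valring_closed P u : valring P -> (forall a, P (iota a)) ->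
  u != 0 -> max_ideal P u -> closed_point iota P.
Proof.
move=> [[h1 h2 h3] h4] h5 u0 mu; split; first by split.
by exists u^-1; apply: inv_mi.
Qed.

Lemma evE f x n : (size f <= n)%N -> ev f x = \sum_(i < n) iota f`_i * x ^+ i.
Proof.
move=> le; rewrite (horner_coef_wide x (leq_trans (size_poly _ _) le)).
by apply: eq_bigr => i _; rewrite coef_map.
Qed.

Lemma ev_point P f x : curve_point iota P -> P x -> P (ev f x).
Proof.
move=> cP Px; rewrite (evE _ (leqnn _)); apply: sr_sum; auto => i _.
by apply: srM; auto; [apply: curve_const | apply: srX; auto].
Qed.

Lemma evM f g x : ev (f * g) x = ev f x * ev g x.
Proof. by rewrite rmorphM hornerM. Qed.

Lemma function_field_transc : is_function_field iota -> exists x, transc x /\ depdt x.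
Proof.
case=> x [trx [n [b hb]]]; exists x; split=> //; exists n.+1 => z.
have /(_ _)/cid h i := hb (z i).
pose den i := sval (h i).
have /(_ _)/cid h' i := svalP (h i).
pose num i := sval (h' i).
have hd i : den i != 0 by case: (svalP (h' i)).
have hz i : z i * ev (den i) x = \sum_j ev (num i j) x * b j by case: (svalP (h' i)).
(* The extra zero column makes the square matrix singular, so its rows satisfy a nonzero relation
   [c] with polynomial coefficients. *)
pose A : 'M[{poly F}]_n.+1 := \matrix_(i, j) if unlift ord_max j is Some k then num i k else 0.
have /det0P[c c0 cA] : \det A == 0.
  apply/eqP; rewrite (expand_det_col A ord_max) big1 // => i _.
  by rewrite mxE unlift_none mul0r.
exists (fun i => c 0 i * den i); split.
  have /existsP[i ci] : [exists i, c 0 i != 0].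
    apply: contra_neqT c0 => /existsPn h0; apply/rowP=> i; rewrite mxE.
    by apply/eqP; have := h0 i; rewrite negbK.
  by exists i; rewrite mulf_neq0.
under eq_bigr do rewrite evM -mulrA [_ * z _]mulrC hz mulr_sumr.
rewrite exchange_big big1 //= => j _.
under eq_bigr do rewrite mulrA -evM.
rewrite -mulr_suml -horner_sum -rmorph_sum /=.
have := congr1 (fun B : 'rV_n.+1 => B 0 (lift ord_max j)) cA.
rewrite !mxE (eq_bigr (fun i => c 0 i * num i j)) => [->|i _].
  by rewrite rmorph0 horner0 mul0r.
by rewrite mxE liftK.
Qed.

Lemma ev_inv f x D : x != 0 -> (size f <= D.+1)%N ->
  ev (\poly_(j < D.+1) f`_(D - j)) x^-1 = x^-1 ^+ D * ev f x.
Proof.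
move=> x0 le; rewrite (evE _ (size_poly _ _)) (evE x le) mulr_sumr.
rewrite (reindex_inj rev_ord_inj) /=; apply: eq_bigr => i _.
have iD : (i <= D)%N by rewrite -ltnS.
rewrite coef_poly subSS ltnS leq_subr subKn // -mulXV //; ring.
Qed.

Lemma transc_neq0 x : transc x -> x != 0.
Proof.
move=> trx; apply/eqP => x0; have /trx/eqP : ev 'X x = 0 by rewrite map_polyX hornerX.
by rewrite polyX_eq0.
Qed.

Lemma transc_inv x : transc x -> transc x^-1.
Proof.
move=> trx f e; have x0 := transc_neq0 trx.
have xV0 : x^-1 != 0 by rewrite invr_eq0.
have := @ev_inv f x^-1 (size f) xV0 (leqnSn _); rewrite e mulr0 invrK => /trx h.
apply/polyP=> i; rewrite coef0.
have [ii|ii] := ltnP i (size f); last by rewrite nth_default.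
have := congr1 (fun p : {poly F} => p`_(size f - i)) h.
by rewrite coef_poly coef0 ltnS leq_subr subKn // ltnW.
Qed.

Lemma depdt_inv x : transc x -> depdt x -> depdt x^-1.
Proof.
move=> trx [N dx]; exists N => z; have [f [[i fi] e]] := dx z.
have x0 := transc_neq0 trx.
pose D := (\max_i size (f i))%N.
have le j : (size (f j) <= D.+1)%N by rewrite ltnW // ltnS (@leq_bigmax _ (fun j => size (f j))).
exists (fun i => \poly_(j < D.+1) (f i)`_(D - j)); split.
  exists i; apply: contra_neq fi => e0; apply: trx.
  have := ev_inv x0 (le i); rewrite e0 rmorph0 horner0 => /esym/eqP.
  by rewrite mulf_eq0 expf_eq0 invr_eq0 (negPf x0) andbF => /eqP.
under eq_bigr do rewrite ev_inv //.
by under eq_bigr do rewrite -mulrA; rewrite -mulr_sumr e mulr0.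
Qed.

Lemma transc_in P : is_function_field iota -> valring P ->
  exists x, [/\ transc x, depdt x & P x].
Proof.
move=> /function_field_transc [x [t d]] vP; case: (vP) => _ /(_ x) [Px|Px].
  by exists x.
by exists x^-1; split=> //; [apply: transc_inv | apply: depdt_inv].
Qed.

(* Common factors of the coefficients of a relation can be cancelled. *)
Lemma depdt_primitive x : transc x -> depdt x -> exists N, forall f, (1 < size f)%N ->
  forall z : 'I_N -> E, exists g : 'I_N -> {poly F},
  (exists i, ~~ (f %| g i)) /\ \sum_i ev (g i) x * z i = 0.
Proof.
move=> trx [N dx]; exists N => f sf z; have [g [[i gi] e]] := dx z.
have f0 : f != 0 by rewrite -size_poly_gt0 ltnW.
have [m] := ubnP (size (g i)); elim: m => // m IH in g gi e *; rewrite ltnS => le.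
have [h|h] := pselect (exists i, ~~ (f %| g i)); first by exists g.
have {}h j : g j = (g j %/ f) * f.
  by apply/esym/divpK; apply: contrapT => nd; apply: h; exists j; apply/negP.
apply: (IH (fun j => g j %/ f)).
- by apply: contra_neq gi => e0; rewrite (h i) e0 mul0r.
- have fx0 : ev f x != 0 by apply: contra_neq f0; apply: trx.
  apply: (mulIf fx0); rewrite mul0r mulr_suml -[RHS]e; apply: eq_bigr => j _.
  by rewrite [in RHS]h evM mulrAC.
- apply: leq_trans le; rewrite size_divp //.
  rewrite -subn1 ltn_subrL size_poly_gt0 gi andbT; by case: (size f) sf => [|[]].
Qed.

(** [f] generates the kernel of the map from F[X] to the residue field of [P] given by [x]: it is
    the minimal polynomial of the residue of [x], up to a constant. *)
Definition min_eq P x f :=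
  [/\ (1 < size f)%N, max_ideal P (ev f x) & forall g, max_ideal P (ev g x) -> f %| g].

Lemma min_eq_ex P x f : closed_point iota P -> P x -> f != 0 -> max_ideal P (ev f x) ->
  exists g, min_eq P x g.
Proof.
move=> cP Px fn0 mf; have vP : valring P by auto.
have ex : exists n, `[< exists f, [/\ f != 0, max_ideal P (ev f x) & size f = n] >].
  by exists (size f); apply/asboolP; exists f.
case: (ex_minnP ex) => n /asboolP[{fn0 mf}f [f0 mf sf]] hmin; exists f; split=> //.
  rewrite ltnNge; apply/negP=> /size1_polyC e.
  move: mf f0; rewrite e map_polyC hornerC => /(curve_const_mi (closed_curve cP)) ->.
  by rewrite polyC0 eqxx.
move=> g mg; rewrite /dvdp; apply: contraT => r0.
have := ltn_modpN0 g f0; rewrite ltnNge sf hmin //; apply/asboolP.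
exists (g %% f); split=> //.
have -> : ev (g %% f) x = ev g x - ev (g %/ f) x * ev f x.
  by rewrite {2}(divp_eq g f) rmorphD hornerD evM addrC addKr.
by apply: miB => //; apply: miMl; auto; apply: ev_point; auto.
Qed.

(** The powers of a nonzero [u] in the maximal ideal are dependent over F(x). After division by the
    lowest power of [u] that occurs, the coefficient of that power is seen to be a multiple of [u],
    and it is a polynomial in [x]. *)
Lemma closed_min_eq P x : closed_point iota P -> transc x -> depdt x -> P x ->
  exists f, min_eq P x f.
Proof.
move=> cP trx [N dx] Px; have vP : valring P by auto.
have [u u0 mu] := closed_mi cP.
have [f [fn0 mf]] : exists f, f != 0 /\ max_ideal P (ev f x).
  have [f [[i0 fi0] e]] := dx (fun i => u ^+ i).
  pose a i := if insub i is Some j then f j else 0 : {poly F}.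
  have ea : \sum_(i < N) ev (a i) x * u ^+ i = 0.
    by rewrite -[RHS]e; apply: eq_bigr => i _; rewrite /a valK.
  have ex : exists i, a i != 0 by exists i0; rewrite /a valK.
  case: (ex_minnP ex) => m am hm.
  have mN : (m < N)%N by move: am; rewrite /a; case: insubP => //; rewrite eqxx.
  exists (a m); split=> //.
  move: ea; rewrite -(big_mkord xpredT (fun i => ev (a i) x * u ^+ i)).
  rewrite (big_cat_nat (n := m)) ?(ltnW mN) //= big1_seq ?add0r; last first.
    move=> i /andP[_]; rewrite mem_index_iota => /andP[_ im].
    have [->|/hm] := eqVneq (a i) 0; first by rewrite rmorph0 horner0 mul0r.
    by rewrite leqNgt im.
  rewrite big_ltn // => /eqP; rewrite addr_eq0 => /eqP e'.
  have um0 : u ^+ m != 0 by rewrite expf_neq0.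
  have -> : ev (a m) x = - \sum_(m.+1 <= i < N) ev (a i) x * u ^+ (i - m.+1) * u.
    apply: (mulIf um0); rewrite e' mulNr mulr_suml; congr (- _).
    rewrite !big_nat; apply: eq_bigr => i /andP[mi _].
    by rewrite -!mulrA -exprS -exprD subnK.
  apply: miN; auto; apply: mi_sum => // i _; apply: miMl; auto.
  apply: srM; auto; first by apply: ev_point; auto.
  by apply: srX; auto; apply: mi_sub mu.
exact: min_eq_ex cP Px fn0 mf.
Qed.

Lemma min_eqP P x f g : curve_point iota P -> P x -> min_eq P x f ->
  f %| g <-> max_ideal P (ev g x).
Proof.
move=> cP Px [_ mf h]; split; last exact: h.
move=> /dvdpP[q ->]; rewrite evM; apply: miMl; auto; exact: ev_point.
Qed.

End FunctionField.

Section Places.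
Variables (F E : fieldType) (iota : {rmorphism F -> E}).
Hypothesis ffE : is_function_field iota.
Implicit Types (P Q : set E) (x y z u : E) (f g p : {poly F}).

Local Notation ev f x := (map_poly iota f).[x].
Local Notation cl := (closed_point iota).
Let clv P : cl P -> valring P := @closed_valring _ _ iota P.
Let clc P : cl P -> curve_point iota P := @closed_curve _ _ iota P.
#[local] Hint Resolve clv clc : core.

Lemma depdt_first x : transc iota x -> depdt iota x -> exists N, forall f, (1 < size f)%N ->
  forall z : nat -> E, exists (g : nat -> {poly F}) m,
  [/\ (m < N)%N, ~~ (f %| g m), forall i, (i < m)%N -> f %| g i &
      \sum_(i < N) ev (g i) x * z i = 0].
Proof.
move=> t d; have [N h] := depdt_primitive t d; exists N => f sf z.
have [g [[i0 gi0] e]] := h f sf (fun i => z i).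
pose a i := if insub i is Some j then g j else 0 : {poly F}.
have ex : exists i, ~~ (f %| a i) by exists i0; rewrite /a valK.
case: (ex_minnP ex) => m am hm; exists a, m; split=> //.
- by move: am; rewrite /a; case: insubP => //; rewrite dvdp0.
- by move=> i im; apply: contraLR im => /hm; rewrite -leqNgt.
- by rewrite -[RHS]e; apply: eq_bigr => i _; rewrite /a valK.
Qed.

(** For [b] in [Q] outside [P], the inverse of [b] is a unit at [Q] and lies in the maximal ideal of
    [P]. In a primitive relation between its powers, the first coefficient not divisible by the
    minimal equation [f] of [x] at [Q] must vanish at [P]. But [f] is, up to a constant, also the
    minimal equation of [x] at [P]: a contradiction. *)
Lemma closed_maximal P Q : cl P -> cl Q -> P `<=` Q -> P = Q.
Proof.
move=> cP cQ PQ; apply/seteqP; split=> // b Qb; apply: contrapT => nPb.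
have [x [t d Px]] := transc_in ffE (closed_valring cP).
have [f mf] := closed_min_eq cQ t d (PQ _ Px).
have [fP mfP] := closed_min_eq cP t d Px.
have mQP y : max_ideal Q y -> max_ideal P y.
  have [->|y0] := eqVneq y 0; first by move=> _; apply: mi0; auto.
  move=> /(inv_mi y0) nQ; rewrite -(invrK y); apply: mi_inv; auto.
have mc : max_ideal P b^-1 by apply: mi_inv; auto.
have b0 : b != 0 by apply: contra_notN nPb => /eqP->; apply: sr0; auto.
have Qc : Q b^-1 by apply: PQ; apply: mi_sub mc.
have [N prim] := depdt_first t d.
have [sf mfx _] := mf.
have [g [m [mN ngm gi e]]] := prim f sf (fun i => b^-1 ^+ i).
have Qg i : Q (ev (g i) x) by apply: ev_point; auto.
have Pg i : P (ev (g i) x) by apply: ev_point; auto.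
have mgm : max_ideal P (ev (g m) x).
  move: e; rewrite -(big_mkord xpredT (fun i => ev (g i) x * b^-1 ^+ i)).
  rewrite (big_cat_nat (n := m)) ?(ltnW mN) //= [X in _ + X]big_ltn // addrCA => /eqP.
  rewrite addr_eq0 => /eqP e.
  (* Terms before [m] are divisible by [f] and so lie in the maximal ideal of [Q], hence in that of
     [P]; terms after [m] keep a factor [b^-1]. *)
  have -> : ev (g m) x = - (\sum_(0 <= i < m) ev (g i) x * b ^+ (m - i)
       + \sum_(m.+1 <= i < N) ev (g i) x * b^-1 ^+ (i - m.+1) * b^-1).
    have bm0 : b^-1 ^+ m != 0 by rewrite expf_neq0 // invr_eq0.
    apply: (mulIf bm0); rewrite e mulNr mulrDl !mulr_suml; congr (- (_ + _)).
      rewrite !big_nat; apply: eq_bigr => i /andP[_ im].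
      by rewrite -mulrA mulXV ?leq_subr // subKn // ltnW.
    rewrite !big_nat; apply: eq_bigr => i /andP[mi _].
    by rewrite -!mulrA -exprS -exprD subnK.
  apply: miN; auto; apply: miD; auto.
    apply: mQP; rewrite big_nat; apply: mi_sum; auto => i /andP[_ im]; apply: miMr; auto.
      by apply: srX; auto.
    by apply: (min_eqP (g i) (clc cQ) (PQ _ Px) mf).1; apply: gi.
  apply: mi_sum; auto => i _; apply: miMl; auto.
  by apply: srM; auto; apply: srX; auto; apply: mi_sub mc.
have fg := (min_eqP (g m) (closed_curve cP) Px mfP).2 mgm.
have /dvdpP[q eq] := (min_eqP f (closed_curve cP) Px mfP).2 (mQP _ mfx).
have f0 : f != 0 by rewrite -size_poly_gt0 ltnW.
have sP : (1 < size fP)%N by case: mfP.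
have q0 : q != 0 by apply: contra_neq f0 => q0; rewrite eq q0 mul0r.
have Qx := PQ _ Px.
move: (mfx); rewrite {1}eq evM => /(miMp (clv cQ)) [||mq|mfp]; try by apply: ev_point; auto.
  have /dvdp_leq : f %| q by case: mf => _ _; apply.
  rewrite q0 => /(_ isT); rewrite {1}eq size_mul // -?size_poly_gt0 ?(ltnW sP) //.
  by case: (size fP) sP => [|[|n]] // _; rewrite addnS /= -addSnnS leqNgt ltn_addr.
move: ngm; apply/negP; rewrite negbK; apply: dvdp_trans fg.
by case: mf => _ _; apply.
Qed.

(** The elements that some power of [u] carries into [Q] form a ring containing [Q]. If it were not
    all of [E], it would equal [Q] by maximality; but it contains [u^-1]. *)
Lemma rank_one Q u x : cl Q -> max_ideal Q u ->
  exists N, forall n, (N <= n)%N -> max_ideal Q (u ^+ n * x).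
Proof.
move=> cQ mu; have vQ : valring Q by auto.
have Qu := mi_sub mu.
have [->|u0] := eqVneq u 0.
  by exists 1%N => -[//|n] _; rewrite exprS mul0r mul0r; apply: mi0; auto.
suff [N hN] : exists n, Q (u ^+ n * x).
  exists N.+1 => n Nn; rewrite -(subnK Nn) exprD exprS -!mulrA mulrCA.
  by apply: miMr; auto; apply: srM; auto; apply: srX; auto.
pose R := [set y | exists n, Q (u ^+ n * y)].
have QR : Q `<=` R by move=> y Qy; exists 0%N; rewrite mul1r.
have [//|nx] := pselect (R x).
have cR : cl R.
  split; last by exists x.
  split.
  - by move=> a; apply: QR; apply: curve_const; auto.
  - move=> y z [n hn] [m hm]; exists (n + m)%N; rewrite mulrBr exprD.
    apply: srB; auto; last by rewrite -mulrA; apply: srM; auto; apply: srX; auto.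
    by rewrite mulrAC mulrC; apply: srM; auto; apply: srX; auto.
  - move=> y z [n hn] [m hm]; exists (n + m)%N.
    by rewrite exprD mulrACA; apply: srM; auto.
  - by move=> y; case: (vQ) => _ /(_ y) []; [left|right]; apply: QR.
have := inv_mi u0 mu; rewrite (closed_maximal cQ cR QR); case.
by exists 1%N; rewrite expr1 mulfV //; apply: sr1; auto.
Qed.

(** Induction on the points: to the function [y] found so far a high power of [h] is added, where
    [h] has a zero at [P] and a pole at the new point. Where [h] has a pole the power dominates [y];
    where [h] is regular the pole of [y] survives. *)
Lemma approx_pole P n (Q : nat -> set E) : cl P -> (forall i, (i < n)%N -> cl (Q i)) ->
  exists y, max_ideal P y /\ forall i, (i < n)%N -> Q i <> P -> ~ Q i y.
Proof.
move=> cP; elim: n => [|n IH] cQ; first by exists 0; split=> //; apply: mi0; auto.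
have [|y [my hy]] := IH; first by move=> i /ltnW; apply: cQ.
have [en|ne] := pselect (Q n = P).
  by exists y; split=> // i; rewrite ltnS leq_eqVlt => /orP[/eqP -> //|]; apply: hy.
have cQn := cQ _ (ltnSn n).
have [h [mh nh]] : exists h, max_ideal P h /\ ~ Q n h.
  have [a [Pa na]] : exists a, P a /\ ~ Q n a.
    apply: contrapT => H; apply: ne; symmetry; apply: closed_maximal => // a Pa.
    by apply: contrapT => na; apply: H; exists a.
  have [b [Qb nb]] : exists a, Q n a /\ ~ P a.
    apply: contrapT => H; apply: ne; apply: closed_maximal => // b Pb.
    by apply: contrapT => nb; apply: H; exists b.
  exists (a / b); split; first by apply: miMl; auto; apply: mi_inv; auto.
  have b0 : b != 0 by apply: contra_notN nb => /eqP->; apply: sr0; auto.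
  by move=> h; apply: na; rewrite -(divfK b0 a); apply: srM; auto.
have H i : (i < n.+1)%N -> exists N, forall e, (N <= e)%N -> Q i <> P -> ~ Q i (y + h ^+ e).
  move=> lt; have cQi := cQ _ lt; have sQi : subring (Q i) by auto.
  have [Qh|nQh] := pselect (Q i h).
    have lt' : (i < n)%N.
      by move: lt; rewrite ltnS leq_eqVlt => /orP[/eqP e0|//]; case: nh; rewrite -e0.
    exists 0%N => e _ neq Qy; apply: (hy _ lt' neq).
    by rewrite -(addrK (h ^+ e) y); apply: srB; auto; apply: srX; auto.
  have h0 : h != 0 by apply: contra_notN nQh => /eqP->; apply: sr0; auto.
  have [N hN] := rank_one y cQi (mi_inv (closed_valring cQi) nQh).
  exists N.+1 => -[//|e] Ne neq Qy; have mye := hN _ (ltnW Ne).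
  have := hN _ (ltnW Ne) => my'.
  have e1 : 1 = (h^-1) ^+ e.+1 * (y + h ^+ e.+1) - h^-1 ^+ e.+1 * y.
    by rewrite mulrDr addrC addKr -exprMn mulVf // expr1n.
  have : max_ideal (Q i) 1.
    rewrite e1; apply: miB; auto; apply: miMr; auto.
    rewrite exprS; apply: miMr; auto; last by apply: mi_inv; auto.
    by apply: srX; auto; apply: vr_inv; auto.
  by apply: mi1; auto.
have [N hN] : exists N, forall i, (i < n.+1)%N -> Q i <> P -> ~ Q i (y + h ^+ N.+1).
  have [M hM] : exists M, forall i, (i < n.+1)%N -> forall e, (M <= e)%N ->
      Q i <> P -> ~ Q i (y + h ^+ e).
    elim: n.+1 H => [|k IHk] H; first by exists 0%N.
    have [M hM] := IHk (fun i lt => H i (ltnW lt)).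
    have [M' hM'] := H _ (ltnSn k).
    exists (maxn M M') => i; rewrite ltnS leq_eqVlt => /orP[/eqP->|lt] e; rewrite geq_max => /andP[le le'].
      exact: hM'.
    exact: hM.
  by exists M => i lt; apply: hM.
exists (y + h ^+ N.+1); split=> //; apply: miD; auto.
by rewrite exprS; apply: miMr; auto; apply: srX; auto; apply: mi_sub mh.
Qed.

(** With [y] from [approx_pole], the inverse of [1 + y] has value 1 at [P] and turns the poles at
    the other points into zeros. *)
Lemma approx P n (Q : nat -> set E) : cl P -> (forall i, (i < n)%N -> cl (Q i)) ->
  exists z, max_ideal P (z - 1) /\ forall i, (i < n)%N -> Q i <> P -> max_ideal (Q i) z.
Proof.
move=> cP cQ; have [y [my hy]] := approx_pole cP cQ.
have n1 : ~ max_ideal P (1 + y).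
  by move=> h; apply: (@mi1 _ P); auto; rewrite -(addrK y 1); apply: miB; auto.
have P1 : P (1 + y) by apply: srD; auto; [apply: sr1; auto| apply: mi_sub my].
have [y10 Py1] := mi_unit P1 n1.
exists (1 + y)^-1; split.
  have -> : (1 + y)^-1 - 1 = - (y * (1 + y)^-1) by field.
  by apply: miN; auto; apply: miMr; auto.
move=> i lt ne; have cQi := cQ _ lt; apply: mi_inv; auto => Qy; apply: (hy _ lt ne).
by rewrite -(addKr 1 y) addrC; apply: srB; auto; apply: sr1; auto.
Qed.

Lemma infinite_inj (T : Type) (A : set T) : ~ finite_set A ->
  exists h : nat -> T, injective h /\ forall i, A (h i).
Proof.
move=> /infiniteP /card_leP [h].
pose k (n : nat) : [set: nat] := SigSub (mem_set (I : [set: nat] n)).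
exists (fun n => val (h (k n))); split.
  move=> i j /val_inj e; have : k i = k j by apply: (@inj _ _ _ h); rewrite ?inE.
  by move=> /(congr1 val).
by move=> i; apply: set_mem; apply: valP.
Qed.

(** If an irreducible [p] had infinitely many zeros, take [z i] congruent to 1 at one of them and to
    0 at the first [N] others. A primitive relation between them, reduced at each point in turn, has
    all its coefficients divisible by [p], which is absurd. A reducible [p] is split into
    factors. *)
Lemma finite_zeros x p : transc iota x -> depdt iota x -> p != 0 ->
  finite_set [set Q | [/\ cl Q, Q x & max_ideal Q (ev p x)]].
Proof.
move=> t d; have [n] := ubnP (size p); elim: n p => // n IH p; rewrite ltnS => sp p0.
have [[g [sg gp lt]]|irr] := pselect (exists g, [/\ (1 < size g)%N, g %| p & (size g < size p)%N]).
  have /dvdpP[q eq] := gp.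
  have q0 : q != 0 by apply: contra_neq p0 => q0; rewrite eq q0 mul0r.
  have g0 : g != 0 by rewrite -size_poly_gt0 ltnW.
  have lq : (size q < size p)%N.
    rewrite eq size_mul // addnC; case: (size g) sg => [|[|k]] // _.
    by rewrite addSn /= addSn ltnS leq_addl.
  apply: (@sub_finite_set _ _ ([set Q | [/\ cl Q, Q x & max_ideal Q (ev q x)]] `|`
     [set Q | [/\ cl Q, Q x & max_ideal Q (ev g x)]])); last first.
    by rewrite finite_setU; split; [apply: (IH q) => //; apply: leq_trans lq sp | apply: (IH g) => //; apply: leq_trans lt sp].
  move=> Q [cQ Qx]; rewrite eq evM => /(miMp (clv cQ)) [||h|h]; try by apply: ev_point; auto.
    by left; split.
  by right; split.
apply: contrapT => /infinite_inj [h [hinj hQ]].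
have sp1 : (1 < size p)%N.
  rewrite ltnNge; apply/negP => /size1_polyC e; case: (hQ 0%N) => cQ _.
  rewrite e map_polyC hornerC => /(curve_const_mi (closed_curve cQ)) e0.
  by move: p0; rewrite e e0 polyC0 eqxx.
have [N prim] := depdt_primitive t d.
have /(_ _)/cid z : forall i, exists z, max_ideal (h i) (z - 1) /\
    forall j, (j < N)%N -> h j <> h i -> max_ideal (h j) z.
  by move=> i; apply: approx => [|j _]; [case: (hQ i) | case: (hQ j)].
have [g [[i ngi] e]] := prim p sp1 (fun i => sval (z i)).
have [cQ Qx mp] := hQ i; case: (svalP (z i)) => mz _.
have mg : max_ideal (h i) (ev (g i) x).
  have Qz : h i (sval (z i)).
    by rewrite -(subrK 1 (sval (z i))); apply: srD; auto; [apply: mi_sub mz|apply: sr1; auto].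
  have : max_ideal (h i) (ev (g i) x * sval (z i)).
    move: e; rewrite (bigD1 i) //= => /eqP; rewrite addr_eq0 => /eqP ->.
    apply: miN; auto; apply: mi_sum; auto => j ji; apply: miMl; auto.
      by apply: ev_point; auto.
    case: (svalP (z j)) => _; apply => // /hinj/ord_inj/eqP; rewrite eq_sym; exact/negP.
  move=> /(miMp (clv cQ)) [||//|mz']; rewrite //; first by apply: ev_point; auto.
  case: (@mi1 _ (h i)); auto; rewrite -(subKr (sval (z i)) 1); apply: miB; auto.
have [f mf] := closed_min_eq cQ t d Qx; have [sf _ hf] := mf.
have f0 : f != 0 by rewrite -size_poly_gt0 ltnW.
have fp := hf _ mp.
have ef : size f = size p.
  apply/eqP; rewrite eqn_leq dvdp_leq //= leqNgt; apply/negP=> lt.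
  by apply: irr; exists f.
move: ngi; rewrite -(eqp_dvdl _ (_ : f %= p)) ?hf //.
by rewrite -dvdp_size_eqp // ef.
Qed.

(** Where [x] is regular and the leading coefficient of an equation of [y] over F[x] is a unit, [y]
    is integral. The poles of [y] therefore lie among the poles of [x] and the zeros of that
    coefficient. *)
Lemma finite_poles y : finite_set [set Q | cl Q /\ ~ Q y].
Proof.
have [x [t [N d]]] := function_field_transc ffE.
have [f [[i0 fi0] e]] := d (fun i => y ^+ i).
pose a i := if insub i is Some j then f j else 0 : {poly F}.
have ex : exists i, a i != 0 by exists i0; rewrite /a valK.
have ub i : a i != 0 -> (i <= N)%N.
  by rewrite /a; case: insubP => [j lt _ _|_]; [apply: ltnW | rewrite eqxx].
case: (ex_maxnP ex ub) => m am hm.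
have mN : (m < N)%N by move: am; rewrite /a; case: insubP => //; rewrite eqxx.
have ea : \sum_(i < m.+1) ev (a i) x * y ^+ i = 0.
  rewrite -[RHS]e (eq_bigr (fun i : 'I_N => ev (a i) x * y ^+ i)); last first.
    by move=> i _; rewrite /a valK.
  rewrite -!(big_mkord xpredT (fun i => ev (a i) x * y ^+ i)).
  rewrite [RHS](big_cat_nat (n := m.+1)) //= [X in _ + X]big1_seq ?addr0 // => i /andP[_].
  rewrite mem_index_iota => /andP[mi _].
  have [->|/hm] := eqVneq (a i) 0; first by rewrite rmorph0 horner0 mul0r.
  by rewrite leqNgt mi.
have dx : depdt iota x by exists N.
apply: (@sub_finite_set _ _ ([set Q | [/\ cl Q, Q x^-1 & max_ideal Q (ev 'X x^-1)]] `|`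
   [set Q | [/\ cl Q, Q x & max_ideal Q (ev (a m) x)]])).
  move=> Q [cQ ny]; have vQ : valring Q by auto.
  have [Qx|nQx] := pselect (Q x); [right|left].
    split=> //; apply: contrapT => nm; apply: ny.
    apply: (int_closed (a := fun i => ev (a i) x)) nm ea; auto.
    by move=> i; apply: ev_point; auto.
  split=> //; first exact: vr_inv.
  by rewrite map_polyX hornerX; apply: mi_inv.
rewrite finite_setU; split; apply: finite_zeros => //.
- exact: transc_inv.
- exact: depdt_inv.
- by rewrite polyX_eq0.
Qed.

End Places.

(** * Units, uniformizers and valuations *)

Section UnitsOf.
Variable E : fieldType.
Implicit Types (P : set E) (x y t : E).

Definition isu P x := [/\ x != 0, P x & P x^-1].

Lemma isu1 P : subring P -> isu P 1.
Proof. by move=> h; split; rewrite ?oner_eq0 ?invr1 //; apply: sr1. Qed.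

Lemma isuM P x y : subring P -> isu P x -> isu P y -> isu P (x * y).
Proof.
move=> h [x0 Px Px'] [y0 Py Py']; split; first by rewrite mulf_neq0.
  exact: srM.
by rewrite invfM; apply: srM.
Qed.

Lemma isuV P x : isu P x -> isu P x^-1.
Proof. by move=> [x0 Px Px']; split; rewrite ?invrK // invr_eq0. Qed.

Lemma isuX P x n : subring P -> isu P x -> isu P (x ^+ n).
Proof.
move=> h ux; elim: n => [|n IH]; first by rewrite expr0; apply: isu1.
by rewrite exprS; apply: isuM.
Qed.

Lemma isuXz P x (n : int) : subring P -> isu P x -> isu P (x ^ n).
Proof.
move=> h ux; case: n => n; first by rewrite -exprnP; apply: isuX.
by rewrite NegzE -exprnN; apply: isuV; apply: isuX.
Qed.

Lemma isu_nmi P x : isu P x -> ~ max_ideal P x.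
Proof. by case=> x0 _ h; apply: unit_nmi. Qed.

Lemma nmi_isu P x : P x -> ~ max_ideal P x -> isu P x.
Proof. by move=> Px /(mi_unit Px) []. Qed.

Lemma uniformizer_isu P t t' : uniformizer P t -> uniformizer P t' -> isu P (t / t').
Proof.
move=> [mt t0 ht] [mt' t0' ht']; split; rewrite ?mulf_neq0 ?invr_eq0 //; first exact: ht'.
by rewrite invf_div; apply: ht.
Qed.

Lemma uniformizer_pow P t (n : int) : valring P -> uniformizer P t -> isu P (t ^ n) -> n = 0.
Proof.
move=> vP [mt t0 ht].
have key k : ~ isu P (t ^+ k.+1).
  move=> /isu_nmi; apply; rewrite exprS; apply: miMr; auto.
  by apply: srX; auto; apply: mi_sub mt.
case: n => [[//|n]|n]; first by rewrite -exprnP => /key.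
by rewrite NegzE -exprnN => /isuV; rewrite invrK => /key.
Qed.

(** The normalised valuation at [P]. At 0 it takes the default value 0, hence the hypotheses
    [x != 0] in what follows. *)
Definition vl P x : int :=
  xget 0 [set n : int | exists2 t, uniformizer P t & isu P (x * t ^ (- n))].

Lemma vl_uniq P t x (n : int) : valring P -> uniformizer P t -> isu P (x * t ^ (- n)) ->
  vl P x = n.
Proof.
move=> vP ut ux; rewrite /vl; apply: xget_unique; first by exists t.
move=> m [t' ut' ux']; apply/eqP; rewrite -subr_eq0; apply/eqP.
have [_ t0 _] := ut; have [_ t0' _] := ut'.
have x0 : x != 0 by case: ux; rewrite mulf_eq0 negb_or => /andP[].
apply: (uniformizer_pow vP ut).
have -> : t ^ (m - n) = (x * t ^ (- n)) / (x * t' ^ (- m)) * (t / t') ^ m.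
  rewrite expfzMl expfzDr // exprz_inv -[t' ^ (-m)]invr_expz invfM invrK.
  have := expfz_neq0 m t0'; rewrite -invr_expz; move: (t ^ m) (t' ^ m) (t ^ (- n)) => a b c b0.
  by field; rewrite b0 x0 expfz_neq0.
apply: isuM; auto; last by apply: isuXz; auto; apply: uniformizer_isu.
by apply: isuM; auto; apply: isuV.
Qed.

End UnitsOf.

Section Valuation.
Variables (F E : fieldType) (iota : {rmorphism F -> E}).
Hypothesis ffE : is_function_field iota.
Implicit Types (P Q : set E) (x y z u t : E) (f g p : {poly F}).

Local Notation ev f x := (map_poly iota f).[x].
Local Notation cl := (closed_point iota).
Let clv P : cl P -> valring P := @closed_valring _ _ iota P.
Let clc P : cl P -> curve_point iota P := @closed_curve _ _ iota P.
#[local] Hint Resolve clv clc : core.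

(* If no uniformizer existed there would be arbitrarily long chains of elements whose
   valuations lie strictly between 0 and that of [ev f x]; such elements are linearly
   independent over [F(x)]. *)
Lemma uniformizer_exists P : cl P -> exists t, uniformizer P t.
Proof.
move=> cP; apply: contrapT => nt; have vP := clv cP.
have [x [t d Px]] := transc_in ffE vP.
have [f mf] := closed_min_eq cP t d Px; have [sf mfx _] := mf.
have f0 : f != 0 by rewrite -size_poly_gt0 ltnW.
have fx0 : ev f x != 0 by apply: contra_neq f0; apply: t.
pose good a := max_ideal P a /\ a != 0.
have /choice[nxt hn] : forall a, exists b, good a -> good b /\ max_ideal P (a / b).
  move=> a; have [[ma a0]|na] := pselect (good a); last by exists 0 => /na.
  have [b [mb nb]] : exists b, max_ideal P b /\ ~ P (b / a).
    apply: contrapT => H; apply: nt; exists a; split=> // b mb.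
    by apply: contrapT => nb; apply: H; exists b.
  have b0 : b != 0 by apply: contra_notN nb => /eqP->; rewrite mul0r; apply: sr0; auto.
  exists b => _; split; first by split.
  by have := mi_inv vP nb; rewrite invf_div.
pose s i := iter i nxt (ev f x).
have gs i : good (s i) by elim: i => [|i /hn []//]; split.
have ms i j : (i < j)%N -> max_ideal P (s i / s j).
  elim: j => // j IH; rewrite ltnS leq_eqVlt => /orP[/eqP<-|/IH h]; first by case: (hn _ (gs i)).
  have [_ m] := hn _ (gs j); have [_ sj0] := gs j; have [_ sj1] := gs j.+1.
  have -> : s i / s j.+1 = (s i / s j) * (s j / s j.+1) by field; apply/andP.
  by apply: miMr; auto; apply: mi_sub m.
have [N prim] := depdt_first t d.
have [g [m [mN ngm gi e]]] := prim f sf (fun i => s (N - i)%N).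
have [_ sm0] := gs (N - m)%N.
have : max_ideal P (ev (g m) x).
  have -> : ev (g m) x = - \sum_(i < N | val i != m) ev (g i) x * (s (N - i)%N / s (N - m)%N).
    apply: (mulIf sm0); rewrite mulNr mulr_suml; apply/eqP; rewrite -addr_eq0 -[X in _ == X]e.
    rewrite [X in _ == X](bigD1 (Ordinal mN)) //=; apply/eqP; congr (_ + _).
    by apply: eq_bigr => i _; rewrite -mulrA divfK.
  apply: miN; auto; apply: mi_sum; auto => i im.
  have [lt|gt|eq] := ltngtP i m.
  - have /dvdpP[q ->] := gi _ lt; rewrite evM -mulrA.
    have -> : ev q x * (ev f x * (s (N - i)%N / s (N - m)%N))
       = (ev q x * s (N - i)%N) * (s 0%N / s (N - m)%N) by rewrite /s /=; ring.
    apply: miMl; auto; last by apply: ms; rewrite subn_gt0.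
    by apply: srM; auto; [apply: ev_point; auto | have [/mi_sub] := gs (N - i)%N].
  - apply: miMl; auto; first by apply: ev_point; auto.
    by apply: ms; rewrite ltn_sub2l.
  - by case/negP: im; apply/eqP.
by move=> /(min_eqP (g m) (clc cP) Px mf); apply/negP.
Qed.

(** For [y] in [P] the exponent is the last [n] with [y / t ^+ n] in [P]; [rank_one] guarantees that
    there is a last one. Elements outside [P] are inverted first. *)
Lemma uniformizer_val P t y : cl P -> uniformizer P t -> y != 0 ->
  exists n : int, isu P (y * t ^ (- n)).
Proof.
move=> cP [mt t0 ht] y0; have vP := clv cP.
wlog Py : y y0 / P y => [W|].
  have [Py|/(vr_inv vP) Py] := pselect (P y); first exact: W.
  have [|n /isuV hn] := W y^-1 _ Py; first by rewrite invr_eq0.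
  by exists (- n); move: hn; rewrite invfM invrK invr_expz.
have [N hN] := rank_one ffE y^-1 cP mt.
have ex : exists n, `[< ~ P (y / t ^+ n) >].
  exists N; apply/asboolP => h.
  case: (inv_mi _ (hN N (leqnn _))); last by rewrite invfM invrK mulrC.
  by rewrite mulf_neq0 // ?expf_neq0 // invr_eq0.
case: (ex_minnP ex) => -[/asboolP|n /asboolP hn hm]; first by rewrite expr0 divr1.
exists n%:Z; rewrite -exprnN.
have Pn : P (y / t ^+ n).
  apply: contrapT => h; suff : (n < n)%N by rewrite ltnn.
  by apply: hm; apply/asboolP.
apply: nmi_isu => // /ht; rewrite -mulrA -invfM -exprSr; exact: hn.
Qed.

Lemma vlP P x : cl P -> x != 0 -> exists2 t, uniformizer P t & isu P (x * t ^ (- vl P x)).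
Proof.
move=> cP x0; have [t ut] := uniformizer_exists cP.
have [n hn] := uniformizer_val cP ut x0.
by exists t => //; rewrite (vl_uniq (clv cP) ut hn).
Qed.

Lemma vl_uniformizer P t : cl P -> uniformizer P t -> vl P t = 1.
Proof.
move=> cP ut; apply: (vl_uniq (clv cP) ut); have [_ t0 _] := ut.
by rewrite exprN1 mulfV //; apply: isu1; auto.
Qed.

Lemma vl_isu P x : cl P -> isu P x -> vl P x = 0.
Proof.
move=> cP ux; have [t ut] := uniformizer_exists cP; apply: (vl_uniq (clv cP) ut).
by rewrite oppr0 expr0z mulr1.
Qed.

Lemma vl1 P : cl P -> vl P 1 = 0.
Proof. by move=> cP; apply: vl_isu => //; apply: isu1; auto. Qed.

Lemma vlM P x y : cl P -> x != 0 -> y != 0 -> vl P (x * y) = vl P x + vl P y.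
Proof.
move=> cP x0 y0; have [t ut ux] := vlP cP x0; have [t' ut' uy] := vlP cP y0.
apply: (vl_uniq (clv cP) ut).
have [_ t0 _] := ut; have [_ t0' _] := ut'.
have -> : x * y * t ^ (- (vl P x + vl P y)) =
   (x * t ^ (- vl P x)) * (y * t' ^ (- vl P y)) * (t' / t) ^ (vl P y).
  rewrite expfzMl opprD expfzDr // exprz_inv -[t' ^ (-_)]invr_expz.
  have := expfz_neq0 (vl P y) t0'; move: (t ^ (- vl P x)) (t' ^ vl P y) (t ^ (- vl P y)) => a b c b0.
  by field.
apply: isuM; auto; first by apply: isuM; auto.
by apply: isuXz; auto; apply: uniformizer_isu.
Qed.

Lemma vlV P x : cl P -> x != 0 -> vl P x^-1 = - vl P x.
Proof.
move=> cP x0; have xV0 : x^-1 != 0 by rewrite invr_eq0.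
by apply/eqP; rewrite -addr_eq0 -vlM // mulVf // vl1 // eqxx.
Qed.

Lemma vlX P x n : cl P -> x != 0 -> vl P (x ^+ n) = vl P x *+ n.
Proof.
move=> cP x0; elim: n => [|n IH]; first by rewrite expr0 vl1.
by rewrite exprS mulrS vlM ?expf_neq0 // IH.
Qed.

Lemma vl_ge0 P x : cl P -> x != 0 -> P x <-> 0 <= vl P x.
Proof.
move=> cP x0; have [t ut ux] := vlP cP x0; have [mt t0 ht] := ut.
have Pt : P t := mi_sub mt.
split=> [Px|]; last first.
  case: (vl P x) ux => // n; rewrite -exprnN => -[_ h _] _.
  rewrite -(divfK (expf_neq0 n t0) x); apply: srM; auto.
  by apply: srX; auto.
rewrite leNgt; apply/negP; case: (vl P x) ux => // n.
rewrite NegzE opprK -exprnP => /isu_nmi + _; apply; apply: miMl; auto.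
by rewrite exprS; apply: miMr; auto; apply: srX; auto.
Qed.

Lemma vl_eq0 P x : cl P -> x != 0 -> vl P x = 0 -> isu P x.
Proof.
move=> cP x0 v0; split=> //; apply/vl_ge0; rewrite ?invr_eq0 ?vlV ?v0 //.
Qed.

Lemma vl_gt0 P x : cl P -> x != 0 -> max_ideal P x <-> 0 < vl P x.
Proof.
move=> cP x0; split.
  move=> mx; rewrite lt_neqAle; apply/andP; split; last by apply/vl_ge0 => //; apply: mi_sub mx.
  by apply/negP => /eqP /esym /(vl_eq0 cP x0) /isu_nmi.
move=> lt; have Px : P x by apply/vl_ge0 => //; apply: ltW.
by apply: contrapT => /(nmi_isu Px) /(vl_isu cP) v0; rewrite v0 in lt.
Qed.

End Valuation.

(** * Poles, and functions without poles *)

Section Algebraic.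
Variables (F E : fieldType) (iota : {rmorphism F -> E}).
Local Notation ev f x := (map_poly iota f).[x].

(** Chevalley's theorem for the ring F[y^-1] and its element [y^-1]. This element generates a proper
    ideal because it is transcendental: a polynomial identity [f * 'X = 1] fails at 0. *)
Lemma transc_pole y : transc iota y -> exists P, closed_point iota P /\ ~ P y.
Proof.
move=> ty; have y0 := transc_neq0 ty; have tV := transc_inv ty.
pose R := [set z | exists f, z = ev f y^-1].
have [||h|P [vP RP IP]] := @chevalley E R [set y^-1].
- split; first by exists 1; rewrite rmorph1 hornerC.
    by move=> _ _ [f ->] [g ->]; exists (f - g); rewrite rmorphB hornerD hornerN.
  by move=> _ _ [f ->] [g ->]; exists (f * g); rewrite evM.
- by move=> _ ->; exists 'X; rewrite map_polyX hornerX.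
- have [f e] : exists f, 1 = ev f y^-1 * y^-1.
    case: h => n [a [s [h ->]]].
    have /(_ _)/cid g i := (h i).1.
    exists (\sum_i sval (g i)).
    rewrite rmorph_sum horner_sum mulr_suml; apply: eq_bigr => i _.
    by rewrite -(svalP (g i)) (h i).2.
  have : ev (f * 'X - 1) y^-1 = 0.
    rewrite rmorphB hornerD hornerN evM map_polyX hornerX -e.
    by rewrite rmorph1 hornerC subrr.
  move=> /tV /eqP; rewrite subr_eq0 => /eqP /(congr1 (fun p => p.[0])).
  by rewrite hornerM hornerX mulr0 hornerC => /eqP; rewrite eq_sym oner_eq0.
have my := IP _ erefl; have yV0 : y^-1 != 0 by rewrite invr_eq0.
exists P; split; last by have := inv_mi yV0 my; rewrite invrK.
apply: (valring_closed vP _ yV0 my) => a; apply: RP; exists a%:P.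
by rewrite map_polyC hornerC.
Qed.

Lemma algebraic_regular P y : closed_point iota P -> ~ transc iota y -> P y.
Proof.
move=> cP; have vP := closed_valring cP; apply: contra_notP => nP f e.
apply: contrapT => /eqP f0; apply: nP.
have sf : size f = (size f).-1.+1 by rewrite prednK // size_poly_gt0.
apply: (int_closed (n := (size f).-1) (a := fun i => iota f`_i)) => //.
- by move=> i; apply: curve_const; apply: closed_curve.
- rewrite -[f`_ _]/(lead_coef f) => /(curve_const_mi (closed_curve cP))/eqP.
  by rewrite lead_coef_eq0 (negPf f0).
- by rewrite -sf -(evE _ _ (leqnn _)).
Qed.

(** A function without poles is algebraic over the constants by [transc_pole]; then so is its
    inverse, which therefore has no poles either. This stands in for the theorem that principal
    divisors have degree 0. *)
Lemma regular_isu y : y != 0 -> (forall P, closed_point iota P -> P y) ->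
  forall P, closed_point iota P -> isu P y.
Proof.
move=> y0 hy P cP; split=> //; first exact: hy.
apply: (algebraic_regular cP) => /transc_inv; rewrite invrK => /transc_pole [Q [cQ nQ]].
exact: nQ (hy _ cQ).
Qed.

End Algebraic.

(** * Codimensions and lattices *)

Section Codimension.
Variables (F E : fieldType) (iota : {rmorphism F -> E}) (V : lmodType E).
Implicit Types (N K M : set V) (d : nat).

Local Notation fsub := (submodule (range iota)).

Lemma submod_const (R : set E) N : (forall a, R (iota a)) -> submodule R N -> fsub N.
Proof. by move=> h [h0 hD hM]; split=> // _ v [a _ <-]; apply: hM. Qed.

Lemma fsubZ N a v : fsub N -> N v -> N (iota a *: v).
Proof. by case=> _ _ hM; apply: hM; exists a. Qed.

Lemma fsubB N u v : fsub N -> N u -> N v -> N (u - v).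
Proof.
move=> fN Nu Nv; rewrite -scaleN1r -(rmorph1 iota) -rmorphN.
by case: (fN) => _ hD _; apply: hD => //; apply: fsubZ.
Qed.

Definition spans_mod N M d (w : 'I_d -> V) :=
  forall v, M v -> exists a : 'I_d -> F, N (v - \sum_i iota (a i) *: w i).

Definition free_mod N d (w : 'I_d -> V) :=
  forall a : 'I_d -> F, N (\sum_i iota (a i) *: w i) -> forall i, a i = 0.

(** Exchange argument modulo [N]: if there were more free vectors than generators, the matrix
    expressing the former by the latter would have a nonzero left kernel. *)
Lemma free_mod_le N M d d' (w : 'I_d -> V) (w' : 'I_d' -> V) : fsub N ->
  spans_mod N M w -> (forall i, M (w' i)) -> free_mod N w' -> (d' <= d)%N.
Proof.
move=> fN sw Mw fw; have /choice[A hA] := fun i => sw _ (Mw i).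
pose B := \matrix_(i, j) A i j.
rewrite leqNgt; apply/negP => lt.
have : kermx B != 0.
  rewrite kermx_eq0 /row_free; apply: contraTneq lt => <-.
  by rewrite -leqNgt rank_leq_col.
move=> /rowV0Pn[a] /sub_kermxP aB0 /negP; apply; apply/eqP/rowP => i; rewrite mxE.
apply: (fw (fun i => a 0 i)).
have -> : \sum_i iota (a 0 i) *: w' i
   = \sum_i iota (a 0 i) *: (w' i - \sum_j iota (A i j) *: w j).
  under [RHS]eq_bigr do rewrite scalerBr.
  rewrite sumrB [X in _ = _ - X](_ : _ = 0) ?subr0 //.
  under eq_bigr do rewrite scaler_sumr.
  rewrite exchange_big big1 //= => j _.
  have := congr1 (fun C : 'rV_d => C 0 j) aB0; rewrite !mxE => e.
  under eq_bigr do rewrite scalerA -rmorphM.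
  rewrite -scaler_suml -rmorph_sum /=.
  rewrite [X in iota X](_ : _ = 0) ?rmorph0 ?scale0r // -[RHS]e.
  by apply: eq_bigr => k _; rewrite mxE.
by apply: (submod_sum fN) => k _; apply: fsubZ.
Qed.

Lemma has_codim_uniq N M d d' : fsub N -> has_codim iota N M d ->
  has_codim iota N M d' -> d = d'.
Proof.
move=> fN [w [Mw sw fw]] [w' [Mw' sw' fw']]; apply/eqP; rewrite eqn_leq.
by apply/andP; split; [apply: free_mod_le fN sw' Mw fw | apply: free_mod_le fN sw Mw' fw'].
Qed.

Lemma has_codim0 N M : M `<=` N -> has_codim iota N M 0.
Proof.
move=> MN; exists (fun _ => 0); split=> [[]//|v Mv|a _ []//].
by exists (fun _ => 0); rewrite big_ord0 subr0; apply: MN.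
Qed.

Lemma has_codim_add N K M d1 d2 : fsub K -> fsub N -> N `<=` K -> K `<=` M ->
  has_codim iota N K d1 -> has_codim iota K M d2 -> has_codim iota N M (d1 + d2).
Proof.
move=> fK fN NK KM [u [Ku su fu]] [w [Mw sw fw]].
exists (fun i : 'I_(d1 + d2) => match fintype.split i with inl i => u i | inr j => w j end).
have spl (a : 'I_(d1 + d2) -> F) : \sum_i iota (a i) *:
    match fintype.split i with inl i => u i | inr j => w j end =
    \sum_i iota (a (lshift d2 i)) *: u i + \sum_j iota (a (rshift d1 j)) *: w j.
  rewrite big_split_ord; congr (_ + _); apply: eq_bigr => i _;
    [have := unsplitK (inl i : 'I_d1 + 'I_d2) | have := unsplitK (inr i : 'I_d1 + 'I_d2)] => /= ->//.
split.
- by move=> i; case: fintype.split => j; [apply/KM/Ku | apply: Mw].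
- move=> v /sw[b hb]; have [a ha] := su _ hb.
  exists (fun i => match fintype.split i with inl i => a i | inr j => b j end).
  rewrite spl.
  under eq_bigr => i do rewrite (unsplitK (inl i : 'I_d1 + 'I_d2)).
  under [X in _ - (_ + X)]eq_bigr => i do rewrite (unsplitK (inr i : 'I_d1 + 'I_d2)).
  by rewrite [X in _ - X]addrC opprD addrA.
- move=> a; rewrite spl => Na.
  have b0 : forall j, a (rshift d1 j) = 0.
    apply: (fw (fun j => a (rshift d1 j))); move: Na.
    set A := \sum_i _; set S := \sum_j _ => Na.
    rewrite -[X in K X](addKr A) addrC; apply: fsubB => //; first exact: NK.
    by apply: (submod_sum fK) => i _; apply: fsubZ.
  move: Na; rewrite [X in _ + X]big1 ?addr0 => [/fu a0 i|j _]; last by rewrite b0 rmorph0 scale0r.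
  by case: (split_ordP i) => j ->; [apply: a0 | apply: b0].
Qed.

Lemma has_codim_ex N M d (w : 'I_d -> V) : fsub N -> (forall i, M (w i)) ->
  spans_mod N M w -> exists d', has_codim iota N M d'.
Proof.
move=> fN Mw sw.
pose fam n := `[< exists w' : 'I_n -> V, (forall i, M (w' i)) /\ free_mod N w' >].
have ex : exists n, fam n.
  by exists 0%N; apply/asboolP; exists (fun _ => 0); split; [case|move=> a _ []].
have ub n : fam n -> (n <= d)%N by move=> /asboolP[w' [Mw' fw']]; apply: free_mod_le fN sw Mw' fw'.
case: (ex_maxnP ex ub) => m /asboolP[u [Mu fu]] hm; exists m, u; split=> // v Mv.
apply: contrapT => nv.
suff : (m.+1 <= m)%N by rewrite ltnn.
apply: hm; apply/asboolP; exists (fun i => oapp u v (unlift ord0 i)); split.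
  by move=> i; case: (unlift ord0 i) => [j|] /=.
move=> a; rewrite big_ord_recl unlift_none /=.
under eq_bigr do rewrite liftK /=.
move=> Na; have a0 : a ord0 = 0.
  apply: contrapT => /eqP a0; apply: nv.
  exists (fun i => - (a (lift ord0 i) / a ord0)).
  have := fsubZ (a ord0)^-1 fN Na; rewrite scalerDr scalerA -rmorphM mulVf // rmorph1 scale1r.
  congr N; congr (_ + _); rewrite scaler_sumr -sumrN; apply: eq_bigr => i _.
  by rewrite scalerA -rmorphM rmorphN scaleNr opprK mulrC.
move: Na; rewrite a0 rmorph0 scale0r add0r => /fu h i.
by case: (unliftP ord0 i) => [j ->|->].
Qed.

(** Any exponent can be lowered to the dimension. The [d.+1] vectors obtained from [v] by applying
    the first [i] factors are dependent modulo [N]. The first nonzero term of a relation, at index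
    [m], shows that [1 - y] carries the m-th vector into [N] for some [y] in [J], and [1 - y] is
    invertible modulo [y ^+ D]. For every new object this yields annihilation by the power that its
    own dimension prescribes. *)
Lemma power_kills_codim (R J : set E) N M D d : subring R -> (forall a, R (iota a)) ->
  J `<=` R -> submodule (V := E^o) R J -> submodule R N -> submodule R M ->
  power_kills J D N M -> has_codim iota N M d -> power_kills J d N M.
Proof.
move=> sR Ri JR sJ sN sM kJ [w [Mw sw fw]] x v Jx Mv; apply: contrapT => nN.
have fN := submod_const Ri sN.
have [N0 ND NM] := sN; have [_ _ MM] := sM.
pose x' i := if insub i is Some j then x j else 0 : E.
have Jx' i : J (x' i) by rewrite /x'; case: insub => [j|]; [apply: Jx | case: sJ].
have Rx' i : R (x' i) by apply: JR.
pose pr i j := \prod_(i <= k < j) x' k.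
have Rpr i j : R (pr i j) by apply: sr_prod.
have prd : pr 0%N d = \prod_i x i.
  by rewrite /pr big_mkord; apply: eq_bigr => i _; rewrite /x' valK.
pose u (i : 'I_d.+1) := pr 0%N i *: v.
suff : (d.+1 <= d)%N by rewrite ltnn.
apply: (free_mod_le fN sw (w' := u)) => [i|a]; first by apply: MM.
pose a' i := if insub i is Some j then a j else 0 : F.
have -> : \sum_i iota (a i) *: u i = (\sum_(0 <= i < d.+1) iota (a' i) * pr 0%N i) *: v.
  by rewrite big_mkord scaler_suml; apply: eq_bigr => i _; rewrite /a' valK scalerA.
move=> Na i; apply: contrapT => /eqP ai.
have ex : exists i, a' i != 0 by exists i; rewrite /a' valK.
case: (ex_minnP ex) => m am hm.
have md : (m < d.+1)%N by move: am; rewrite /a'; case: insubP => //; rewrite eqxx.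
pose y := - (iota (a' m))^-1 * \sum_(m.+1 <= i < d.+1) iota (a' i) * pr m i.
have am0 : iota (a' m) != 0 by rewrite fmorph_eq0.
have Jy : J y.
  have [J0 JD JM] := sJ.
  apply: (JM); first by rewrite -fmorphV -rmorphN.
  rewrite big_nat; apply: (submod_sum (V := E^o) sJ) => k /andP[mk _].
  apply: (JM) => //; rewrite /pr big_ltn // mulrC; apply: JM => //.
  by apply: sr_prod.
have e1 : \sum_(0 <= i < d.+1) iota (a' i) * pr 0%N i = iota (a' m) * (1 - y) * pr 0%N m.
  rewrite (big_cat_nat (n := m)) ?(ltnW md) //= big1_seq ?add0r; last first.
    move=> k /andP[_]; rewrite mem_index_iota => /andP[_ km].
    have [->|/hm] := eqVneq (a' k) 0; first by rewrite rmorph0 mul0r.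
    by rewrite leqNgt km.
  rewrite big_ltn // mulrBr mulr1 /y mulNr mulrN opprK mulrA mulfV // mul1r mulrDl; congr (_ + _).
  rewrite mulr_suml !big_nat; apply: eq_bigr => k /andP[mk _].
  by rewrite -mulrA; congr (_ * _); rewrite mulrC /pr -big_cat_nat // ltnW.
have Nm : N ((1 - y) *: (pr 0%N m *: v)).
  have : N (iota (a' m)^-1 *: ((iota (a' m) * (1 - y) * pr 0%N m) *: v)).
    by apply: fsubZ => //; rewrite -e1.
  by rewrite !scalerA fmorphV !mulrA mulVf // mul1r.
(* Geometric sum: [1 - y ^+ k] is a multiple of [1 - y]. *)
have Nk k : N (pr 0%N m *: v) \/ N ((1 - y ^+ k) *: (pr 0%N m *: v)).
  right; elim: k => [|k IH]; first by rewrite expr0 subrr scale0r.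
  have -> : 1 - y ^+ k.+1 = (1 - y) + y * (1 - y ^+ k) by rewrite exprS; ring.
  rewrite scalerDl; apply: ND => //; rewrite -scalerA; apply: NM => //; exact: JR.
have Nu : N (pr 0%N m *: v).
  case: (Nk D) => // h; rewrite -[X in N X]scale1r -(subrK (y ^+ D) 1) scalerDl.
  apply: ND => //; have := kJ (fun _ => y) (pr 0%N m *: v).
  rewrite prodr_const card_ord; apply => //; exact: MM.
apply: nN; rewrite -prd.
have -> : pr 0%N d = pr m d * pr 0%N m by rewrite mulrC /pr -big_cat_nat.
by rewrite -scalerA; apply: NM.
Qed.

(** Factors are replaced one at a time. With the others fixed, the admissible first factors form a
    module, so it is enough to take a generator [s]; the induction then applies to the module of
    those [z] with [s *: z] in [N]. *)
Lemma power_kills_span (R S : set E) N M D : subring R -> submodule R N -> submodule R M ->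
  S `<=` R -> power_kills S D N M -> power_kills (lspan (V := E^o) R S) D N M.
Proof.
move=> sR + sM SR; elim: D N => [|D IH] N sN kS x v Sx Mv.
  by have := kS x v; rewrite !big_ord0; apply => // -[].
have [N0 ND NM] := sN.
rewrite big_ord_recl /=; set p := \prod_i _.
suff : lspan (V := E^o) R S `<=` [set z | N ((z * p) *: v)] by apply.
apply: (@lspan_min E E^o R S [set z : E^o | N ((z * p) *: v)]).
  split.
  - by rewrite /= mul0r scale0r.
  - by move=> a b /= ha hb; rewrite mulrDl scalerDl; apply: ND.
  - move=> a b /= Ra hb; change (N ((a * b * p) *: v)).
    by rewrite -mulrA -scalerA; apply: NM.
move=> s Ss /=; rewrite -scalerA.
apply: (IH [set z | N (s *: z)]) => //.
- split.
  + by rewrite /= scaler0.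
  + by move=> a b /= ha hb; rewrite scalerDr; apply: ND.
  + by move=> a b /= Ra hb; rewrite scalerA mulrC -scalerA; apply: NM.
- move=> y z Sy Mz /=; have := kS (fun i => oapp y s (unlift ord0 i)) z.
  rewrite big_ord_recl unlift_none /= -scalerA => h.
  under eq_bigr => i _ do rewrite -[y i]/(oapp y s (Some i)) -(liftK ord0 i).
  by apply: h => // i; case: (unlift ord0 i).
Qed.

Lemma power_killsS (S : set E) N M d e : submodule S M -> power_kills S d N M ->
  power_kills S (d + e) N M.
Proof.
move=> sM kS x v Sx Mv; rewrite big_split_ord /= -scalerA; apply: kS => //.
elim: e x Sx => [|e IH] x Sx; first by rewrite big_ord0 scale1r.
case: (sM) => _ _ MM; rewrite big_ord_recr /= mulrC -scalerA; apply: MM => //.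
have := IH (fun i => x (match fintype.split i with inl i => lshift _ i | inr j => rshift _ (widen_ord (leqnSn e) j) end)).
under eq_bigr => i _ do rewrite (unsplitK (inr i : 'I_d + 'I_e)).
by apply => i.
Qed.

End Codimension.

(** * Lattices over a valuation ring *)

Section Lattices.
Variable E : fieldType.
Implicit Types (P R : set E).

(** Divisibility in a valuation ring is a total preorder, so a finite family that is not identically
    zero has a member dividing all the others. *)
Lemma min_val P (I : finType) (f : I -> E) : valring P -> (exists i, f i != 0) ->
  exists i, f i != 0 /\ forall j, P (f j / f i).
Proof.
move=> vP [i0 fi0].
suff [i [fi hi]] : exists i, f i != 0 /\ forall j, j \in enum I -> P (f j / f i).
  by exists i; split=> // j; apply: hi; rewrite mem_enum.
elim: (enum I) => [|k s [i [fi hi]]]; first by exists i0; split.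
have [Pk|nPk] := pselect (P (f k / f i)).
  by exists i; split=> // j; rewrite inE => /orP[/eqP->|/hi].
have fk : f k != 0.
  by apply: contra_notN nPk => /eqP->; rewrite mul0r; apply: sr0; auto.
exists k; split=> // j; rewrite inE => /orP[/eqP->|/hi Pj].
  by rewrite mulfV //; apply: sr1; auto.
have -> : f j / f k = (f j / f i) * (f k / f i)^-1 by field; apply/andP.
by apply: srM; auto; apply: vr_inv.
Qed.

Definition mxover P m n (A : 'M[E]_(m, n)) := forall i j, P (A i j).

Lemma mxoverM P m n p (A : 'M[E]_(m, n)) (B : 'M[E]_(n, p)) : subring P ->
  mxover P A -> mxover P B -> mxover P (A *m B).
Proof. by move=> sP hA hB i j; rewrite mxE; apply: sr_sum => // k _; apply: srM. Qed.

Lemma mxover_det P n (A : 'M[E]_n) : subring P -> mxover P A -> P (\det A).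
Proof.
move=> sP hA; apply: sr_sum => // s _; apply: srM => //.
  by apply: srX => //; apply: srN => //; apply: sr1.
by apply: sr_prod.
Qed.

Lemma mxover_inv P n (A : 'M[E]_n) : subring P -> mxover P A -> isu P (\det A) ->
  mxover P (invmx A).
Proof.
move=> sP hA [d0 _ Pd] i j; rewrite /invmx unitmxE unitfE d0 !mxE /cofactor.
apply: srM => //; apply: srM => //.
  by apply: srX => //; apply: srN => //; apply: sr1.
by apply: mxover_det => // k l; rewrite !mxE.
Qed.

Lemma det_isu P n (A : 'M[E]_n) : subring P -> A \in unitmx -> mxover P A ->
  mxover P (invmx A) -> isu P (\det A).
Proof.
move=> sP uA hA hA'; split; first by rewrite -unitfE -unitmxE.
  exact: mxover_det.
by rewrite -det_inv; apply: mxover_det.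
Qed.

(** Unlike [free_on], this allows rectangular generating families: the image of a lattice is spanned
    by more rows than its rank. *)
Definition rspan P m n (A : 'M[E]_(m, n)) : set 'rV[E]_n :=
  [set v | exists2 a : 'rV[E]_m, mxover P a & v = a *m A].

Lemma free_on_rspan P n (B : 'M[E]_n) : free_on P B = rspan P B.
Proof.
by apply/seteqP; split=> v [a ha ->]; exists a => // i j; rewrite ord1.
Qed.

Lemma rspan_row P m n (A : 'M[E]_(m, n)) i : subring P -> rspan P A (row i A).
Proof.
move=> sP; exists (delta_mx 0 i); last by rewrite -rowE.
by move=> k l; rewrite mxE; case: (_ && _); [apply: sr1|apply: sr0].
Qed.

Lemma rspan_mul P m n p (A : 'M[E]_(m, n)) (R : 'M[E]_(p, m)) : subring P ->
  mxover P R -> rspan P (R *m A) `<=` rspan P A.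
Proof. by move=> sP hR _ [a ha ->]; exists (a *m R); rewrite ?mulmxA //; apply: mxoverM. Qed.

Lemma mximg_rspan P m n p (A : 'M[E]_(m, n)) (f : 'M[E]_(n, p)) :
  mximg f (rspan P A) = rspan P (A *m f).
Proof.
apply/seteqP; split.
  by move=> _ [_ [a ha ->] <-]; exists a; rewrite ?mulmxA.
by move=> _ [a ha ->]; exists (a *m A); [exists a | rewrite mulmxA].
Qed.

Lemma rspan_submod P m n (A : 'M[E]_(m, n)) : subring P -> submodule P (rspan P A).
Proof.
move=> sP; split.
- by exists 0; [move=> i j; rewrite mxE; apply: sr0 | rewrite mul0mx].
- move=> _ _ [a ha ->] [b hb ->]; exists (a + b); last by rewrite mulmxDl.
  by move=> i j; rewrite mxE; apply: srD.
- move=> x _ Px [a ha ->]; exists (x *: a); last by rewrite scalemxAl.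
  by move=> i j; rewrite mxE; apply: srM.
Qed.

Lemma rspan_sub_submod P m n (A : 'M[E]_(m, n)) M : submodule P M ->
  (forall i, M (row i A)) -> rspan P A `<=` M.
Proof.
move=> sM hM _ [a ha ->]; rewrite mulmx_sum_row; apply: (submod_sum sM) => i _.
by case: sM => _ _; apply.
Qed.

Lemma free_onP P n (B : 'M[E]_n) v : B \in unitmx ->
  rspan P B v <-> mxover P (v *m invmx B).
Proof.
move=> uB; split; first by move=> [a ha ->]; rewrite mulmxK.
by move=> h; exists (v *m invmx B); rewrite ?mulmxKV.
Qed.

Lemma rspan_subP P m n (A : 'M[E]_(m, n)) (B : 'M[E]_n) : subring P -> B \in unitmx ->
  rspan P A `<=` rspan P B <-> mxover P (A *m invmx B).
Proof.
move=> sP uB; split=> [h i j|h].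
  have /h /(free_onP _ _ uB) /(_ 0 j) := rspan_row A i sP.
  by rewrite -row_mul mxE.
by rewrite -{1}(mulmxKV uB A); apply: rspan_mul.
Qed.

Lemma rspan_eq_isu P n (A B : 'M[E]_n) : subring P -> A \in unitmx -> B \in unitmx ->
  rspan P A = rspan P B -> isu P (\det A / \det B).
Proof.
move=> sP uA uB e; rewrite -det_inv -det_mulmx; apply: det_isu => //.
- by rewrite unitmx_mul uA unitmx_inv.
- by apply/rspan_subP; rewrite ?e.
- have -> : invmx (A *m invmx B) = B *m invmx A.
    apply: (can_inj (mulmxK (_ : A *m invmx B \in unitmx))).
      by rewrite unitmx_mul uA unitmx_inv.
    rewrite mulVmx ?unitmx_mul ?uA ?unitmx_inv //.
    by rewrite mulmxA mulmxKV // mulmxV.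
  by apply/rspan_subP; rewrite ?e.
Qed.

(** Cramer's rule: the minor with one row exchanged is the numerator of a coordinate of [row i X]
    with respect to the rows of [rowsub f X]. *)
Lemma det_rowsub_repl r s (X : 'M[E]_(r, s)) (f : 'I_s -> 'I_r) i j :
  \det (rowsub (fun k => if k == j then i else f k) X) = (row i X *m \adj (rowsub f X)) 0 j.
Proof.
rewrite (expand_det_row _ j) !mxE; apply: eq_bigr => k _.
rewrite !mxE eqxx; congr (_ * _); rewrite /cofactor; congr (_ * \det _).
by apply/matrixP => a b; rewrite !mxE eq_sym (negPf (neq_lift _ _)).
Qed.

(* The rows of a maximal minor of least valuation generate. *)
Lemma rspan_basis P r s (X : 'M[E]_(r, s)) : valring P -> row_full X ->
  exists B (A : 'M[E]_(r, s)) (A' : 'M[E]_(s, r)),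
  [/\ B \in unitmx, mxover P A, mxover P A', X = A *m B & B = A' *m X].
Proof.
move=> vP fX; have sP := vr_sub vP.
have [|f [df hf]] := @min_val P _ (fun f : {ffun 'I_s -> 'I_r} => \det (rowsub f X)) vP.
  exists [ffun i => fullrankfun fX i]; rewrite -unitfE -unitmxE.
  have -> : rowsub [ffun i => fullrankfun fX i] X = rowsub (fullrankfun fX) X.
    by apply/matrixP => i j; rewrite !mxE ffunE.
  exact: fullrowsub_unit.
have uB : rowsub f X \in unitmx by rewrite unitmxE unitfE.
exists (rowsub f X), (X *m invmx (rowsub f X)), (rowsub f 1%:M); split=> //.
- move=> i j; have := hf [ffun k => if k == j then i else f k].
  have -> : rowsub [ffun k => if k == j then i else f k] X =
            rowsub (fun k => if k == j then i else f k) X.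
    by apply/matrixP => a b; rewrite !mxE ffunE.
  rewrite det_rowsub_repl; congr P; rewrite /invmx uB -scalemxAr !mxE mulrC; congr (_ * _).
  by apply: eq_bigr => k _; rewrite !mxE.
- by move=> i j; rewrite !mxE; case: eqP => _; [apply: sr1|apply: sr0].
- by rewrite mulmxKV.
- by rewrite mul_rowsub_mx mul1mx.
Qed.

Lemma rspan_eqP P r s (X : 'M[E]_(r, s)) B (A : 'M[E]_(r, s)) (A' : 'M[E]_(s, r)) :
  subring P -> mxover P A -> mxover P A' -> X = A *m B -> B = A' *m X -> rspan P X = rspan P B.
Proof.
move=> sP hA hA' eX eB; apply/seteqP; split; first by rewrite eX; apply: rspan_mul.
by rewrite {1}eB; apply: rspan_mul.
Qed.

(** The elementary change of basis with which [index_std] replaces one row by a combination of rows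
    divided by a uniformizer. *)
Lemma det_row_unit n (a : 'rV[E]_n) i :
  \det (\matrix_k (if k == i then a else delta_mx 0 k)) = a 0 i.
Proof.
rewrite (expand_det_row _ i).
have cof j : cofactor (\matrix_k (if k == i then a else delta_mx 0 k)) i j = (i == j)%:R.
  have -> : cofactor (\matrix_k (if k == i then a else delta_mx 0 k)) i j = cofactor 1%:M i j.
    rewrite /cofactor; congr (_ * \det _).
    by apply/matrixP => p q; rewrite !mxE [lift i p == i]eq_sym (negPf (neq_lift _ _)) mxE eqxx eq_sym.
  have -> : cofactor 1%:M i j = (\adj (1%:M : 'M[E]_n)) j i by rewrite mxE.
  have -> : \adj (1%:M : 'M[E]_n) = 1%:M.
    by rewrite -[LHS]mul1mx mul_mx_adj det1.
  by rewrite mxE eq_sym.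
rewrite (bigD1 i) //= cof eqxx mulr1 !mxE eqxx big1 ?addr0 // => j ji.
by rewrite cof eq_sym (negPf ji) mulr0.
Qed.

End Lattices.

Lemma mxover_submod_const (F E : fieldType) (iota : {rmorphism F -> E}) (P : set E) m n
   (A : 'M[E]_(m, n)) : curve_point iota P -> submodule (range iota) (rspan P A).
Proof.
move=> cP; have sP := vr_sub (curve_valring cP).
by apply: submod_const (rspan_submod _ sP) => a; apply: curve_const.
Qed.

Section MatrixCodim.
Variables (F E : fieldType) (iota : {rmorphism F -> E}).

Lemma mximg_submod (R : set E) r s (f : 'M[E]_(r, s)) N :
  submodule R N -> submodule R (mximg f N).
Proof.
move=> [h0 hD hM]; split.
- by exists 0; rewrite ?mul0mx.
- by move=> _ _ [u hu <-] [v hv <-]; exists (u + v); rewrite ?mulmxDl //; apply: hD.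
- by move=> a _ Ra [u hu <-]; exists (a *: u); rewrite ?scalemxAl //; apply: hM.
Qed.

Lemma has_codim_unitmx r (N M : set 'rV[E]_r) (f : 'M[E]_r) d : f \in unitmx ->
  has_codim iota N M d -> has_codim iota (mximg f N) (mximg f M) d.
Proof.
move=> uf [w [Mw sw fw]]; exists (fun i => w i *m f); split.
- by move=> i; exists (w i).
- move=> _ [v Mv <-]; have [a ha] := sw _ Mv; exists a; eexists; first exact: ha.
  rewrite mulmxBl mulmx_suml; congr (_ - _); apply: eq_bigr => i _.
  by rewrite scalemxAl.
- move=> a [v Nv e]; apply: fw; suff <- : v = \sum_i iota (a i) *: w i by [].
  rewrite -(mulmxK uf v) e mulmx_suml; apply: eq_bigr => i _.
  by rewrite -scalemxAl mulmxK.
Qed.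

Lemma has_codim_img r s (N M : set 'rV[E]_r) (f : 'M[E]_(r, s)) d :
  submodule (range iota) N -> has_codim iota N M d ->
  exists d', has_codim iota (mximg f N) (mximg f M) d'.
Proof.
move=> fN [w [Mw sw _]]; apply: (@has_codim_ex _ _ _ _ _ _ d (fun i => w i *m f)).
- exact: mximg_submod.
- by move=> i; exists (w i).
- move=> _ [v Mv <-]; have [a ha] := sw _ Mv; exists a; eexists; first exact: ha.
  rewrite mulmxBl mulmx_suml; congr (_ - _); apply: eq_bigr => i _.
  by rewrite scalemxAl.
Qed.

Definition dsum r s (M : set 'rV[E]_r) (N : set 'rV[E]_s) : set 'rV[E]_(r + s) :=
  [set v | M (lsubmx v) /\ N (rsubmx v)].

Lemma dsum_submod (R : set E) r s (M : set 'rV[E]_r) (N : set 'rV[E]_s) :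
  submodule R M -> submodule R N -> submodule R (dsum M N).
Proof.
move=> [M0 MD MM] [N0 ND NM]; split.
- by split; rewrite linear0.
- by move=> u v [? ?] [? ?]; split; rewrite linearD; [apply: MD|apply: ND].
- by move=> a v Ra [? ?]; split; rewrite linearZ; [apply: MM|apply: NM].
Qed.

Lemma sum_row_mx r s (I : finType) (f : I -> 'rV[E]_r) (g : I -> 'rV[E]_s) :
  \sum_i row_mx (f i) (g i) = row_mx (\sum_i f i) (\sum_i g i).
Proof. by elim/big_rec3: _ => [|i a b c _ ->]; rewrite ?row_mx0 ?add_row_mx. Qed.

Lemma has_codim_dsum r s (N1 M1 : set 'rV[E]_r) (N2 M2 : set 'rV[E]_s) d1 d2 :
  N1 0 -> N2 0 -> M1 0 -> M2 0 -> has_codim iota N1 M1 d1 -> has_codim iota N2 M2 d2 ->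
  has_codim iota (dsum N1 N2) (dsum M1 M2) (d1 + d2).
Proof.
move=> N10 N20 M10 M20 [u [Mu su fu]] [w [Mw sw fw]].
pose z (i : 'I_(d1 + d2)) : 'rV[E]_(r + s) :=
  match fintype.split i with inl i => row_mx (u i) 0 | inr j => row_mx 0 (w j) end.
have spl (a : 'I_(d1 + d2) -> F) : \sum_i iota (a i) *: z i =
    row_mx (\sum_i iota (a (lshift d2 i)) *: u i) (\sum_j iota (a (rshift d1 j)) *: w j).
  rewrite big_split_ord /= /z.
  under eq_bigr => i do rewrite (unsplitK (inl i : 'I_d1 + 'I_d2)) /= scale_row_mx scaler0.
  under [X in _ + X]eq_bigr => i do rewrite (unsplitK (inr i : 'I_d1 + 'I_d2)) /= scale_row_mx scaler0.
  by rewrite !sum_row_mx !big1_eq add_row_mx addr0 add0r.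
exists z; split.
- move=> i; rewrite /z; case: fintype.split => j; split; rewrite ?row_mxKl ?row_mxKr //.
- move=> v [/su[a ha] /sw[b hb]].
  exists (fun i => match fintype.split i with inl i => a i | inr j => b j end).
  rewrite spl -[v]hsubmxK opp_row_mx add_row_mx; split; rewrite ?row_mxKl ?row_mxKr.
    by under eq_bigr => i do rewrite (unsplitK (inl i : 'I_d1 + 'I_d2)).
  by under eq_bigr => i do rewrite (unsplitK (inr i : 'I_d1 + 'I_d2)).
- move=> a; rewrite spl => -[]; rewrite row_mxKl row_mxKr => /fu ha /fw hb i.
  by case: (split_ordP i) => j ->; [apply: ha | apply: hb].
Qed.

End MatrixCodim.

(** * The index of a lattice as the valuation of a determinant *)

Section Index.
Variables (F E : fieldType) (iota : {rmorphism F -> E}).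
Hypothesis ffE : is_function_field iota.
Local Notation cl := (closed_point iota).
Let clv P : cl P -> valring P := @closed_valring _ _ iota P.
Let clc P : cl P -> curve_point iota P := @closed_curve _ _ iota P.
#[local] Hint Resolve clv clc : core.

Lemma det_congr P n (A B : 'M[E]_n) : valring P -> mxover P A -> mxover P B ->
  (forall i j, max_ideal P (A i j - B i j)) -> max_ideal P (\det A - \det B).
Proof.
move=> vP hA hB h; have sP := vr_sub vP.
pose rel x y := [/\ P x, P y & max_ideal P (x - y)].
have relM x x' y y' : rel x x' -> rel y y' -> rel (x * y) (x' * y').
  move=> [Px Px' hx] [Py Py' hy]; split; try exact: srM.
  have -> : x * y - x' * y' = x * (y - y') + (x - x') * y' by ring.
  by apply: miD => //; [apply: miMl | apply: miMr].
have relD x x' y y' : rel x x' -> rel y y' -> rel (x + y) (x' + y').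
  move=> [Px Px' hx] [Py Py' hy]; split; try exact: srD.
  by rewrite opprD addrACA; apply: miD.
suff [_ _ //] : rel (\det A) (\det B).
apply: (big_ind2 rel) => // [|s _].
  by split; rewrite ?subrr; [apply: sr0|apply: sr0|apply: mi0].
apply: (relM); last first.
  apply: (big_ind2 rel) => //.
  by split; rewrite ?subrr; [apply: sr1|apply: sr1|apply: mi0].
have hs : P ((-1) ^+ (perm.odd_perm s)) by apply: srX => //; apply: srN => //; apply: sr1.
by split; rewrite ?subrr //; apply: mi0.
Qed.

(** Induction on the valuation of the determinant. If it is positive, the reduction of [T] modulo
    the maximal ideal, a matrix over [F] since the point is rational, has a left kernel vector. The
    corresponding combination [w] of the rows is divisible by [t], and exchanging one row for
    [w / t] gives a lattice in which the old one has codimension 1. *)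
Lemma index_std P r (T : 'M[E]_r) : rational_point iota P -> T \in unitmx -> mxover P T ->
  exists2 d, has_codim iota (rspan P T) (rspan P 1%:M) d & d%:Z = vl P (\det T).
Proof.
move=> [cP rat] uT oT; have vP := clv cP; have sP := vr_sub vP.
have dT0 : \det T != 0 by rewrite -unitfE -unitmxE.
have : 0 <= vl P (\det T) by apply/(vl_ge0 ffE) => //; apply: mxover_det.
case ed : (vl P (\det T)) => [d|//] _; exists d => //.
elim: d => [|d IH] in T uT oT dT0 ed *.
  apply: has_codim0; apply/rspan_subP => //; rewrite mul1mx.
  by apply: mxover_inv => //; exact: (vl_eq0 ffE cP dT0 ed).
have mT : max_ideal P (\det T) by apply/(vl_gt0 ffE) => //; rewrite ed.
have [t ut] := uniformizer_exists ffE cP; have [mt t0 ht] := ut.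
have Pt : P t := mi_sub mt.
have /(_ _ _)/cid c i j := rat _ (oT i j).
pose C : 'M[F]_r := \matrix_(i, j) sval (c i j).
have hC i j : max_ideal P (T i j - iota (C i j)) by rewrite mxE; apply: (svalP (c i j)).
have [a a0 aC] : exists2 a : 'rV[F]_r, a != 0 & a *m C = 0.
  apply/det0P; rewrite -(fmorph_eq0 iota) -det_map_mx; apply/eqP.
  apply: contrapT => /eqP dC0.
  have h : max_ideal P (\det T - \det (map_mx iota C)).
    apply: det_congr => // i j; rewrite ?mxE -?[sval _]mxE; last first.
      by have := hC i j; rewrite mxE.
    by apply: curve_const; auto.
  have : max_ideal P (\det (map_mx iota C)) by rewrite -(subKr (\det T) (\det _)); apply: miB.
  rewrite det_map_mx => /(curve_const_mi (clc cP)) e.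
  by move: dC0; rewrite det_map_mx e rmorph0 eqxx.
have [i0 ai0] : exists i, a 0 i != 0.
  apply: contrapT => H; case/eqP: a0; apply/rowP => i; rewrite mxE.
  by apply: contrapT => /eqP h; apply: H; exists i.
(* With coefficient 1 at [i0], the exchange of that row for [w / t] divides the determinant exactly
   by [t]. *)
wlog ai1 : a a0 aC ai0 / a 0 i0 = 1 => [W|].
  apply: (W ((a 0 i0)^-1 *: a)).
  - by rewrite scaler_eq0 invr_eq0 (negPf ai0).
  - by rewrite -scalemxAl aC scaler0.
  - by rewrite mxE mulVf // oner_eq0.
  - by rewrite mxE mulVf.
pose b := map_mx iota a; pose w := b *m T.
have mw j : max_ideal P (w 0 j).
  have -> : w 0 j = \sum_i iota (a 0 i) * (T i j - iota (C i j)).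
    have := congr1 (fun A : 'rV_r => iota (A 0 j)) aC; rewrite !mxE rmorph0 rmorph_sum => e.
    under [RHS]eq_bigr do rewrite mulrBr -rmorphM.
    by rewrite sumrB e subr0; apply: eq_bigr => i _; rewrite mxE.
  by apply: mi_sum => // i _; apply: miMl => //; apply: curve_const; auto.
pose A := \matrix_k (if k == i0 then t^-1 *: b else delta_mx 0 k).
pose T1 := A *m T.
have rT1 i : row i T1 = if i == i0 then t^-1 *: w else row i T.
  rewrite row_mul rowK; case: eqP => _; first by rewrite -scalemxAl.
  by rewrite -rowE.
have dA : \det A = t^-1 by rewrite det_row_unit !mxE ai1 rmorph1 mulr1.
have dT1 : \det T1 != 0 by rewrite det_mulmx dA mulf_neq0 // invr_eq0.
have uT1 : T1 \in unitmx by rewrite unitmxE unitfE.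
have oT1 : mxover P T1.
  move=> i j; have := congr1 (fun B : 'rV_r => B 0 j) (rT1 i); rewrite mxE => ->.
  by case: ifP => _; rewrite !mxE; [rewrite mulrC; apply: ht; have := mw j; rewrite mxE | apply: oT].
have vT1 : vl P (\det T1) = d.
  rewrite det_mulmx dA (vlM ffE cP) ?invr_eq0 // (vlV ffE cP) // (vl_uniformizer cP ut) ed.
  by rewrite -[d.+1]add1n PoszD addKr.
have sN1 := rspan_submod T1 sP; have sN := rspan_submod T sP.
have [_ N1D N1M] := sN1; have [_ ND NM] := sN.
have fN := @mxover_submod_const _ _ _ _ _ _ T (clc cP).
have N1w : rspan P T1 (t^-1 *: w) by have := rspan_row T1 i0 sP; rewrite rT1 eqxx.
have wE : w = row i0 T + \sum_(i | i != i0) iota (a 0 i) *: row i T.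
  rewrite /w mulmx_sum_row (bigD1 i0) //= mxE ai1 rmorph1 scale1r; congr (_ + _).
  by apply: eq_bigr => i _; rewrite mxE.
have Nw : rspan P T w.
  exists b => // i j; rewrite mxE; apply: curve_const; auto.
have NN1 : rspan P T `<=` rspan P T1.
  apply: rspan_sub_submod => // i; have [->|ii] := eqVneq i i0; last first.
    by have := rspan_row T1 i sP; rewrite rT1 (negPf ii).
  have -> : row i0 T = t *: (t^-1 *: w) + \sum_(i | i != i0) iota (- a 0 i) *: row i T.
    rewrite scalerA mulfV // scale1r wE -addrA -big_split big1 ?addr0 //= => k _.
    by rewrite rmorphN scaleNr addrN.
  apply: N1D; first exact: N1M.
  apply: (submod_sum sN1) => k ki; apply: N1M; first by apply: curve_const; auto.
  by have := rspan_row T1 k sP; rewrite rT1 (negPf ki).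
have -> : d.+1 = (1 + d)%N by rewrite add1n.
apply: (has_codim_add _ fN NN1 _ _ (IH T1 uT1 oT1 dT1 vT1)).
- exact: mxover_submod_const (clc cP).
- by apply/rspan_subP; rewrite ?unitmx1 // invmx1 mulmx1.
(* [w / t] spans the quotient: its coefficient may be altered by elements of the maximal ideal, that
   is, by multiples of [w], and [w] lies in the smaller lattice. *)
exists (fun _ => t^-1 *: w); split=> // [v [q hq ->]|x].
  have [x mx] := rat _ (hq 0 i0); exists (fun _ => x).
  rewrite big_ord1 mulmx_sum_row (bigD1 i0) //= rT1 eqxx addrAC -scalerBl.
  apply: ND; last first.
    apply: (submod_sum sN) => i ii; rewrite rT1 (negPf ii); apply: NM => //.
    exact: rspan_row.
  by rewrite scalerA; apply: NM => //; apply: ht.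
rewrite big_ord1 => Nx i; rewrite ord1; apply: contrapT => /eqP x0.
have ix0 : iota (x 0) != 0 by rewrite fmorph_eq0.
have : rspan P T (t^-1 *: w).
  have := fsubZ (x 0)^-1 fN Nx; rewrite scalerA fmorphV mulVf // scale1r.
  by congr (rspan P T _).
move=> [e oe ee]; have : b = t *: e.
  by apply: (can_inj (mulmxK uT)); rewrite -/w -scalemxAl -ee scalerA mulfV // scale1r.
move=> /(congr1 (fun B : 'rV_r => B 0 i0)); rewrite !mxE ai1 rmorph1 => e1.
by apply: (@mi1 _ P) => //; rewrite e1; apply: miMr.
Qed.

Lemma lattice_index P r (B1 B2 : 'M[E]_r) : rational_point iota P ->
  B1 \in unitmx -> B2 \in unitmx -> rspan P B1 `<=` rspan P B2 ->
  exists2 d, has_codim iota (rspan P B1) (rspan P B2) d &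
    d%:Z = vl P (\det B1) - vl P (\det B2).
Proof.
move=> rP u1 u2 sub; have [cP _] := rP; have sP : subring P by auto.
have d1 : \det B1 != 0 by rewrite -unitfE -unitmxE.
have d2 : \det B2 != 0 by rewrite -unitfE -unitmxE.
have uT : B1 *m invmx B2 \in unitmx by rewrite unitmx_mul u1 unitmx_inv.
have oT : mxover P (B1 *m invmx B2) by apply/rspan_subP.
have [d cd ed] := index_std rP uT oT; exists d.
  have := has_codim_unitmx u2 cd; rewrite !mximg_rspan mulmxKV // mul1mx.
  by [].
by rewrite ed det_mulmx det_inv (vlM ffE cP) ?invr_eq0 // (vlV ffE cP).
Qed.

Lemma lattice_codim P r (B1 B2 : 'M[E]_r) d : rational_point iota P ->
  B1 \in unitmx -> B2 \in unitmx -> rspan P B1 `<=` rspan P B2 ->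
  has_codim iota (rspan P B1) (rspan P B2) d <-> d%:Z = vl P (\det B1) - vl P (\det B2).
Proof.
move=> rP u1 u2 sub; have [cP _] := rP.
have [d' cd' ed'] := lattice_index rP u1 u2 sub.
have fB := @mxover_submod_const _ _ _ _ _ _ B1 (clc cP).
split=> [cd|]; first by rewrite (has_codim_uniq fB cd cd').
by rewrite -ed' => -[->].
Qed.

Lemma rspan_eq_val P r (A B : 'M[E]_r) : cl P -> A \in unitmx -> B \in unitmx ->
  rspan P A = rspan P B -> vl P (\det A) = vl P (\det B).
Proof.
move=> cP uA uB e.
have dA : \det A != 0 by rewrite -unitfE -unitmxE.
have dB : \det B != 0 by rewrite -unitfE -unitmxE.
have /(vl_isu ffE cP) : isu P (\det A / \det B) by apply: rspan_eq_isu; auto.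
rewrite (vlM ffE cP) ?invr_eq0 // (vlV ffE cP) // => /eqP; rewrite subr_eq0 => /eqP; exact.
Qed.

End Index.

(** * Constant extensions *)

(* [E] is the compositum of [E0] and the finite field [L], linearly disjoint over [k];
   [ce_s] is the automorphism fixing [E0] and inducing the Frobenius of [L / k]. *)
Record const_ext (k L : finFieldType) (E0 E : fieldType) (j0 : {rmorphism k -> E0})
    (j : {rmorphism L -> E}) := ConstExt {
  ce_i : {rmorphism k -> L};
  ce_phi : {rmorphism E0 -> E};
  ce_s : {rmorphism E -> E};
  ce_comm : forall a, ce_phi (j0 a) = j (ce_i a);
  ce_gen : forall y, exists n (x : 'I_n -> E0) (b : 'I_n -> L),
    y = \sum_i ce_phi (x i) * j (b i);
  ce_disj : forall n (b : 'I_n -> L),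
    (forall a : 'I_n -> k, \sum_i ce_i (a i) * b i = 0 -> forall i, a i = 0) ->
    forall x : 'I_n -> E0, \sum_i ce_phi (x i) * j (b i) = 0 -> forall i, x i = 0;
  ce_s_phi : forall x, ce_s (ce_phi x) = ce_phi x;
  ce_s_j : forall b, ce_s (j b) = j (b ^+ #|k|) }.

Section ConstExt.
Variables (k L : finFieldType) (E0 E : fieldType) (j0 : {rmorphism k -> E0}).
Variables (j : {rmorphism L -> E}) (X : const_ext j0 j).

Local Notation ci := (ce_i X).
Local Notation phi := (ce_phi X).
Local Notation s := (ce_s X).
Implicit Types (P : set E) (x : E0) (y : E).

Definition ce_basis n (b : 'I_n -> L) :=
  (forall a : 'I_n -> k, \sum_l ci (a l) * b l = 0 -> forall l, a l = 0) /\
  (forall y : L, exists a : 'I_n -> k, y = \sum_l ci (a l) * b l).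

Lemma ce_indep_inj n (b : 'I_n -> L) :
  (forall a : 'I_n -> k, \sum_l ci (a l) * b l = 0 -> forall l, a l = 0) ->
  injective (fun a : {ffun 'I_n -> k} => \sum_l ci (a l) * b l).
Proof.
move=> ind a a' /eqP; rewrite -subr_eq0 -sumrB => /eqP e; apply/ffunP => l.
apply/eqP; rewrite -subr_eq0; apply/eqP; apply: (ind (fun l => a l - a' l)).
by rewrite -[RHS]e; apply: eq_bigr => m _; rewrite rmorphB mulrBl.
Qed.

(** The coordinate space of an independent family of size [n] injects into the finite field [L],
    which bounds [n]; a maximal independent family spans. *)
Lemma ce_basis_ex : exists n (b : 'I_n -> L), ce_basis b.
Proof.
pose fam n := `[< exists b : 'I_n -> L,
  forall a : 'I_n -> k, \sum_l ci (a l) * b l = 0 -> forall l, a l = 0 >].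
have ex : exists n, fam n by exists 0%N; apply/asboolP; exists (fun _ => 0) => a _ [].
have ub n : fam n -> (n <= #|L|)%N.
  move=> /asboolP[b /ce_indep_inj/leq_card]; rewrite card_ffun card_ord; apply: leq_trans.
  by apply/ltnW/ltn_expl/finNzRing_gt1.
case: (ex_maxnP ex ub) => n /asboolP[b ind] hn; exists n, b; split=> // y.
apply: contrapT => ny; suff : (n.+1 <= n)%N by rewrite ltnn.
apply: hn; apply/asboolP; exists (fun l => oapp b y (unlift ord0 l)) => a.
rewrite big_ord_recl unlift_none /=; under eq_bigr do rewrite liftK /=.
move=> e; have a0 : a ord0 = 0.
  apply: contrapT => /eqP a0; apply: ny.
  exists (fun l => - (a (lift ord0 l) / a ord0)).
  have ia0 : ci (a ord0) != 0 by rewrite fmorph_eq0.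
  apply: (mulfI ia0); move/eqP: e; rewrite addr_eq0 => /eqP ->.
  rewrite mulr_sumr -sumrN; apply: eq_bigr => l _.
  by rewrite rmorphN fmorph_div; field.
move: e; rewrite a0 rmorph0 mul0r add0r => /ind h l.
by case: (unliftP ord0 l) => [m ->|->].
Qed.

Lemma ce_basis_card n (b : 'I_n -> L) : ce_basis b -> #|L| = (#|k| ^ n)%N.
Proof.
move=> [ind sp]; have inj := ce_indep_inj ind.
have <- : #|{: {ffun 'I_n -> k}}| = (#|k| ^ n)%N by rewrite card_ffun card_ord.
have /choice[g hg] := sp.
have injg : injective (fun y : L => [ffun l => g y l]).
  move=> y z /ffunP e; rewrite (hg y) (hg z); apply: eq_bigr => l _.
  by have := e l; rewrite !ffunE => ->.
by apply/eqP; rewrite eqn_leq (leq_card _ inj) (leq_card _ injg).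
Qed.

Variables (n : nat) (b : 'I_n -> L).
Hypothesis bb : ce_basis b.

Lemma ce_coord y : exists x : 'I_n -> E0, y = \sum_l phi (x l) * j (b l).
Proof.
have [m [x [c ->]]] := ce_gen X y; have [_ sp] := bb.
have /choice[a ha] := fun l => sp (c l).
exists (fun l => \sum_i x i * j0 (a i l)).
under [RHS]eq_bigr do rewrite rmorph_sum mulr_suml.
rewrite exchange_big; apply: eq_bigr => l _ /=.
rewrite {1}ha rmorph_sum mulr_sumr; apply: eq_bigr => r _.
by rewrite !rmorphM ce_comm mulrA.
Qed.

Lemma ce_coord0 (x : 'I_n -> E0) : \sum_l phi (x l) * j (b l) = 0 -> forall l, x l = 0.
Proof. by apply: ce_disj; case: bb. Qed.

Lemma ce_coord_uniq (x x' : 'I_n -> E0) :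
  \sum_l phi (x l) * j (b l) = \sum_l phi (x' l) * j (b l) -> x = x'.
Proof.
move=> /eqP; rewrite -subr_eq0 -sumrB => /eqP e; apply/funext => l.
apply/eqP; rewrite -subr_eq0; apply/eqP; apply: (ce_coord0 (x := fun l => x l - x' l)).
by rewrite -[RHS]e; apply: eq_bigr => m _; rewrite rmorphB mulrBl.
Qed.

Lemma ce_iter_phi t x : iter t s (phi x) = phi x.
Proof. by elim: t => //= t ->; rewrite ce_s_phi. Qed.

Lemma ce_iter_j t c : iter t s (j c) = j (c ^+ (#|k| ^ t)).
Proof. by elim: t => [|t IH] /=; rewrite ?expn0 ?expr1 // IH ce_s_j -exprM expnSr. Qed.

Lemma iter_rmorphM (g : {rmorphism E -> E}) t y z :
  iter t g (y * z) = iter t g y * iter t g z.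
Proof. by elim: t => //= t ->; rewrite rmorphM. Qed.

Lemma iter_rmorph_sum (g : {rmorphism E -> E}) t (I : Type) (r : seq I) (f : I -> E) :
  iter t g (\sum_(i <- r) f i) = \sum_(i <- r) iter t g (f i).
Proof. by elim: t => //= t ->; rewrite rmorph_sum. Qed.

Lemma ce_iter_coord t (x : 'I_n -> E0) : iter t s (\sum_l phi (x l) * j (b l)) =
  \sum_l phi (x l) * j (b l ^+ (#|k| ^ t)).
Proof.
rewrite iter_rmorph_sum; apply: eq_bigr => l _.
by rewrite iter_rmorphM ce_iter_phi ce_iter_j.
Qed.

(** In coordinates the n-th iterate raises the basis to the power of exponent [#|k| ^ n], the
    cardinality of [L], which is the identity on [L]. *)
Lemma ce_s_order y : iter n s y = y.
Proof.
have [x ->] := ce_coord y; rewrite ce_iter_coord; apply: eq_bigr => l _.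
by rewrite -(ce_basis_card bb) expf_card.
Qed.

(* The Moore matrix [b_l ^ (q ^ t)] is invertible. *)
Lemma ce_moore : exists D : 'M[L]_n, forall (x : 'I_n -> E0) m,
  phi (x m) = \sum_(t < n) iter t s (\sum_l phi (x l) * j (b l)) * j (D t m).
Proof.
pose M : 'M[L]_n := \matrix_(l, t) b l ^+ (#|k| ^ t).
have k1 : (1 < #|k|)%N by apply: finNzRing_gt1.
have uM : M \in unitmx.
  rewrite -unitmx_tr unitmxE unitfE; apply/negP => /det0P[c c0 /(congr1 trmx)].
  rewrite trmx_mul trmxK trmx0 => cM; case/negP: c0; apply/eqP/rowP => t; rewrite mxE.
  (* A kernel vector gives an additive polynomial of degree at most [#|k| ^ n.-1] that vanishes on
     all of [L], which has [#|k| ^ n] elements. *)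
  pose p : {poly L} := \sum_(t < n) c 0 t *: 'X^(#|k| ^ t).
  have p0 : p = 0.
    apply/eqP; apply: contraT => pn0.
    have rt : all (root p) (enum L).
      apply/allP => y _; have [a ya] := bb.2 y.
      have yt r : y ^+ (#|k| ^ r) = \sum_l ci (a l) * b l ^+ (#|k| ^ r).
        apply: (fmorph_inj j); rewrite -ce_iter_j ya !rmorph_sum iter_rmorph_sum.
        apply: eq_bigr => l _; rewrite rmorphM -ce_comm iter_rmorphM ce_iter_phi.
        by rewrite ce_iter_j ce_comm -rmorphM.
      rewrite /root /p horner_sum.
      under eq_bigr => r _ do rewrite hornerZ hornerXn yt mulr_sumr.
      rewrite exchange_big big1 //= => l _.
      have := congr1 (fun C : 'cV_n => ci (a l) * C l 0) cM; rewrite !mxE mulr0 => e.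
      rewrite -[RHS]e mulr_sumr; apply: eq_bigr => r _.
      by rewrite !mxE; ring.
    have := max_poly_roots pn0 rt (enum_uniq _); rewrite -cardE (ce_basis_card bb) => lt.
    move: lt; rewrite ltnNge => /negP; case.
    apply: (leq_trans (size_sum _ _ _)); apply/bigmax_leqP => r _.
    apply: (leq_trans (size_scale_leq _ _)); rewrite size_polyXn.
    by rewrite ltn_exp2l.
  have := congr1 (fun q : {poly L} => q`_(#|k| ^ t)) p0; rewrite coef0 coef_sum.
  rewrite (bigD1 t) //= coefZ coefXn eqxx mulr1 big1 ?addr0 // => r rt.
  rewrite coefZ coefXn eqn_exp2l // eq_sym; case: eqP => [e|_]; last by rewrite mulr0.
  by case/negP: rt; apply/eqP/val_inj.
exists (invmx M) => x m.
under eq_bigr => t _ do rewrite ce_iter_coord mulr_suml.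
rewrite exchange_big /= (eq_bigr (fun l => phi (x l) * j ((M *m invmx M) l m))); last first.
  move=> l _; rewrite mxE rmorph_sum mulr_sumr; apply: eq_bigr => t _.
  by rewrite rmorphM mxE mulrA.
rewrite mulmxV // (bigD1 m) //= mxE eqxx rmorph1 mulr1 big1 ?addr0 // => l lm.
by rewrite mxE (negPf lm) rmorph0 mulr0.
Qed.

Lemma ce_ev p x : (map_poly j (map_poly ci p)).[phi x] = phi (map_poly j0 p).[x].
Proof.
rewrite -horner_map -!map_poly_comp; congr (_.[_]); apply: eq_map_poly => a /=.
by rewrite ce_comm.
Qed.

Lemma ce_function_field : is_function_field j0 -> is_function_field j.
Proof.
case=> x [trx [r [c hc]]]; exists (phi x); split.
  move=> p e; have /choice[a ha] : forall m, exists a : 'I_n -> k, p`_m = \sum_l ci (a l) * b l.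
    by move=> m; apply: bb.2.
  pose q l := \poly_(m < size p) a m l.
  have q0 l : q l = 0.
    apply: trx; move: l; apply: ce_coord0; rewrite -[RHS]e (evE _ _ (leqnn _)).
    under [RHS]eq_bigr => m _ do rewrite ha rmorph_sum mulr_suml.
    rewrite exchange_big; apply: eq_bigr => l _ /=.
    rewrite (evE _ _ (size_poly _ _)) rmorph_sum mulr_suml; apply: eq_bigr => m _.
    by rewrite coef_poly ltn_ord !rmorphM rmorphXn ce_comm /=; ring.
  apply/polyP => m; rewrite coef0.
  have [lt|ge] := ltnP m (size p); last by rewrite nth_default.
  rewrite ha big1 // => l _; have := congr1 (fun q : {poly k} => q`_m) (q0 l).
  by rewrite coef_poly lt coef0 => ->; rewrite rmorph0 mul0r.
exists r, (fun l => phi (c l)) => y; have [z ->] := ce_coord y.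
have /choice[den /choice[num h]] := fun l => hc (z l).
pose dn l := map_poly ci (den l).
exists (\prod_l dn l), (fun i => \sum_l (b l)%:P * map_poly ci (num l i) * \prod_(m | m != l) dn m).
split.
  by apply/prodf_neq0 => l _; rewrite map_poly_eq0; case: (h l).
rewrite mulr_suml; under [RHS]eq_bigr => i _ do rewrite rmorph_sum horner_sum mulr_suml.
rewrite [RHS]exchange_big /=; apply: eq_bigr => l _.
rewrite (bigD1 l) //= evM ce_ev.
have -> : phi (z l) * j (b l) * (phi (map_poly j0 (den l)).[x] * (map_poly j (\prod_(m | m != l) dn m)).[phi x])
  = phi (z l * (map_poly j0 (den l)).[x]) * (j (b l) * (map_poly j (\prod_(m | m != l) dn m)).[phi x]).
  by rewrite rmorphM; ring.
rewrite (h l).2 rmorph_sum mulr_suml; apply: eq_bigr => i _.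
by rewrite !evM ce_ev map_polyC hornerC rmorphM /=; ring.
Qed.

Lemma mi_preim P x : max_ideal (phi @^-1` P) x <-> max_ideal P (phi x).
Proof.
rewrite /max_ideal /= fmorphV; split=> -[Px [h|h]]; split=> //.
- by left; rewrite h rmorph0.
- by right.
- by left; apply/eqP; rewrite -(fmorph_eq0 phi); apply/eqP.
- by right.
Qed.

Lemma preim_curve P : curve_point j P -> curve_point j0 (phi @^-1` P).
Proof.
case=> h1 h2 h3 h4; split.
- by move=> a /=; rewrite ce_comm; apply: h1.
- by move=> x y' /= ? ?; rewrite rmorphB; apply: h2.
- by move=> x y' /= ? ?; rewrite rmorphM; apply: h3.
- by move=> x /=; rewrite fmorphV.
Qed.

(** If all of [E0] were regular at [P], all of [E] would be, as it is generated over [E0] by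
    constants. *)
Lemma preim_closed P : closed_point j P -> closed_point j0 (phi @^-1` P).
Proof.
move=> [cP [y ny]]; split; first exact: preim_curve.
apply: contrapT => H; apply: ny; have [x ->] := ce_coord y.
have sP := vr_sub (curve_valring cP).
apply: sr_sum => // l _; apply: srM => //; last exact: curve_const.
by apply: contrapT => nx; apply: H; exists (x l).
Qed.

(** Chevalley's theorem for the ring of elements with coordinates in [Q] and the maximal ideal of
    [Q]. That ideal generates only elements with coordinates in it, whereas the coordinates of 1 are
    constants and not all zero. *)
Lemma lying_over (Q : set E0) : closed_point j0 Q -> exists P, closed_point j P /\ phi @^-1` P = Q.
Proof.
move=> cQ; have vQ := closed_valring cQ; have sQ := vr_sub vQ.
have cuQ := closed_curve cQ.
pose coords (A : set E0) := [set y | exists2 x : 'I_n -> E0, forall l, A (x l) & y = \sum_l phi (x l) * j (b l)].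
have coordsB A y z : (forall x x', A x -> A x' -> A (x - x')) -> coords A y -> coords A z -> coords A (y - z).
  move=> hB [x hx ->] [x' hx' ->]; exists (fun l => x l - x' l); first by move=> l; apply: hB.
  by rewrite -sumrB; apply: eq_bigr => l _; rewrite rmorphB mulrBl.
have coordsj (A : set E0) x c : (forall a x, A x -> A (x * j0 a)) -> A x -> coords A (phi x * j c).
  move=> hA Ax; have [a ha] := bb.2 c; exists (fun l => x * j0 (a l)); first by move=> l; apply: hA.
  rewrite {1}ha rmorph_sum mulr_sumr; apply: eq_bigr => l _.
  by rewrite !rmorphM ce_comm mulrA.
have coords_sum A (I : finType) (f : I -> E) : submodule Q (V := E0^o) A ->
    (forall i, coords A (f i)) -> coords A (\sum_i f i).
  move=> [A0 AD _] hf; elim/big_ind: _ => //.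
    by exists (fun _ => 0) => //; rewrite big1 // => l _; rewrite rmorph0 mul0r.
  move=> y z [x hx ->] [x' hx' ->]; exists (fun l => x l + x' l); first by move=> l; apply: AD.
  by rewrite -big_split; apply: eq_bigr => l _; rewrite rmorphD mulrDl.
have coordsM A y z : submodule Q (V := E0^o) A -> coords Q y -> coords A z -> coords A (y * z).
  move=> sA [x hx ->] [x' hx' ->]; have [_ _ AM] := sA.
  rewrite mulr_suml; apply: (coords_sum) => // l; rewrite mulr_sumr; apply: coords_sum => // m.
  rewrite mulrACA -!rmorphM; apply: coordsj; last exact: AM.
  move=> a u Au; rewrite mulrC; apply: AM => //; exact: curve_const.
have sQQ : submodule Q (V := E0^o) Q.
  by split; [apply: sr0 | move=> *; apply: srD | move=> *; apply: srM].
have sQm : submodule Q (V := E0^o) (max_ideal Q).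
  by split; [apply: mi0 | move=> *; apply: miD | move=> *; apply: miMl].
have coords1 x : Q x -> coords Q (phi x).
  move=> Qx; rewrite -[phi x]mulr1 -(rmorph1 j); apply: coordsj => // a z Qz.
  by apply: srM => //; apply: curve_const.
have coordsm x : max_ideal Q x -> coords (max_ideal Q) (phi x).
  move=> Qx; rewrite -[phi x]mulr1 -(rmorph1 j); apply: coordsj => // a z Qz.
  by apply: miMr => //; apply: curve_const.
have sR : subring (coords Q).
  split.
  - by rewrite -(rmorph1 phi); apply: coords1; apply: sr1.
  - by move=> y z; apply: coordsB => *; apply: srB.
  - by move=> y z; apply: coordsM.
have [|h|P [vP RP IP]] := @chevalley E (coords Q) (phi @` max_ideal Q) sR.
- by move=> _ [x mx <-]; apply: coords1; apply: mi_sub.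
- have [x mx e] : coords (max_ideal Q) 1.
    case: h => r [a [z [h ->]]]; apply: coords_sum => // m; apply: coordsM => //.
      exact: (h m).1.
    by have [_ [x mx <-]] := h m; apply: coordsm.
  have [a ha] := bb.2 1.
  have ex : x = fun l => j0 (a l).
    apply: ce_coord_uniq; rewrite -e -(rmorph1 j) [in LHS]ha rmorph_sum.
    by apply: eq_bigr => l _; rewrite rmorphM ce_comm.
  have a0 l : a l = 0 by apply: (curve_const_mi cuQ); have := mx l; rewrite ex.
  move: ha; rewrite big1 => [/eqP|l _]; first by rewrite oner_eq0.
  by rewrite a0 rmorph0 mul0r.
have [u u0 mu] := closed_mi cQ.
have PQ x : Q x -> P (phi x) by move=> /coords1/RP.
exists P; split.
  apply: (valring_closed vP (u := phi u)); rewrite ?fmorph_eq0 //; last by apply: IP; exists u.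
  move=> a; apply: RP; rewrite -[j a]mul1r -(rmorph1 phi); apply: coordsj; last exact: sr1.
  by move=> c z Qz; apply: srM => //; apply: curve_const.
apply/seteqP; split=> x; last exact: PQ.
move=> Px; apply: contrapT => nQ.
have mx : max_ideal P (phi x^-1) by apply: IP; exists x^-1 => //; apply: mi_inv.
have x0 : x != 0 by apply: contra_notN nQ => /eqP->; apply: sr0.
by case: (inv_mi (_ : phi x^-1 != 0) mx); rewrite ?fmorph_eq0 ?invr_eq0 // fmorphV invrK.
Qed.

Section RationalPoint.
Variables (P : set E).
Hypothesis cP : curve_point j P.
Hypothesis rQ : rational_point j0 (phi @^-1` P).

Let vP := curve_valring cP.
Let sP := vr_sub vP.
Let cQ : closed_point j0 (phi @^-1` P). Proof. by case: rQ. Qed.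
Let vQ := closed_valring cQ.

(** After division by the coordinate of least valuation, all coordinates have residues in [k], one
    of them equal to 1, and independence of the basis keeps the residue of the sum nonzero. The
    valuation upstairs is thus the minimum over the coordinates, which makes the point above a
    rational point unique, rational and unramified. *)
Lemma rational_coord (x : 'I_n -> E0) : (exists l, x l != 0) -> exists l0, [/\ x l0 != 0,
  forall l, P (phi (x l / x l0)) & isu P ((\sum_l phi (x l) * j (b l)) / phi (x l0))].
Proof.
move=> ex; have [l0 [x0 hl]] := min_val vQ ex; exists l0; split=> //.
have /choice[a ha] : forall l, exists a, max_ideal (phi @^-1` P) (x l / x l0 - j0 a).
  by move=> l; case: rQ => _; apply; apply: hl.
pose c := \sum_l ci (a l) * b l.
have mc : max_ideal P ((\sum_l phi (x l) * j (b l)) / phi (x l0) - j c).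
  rewrite mulr_suml rmorph_sum -sumrB; apply: mi_sum => // l _.
  have -> : phi (x l) * j (b l) / phi (x l0) - j (ci (a l) * b l) =
     phi (x l / x l0 - j0 (a l)) * j (b l).
    by rewrite rmorphB fmorph_div ce_comm rmorphM mulrBl mulrAC.
  by apply: miMr => //; [apply: curve_const | apply/mi_preim].
have c0 : c != 0.
  apply/eqP => /bb.1 /(_ l0) al0; have := ha l0; rewrite mulfV // al0 rmorph0 subr0.
  by apply: mi1; apply: vr_sub.
have Pc : P (j c) by apply: curve_const.
apply: nmi_isu.
  by rewrite -[X in P X](subrK (j c)); apply: srD => //; apply: mi_sub mc.
move=> h; case/eqP: c0; apply: (curve_const_mi cP).
rewrite -[j c](subKr ((\sum_l phi (x l) * j (b l)) / phi (x l0))).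
exact: miB.
Qed.

Lemma rational_memP (x : 'I_n -> E0) : P (\sum_l phi (x l) * j (b l)) <-> forall l, P (phi (x l)).
Proof.
split; last first.
  by move=> h; apply: sr_sum => // l _; apply: srM => //; apply: curve_const.
have [ex|nx] := pselect (exists l, x l != 0); last first.
  move=> _ l; have [->|xl] := eqVneq (x l) 0; first by rewrite rmorph0; apply: sr0.
  by case: nx; exists l.
have [l0 [x0 hl [y0 _ h]]] := rational_coord ex; move=> Py l.
rewrite -(divfK x0 (x l)) rmorphM; apply: srM => //.
move: h; rewrite invf_div => h; move: y0; rewrite mulf_eq0 negb_or => /andP[y0 _].
by rewrite -(divfK y0 (phi (x l0))); apply: srM.
Qed.

Lemma rational_miP (x : 'I_n -> E0) : max_ideal P (\sum_l phi (x l) * j (b l)) <->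
  forall l, max_ideal P (phi (x l)).
Proof.
split; last first.
  by move=> h; apply: mi_sum => // l _; apply: miMr => //; apply: curve_const.
have [ex|nx] := pselect (exists l, x l != 0); last first.
  move=> _ l; have [->|xl] := eqVneq (x l) 0; first by rewrite rmorph0; apply: mi0.
  by case: nx; exists l.
have [l0 [x0 hl [y0 _ h]]] := rational_coord ex; move=> my l.
rewrite -(divfK x0 (x l)) rmorphM; apply: miMl => //.
move: h; rewrite invf_div => h; move: y0; rewrite mulf_eq0 negb_or => /andP[y0 _].
by rewrite -(divfK y0 (phi (x l0))); apply: miMl.
Qed.

Lemma rational_over : rational_point j P.
Proof.
split.
  split=> //; case: cQ => _ [x nx]; by exists (phi x).
move=> y; have [x ->] := ce_coord y => /rational_memP Px.
have /choice[a ha] : forall l, exists a, max_ideal (phi @^-1` P) (x l - j0 a).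
  by move=> l; case: rQ => _; apply; apply: Px.
exists (\sum_l ci (a l) * b l); rewrite rmorph_sum -sumrB; apply: mi_sum => // l _.
rewrite rmorphM -ce_comm -mulrBl -rmorphB; apply: miMr => //; first exact: curve_const.
exact/mi_preim.
Qed.

Lemma rational_uniformizer t : uniformizer (phi @^-1` P) t -> uniformizer P (phi t).
Proof.
move=> [mt t0 ht]; split; rewrite ?fmorph_eq0 //; first exact/mi_preim.
move=> y; have [x ->] := ce_coord y => /rational_miP mx.
rewrite mulr_suml; apply: sr_sum => // l _; rewrite mulrAC -fmorph_div.
apply: srM => //; last exact: curve_const.
by apply: ht; apply/mi_preim.
Qed.

Lemma vl_rational x : is_function_field j0 -> x != 0 -> vl P (phi x) = vl (phi @^-1` P) x.
Proof.
move=> ff x0; have [t ut ux] := vlP ff cQ x0.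
apply: (vl_uniq vP (rational_uniformizer ut)).
case: ux => h1 /= h2 h3; move: h1 h2 h3; rewrite fmorphV rmorphM -(fmorph_eq0 phi) rmorphM.
by rewrite fmorphXz => *; split.
Qed.

End RationalPoint.

Lemma rational_uniq P P' : curve_point j P -> curve_point j P' ->
  rational_point j0 (phi @^-1` P) -> phi @^-1` P' = phi @^-1` P -> P' = P.
Proof.
move=> cP cP' rQ e; have rQ' : rational_point j0 (phi @^-1` P') by rewrite e.
have ex x : P' (phi x) = P (phi x) by have := congr1 (fun S : set E0 => S x) e.
apply/seteqP; split=> y; have [x ->] := ce_coord y.
  by move=> /(rational_memP cP' rQ') h; apply/(rational_memP cP rQ) => l; rewrite -ex.
by move=> /(rational_memP cP rQ) h; apply/(rational_memP cP' rQ') => l; rewrite ex.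
Qed.

End ConstExt.

(** * Conjugate points, and vectors over a constant extension *)

Section ConstExtVectors.
Variables (k L : finFieldType) (E0 E : fieldType) (j0 : {rmorphism k -> E0}).
Variables (j : {rmorphism L -> E}) (X : const_ext j0 j).
Local Notation ci := (ce_i X).
Local Notation phi := (ce_phi X).
Local Notation s := (ce_s X).
Variables (n : nat) (b : 'I_n -> L).
Hypothesis bb : ce_basis X b.

Lemma ce_basis_gt0 : (0 < n)%N.
Proof.
case: n b bb => // b' [_ /(_ 1)[a]]; rewrite big_ord0 => /eqP.
by rewrite oner_eq0.
Qed.

Lemma ce_s_surj y : exists z, y = s z.
Proof.
exists (iter n.-1 s y); rewrite -iterS prednK ?ce_basis_gt0 //.
by rewrite (ce_s_order bb).
Qed.

(** The Galois conjugates of the point [P], indexed by exponents of the Frobenius, with repetitions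
    when the orbit is short. *)
Definition spre t (P : set E) : set E := [set y | P (iter t s y)].

Lemma spreS t P : spre t.+1 P = s @^-1` (spre t P).
Proof. by apply/funext => y; rewrite /spre /= -iterSr. Qed.

Lemma spre_order P : spre n P = P.
Proof. by apply/funext => y; rewrite /spre /= (ce_s_order bb). Qed.

Lemma s_preim_closed P : closed_point j P -> closed_point j (s @^-1` P).
Proof.
move=> [[h1 h2 h3 h4] [y ny]]; split; last first.
  by have [z ez] := ce_s_surj y; exists z => /=; rewrite -ez.
split.
- by move=> a /=; rewrite ce_s_j; apply: h1.
- by move=> x z /= ? ?; rewrite rmorphB; apply: h2.
- by move=> x z /= ? ?; rewrite rmorphM; apply: h3.
- by move=> x /=; rewrite fmorphV.
Qed.

Lemma spre_closed t P : closed_point j P -> closed_point j (spre t P).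
Proof. by elim: t => // t IH /IH h; rewrite spreS; apply: s_preim_closed. Qed.

Lemma s_preim_mi P x : max_ideal (s @^-1` P) x <-> max_ideal P (s x).
Proof.
rewrite /max_ideal /= fmorphV; split=> -[Px [h|h]]; split=> //.
- by left; rewrite h rmorph0.
- by right.
- by left; apply/eqP; rewrite -(fmorph_eq0 s); apply/eqP.
- by right.
Qed.

Lemma vl_s P x : is_function_field j -> closed_point j P -> x != 0 ->
  vl P (s x) = vl (s @^-1` P) x.
Proof.
move=> ff cP x0; have [t [mt t0 ht] ux] := vlP ff (s_preim_closed cP) x0.
have ut : uniformizer P (s t).
  split; rewrite ?fmorph_eq0 //; first exact: (s_preim_mi P t).1.
  move=> y; have [z ->] := ce_s_surj y => /(s_preim_mi P z).2 /ht.
  by rewrite /= fmorph_div.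
apply: (vl_uniq (closed_valring cP) ut).
case: ux => h1 /= h2 h3; move: h1 h2 h3; rewrite fmorphV rmorphM -(fmorph_eq0 s) rmorphM.
by rewrite fmorphXz => *; split.
Qed.

Lemma ce_coord_rv r (v : 'rV[E]_r) : exists u : 'I_n -> 'rV[E0]_r,
  v = \sum_l j (b l) *: map_mx phi (u l).
Proof.
have /choice[x hx] := fun i => ce_coord bb (v 0 i).
exists (fun l => \row_i x i l); apply/rowP => i; rewrite hx summxE.
by apply: eq_bigr => l _; rewrite !mxE mulrC.
Qed.

Lemma ce_moore_rv : exists D : 'M[L]_n, forall r (u : 'I_n -> 'rV[E0]_r) m,
  map_mx phi (u m) =
  \sum_(t < n) j (D t m) *: map_mx (iter t s) (\sum_l j (b l) *: map_mx phi (u l)).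
Proof.
have [D hD] := ce_moore bb; exists D => r u m; apply/rowP => i.
rewrite mxE (hD (fun l => u l 0 i)) summxE; apply: eq_bigr => t _.
rewrite !mxE mulrC summxE; congr (_ * iter _ _ _).
by apply: eq_bigr => l _; rewrite !mxE mulrC.
Qed.

Lemma ce_coord_rv0 r (u : 'I_n -> 'rV[E0]_r) :
  \sum_l j (b l) *: map_mx phi (u l) = 0 -> forall l, u l = 0.
Proof.
move=> e l; apply/rowP => i; rewrite mxE; apply: (ce_coord0 bb (x := fun l => u l 0 i)).
have := congr1 (fun A : 'rV_r => A 0 i) e; rewrite summxE mxE => e'; rewrite -[RHS]e'.
by apply: eq_bigr => m _; rewrite !mxE mulrC.
Qed.

(** Extension of scalars from the smaller constant field to [L], in coordinates. [lspan_bcset]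
    identifies it with the span over a suitably extended ring. *)
Definition bcset r (M : set 'rV[E0]_r) : set 'rV[E]_r :=
  [set v | exists2 u : 'I_n -> 'rV[E0]_r, forall l, M (u l) &
    v = \sum_l j (b l) *: map_mx phi (u l)].

Lemma bcset_const r (M : set 'rV[E0]_r) c v : submodule (range j0) M -> M v ->
  bcset M (j c *: map_mx phi v).
Proof.
move=> sM Mv; have [a ha] := bb.2 c; exists (fun l => j0 (a l) *: v).
  by move=> l; apply: fsubZ.
rewrite {1}ha rmorph_sum scaler_suml; apply: eq_bigr => l _.
by rewrite map_mxZ ce_comm scalerA -rmorphM mulrC.
Qed.

Lemma bcset_fsub r (M : set 'rV[E0]_r) : submodule (range j0) M -> submodule (range j) (bcset M).
Proof.
move=> sM; have [M0 MD MM] := sM.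
have bD : forall u v, bcset M u -> bcset M v -> bcset M (u + v).
  move=> _ _ [u hu ->] [v hv ->]; exists (fun l => u l + v l); first by move=> l; apply: MD.
  by rewrite -big_split; apply: eq_bigr => l _; rewrite raddfD scalerDr.
have b0 : bcset M 0.
  by exists (fun _ => 0) => //; rewrite big1 // => l _; rewrite raddf0 scaler0.
split=> // _ _ [c _ <-] [u hu ->]; rewrite scaler_sumr.
elim/big_ind: _ => // l _; rewrite scalerA -rmorphM.
exact: bcset_const.
Qed.

(** A basis of the quotient stays one after base change, because membership in [bcset] is decided
    coordinate by coordinate. *)
Lemma has_codim_bc r (N M : set 'rV[E0]_r) d : submodule (range j0) N ->
  submodule (range j0) M -> has_codim j0 N M d -> has_codim j (bcset N) (bcset M) d.
Proof.
move=> sN sM [w [Mw sw fw]]; exists (fun i => map_mx phi (w i)); split.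
- by move=> i; have := bcset_const 1 sM (Mw i); rewrite rmorph1 scale1r.
- move=> _ [u hu ->]; have /choice[a ha] := fun l => sw _ (hu l).
  exists (fun i => \sum_l ci (a l i) * b l).
  exists (fun l => u l - \sum_i j0 (a l i) *: w i) => //.
  under [RHS]eq_bigr do rewrite raddfB scalerBr.
  rewrite sumrB; congr (_ - _).
  under eq_bigr do rewrite rmorph_sum scaler_suml.
  rewrite exchange_big; apply: eq_bigr => l _ /=.
  rewrite raddf_sum scaler_sumr; apply: eq_bigr => i _.
  by rewrite /= map_mxZ scalerA rmorphM ce_comm mulrC.
- move=> a [u hu e] i; have /choice[x hx] := fun i => bb.2 (a i).
  have hu' l : u l = \sum_i j0 (x i l) *: w i.
    apply/eqP; rewrite -subr_eq0; apply/eqP; move: l; apply: ce_coord_rv0.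
    under eq_bigr do rewrite raddfB scalerBr.
    rewrite sumrB -e; apply/eqP; rewrite subr_eq0; apply/eqP.
    under eq_bigr do rewrite hx rmorph_sum scaler_suml.
    rewrite exchange_big; apply: eq_bigr => l _ /=.
    rewrite raddf_sum scaler_sumr; apply: eq_bigr => m _.
    by rewrite /= map_mxZ scalerA rmorphM ce_comm mulrC.
  rewrite hx big1 // => l _; rewrite (fw (fun i => x i l)) ?rmorph0 ?mul0r //.
  by rewrite -hu'.
Qed.

Lemma lspan_bcset (R : set E0) (R' : set E) r (M : set 'rV[E0]_r) :
  subring R -> subring R' -> (forall a, R (j0 a)) -> (forall c, R' (j c)) ->
  (forall x, R x -> R' (phi x)) ->
  (forall y, R' y -> exists2 x : 'I_n -> E0, forall l, R (x l) & y = \sum_l phi (x l) * j (b l)) ->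
  submodule R M -> lspan R' (map_mx phi @` M) = bcset M.
Proof.
move=> sR sR' Rj Rj' Rphi R'R sM; have fM := submod_const Rj sM.
have [_ _ MM] := sM; have [b0 bD _] := bcset_fsub fM.
apply/seteqP; split.
  apply: lspan_min; last first.
    by move=> _ [v Mv <-]; have := bcset_const 1 fM Mv; rewrite rmorph1 scale1r.
  split=> // y _ /R'R[x Rx ->] [u hu ->]; rewrite scaler_suml.
  elim/big_ind: _ => // l _; rewrite scaler_sumr; elim/big_ind: _ => // m _.
  have -> : (phi (x l) * j (b l)) *: (j (b m) *: map_mx phi (u m)) =
    j (b l * b m) *: map_mx phi (x l *: u m).
    by rewrite map_mxZ !scalerA rmorphM; congr (_ *: _); ring.
  by apply: bcset_const => //; apply: MM.
have [s0 sD sM'] := lspan_submod (map_mx phi @` M) sR'.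
move=> _ [u hu ->]; elim/big_ind: _ => // l _.
apply: sM' => //; apply: lspan_mem; first exact: sr1.
by exists (u l).
Qed.

End ConstExtVectors.

(** * The constant extensions C_L over C and C_L' over C_L *)

Section Instances.
Variables (k : finFieldType) (C : curve k) (L L' : finFieldType).
Variables (X : base_curve C L) (X' : base_curve C L') (e : base_ext X X').

Definition ce_base (Y : base_curve C L) : const_ext (@const k C) (jL Y) :=
  ConstExt (@fun_comm _ _ _ Y) (@fun_gen _ _ _ Y) (@fun_disj _ _ _ Y) (@sigma_Q _ _ _ Y)
    (@sigma_L _ _ _ Y).

Lemma ext_sigma x : ext_fun e (sigma X x) = sigma X' (ext_fun e x).
Proof.
have [n [y [b ->]]] := fun_gen x; rewrite !rmorph_sum; apply: eq_bigr => i _.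
by rewrite !rmorphM sigma_Q sigma_L !ext_fun_Q !ext_fun_L sigma_Q sigma_L rmorphXn.
Qed.

End Instances.

Fixpoint rmorph_iter (E : fieldType) (g : {rmorphism E -> E}) n : {rmorphism E -> E} :=
  if n is m.+1 then [the {rmorphism E -> E} of g \o rmorph_iter g m]
  else [the {rmorphism E -> E} of idfun].

Lemma rmorph_iterE (E : fieldType) (g : {rmorphism E -> E}) n y :
  rmorph_iter g n y = iter n g y.
Proof. by elim: n => //= n ->. Qed.

Section ExtInstance.
Variables (k : finFieldType) (C : curve k) (L L' : finFieldType).
Variables (X : base_curve C L) (X' : base_curve C L') (e : base_ext X X').

(** The Frobenius of [L'] over [L] is the iterate of [sigma] whose exponent is the degree of [L]
    over [k]. Disjointness over [L] follows from disjointness over [k] for the products of a basis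
    of [L] with the given independent family. *)
Lemma ce_ext_ex : exists Y : const_ext (jL X) (jL X'),
  [/\ ce_phi Y = ext_fun e, ce_i Y = ext_L e &
      exists n, forall y, ce_s Y y = iter n (sigma X') y].
Proof.
have [n [b bb]] := ce_basis_ex (ce_base X).
have [n' [b' bb']] := ce_basis_ex (ce_base X').
pose g := rmorph_iter (sigma X') n.
have comm a : ext_fun e (jL X a) = jL X' (ext_L e a) by apply: ext_fun_L.
have gen y : exists n (x : 'I_n -> X) (b : 'I_n -> L'), y = \sum_i ext_fun e (x i) * jL X' (b i).
  have [m [x [c ->]]] := fun_gen y; exists m, (fun i => jQ X (x i)), c.
  by apply: eq_bigr => i _; rewrite ext_fun_Q.
have gphi x : g (ext_fun e x) = ext_fun e x.
  rewrite /g rmorph_iterE.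
  have h t : iter t (sigma X') (ext_fun e x) = ext_fun e (iter t (sigma X) x).
    by elim: t => //= t ->; rewrite ext_sigma.
  by rewrite h (ce_s_order bb).
have gj c : g (jL X' c) = jL X' (c ^+ #|L|).
  by rewrite /g rmorph_iterE (ce_iter_j (ce_base X')) (ce_basis_card bb).
have disj m (c : 'I_m -> L') :
    (forall a : 'I_m -> L, \sum_i ext_L e (a i) * c i = 0 -> forall i, a i = 0) ->
    forall x : 'I_m -> X, \sum_i ext_fun e (x i) * jL X' (c i) = 0 -> forall i, x i = 0.
  move=> ind x ex i; have /choice[z hz] := fun i => ce_coord bb (x i).
  have sumE (V : nmodType) (f : 'I_m * 'I_n -> V) :
     \sum_(p < #|{: 'I_m * 'I_n}|) f (enum_val p) = \sum_i \sum_l f (i, l).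
    rewrite pair_big /= (eq_bigl (fun p => p \in {: 'I_m * 'I_n})) //.
    by rewrite [RHS]big_enum_val; apply: eq_bigr => p _; case: (enum_val p).
  pose N := #|{: 'I_m * 'I_n}|.
  pose d (p : 'I_N) := ext_L e (b (enum_val p).2) * c (enum_val p).1.
  have ind2 : forall a : 'I_N -> k, \sum_p iL X' (a p) * d p = 0 -> forall p, a p = 0.
    move=> a ea p; have := bb.1 (fun l => a (enum_rank ((enum_val p).1, l))).
    have -> : a p = a (enum_rank ((enum_val p).1, (enum_val p).2)).
      by rewrite -surjective_pairing enum_valK.
    move/(_ _ (enum_val p).2); apply.
    apply: (ind (fun i => \sum_l iL X (a (enum_rank (i, l))) * b l)).
    pose f (q : 'I_m * 'I_n) := iL X' (a (enum_rank q)) * (ext_L e (b q.2) * c q.1).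
    rewrite -[RHS]ea (eq_bigr (fun p => f (enum_val p))) => [|q _]; last first.
      by rewrite /f enum_valK.
    rewrite sumE; apply: eq_bigr => i' _; rewrite rmorph_sum mulr_suml.
    by apply: eq_bigr => l _; rewrite /f rmorphM ext_L_k mulrA.
  have h : \sum_p jQ X' (z (enum_val p).1 (enum_val p).2) * jL X' (d p) = 0.
    pose f (q : 'I_m * 'I_n) := jQ X' (z q.1 q.2) * jL X' (ext_L e (b q.2) * c q.1).
    rewrite (sumE _ f) -[RHS]ex; apply: eq_bigr => i' _; rewrite hz rmorph_sum mulr_suml.
    by apply: eq_bigr => l _; rewrite /f !rmorphM ext_fun_Q ext_fun_L mulrA.
  rewrite hz big1 // => l _.
  have := fun_disj ind2 h (enum_rank (i, l)); rewrite enum_rankK /= => ->.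
  by rewrite rmorph0 mul0r.
exists (@ConstExt _ _ _ _ _ _ (ext_L e) (ext_fun e) g comm gen disj gphi gj).
by split=> //; exists n => y; apply: rmorph_iterE.
Qed.

End ExtInstance.

(** * The point of C_L on the graph of the characteristic *)

Section GraphPoint.
Variables (k : finFieldType) (C : curve k) (L : finFieldType) (X : base_curve C L).
Variables (eps : set C) (c : C -> L).
Implicit Types (P Q : set X).

Local Notation cl := (closed_point (jL X)).
Let clv P : cl P -> valring P := @closed_valring _ _ (jL X) P.
Let clc P : cl P -> curve_point (jL X) P := @closed_curve _ _ (jL X) P.
#[local] Hint Resolve clv clc : core.

Lemma base_function_field : is_function_field (jL X).
Proof.
have [n [b bb]] := ce_basis_ex (ce_base X).
exact: (ce_function_field bb (curve_function_field C)).
Qed.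

(** The closed points at which [graph_ideal] is proper. There turns out to be at most one, and it is
    rational over [L]. *)
Definition graph_pt P :=
  [/\ cl P, jQ X @^-1` P = eps & forall x, eps x -> max_ideal P (jQ X x - jL X (c x))].

Lemma graph_pt_or P : cl P -> graph_pt P \/ graph_ideal eps c P 1.
Proof.
move=> cP; have sP : subring P by auto.
have [e|ne] := pselect (jQ X @^-1` P = eps); last by right; split; [apply: sr1 | move=> /ne].
have [h|h] := pselect (forall x, eps x -> max_ideal P (jQ X x - jL X (c x))); first by left.
right; split; first exact: sr1.
move=> _; have [x [ex nx]] : exists x, eps x /\ ~ max_ideal P (jQ X x - jL X (c x)).
  apply: contrapT => H; apply: h => x ex; apply: contrapT => nx; apply: H.
  by exists x.
have Pu : P (jQ X x - jL X (c x)).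
  by apply: srB => //; [rewrite -e in ex | apply: curve_const; auto].
have [u0 Pu'] := mi_unit Pu nx.
exists 1%N, (fun _ => (jQ X x - jL X (c x))^-1), (fun _ => jQ X x - jL X (c x)); split.
  by move=> _; split=> //; exists x.
by rewrite big_ord1 /GRing.scale /= mulVf.
Qed.

Lemma graph_pt_mi P : graph_pt P -> graph_ideal eps c P `<=` max_ideal P.
Proof.
move=> [cP e h] y [_ /(_ e)]; apply: (@lspan_min _ X^o).
  split; first by apply: mi0; auto.
    by move=> *; apply: miD; auto.
  by move=> a v Pa mv; apply: miMl; auto.
by move=> _ [x ex ->]; apply: h.
Qed.

Lemma c_sum n (x : 'I_n -> C) P a : graph_pt P -> (forall l, eps (x l)) ->
  max_ideal P (\sum_l jQ X (x l) * jL X (a l) - jL X (\sum_l c (x l) * a l)).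
Proof.
move=> [cP e h] hx; rewrite rmorph_sum -sumrB; apply: mi_sum; auto => l _.
by rewrite rmorphM -mulrBl; apply: miMr; auto; apply: curve_const; auto.
Qed.

Lemma max_ev n (A : nat -> nat -> Prop) :
  (forall i, (i < n)%N -> exists N, forall m, (N <= m)%N -> A i m) ->
  exists N, forall i, (i < n)%N -> A i N.
Proof.
move=> H; suff [N hN] : exists N, forall i, (i < n)%N -> forall m, (N <= m)%N -> A i m.
  by exists N => i lt; apply: hN.
elim: n H => [|n IH] H; first by exists 0%N.
have [M hM] := IH (fun i lt => H i (ltnW lt)).
have [M' hM'] := H _ (ltnSn n).
exists (maxn M M') => i; rewrite ltnS leq_eqVlt => /orP[/eqP->|lt] e; rewrite geq_max => /andP[le le'].
  exact: hM'.
exact: hM.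
Qed.

Lemma mi_exprB1 P z N : valring P -> max_ideal P (z - 1) -> max_ideal P (z ^+ N - 1).
Proof.
move=> vP mz; have sP := vr_sub vP.
have Pz : P z by rewrite -(subrK 1 z); apply: srD => //; [apply: mi_sub mz | apply: sr1].
elim: N => [|N IH]; first by rewrite expr0 subrr; apply: mi0.
have -> : z ^+ N.+1 - 1 = z * (z ^+ N - 1) + (z - 1) by rewrite exprS; ring.
by apply: miD => //; apply: miMl.
Qed.

Variables (n : nat) (b : 'I_n -> L).
Hypothesis bb : ce_basis (ce_base X) b.

(** By the Moore formula the coordinates of [w] are combinations of its conjugates, and these are
    regular at [P] because [w] is regular at the conjugates of [P]. *)
Lemma regular_coord P w : graph_pt P -> (forall t, (t < n)%N -> spre (ce_base X) t P w) ->
  exists2 x : 'I_n -> C, forall l, eps (x l) & w = \sum_l jQ X (x l) * jL X (b l).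
Proof.
move=> [cP e _] hw; have [x ex] := ce_coord bb w; exists x => // l.
have [D hD] := ce_moore bb.
rewrite -e /=; have -> := hD x l; apply: sr_sum; auto => t _.
apply: srM; auto; last by apply: curve_const; auto.
by have := hw _ (ltn_ord t); rewrite /spre /= ex.
Qed.

(** An element with coordinates in [eps] has a residue computed through [c], hence in [L]. Any [y]
    regular at [P] is brought to this form, with the same residue, by a high power of a function
    that is congruent to 1 at [P] and vanishes at the other conjugates of [P]. *)
Lemma graph_rational P : graph_pt P -> rational_point (jL X) P.
Proof.
move=> gP; have [cP e h] := gP; split=> // y Py; have ff := base_function_field.
have cQ t : cl (spre (ce_base X) t P) by apply: (spre_closed bb).
have [z [mz hz]] := @approx _ _ _ ff P n (fun t => spre (ce_base X) t P) cP (fun i _ => cQ i).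
have Pz : P z by rewrite -(subrK 1 z); apply: srD; auto; [apply: mi_sub mz | apply: sr1; auto].
have [N hN] : exists N, forall t, (t < n)%N -> spre (ce_base X) t P (z ^+ N * y).
  apply: max_ev => t lt; have [eP|nP] := pselect (spre (ce_base X) t P = P).
    exists 0%N => m _; rewrite eP; apply: srM; auto; apply: srX; auto.
  have [N hN] := rank_one ff y (cQ t) (hz _ lt nP).
  by exists N => m le; apply: mi_sub; apply: hN.
have [x ex ew] := regular_coord gP hN.
exists (\sum_l c (x l) * b l).
rewrite -[_ - _](subrKA (z ^+ N * y)); apply: miD; auto; last first.
  by rewrite ew; apply: c_sum.
rewrite -opprB; apply: miN; auto; rewrite -{2}[y]mul1r -mulrBl.
by apply: miMr; auto; apply: mi_exprB1; auto.
Qed.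

(** Otherwise some [z] would be congruent to 1 at [P], vanish at [Q] and be regular at all
    conjugates of [P]. Its coordinates lie in [eps], so the same formula gives its residue at both
    points: 1 would equal 0. *)
Lemma graph_uniq P Q : graph_pt P -> graph_pt Q -> Q = P.
Proof.
move=> gP gQ; apply: contrapT => neq; have [cP e h] := gP; have [cQ e' h'] := gQ.
have ff := base_function_field.
have cS t : cl (spre (ce_base X) t P) by apply: (spre_closed bb).
(* The conjugates of [P] take the indices below [n], and [Q] the index [n]. *)
pose S t := if (t < n)%N then spre (ce_base X) t P else Q.
have [||z [mz hz]] := @approx _ _ _ ff P n.+1 S => //.
  by move=> t _; rewrite /S; case: ifP.
have Pz : P z by rewrite -(subrK 1 z); apply: srD; auto; [apply: mi_sub mz | apply: sr1; auto].
have mQz : max_ideal Q z by have := hz n (ltnSn n); rewrite /S ltnn; apply.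
have hw t : (t < n)%N -> spre (ce_base X) t P z.
  move=> lt; have [->//|ne] := pselect (spre (ce_base X) t P = P).
  by apply: mi_sub; have := hz t (leqW lt); rewrite /S lt; apply.
have [x ex ew] := regular_coord gP hw.
have m1 := c_sum b gP ex; have m2 := c_sum b gQ ex.
move: m1 m2; rewrite -ew; set a := \sum_l _ => m1 m2.
have a0 : a = 0.
  apply: (curve_const_mi (clc cQ)); rewrite -(subKr z (jL X a)).
  by apply: miB; auto.
apply: (@mi1 _ P); auto; move: m1; rewrite a0 rmorph0 subr0 => m1.
by rewrite -(subKr z 1); apply: miB; auto.
Qed.

End GraphPoint.

(** * Locally free sheaves *)

Section MatrixImages.
Variable E : fieldType.

Lemma row_free_inj0 r r' (f : 'M[E]_(r, r')) (v : 'rV_r) : row_free f -> v *m f = 0 -> v = 0.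
Proof. by move=> /row_free_inj h e; apply: h; rewrite e mul0mx. Qed.

Lemma rspan_absorb (P : set E) r (B : 'M[E]_r) (v : 'rV[E]_r) : valring P -> B \in unitmx ->
  exists2 a, a != 0 & rspan P B (a *: v).
Proof.
move=> vP uB; pose w := v *m invmx B.
have [ex|nx] := pselect (exists j, w 0 j != 0); last first.
  exists 1; rewrite ?oner_eq0 // scale1r; apply/free_onP => // i j.
  rewrite ord1 -/w; have -> : w 0 j = 0 by apply: contrapT => /eqP h; apply: nx; exists j.
  by apply: sr0; auto.
have [j [wj h]] := min_val vP ex; exists (w 0 j)^-1; rewrite ?invr_eq0 //.
by apply/free_onP => // i l; rewrite ord1 -scalemxAl -/w mxE mulrC.
Qed.

(** Every vector has a nonzero multiple in a given lattice, so injectivity on one stalk is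
    injectivity on the generic stalk. *)
Lemma mxinj_on_row_free (P : set E) r r' (B : 'M[E]_r) (f : 'M[E]_(r, r')) : valring P ->
  B \in unitmx -> mxinj_on f (rspan P B) -> row_free f.
Proof.
move=> vP uB h; apply: inj_row_free => v vf.
have [a a0 hv] := rspan_absorb v vP uB.
have /eqP : a *: v = 0 by apply: h => //; rewrite -scalemxAl vf scaler0.
by rewrite scaler_eq0 (negPf a0) => /eqP.
Qed.

Lemma row_free_mxinj r r' (f : 'M[E]_(r, r')) S : row_free f -> mxinj_on f S.
Proof. by move=> ff v _; apply: row_free_inj0. Qed.

Lemma rspan_row_full (P : set E) r r' (S : set 'rV[E]_r) (B : 'M[E]_r') (f : 'M[E]_(r, r')) :
  subring P -> B \in unitmx -> rspan P B `<=` mximg f S -> row_full f.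
Proof.
move=> sP uB h; rewrite -sub1mx; apply: submx_trans (_ : (B <= f)%MS).
  by rewrite sub1mx row_full_unit.
by apply/row_subP => i; have [v _ <-] := h _ (rspan_row B i sP); apply: submxMl.
Qed.

Lemma rspan_block (P : set E) r s (A : 'M[E]_r) (B : 'M[E]_s) :
  rspan P (block_mx A 0 0 B) = dsum (rspan P A) (rspan P B).
Proof.
apply/seteqP; split.
  move=> _ [a ha ->]; rewrite -[a]hsubmxK mul_row_block !mulmx0 addr0 add0r.
  split; rewrite ?row_mxKl ?row_mxKr; [exists (lsubmx a) | exists (rsubmx a)] => // i j;
    by rewrite !mxE; apply: ha.
move=> v [[a ha ea] [c hc ec]]; exists (row_mx a c).
  by move=> i j; rewrite mxE; case: fintype.split.
by rewrite mul_row_block !mulmx0 addr0 add0r -ea -ec hsubmxK.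
Qed.

Lemma mximg_comp r s t (f : 'M[E]_(r, s)) (g : 'M[E]_(s, t)) S :
  mximg g (mximg f S) = mximg (f *m g) S.
Proof.
apply/seteqP; split; first by move=> _ [_ [v Sv <-] <-]; exists v; rewrite ?mulmxA.
by move=> _ [v Sv <-]; exists (v *m f); [exists v | rewrite mulmxA].
Qed.

Lemma mximg1 r (S : set 'rV[E]_r) : mximg 1%:M S = S.
Proof.
apply/seteqP; split; first by move=> _ [v Sv <-]; rewrite mulmx1.
by move=> v Sv; exists v; rewrite ?mulmx1.
Qed.

Lemma mximg_mono r s (f : 'M[E]_(r, s)) S T : S `<=` T -> mximg f S `<=` mximg f T.
Proof. by move=> h _ [v Sv <-]; exists v => //; apply: h. Qed.

Lemma mximg_lspan (R : set E) r s (f : 'M[E]_(r, s)) S : mximg f (lspan R S) = lspan R (mximg f S).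
Proof.
apply/seteqP; split.
  move=> _ [_ [n [a [w [h ->]]]] <-]; exists n, a, (fun i => w i *m f); split.
    by move=> i; have [? ?] := h i; split=> //; exists (w i).
  by rewrite mulmx_suml; apply: eq_bigr => i _; rewrite scalemxAl.
move=> _ [n [a [w [h ->]]]].
have /choice[u hu] : forall i, exists v, S v /\ v *m f = w i.
  by move=> i; have [_ [v Sv <-]] := h i; exists v.
exists (\sum_i a i *: u i).
  by exists n, a, u; split=> // i; split; [case: (h i) | case: (hu i)].
by rewrite mulmx_suml; apply: eq_bigr => i _; rewrite -scalemxAl (hu i).2.
Qed.

Lemma mximg_unitP r (f : 'M[E]_r) S v : f \in unitmx -> mximg f S v <-> S (v *m invmx f).
Proof.
move=> uf; split; first by move=> [u Su <-]; rewrite mulmxK.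
by move=> h; exists (v *m invmx f); rewrite ?mulmxKV.
Qed.

Lemma mximg_unit_inj r (f : 'M[E]_r) S T : f \in unitmx -> mximg f S = mximg f T -> S = T.
Proof.
move=> uf e; apply/funext => v; apply/propext.
have := mximg_unitP S (v *m f) uf; have := mximg_unitP T (v *m f) uf.
by rewrite mulmxK // e => h1 h2; split => [/h2/h1|/h1/h2].
Qed.

End MatrixImages.

Lemma mximg_map (E E' : fieldType) (phi : {rmorphism E -> E'}) r s (f : 'M[E]_(r, s)) S :
  mximg (map_mx phi f) (map_mx phi @` S) = map_mx phi @` (mximg f S).
Proof.
apply/seteqP; split.
  by move=> _ [_ [v Sv <-] <-]; exists (v *m f); [exists v | rewrite map_mxM].
by move=> _ [_ [v Sv <-] <-]; exists (map_mx phi v); [exists v | rewrite map_mxM].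
Qed.

Section Pullback.
Variables (E E' : fieldType) (phi : {rmorphism E -> E'}).

Lemma pullback_rspan r (M : sheaf E r) (P : set E') (B : 'M[E]_r) : subring P ->
  subring (phi @^-1` P) -> M (phi @^-1` P) = rspan (phi @^-1` P) B ->
  pullback phi M P = rspan P (map_mx phi B).
Proof.
move=> sP sQ e; apply/seteqP; split.
  apply: lspan_min; first exact: rspan_submod.
  move=> _ [v + <-]; rewrite e => -[a ha ->]; exists (map_mx phi a); last by rewrite map_mxM.
  by move=> i j; rewrite mxE; apply: ha.
apply: rspan_sub_submod; first exact: lspan_submod.
move=> i; apply: lspan_mem; first exact: sr1.
by exists (row i B); [rewrite e; apply: rspan_row | rewrite map_row].
Qed.

Lemma pullback_img r s (M : sheaf E r) (f : 'M[E]_(r, s)) (P : set E') :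
  pullback phi (fun Q => mximg f (M Q)) P = mximg (map_mx phi f) (pullback phi M P).
Proof. by rewrite /pullback mximg_lspan mximg_map. Qed.

Lemma extend_scalars_img (R' : set E') r s (M : set 'rV[E]_r) (f : 'M[E]_(r, s)) :
  extend_scalars phi R' (mximg f M) = mximg (map_mx phi f) (extend_scalars phi R' M).
Proof. by rewrite /extend_scalars mximg_lspan mximg_map. Qed.

End Pullback.

Section LocallyFree.
Variables (F E : fieldType) (iota : {rmorphism F -> E}).
Hypothesis ffE : is_function_field iota.
Local Notation cl := (closed_point iota).
Let clv P : cl P -> valring P := @closed_valring _ _ iota P.
#[local] Hint Resolve clv : core.

Lemma locally_free_stalk r (M : sheaf E r) P : locally_free iota M -> cl P ->
  exists2 B, B \in unitmx & M P = rspan P B.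
Proof.
move=> h cP; have [U [B [UP _ uB hB]]] := h P cP.
by exists B => //; rewrite hB // free_on_rspan.
Qed.

Lemma locally_freeP r (M : sheaf E r) : (forall P, cl P -> exists (U : set (set E)) (B : 'M[E]_r),
      [/\ U P, finite_set [set Q | cl Q /\ ~ U Q], B \in unitmx &
          forall Q, cl Q -> U Q -> M Q = rspan Q B]) <-> locally_free iota M.
Proof.
split=> h P cP; have [U [B [UP fU uB hB]]] := h P cP; exists U, B; split=> // Q cQ UQ.
  by rewrite hB // free_on_rspan.
by rewrite hB // free_on_rspan.
Qed.

Lemma finite_mx_poles m n (A : 'M[E]_(m, n)) : finite_set [set Q | cl Q /\ ~ mxover Q A].
Proof.
apply: (@sub_finite_set _ _ (\bigcup_(p in [set: 'I_m * 'I_n]) [set Q | cl Q /\ ~ Q (A p.1 p.2)])).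
  move=> Q [cQ nA]; apply: contrapT => H; apply: nA => i j; apply: contrapT => nQ.
  by apply: H; exists (i, j).
apply: bigcup_finite; first exact: finite_finset.
by move=> p _; apply: finite_poles.
Qed.

(** [rspan_basis] provides a basis of the image at one point together with the matrices [A] and [A']
    of both inclusions. These are regular at almost all points, so the same basis serves on an open
    set. *)
Lemma locally_free_img r s (M : sheaf E r) (p : 'M[E]_(r, s)) : locally_free iota M ->
  row_full p -> locally_free iota (fun P => mximg p (M P)).
Proof.
move=> /locally_freeP lf fp; apply/locally_freeP => P cP; have [U [B [UP fU uB hB]]] := lf P cP.
have fBp : row_full (B *m p) by rewrite /row_full (eqmxMfull p _) ?row_full_unit.
have [B' [A [A' [uB' hA hA' e1 e2]]]] := rspan_basis (clv cP) fBp.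
exists [set Q | [/\ U Q, mxover Q A & mxover Q A']], B'; split=> //.
  apply: (@sub_finite_set _ _ ([set Q | cl Q /\ ~ U Q] `|` ([set Q | cl Q /\ ~ mxover Q A] `|`
     [set Q | cl Q /\ ~ mxover Q A']))).
    move=> Q [cQ nQ]; have [UQ|] := pselect (U Q); last by left.
    have [AQ|] := pselect (mxover Q A); last by right; left.
    by right; right; split=> // AQ'; apply: nQ.
  by rewrite !finite_setU; do 2!split=> //; apply: finite_mx_poles.
move=> Q cQ [UQ AQ AQ']; rewrite hB // mximg_rspan.
by apply: (rspan_eqP (A := A) (A' := A')); auto.
Qed.

Lemma locally_free_dsum r s (M : sheaf E r) (N : sheaf E s) : locally_free iota M ->
  locally_free iota N -> locally_free iota (fun P => dsum (M P) (N P)).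
Proof.
move=> /locally_freeP h1 /locally_freeP h2; apply/locally_freeP => P cP.
have [U [A [UP fU uA hA]]] := h1 P cP; have [V [B [VP fV uB hB]]] := h2 P cP.
exists (U `&` V), (block_mx A 0 0 B); split=> //.
- apply: (@sub_finite_set _ _ ([set Q | cl Q /\ ~ U Q] `|` [set Q | cl Q /\ ~ V Q])).
    move=> Q [cQ nQ]; have [UQ|] := pselect (U Q); last by left.
    by right; split=> // VQ; apply: nQ.
  by rewrite finite_setU.
- by rewrite unitmxE det_ublock unitrM -!unitmxE uA uB.
- by move=> Q cQ [UQ VQ]; rewrite rspan_block hA // hB.
Qed.

End LocallyFree.

Lemma locally_free_pullback (k L : finFieldType) (E0 E : fieldType) (j0 : {rmorphism k -> E0})
    (j : {rmorphism L -> E}) (X : const_ext j0 j) r (M : sheaf E0 r) :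
  is_function_field j0 -> locally_free j0 M -> locally_free j (pullback (ce_phi X) M).
Proof.
move=> ff /locally_freeP lf; have [n [b bb]] := ce_basis_ex X.
have ff' := ce_function_field bb ff.
apply/locally_freeP => P cP; have [U [B [UP fU uB hB]]] := lf _ (preim_closed bb cP).
exists [set Q | U (ce_phi X @^-1` Q)], (map_mx (ce_phi X) B); split=> //.
- apply: (@sub_finite_set _ _ (\bigcup_(Q in [set Q | closed_point j0 Q /\ ~ U Q])
      [set Q' | closed_point j Q' /\ ce_phi X @^-1` Q' = Q])).
    by move=> Q [cQ nU]; exists (ce_phi X @^-1` Q) => //; split=> //; exact: (preim_closed bb cQ).
  (* Each excluded point has finitely many points above it: all of them are poles of the single
     function [u^-1]. *)
  apply: bigcup_finite => // Q [cQ _]; have [u u0 mu] := closed_mi cQ.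
  apply: sub_finite_set (finite_poles ff' (ce_phi X u^-1)) => Q' [cQ' e]; split=> //.
  by move: (inv_mi u0 mu); rewrite -e.
- by rewrite map_unitmx.
- move=> Q cQ UQ; apply: pullback_rspan; first by apply: vr_sub (closed_valring cQ).
    exact: vr_sub (closed_valring (preim_closed bb cQ)).
  by apply: hB => //; exact: (preim_closed bb cQ).
Qed.

(** * Twists by divisors *)

Section Twist.
Variables (k : finFieldType) (C : curve k) (L : finFieldType) (X : base_curve C L).
Local Notation cl := (closed_point (jL X)).

Lemma jQ_preim_closed (P : set X) : cl P -> closed_point (@const k C) (jQ X @^-1` P).
Proof. by have [n [b bb]] := ce_basis_ex (ce_base X); apply: (preim_closed bb). Qed.

Lemma over_oo_rational (P : set X) : over_oo P -> rational_point (@const k C) (jQ X @^-1` P).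
Proof. by rewrite /over_oo => ->; apply: oo_rational. Qed.

(** Two uniformizers differ by a unit, so one of them describes all sections of O(D), and the span
    in the definition of [twist] becomes a rescaled stalk. *)
Lemma twistE (D : set C -> int) r (M : sheaf X r) P t : cl P ->
  uniformizer (jQ X @^-1` P) t -> submodule P (M P) ->
  twist D M P = [set v | M P (jQ X t ^ (D (jQ X @^-1` P)) *: v)].
Proof.
move=> cP ut sM; set Q := jQ X @^-1` P in ut *.
have [M0 MD MM] := sM; have sP : subring P := vr_sub (closed_valring cP).
have cQ : closed_point (@const k C) Q by apply: jQ_preim_closed.
have sQ : subring Q := vr_sub (closed_valring cQ).
have [_ t0 _] := ut; have jt0 : jQ X t != 0 by rewrite fmorph_eq0.
apply/seteqP; split.
  apply: lspan_min.
    split; first by rewrite /= scaler0.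
      by move=> u v /= hu hv; rewrite scalerDr; apply: MD.
    by move=> a v /= Pa hv; rewrite scalerA mulrC -scalerA; apply: MM.
  move=> _ [x [v [[t' [u [ut' Qu ->]]] Mv ->]]] /=.
  rewrite scalerA -fmorphXz -rmorphM.
  have -> : t ^ (D Q) * (u * t' ^ (- D Q)) = u * (t / t') ^ (D Q).
    by rewrite expfzMl exprz_inv; ring.
  apply: MM => //; have [_ h _] := isuXz (D Q) sQ (uniformizer_isu ut ut').
  exact: (srM sQ Qu h).
move=> v /= Mv; apply: lspan_mem; first exact: sr1.
exists (t ^ (- D Q)), (jQ X t ^ (D Q) *: v); split=> //.
  by exists t, 1; split=> //; [apply: sr1 | rewrite mul1r].
by rewrite scalerA fmorphXz -expfzDr // addNr expr0z scale1r.
Qed.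

Lemma twist_unif (P : set X) : cl P -> exists t, uniformizer (jQ X @^-1` P) t.
Proof.
move=> cP; apply: (uniformizer_exists (curve_function_field C)).
exact: jQ_preim_closed.
Qed.

Lemma twist0 (D : set C -> int) r (M : sheaf X r) P : cl P -> submodule P (M P) ->
  D (jQ X @^-1` P) = 0 -> twist D M P = M P.
Proof.
move=> cP sM D0; have [t ut] := twist_unif cP.
by rewrite (twistE _ cP ut sM) D0; apply/funext => v /=; rewrite expr0z scale1r.
Qed.

Lemma twist_img (D : set C -> int) r s (M : sheaf X r) (f : 'M[X]_(r, s)) P : cl P ->
  submodule P (M P) ->
  twist D (fun P => mximg f (M P)) P = mximg f (twist D M P).
Proof.
move=> cP sM; have [t ut] := twist_unif cP.
rewrite (twistE _ cP ut sM) (twistE _ cP ut); last exact: mximg_submod.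
have [_ t0 _] := ut; have z0 : jQ X t ^ (D (jQ X @^-1` P)) != 0.
  by rewrite expfz_neq0 // fmorph_eq0.
apply/seteqP; split=> v /=.
  move=> [u Mu eu]; exists ((jQ X t ^ (D (jQ X @^-1` P)))^-1 *: u) => /=.
    by rewrite scalerA mulfV // scale1r.
  by rewrite -scalemxAl eu scalerA mulVf // scale1r.
by move=> [u Mu <-]; rewrite scalemxAl; eexists; first exact: Mu.
Qed.

Lemma twist_rspan (D : set C -> int) r (M : sheaf X r) P t (B : 'M[X]_r) : cl P ->
  uniformizer (jQ X @^-1` P) t -> M P = rspan P B ->
  twist D M P = rspan P (jQ X t ^ (- D (jQ X @^-1` P)) *: B).
Proof.
move=> cP ut e; have sP : subring P := vr_sub (closed_valring cP).
rewrite (twistE _ cP ut); last by rewrite e; apply: rspan_submod.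
have [_ t0 _] := ut; have jt0 : jQ X t != 0 by rewrite fmorph_eq0.
rewrite e; apply/seteqP; split=> v /= -[a ha ea]; exists a => //.
  rewrite -scalemxAr -ea scalerA -expfzDr // addNr expr0z scale1r //.
by rewrite ea -scalemxAr scalerA -expfzDr // addrN expr0z scale1r.
Qed.

Lemma twist_dsum (D : set C -> int) r s (M : sheaf X r) (N : sheaf X s) P : cl P ->
  submodule P (M P) -> submodule P (N P) ->
  twist D (fun P => dsum (M P) (N P)) P = dsum (twist D M P) (twist D N P).
Proof.
move=> cP sM sN; have [t ut] := twist_unif cP.
rewrite (twistE _ cP ut sM) (twistE _ cP ut sN) (twistE _ cP ut); last exact: dsum_submod.
by apply/funext => v; rewrite /dsum /= !linearZ.
Qed.

End Twist.

(** * Frobenius modules and descent *)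

Lemma row_full_map (E E' : fieldType) (phi : {rmorphism E -> E'}) r s (f : 'M[E]_(r, s)) :
  row_full (map_mx phi f) = row_full f.
Proof. by rewrite /row_full mxrank_map. Qed.

Section TauModules.
Variables (E : fieldType) (sg : {rmorphism E -> E}).

(* The simplicity of [E^r] with the semilinear map [v |-> sg(v) T]. *)
Definition tsimple r (T : 'M[E]_r) := (0 < r)%N /\
  forall r' (p : 'M[E]_(r, r')) (T' : 'M[E]_r'), row_full p ->
    T *m p = map_mx sg p *m T' -> r' = 0%N \/ r' = r.

Definition subspace r (S : set 'rV[E]_r) := submodule setT S.

Lemma subspace_mx r (S : set 'rV[E]_r) : subspace S ->
  exists U : 'M[E]_r, forall v, S v <-> (v <= U)%MS.
Proof.
move=> [S0 SD SM].
have sub m (A : 'M[E]_(m, r)) v : (forall i, S (row i A)) -> (v <= A)%MS -> S v.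
  move=> hA /submxP[a ->]; rewrite mulmx_sum_row.
  by elim/big_ind: _ => // i _; apply: SM.
pose fam d := `[< exists U : 'M[E]_r, (forall i, S (row i U)) /\ \rank U = d >].
have ex : exists d, fam d.
  exists 0%N; apply/asboolP; exists 0; split; first by move=> i; rewrite row0.
  exact: mxrank0.
have ub d : fam d -> (d <= r)%N by move=> /asboolP[U [_ <-]]; apply: rank_leq_row.
case: (ex_maxnP ex ub) => d /asboolP[U [hU rU]] hd; exists U => v; split; last exact: sub.
move=> Sv; apply: contraT => nv.
have : (\rank U < \rank (U + v)%MS)%N.
  have : (U < U + v)%MS.
    rewrite ltmxE addsmxSl /=; apply: contra nv; apply: submx_trans; exact: addsmxSr.
  by move/ltmxW => h; rewrite ltn_neqAle mxrankS // andbT; apply: contra nv => /eqP e;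
     apply: submx_trans (addsmxSr U v) _; rewrite -(geq_leqif (mxrank_leqif_sup h)) e.
rewrite rU ltnNge hd //; apply/asboolP; exists (U + v)%MS; split=> // i.
apply: (sub _ (col_mx U v)); last by rewrite -addsmxE row_sub.
move=> l; rewrite -[l]splitK; case: fintype.split => l' /=.
  by have -> : row (lshift 1 l') (col_mx U v) = row l' U by apply/rowP => q; rewrite !mxE (unsplitK (inl l')).
by have -> : row (rshift r l') (col_mx U v) = v by apply/rowP => q; rewrite !mxE (unsplitK (inr l')) ord1.
Qed.

(** The projection is the full-rank factor of the cokernel matrix. As the kernel is stable, [T *m p]
    vanishes on the kernel of the twisted projection, so any section of the latter defines the
    operator on the quotient. *)
Lemma quotient_ex r (T : 'M[E]_r) (S : set 'rV[E]_r) : subspace S ->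
  (forall v, S v -> S (map_mx sg v *m T)) ->
  exists r' (p : 'M[E]_(r, r')) T', [/\ row_full p, T *m p = map_mx sg p *m T' &
    forall v, v *m p = 0 <-> S v].
Proof.
move=> sS stab; have [U hU] := subspace_mx sS.
pose p := col_base (cokermx U).
have kp v : v *m p = 0 <-> S v.
  have e : v *m cokermx U = v *m p *m row_base (cokermx U) by rewrite -mulmxA mulmx_base.
  rewrite hU submxE e; split=> [->|/eqP h]; first by rewrite mul0mx.
  by apply: (row_free_inj0 (row_base_free (cokermx U))).
have fp : row_full p by apply: col_base_full.
exists _, p, (pinvmx (map_mx sg p) *m (T *m p)); split=> //.
set q := map_mx sg p; have fq : row_full q by rewrite row_full_map.
have h (v : 'rV_r) : v *m p = 0 -> map_mx sg v *m (T *m p) = 0.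
  by move=> /(kp v).1 /stab /(kp _).2; rewrite mulmxA.
(* The defect of the section lies in the kernel of [q], which is the twist of the kernel of [p];
   this is where stability applies. *)
have : (q *m pinvmx q - 1%:M <= kermx q)%MS.
  by apply/sub_kermxP; rewrite mulmxBl -mulmxA mulVpmx // mulmx1 mul1mx subrr.
rewrite -map_kermx => /submxP[A eA].
have : (q *m pinvmx q - 1%:M) *m (T *m p) = 0.
  rewrite eA -mulmxA; apply/row_matrixP => i; rewrite row0 row_mul.
  suff -> : map_mx sg (kermx p) *m (T *m p) = 0 by rewrite mulmx0.
  apply/row_matrixP => l; rewrite row0 row_mul -map_row; apply: h.
  by rewrite -row_mul mulmx_ker row0.
by move=> /eqP; rewrite mulmxBl mul1mx subr_eq0 => /eqP e; rewrite [RHS]mulmxA e.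
Qed.

(** A stable subspace is the kernel of a quotient, whose rank is 0 or [r] by simplicity. This
    converts the definition by ranks into one by subspaces. *)
Lemma tsimple_set r (T : 'M[E]_r) (S : set 'rV[E]_r) : tsimple T -> subspace S ->
  (forall v, S v -> S (map_mx sg v *m T)) -> (forall v, S v -> v = 0) \/ (forall v, S v).
Proof.
move=> [r0 simT] sS stab; have [r' [p [T' [fp eT kp]]]] := quotient_ex sS stab.
case: (simT _ _ _ fp eT) => e; last first.
  left=> v /kp; apply: row_free_inj0; rewrite /row_free.
  by move: fp; rewrite /row_full => /eqP ->; apply/eqP.
right=> v; apply/kp; apply/rowP => i; have := ltn_ord i; rewrite [X in (_ < X)%N]e.
by [].
Qed.

Lemma surj_row_full r s (f : 'M[E]_(r, s)) : (forall w : 'rV_s, exists v, v *m f = w) -> row_full f.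
Proof.
move=> h; rewrite -sub1mx; apply/row_subP => i; have [v <-] := h (row i 1%:M).
exact: submxMl.
Qed.

Lemma row_full_surj r s (f : 'M[E]_(r, s)) (w : 'rV_s) : row_full f -> exists v, v *m f = w.
Proof. by move=> ff; exists (w *m pinvmx f); rewrite -mulmxA mulVpmx // mulmx1. Qed.

Lemma row_full_mul r s t (f : 'M[E]_(r, s)) (g : 'M[E]_(s, t)) : row_full f -> row_full g ->
  row_full (f *m g).
Proof. by move=> ff fg; rewrite /row_full (eqmxMfull g ff). Qed.

Record qdata r := QData { qr : nat; qm : 'M[E]_(r, qr); qT : 'M[E]_qr }.

Definition qhom r (T : 'M[E]_r) (x : qdata r) := T *m qm x = map_mx sg (qm x) *m qT x.

Fixpoint Forall_seq A (P : A -> Prop) (l : seq A) : Prop :=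
  if l is x :: l' then P x /\ Forall_seq P l' else True.

Lemma Forall_cat A (P : A -> Prop) l l' :
  Forall_seq P (l ++ l') <-> Forall_seq P l /\ Forall_seq P l'.
Proof. by elim: l => [|x l IH] /=; tauto. Qed.

Lemma Forall_imp A (P Q : A -> Prop) l : (forall x, P x -> Q x) -> Forall_seq P l -> Forall_seq Q l.
Proof. by move=> h; elim: l => //= x l IH [/h ? /IH]. Qed.

Lemma Forall_map A B (f : A -> B) (P : B -> Prop) (s : seq A) :
  Forall_seq P (map f s) <-> Forall_seq (fun x => P (f x)) s.
Proof. by elim: s => //= x s IH; tauto. Qed.

Lemma Forall_iota (P : nat -> Prop) m n :
  Forall_seq P (iota m n) <-> forall i, (m <= i < m + n)%N -> P i.
Proof.
elim: n m => [|n IH] m /=; first by split=> // _ i; rewrite addn0 ltnNge andbN.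
rewrite IH addSnnS; split=> [[Pm h] i /andP[]|h].
  by rewrite leq_eqVlt => /orP[/eqP<-//|mi] lt; apply: h; rewrite mi.
split; first by apply: h; rewrite leqnn addnS ltnS leq_addr.
by move=> i /andP[mi lt]; apply: h; rewrite lt andbT ltnW.
Qed.

Fixpoint qcomb r (l : seq (qdata r)) : qdata r :=
  if l is x :: l' then
    QData (row_mx (qm x) (qm (qcomb l'))) (block_mx (qT x) 0 0 (qT (qcomb l')))
  else @QData r 0 0 1%:M.

Lemma qcomb_hom r (T : 'M[E]_r) l : Forall_seq (qhom T) l -> qhom T (qcomb l).
Proof.
elim: l => [_|x l IH /= [hx /IH hl]]; first by rewrite /qhom /= !thinmx0.
rewrite /qhom /= map_row_mx mul_row_block !mulmx0 addr0 add0r -hx -hl.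
by rewrite mul_mx_row.
Qed.

(** A summand is examined on the kernel of the maps already retained. Its image there is a stable
    subspace of a simple module: if zero, the summand adds nothing to joint injectivity and is
    dropped; if everything, keeping it preserves joint surjectivity. *)
Lemma qprune r (T : 'M[E]_r) l :
  Forall_seq (fun x => tsimple (qT x) /\ qhom T x) l -> exists l',
  [/\ Forall_seq (fun x => tsimple (qT x) /\ qhom T x) l', row_full (qm (qcomb l')) &
      forall v : 'rV[E]_r, v *m qm (qcomb l') = 0 -> Forall_seq (fun x => v *m qm x = 0) l].
Proof.
elim: l => [_|x l IH /= [[sx hx] hl]].
  by exists [::]; split=> //=; rewrite /row_full -leqn0 rank_leq_col.
have [l' [gl' fl' kl']] := IH hl.
have hP : qhom T (qcomb l') by apply: qcomb_hom; apply: Forall_imp gl' => y [].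
pose S := [set w | exists2 v : 'rV[E]_r, v *m qm (qcomb l') = 0 & w = v *m qm x].
have sS : subspace S.
  split; first by exists 0; rewrite !mul0mx.
    by move=> _ _ [u hu ->] [v hv ->]; exists (u + v); rewrite !mulmxDl // hu hv addr0.
  by move=> a _ _ [u hu ->]; exists (a *: u); rewrite -!scalemxAl // hu scaler0.
have stab w : S w -> S (map_mx sg w *m qT x).
  move=> [v hv ->]; exists (map_mx sg v *m T).
    by rewrite -mulmxA hP mulmxA -map_mxM hv raddf0 mul0mx.
  by rewrite -mulmxA hx mulmxA map_mxM.
have [S0|Sall] := tsimple_set sx sS stab.
  exists l'; split=> // v hv; split; last exact: kl'.
  by apply: S0; exists v.
exists (x :: l'); split=> //=.
  apply: surj_row_full => w; rewrite -[w]hsubmxK.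
  have [u hu] := row_full_surj (rsubmx w) fl'.
  have [v hv ev] := Sall (lsubmx w - u *m qm x).
  exists (u + v); rewrite mul_mx_row !mulmxDl hu hv addr0 -ev.
  by rewrite addrC subrK.
move=> v; rewrite mul_mx_row => /eqP; rewrite row_mx_eq0 => /andP[/eqP h1 /eqP h2].
by split=> //; apply: kl'.
Qed.

Lemma tsimple_conj r (T : 'M[E]_r) (h h' : {rmorphism E -> E}) : cancel h h' -> cancel h' h ->
  (forall x, h' (sg x) = sg (h' x)) -> tsimple T -> tsimple (map_mx h T).
Proof.
move=> hK hK' comm [r0 simT]; split=> // r' p T' fp e.
have mK m n : cancel (map_mx h : 'M_(m, n) -> _) (map_mx h').
  by move=> A; apply/matrixP => i j; rewrite !mxE hK.
apply: (simT r' (map_mx h' p) (map_mx h' T')); first by rewrite row_full_map.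
have := congr1 (map_mx h') e; rewrite !map_mxM /= mK => ->; congr (_ *m _).
by apply/matrixP => i j; rewrite !mxE comm.
Qed.

Lemma min_quotient r (T : 'M[E]_r) : (0 < r)%N -> exists r0 (p : 'M[E]_(r, r0)) T0,
  [/\ row_full p, T *m p = map_mx sg p *m T0 & tsimple T0].
Proof.
move=> r0.
pose fam d := `[< (0 < d)%N /\ exists (p : 'M[E]_(r, d)) (T' : 'M[E]_d),
   row_full p /\ T *m p = map_mx sg p *m T' >].
have ex : exists d, fam d.
  exists r; apply/asboolP; split=> //; exists 1%:M, T.
  by rewrite row_full_unit unitmx1 map_mx1 mulmx1 mul1mx.
case: (ex_minnP ex) => d /asboolP[d0 [p [T0 [fp eT]]]] hd.
exists d, p, T0; split=> //; split=> // r' q T' fq e'.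
have [->|r'0] := posnP r'; first by left.
right; apply/eqP; rewrite eqn_leq; apply/andP; split.
  by move: fq; rewrite /row_full => /eqP <-; apply: rank_leq_row.
apply: hd; apply/asboolP; split=> //; exists (p *m q), T'; split.
  exact: row_full_mul.
by rewrite mulmxA eT -mulmxA e' mulmxA map_mxM.
Qed.

End TauModules.

(** * Galois descent *)

Section Descent.
Variables (k L : finFieldType) (E0 E : fieldType) (j0 : {rmorphism k -> E0}).
Variables (j : {rmorphism L -> E}) (Y : const_ext j0 j).
Variables (sg0 : {rmorphism E0 -> E0}) (sg : {rmorphism E -> E}).
Local Notation phi := (ce_phi Y).
Local Notation s := (ce_s Y).
Hypothesis phi_sg : forall x, phi (sg0 x) = sg (phi x).
Hypothesis s_sg : forall x, s (sg x) = sg (s x).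

(* The conjugates of a minimal quotient are jointly injective: the intersection of their
   kernels is Galois stable, hence comes from a proper submodule over the small field. *)
Lemma tsimple_descent r (T : 'M[E0]_r) : tsimple sg0 T -> exists l : seq (qdata E r),
  Forall_seq (fun x => tsimple sg (qT x) /\ qhom sg (map_mx phi T) x) l /\
  forall v : 'rV[E]_r, Forall_seq (fun x => v *m qm x = 0) l -> v = 0.
Proof.
move=> simT; have [r0 _] := simT; have [n [b bb]] := ce_basis_ex Y.
have [d [p [T0 [fp eT simT0]]]] := min_quotient sg (map_mx phi T) r0.
have n0 := ce_basis_gt0 bb.
pose g t := rmorph_iter s t.
have gE t y : g t y = iter t s y by apply: rmorph_iterE.
have gsg t x : g t (sg x) = sg (g t x).
  by rewrite !gE; elim: t => //= t ->; rewrite s_sg.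
have gphi t x : g t (phi x) = phi x by rewrite gE ce_iter_phi.
have gmod t x : g t x = g (t %% n)%N x.
  rewrite !gE {1}(divn_eq t n) addnC iterD.
  elim: (t %/ n)%N => [|q IH]; first by rewrite mul0n.
  by rewrite mulSn iterD (ce_s_order bb).
pose x t := @QData E r d (map_mx (g t) p) (map_mx (g t) T0).
have hx t : qhom sg (map_mx phi T) (x t).
  rewrite /qhom /=; have := congr1 (map_mx (g t)) eT; rewrite !map_mxM /=.
  rewrite (_ : map_mx (g t) (map_mx phi T) = map_mx phi T); last first.
    by apply/matrixP => i l; rewrite !mxE gphi.
  move=> ->; congr (_ *m _); apply/matrixP => i l; rewrite !mxE; exact: gsg.
exists (map x (iota 0 n)); split.
  apply/Forall_map/Forall_iota => t /andP[_ tn]; split; last exact: hx.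
  apply: (@tsimple_conj _ _ _ _ _ (g (n - t)%N)) => //.
  - by move=> y; rewrite !gE -iterD subnK ?(ltnW tn) // (ce_s_order bb).
  - by move=> y; rewrite !gE -iterD subnKC ?(ltnW tn) // (ce_s_order bb).
pose K := [set v : 'rV[E]_r | forall t, v *m map_mx (g t) p = 0].
move=> v /Forall_map/Forall_iota hv.
have Kv : K v.
  move=> t; have := hv (t %% n)%N; rewrite /= ltn_mod n0 => /(_ isT) h; rewrite -[RHS]h.
  by congr (_ *m _); apply/matrixP => i l; rewrite !mxE; apply: gmod.
have Ks t w : K w -> K (map_mx (iter t s) w).
  elim: t w => [|t IH] w Kw.
    by rewrite (_ : map_mx _ w = w) //; apply/matrixP => i l; rewrite mxE.
  move=> m; have -> : map_mx (iter t.+1 s) w = map_mx s (map_mx (iter t s) w).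
    by apply/matrixP => i l; rewrite !mxE.
  (* The index [(m + n).-1] is [m - 1] modulo the order [n] of [s], shifted by [n] so as to cover
     [m = 0]. *)
  have -> : map_mx (g m) p = map_mx s (map_mx (g (m + n).-1) p).
    apply/matrixP => i l; rewrite !mxE gmod -[s _]/((iter 1 s) _) gE (gE (m + n).-1).
    rewrite -iterD add1n prednK ?addn_gt0 ?n0 ?orbT // iterD (ce_s_order bb).
    by rewrite -!gE -gmod.
  by rewrite -map_mxM IH // raddf0.
pose K0 := [set u : 'rV[E0]_r | K (map_mx phi u)].
have sK0 : subspace K0.
  split; first by move=> t; rewrite raddf0 mul0mx.
    by move=> u w hu hw t; rewrite raddfD mulmxDl hu hw addr0.
  by move=> a u _ hu t; rewrite map_mxZ -scalemxAl hu scaler0.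
have stab u : K0 u -> K0 (map_mx sg0 u *m T).
  move=> hu t; rewrite map_mxM.
  have -> : map_mx phi (map_mx sg0 u) = map_mx sg (map_mx phi u).
    by apply/matrixP => i l; rewrite !mxE phi_sg.
  have := hx t; rewrite /qhom /= => e; rewrite -mulmxA e mulmxA -map_mxM.
  by rewrite (hu t) raddf0 mul0mx.
have [K00|Kall] := tsimple_set simT sK0 stab.
  (* The Moore formula writes the coordinates of [v] as combinations of its conjugates, all of which
     lie in [K]; hence they lie in [K0] and vanish. *)
  have [D hD] := ce_moore_rv bb; have [u eu] := ce_coord_rv bb v.
  have u0 m : u m = 0.
    apply: K00; rewrite /K0 /= hD -eu => t; rewrite mulmx_suml big1 // => t' _.
    by rewrite -scalemxAl (Ks _ _ Kv) scaler0.
  by rewrite eu big1 // => m _; rewrite u0 raddf0 scaler0.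
have p0 : p = 0.
  apply/row_matrixP => i; rewrite row0 rowE; have := Kall (delta_mx 0 i) 0%N.
  rewrite map_delta_mx; congr (_ *m _ = _).
  by apply/matrixP => a c; rewrite mxE.
by case: simT0 => d0 _; move: fp d0; rewrite p0 /row_full mxrank0 eq_sym => /eqP ->.
Qed.

(** Each simple quotient over the small field is replaced by the list that its own descent provides,
    composed with the projection after base change. Joint injectivity of the projections survives
    base change, as is seen on coordinates. *)
Lemma semisimple_descent r (T : 'M[E0]_r) l : Forall_seq (fun x => tsimple sg0 (qT x) /\ qhom sg0 T x) l ->
  (forall v : 'rV[E0]_r, Forall_seq (fun x => v *m qm x = 0) l -> v = 0) ->
  exists l' : seq (qdata E r),
  [/\ Forall_seq (fun x => tsimple sg (qT x) /\ qhom sg (map_mx phi T) x) l',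
      row_full (qm (qcomb l')), row_free (qm (qcomb l')) & qhom sg (map_mx phi T) (qcomb l')].
Proof.
move=> hl inj.
suff [l1 [gl1 il1]] : exists l1 : seq (qdata E r),
    Forall_seq (fun x => tsimple sg (qT x) /\ qhom sg (map_mx phi T) x) l1 /\
    forall v : 'rV[E]_r, Forall_seq (fun x => v *m qm x = 0) l1 -> v = 0.
  have [l' [gl' fl' kl']] := qprune gl1; exists l'; split=> //.
    by apply: inj_row_free => v /kl'; apply: il1.
  by apply: qcomb_hom; apply: Forall_imp gl' => x [].
suff [l1 [gl1 il1]] : exists l1 : seq (qdata E r),
    Forall_seq (fun x => tsimple sg (qT x) /\ qhom sg (map_mx phi T) x) l1 /\
    forall v : 'rV[E]_r, Forall_seq (fun x => v *m qm x = 0) l1 ->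
      Forall_seq (fun x => v *m map_mx phi (qm x) = 0) l.
  exists l1; split=> // v /il1 h.
  have [n [b bb]] := ce_basis_ex Y; have [u eu] := ce_coord_rv bb v.
  have u0 m : u m = 0.
    apply: inj; elim: l h {hl il1} => //= x l IH [h1 h2]; split; last exact: IH.
    move: m {IH}; apply: (ce_coord_rv0 bb (u := fun m => u m *m qm x)).
    rewrite -[RHS]h1 eu mulmx_suml; apply: eq_bigr => m _.
    by rewrite map_mxM scalemxAl.
  by rewrite eu big1 // => m _; rewrite u0 raddf0 scaler0.
elim: l hl {inj} => [_|x l IH /= [[sx hx] /IH [l1 [gl1 il1]]]]; first by exists [::].
have [lx [glx ilx]] := tsimple_descent sx.
pose f (y : qdata E (qr x)) := @QData E r (qr y) (map_mx phi (qm x) *m qm y) (qT y).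
exists (map f lx ++ l1); split.
  apply/Forall_cat; split=> //; apply/Forall_map; apply: Forall_imp glx => y [sy hy].
  split=> //; rewrite /qhom /= mulmxA -map_mxM hx map_mxM -mulmxA hy mulmxA map_mxM.
  by congr (_ *m _ *m _); apply/matrixP => i m; rewrite !mxE phi_sg.
move=> v /Forall_cat[/Forall_map h1 /il1 h2]; split=> //.
by apply: ilx; apply: Forall_imp h1 => y /=; rewrite mulmxA.
Qed.

End Descent.

(** * Abelian tau-sheaves *)

Section CokerSingle.
Variables (F E : fieldType) (iota : {rmorphism F -> E}).
Local Notation cl := (closed_point iota).
Variables (r r' : nat) (M : sheaf E r) (M' : sheaf E r') (f : 'M[E]_(r, r')) (S : set (set E)).
Hypothesis S_uniq : forall P Q, cl P -> cl Q -> S P -> S Q -> P = Q.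
Hypothesis S_supp : forall P, cl P -> ~ S P -> mximg f (M P) = M' P.
Hypothesis fsubM : forall P, cl P -> submodule (range iota) (mximg f (M P)).

(** Local dimensions vanish outside [S], and [S] holds at one closed point at most, so the sum
    defining the dimension has at most one nonzero term. *)
Lemma coker_dim_stalk d P : sheaf_coker_dim iota M M' f d -> cl P -> S P ->
  has_codim iota (mximg f (M P)) (M' P) d.
Proof.
move=> [n [Q [m [Qinj hQ hout ->]]]] cP SP.
have m0 j : Q j <> P -> m j = 0%N.
  move=> ne; have [cQ hm] := hQ j.
  have nS : ~ S (Q j) by move=> SQ; apply: ne; apply: S_uniq.
  apply: (has_codim_uniq (fsubM cQ) hm); apply: has_codim0.
  by rewrite (S_supp cQ nS).
have [[j0 ej]|ne] := pselect (exists j, Q j = P).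
  rewrite (bigD1 j0) //= big1 ?addn0; first by have [_] := hQ j0; rewrite ej.
  by move=> j jj; apply: m0 => e; case/negP: jj; apply/eqP/Qinj; rewrite e.
rewrite big1; last by move=> j _; apply: m0 => e; apply: ne; exists j.
by apply: has_codim0; rewrite hout // => j e; apply: ne; exists j.
Qed.

Lemma coker_dim_of_stalk d : (forall P, cl P -> S P -> has_codim iota (mximg f (M P)) (M' P) d) ->
  d = 0%N \/ (exists2 P, cl P & S P) -> sheaf_coker_dim iota M M' f d.
Proof.
move=> h ex; have [[P cP SP]|ne] := pselect (exists2 P, cl P & S P).
  exists 1%N, (fun _ => P), (fun _ => d); split.
  - by move=> i j _; rewrite !ord1.
  - by move=> _; split=> //; apply: h.
  - by move=> Q cQ ne; apply: S_supp => // SQ; apply: (ne ord0); apply: S_uniq.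
  - by rewrite big_ord1.
exists 0%N, (fun _ => setT), (fun _ => 0%N); split.
- by move=> [].
- by move=> [].
- by move=> Q cQ _; apply: S_supp => // SQ; apply: ne; exists Q.
- by rewrite big_ord0; case: ex.
Qed.

Lemma coker_dim_support d : sheaf_coker_dim iota M M' f d -> d = 0%N \/ exists2 P, cl P & S P.
Proof.
move=> [n [Q [m [Qinj hQ hout ->]]]].
have [ex|ne] := pselect (exists2 P, cl P & S P); first by right.
left; apply: big1 => j _; have [cQ hm] := hQ j.
apply: (has_codim_uniq (fsubM cQ) hm); apply: has_codim0.
by rewrite S_supp // => SQ; apply: ne; exists (Q j).
Qed.

End CokerSingle.

Section Transport.
Variables (F E : fieldType) (iota : {rmorphism F -> E}) (r : nat) (g : 'M[E]_r).
Hypothesis ug : g \in unitmx.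

Lemma mximgK (S : set 'rV[E]_r) : mximg (invmx g) (mximg g S) = S.
Proof. by rewrite mximg_comp mulmxV // mximg1. Qed.

Lemma mximg_sub (S T : set 'rV[E]_r) : mximg g S `<=` mximg g T <-> S `<=` T.
Proof.
split; last exact: mximg_mono.
by move=> /(mximg_mono (f := invmx g)); rewrite !mximgK.
Qed.

Lemma has_codim_mximg (S T : set 'rV[E]_r) d :
  has_codim iota (mximg g S) (mximg g T) d <-> has_codim iota S T d.
Proof.
split; last exact: has_codim_unitmx.
have ug' : invmx g \in unitmx by rewrite unitmx_inv.
by move=> /(has_codim_unitmx ug'); rewrite !mximgK.
Qed.

End Transport.

Section LatticePower.
Variables (F E : fieldType) (iota : {rmorphism F -> E}).
Hypothesis ffE : is_function_field iota.

Lemma rank_one_mx P u m n (A : 'M[E]_(m, n)) : closed_point iota P -> max_ideal P u ->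
  exists N, mxover P (u ^+ N *: A).
Proof.
move=> cP mu; have vP := closed_valring cP; have sP := vr_sub vP.
pose h (p : 'I_m * 'I_n) := rank_one ffE (A p.1 p.2) cP mu.
have /choice[N hN] := h.
exists (\max_p N p)%N => i j; rewrite mxE; apply: mi_sub.
by apply: (hN (i, j)); apply: (@leq_bigmax _ N (i, j)).
Qed.

(** A power of a uniformizer clears the denominators of the change of basis, and each element of the
    maximal ideal is a multiple of the uniformizer. *)
Lemma lattice_power P r (B1 B2 : 'M[E]_r) : closed_point iota P -> B1 \in unitmx ->
  exists D, power_kills (max_ideal P) D (rspan P B1) (rspan P B2).
Proof.
move=> cP u1; have vP := closed_valring cP; have sP := vr_sub vP.
have [t [mt t0 ht]] := uniformizer_exists ffE cP.
have [D hD] := rank_one_mx (B2 *m invmx B1) cP mt.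
exists D => x v mx [a ha ->].
have -> : \prod_i x i = (\prod_i (x i / t)) * t ^+ D.
  by rewrite big_split /= prodr_const card_ord -mulrA -exprMn mulVf // expr1n mulr1.
apply/free_onP => //.
have -> : (\prod_i (x i / t) * t ^+ D) *: (a *m B2) *m invmx B1 =
   (\prod_i (x i / t)) *: (a *m (t ^+ D *: (B2 *m invmx B1))).
  by rewrite -scalemxAl -mulmxA -scalemxAr scalerA.
move=> i j; rewrite mxE; apply: srM => //; last exact: mxoverM.
by apply: sr_prod => // l _; apply: ht.
Qed.

End LatticePower.

Section TauSheaves.
Variables (k : finFieldType) (C : curve k) (L : finFieldType) (X : base_curve C L).
Variables (eps : set C) (c : C -> L).
Implicit Types (P : set X) (i : int).

Local Notation cl := (closed_point (jL X)).
Local Notation s := (sigma X).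
Let clv P : cl P -> valring P := @closed_valring _ _ (jL X) P.
Let clc P : cl P -> curve_point (jL X) P := @closed_curve _ _ (jL X) P.
#[local] Hint Resolve clv clc : core.
Let ff := base_function_field X.

(** Normal form of an abelian tau-sheaf: inclusions inside one generic stalk, and one matrix for all
    [tau]. The dimension conditions become local, at the point over infinity and at the graph point;
    [ch_ex] supplies the existence of these points, so that the total dimension can be recovered. *)
Record chain (m l r d : nat) (Lam : int -> sheaf X r) (T : 'M[X]_r) : Prop := Chain {
  ch_m : (0 < m)%N;
  ch_l : (0 < l)%N;
  ch_ld : (l * d = m * r)%N;
  ch_T : T \in unitmx;
  ch_lf : forall i, locally_free (jL X) (Lam i);
  ch_inc : forall i P, cl P -> Lam i P `<=` Lam (i + 1) P;
  ch_tau : forall i P, cl P -> mximg T (pullback s (Lam i) P) `<=` Lam (i + 1) P;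
  ch_tw : forall i P, cl P -> Lam i P = twist (div_oo (- m%:Z)) (Lam (i + l%:Z)) P;
  ch_coPi : forall i P, cl P -> over_oo P -> has_codim (jL X) (Lam i P) (Lam (i + 1) P) d;
  ch_coT0 : forall i P, cl P -> ~ graph_pt eps c P ->
    mximg T (pullback s (Lam i) P) = Lam (i + 1) P;
  ch_coT : forall i P, graph_pt eps c P ->
    has_codim (jL X) (mximg T (pullback s (Lam i) P)) (Lam (i + 1) P) d;
  ch_ex : d = 0%N \/ (exists2 P, cl P & over_oo P) /\ (exists P, graph_pt eps c P) }.

Lemma sigma_preim_closed P : cl P -> cl (s @^-1` P).
Proof. by have [n [b bb]] := ce_basis_ex (ce_base X); apply: (s_preim_closed bb). Qed.

Lemma over_oo_uniq P (Q : set X) : cl P -> cl Q -> over_oo P -> over_oo Q -> P = Q.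
Proof.
move=> cP cQ oP oQ; have [n [b bb]] := ce_basis_ex (ce_base X).
apply: (rational_uniq bb); auto; first exact: over_oo_rational.
by rewrite /= oP oQ.
Qed.

Lemma closed_ex : exists P, cl P.
Proof.
have [n [b bb]] := ce_basis_ex (ce_base X).
have [P [cP _]] := lying_over bb (oo_rational C).1.
by exists P.
Qed.

Lemma stalk r (M : sheaf X r) P : locally_free (jL X) M -> cl P ->
  exists2 B, B \in unitmx & M P = rspan P B.
Proof. exact: locally_free_stalk. Qed.

Lemma stalk_submod r (M : sheaf X r) P : locally_free (jL X) M -> cl P -> submodule P (M P).
Proof. by move=> lf cP; have [B _ ->] := stalk lf cP; apply: rspan_submod; auto. Qed.

Lemma pullback_stalk r (M : sheaf X r) P (B : 'M[X]_r) : cl P -> M (s @^-1` P) = rspan (s @^-1` P) B ->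
  pullback s M P = rspan P (map_mx s B).
Proof.
move=> cP e; have cQ := sigma_preim_closed cP.
by apply: pullback_rspan; auto.
Qed.

Lemma pullback_stalk_ex r (M : sheaf X r) P : locally_free (jL X) M -> cl P ->
  exists2 B, B \in unitmx & pullback s M P = rspan P B.
Proof.
move=> lf cP; have [B uB e] := stalk lf (sigma_preim_closed cP).
by exists (map_mx s B); [rewrite map_unitmx | apply: pullback_stalk].
Qed.

Lemma pullback_submod r (M : sheaf X r) P : locally_free (jL X) M -> cl P ->
  submodule P (pullback s M P).
Proof. by move=> lf cP; have [B _ ->] := pullback_stalk_ex lf cP; apply: rspan_submod; auto. Qed.

Lemma const_submod r P (M : set 'rV[X]_r) : cl P -> submodule P M -> submodule (range (jL X)) M.
Proof. by move=> cP; apply: submod_const => a; apply: curve_const; auto. Qed.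

Lemma sheaf_inj_row_free r r' (M : sheaf X r) (f : 'M[X]_(r, r')) :
  (forall P, cl P -> exists2 B, B \in unitmx & M P = rspan P B) ->
  sheaf_inj (jL X) M f -> row_free f.
Proof.
move=> hM h; have [P cP] := closed_ex; have [B uB e] := hM P cP.
by apply: (mxinj_on_row_free (clv cP) uB); rewrite -e; apply: h.
Qed.

Lemma int_const (A : Type) (f : int -> A) : (forall i, f i = f (i + 1)) -> forall i, f i = f 0.
Proof.
move=> h; elim=> // n IH; first by rewrite -[n.+1]addn1 PoszD -h.
by rewrite -IH [LHS]h; congr f; rewrite -[n.+1]addn1 PoszD opprD subrK.
Qed.

Lemma sub_chain r (Lam : int -> sheaf X r) P :
  (forall i, Lam i P `<=` Lam (i + 1) P) -> forall i (n : nat), Lam i P `<=` Lam (i + n%:Z) P.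
Proof.
move=> h i; elim=> [|n IH]; first by rewrite addr0.
by apply: (subset_trans IH); rewrite -[n.+1]addn1 PoszD addrA.
Qed.

(** Away from infinity the twist is trivial, so [l] inclusions lead back to the same stalk and all
    of them are equalities. *)
Lemma chain_const_aux r (Lam : int -> sheaf X r) m (l : nat) P : (0 < l)%N -> cl P -> ~ over_oo P ->
  (forall i, submodule P (Lam i P)) ->
  (forall i, Lam i P `<=` Lam (i + 1) P) ->
  (forall i, Lam i P = twist (div_oo m) (Lam (i + l%:Z)) P) ->
  forall i, Lam i P = Lam (i + 1) P.
Proof.
move=> l0 cP nP sub inc tw i; apply/seteqP; split; first exact: inc.
rewrite [X in _ `<=` X]tw twist0 //; last by rewrite /div_oo; case: asboolP.
have -> : i + l%:Z = i + 1 + (l.-1)%:Z by rewrite -addrA -PoszD add1n prednK.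
exact: sub_chain.
Qed.

Lemma graph_pt_uniq P (Q : set X) : graph_pt eps c P -> graph_pt eps c Q -> P = Q.
Proof.
have [n [b bb]] := ce_basis_ex (ce_base X).
by move=> gP gQ; exact: (graph_uniq bb gQ gP).
Qed.

Lemma graph_pt_rational P : graph_pt eps c P -> rational_point (jL X) P.
Proof. by have [n [b bb]] := ce_basis_ex (ce_base X); apply: (graph_rational bb). Qed.

(** [Q i] carries the generic stalk of F_i into a common space in which every [Pi] is the identity
    and every [tau] is [T]. *)
Definition frames (F : tsheaf X) (Q : int -> 'M[X]_(ts_rk F)) (T : 'M[X]_(ts_rk F)) :=
  forall i, [/\ Q i \in unitmx, Q i = ts_Pi F i *m Q (i + 1) &
    ts_tau F i *m Q (i + 1) = map_mx s (Q i) *m T].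

Definition framed (F : tsheaf X) (Q : int -> 'M[X]_(ts_rk F)) : int -> sheaf X (ts_rk F) :=
  fun i P => mximg (Q i) (ts_F F i P).

(** [Q i] is a product of inverses of the [Pi] for positive [i] and of the [Pi] themselves for
    negative [i]. The transported [tau] does not depend on [i] because [tau] commutes with [Pi]. *)
Lemma frames_ex (F : tsheaf X) : (forall i, ts_Pi F i \in unitmx) ->
  (forall i, ts_tau F i *m ts_Pi F (i + 1) = map_mx s (ts_Pi F i) *m ts_tau F (i + 1)) ->
  exists Q, frames Q (ts_tau F 0 *m invmx (ts_Pi F 0)) /\ Q 0 = 1%:M.
Proof.
move=> uP comm.
pose Qp := fix Qp n := if n is n'.+1 then invmx (ts_Pi F n'%:Z) *m Qp n' else 1%:M : 'M[X]_(ts_rk F).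
pose Qn := fix Qn n := if n is n'.+1 then ts_Pi F (Negz n') *m Qn n' else 1%:M : 'M[X]_(ts_rk F).
pose Q (i : int) := match i with Posz n => Qp n | Negz n => Qn n.+1 end.
have uQp n : Qp n \in unitmx by elim: n => [|n IH] /=; rewrite ?unitmx1 // unitmx_mul unitmx_inv uP.
have uQn n : Qn n \in unitmx by elim: n => [|n IH] /=; rewrite ?unitmx1 // unitmx_mul uP.
have uQ i : Q i \in unitmx by case: i => n; [apply: uQp | apply: (uQn n.+1)].
have eQ i : Q i = ts_Pi F i *m Q (i + 1).
  case: i => n; first by rewrite -PoszD addn1 /= mulKVmx ?uP.
  have -> : Negz n + 1 = - n%:Z by rewrite NegzE -[n.+1]addn1 PoszD opprD subrK.
  by case: n => [|n] //=; rewrite oppr0.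
exists Q; split=> // i; split=> //.
pose T i := invmx (map_mx s (Q i)) *m ts_tau F i *m Q (i + 1).
have usQ i' : map_mx s (Q i') \in unitmx by rewrite map_unitmx.
have eT i' : T i' = T (i' + 1).
  have e : map_mx s (Q i') *m T (i' + 1) = ts_tau F i' *m Q (i' + 1).
    rewrite [in LHS](eQ i') map_mxM -mulmxA /T -(mulmxA (invmx _)) mulKVmx //.
    by rewrite mulmxA -comm -mulmxA -eQ.
  by rewrite -[RHS](mulKmx (usQ i')) e mulmxA.
have -> : ts_tau F 0 *m invmx (ts_Pi F 0) = T 0.
  rewrite /T /= map_mx1 invmx1 mul1mx; congr (_ *m _).
  by rewrite /= mulmx1.
by rewrite -(int_const eT i) /T -mulmxA mulKVmx.
Qed.

Lemma frames_Pi_comp (F : tsheaf X) Q T i l : @frames F Q T -> Pi_comp F i l *m Q (i + l%:Z) = Q i.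
Proof.
move=> fr; elim: l => [|l IH] /=; first by rewrite mul1mx addr0.
rewrite -[RHS]IH -mulmxA; congr (_ *m _); rewrite -[l.+1]addn1 PoszD addrA.
by have [_ <- _] := fr (i + l%:Z).
Qed.

(** Injectivity on stalks makes [Pi] and [tau] invertible over the function field, so frames exist.
    Each cokernel lives at a single point: that of [Pi] over infinity by periodicity, that of [tau]
    at the graph point because [graph_ideal] contains 1 elsewhere. Total dimensions are thus local
    ones. *)
Lemma abelian_chain (F : tsheaf X) : abelian_tsheaf eps c F -> exists m l Q,
  [/\ frames Q (ts_tau F 0 *m invmx (ts_Pi F 0)), Q 0 = 1%:M &
    chain m l (ts_dim F) (framed Q) (ts_tau F 0 *m invmx (ts_Pi F 0))].
Proof.
move=> [lf hF [m [l [m0 l0 ld tw]]] dPi dtau].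
have uPi i : ts_Pi F i \in unitmx.
  have [_ h _ _ _] := hF i; rewrite -row_free_unit.
  by apply: sheaf_inj_row_free h => P cP; apply: stalk.
have utau i : ts_tau F i \in unitmx.
  have [_ _ _ h _] := hF i; rewrite -row_free_unit.
  by apply: sheaf_inj_row_free h => P cP; apply: pullback_stalk_ex.
have comm i : ts_tau F i *m ts_Pi F (i + 1) = map_mx s (ts_Pi F i) *m ts_tau F (i + 1).
  by have [_ _ _ _ ->] := hF i.
have [Q [fr Q0]] := frames_ex uPi comm; set T := _ *m _ in fr *.
have uQ i : Q i \in unitmx by case: (fr i).
have pb i P : mximg T (pullback s (framed Q i) P) = mximg (Q (i + 1)) (mximg (ts_tau F i) (pullback s (ts_F F i) P)).
  by rewrite /framed pullback_img !mximg_comp; have [_ _ <-] := fr i.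
have eF i P : framed Q i P = mximg (Q (i + 1)) (mximg (ts_Pi F i) (ts_F F i P)).
  by rewrite /framed mximg_comp; have [_ <- _] := fr i.
have lf' i : locally_free (jL X) (framed Q i).
  by apply: locally_free_img => //; rewrite row_full_unit.
have inc i P : cl P -> framed Q i P `<=` framed Q (i + 1) P.
  by move=> cP; rewrite eF; apply: mximg_mono; have [h _ _ _ _] := hF i; apply: h.
have tw' i P : cl P -> framed Q i P = twist (div_oo (- m%:Z)) (framed Q (i + l%:Z)) P.
  move=> cP; rewrite twist_img //; last exact: stalk_submod.
  rewrite -(tw i P cP) mximg_comp (frames_Pi_comp i l fr).
  by [].
have const P i : cl P -> ~ over_oo P -> framed Q i P = framed Q (i + 1) P.
  move=> cP nP; apply: (chain_const_aux (m := - m%:Z) l0 cP nP) => i'; first exact: stalk_submod.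
    exact: inc.
  exact: tw'.
have fsPi i P : cl P -> submodule (range (jL X)) (mximg (ts_Pi F i) (ts_F F i P)).
  by move=> cP; apply: (const_submod cP); apply: mximg_submod; apply: stalk_submod.
have fst i P : cl P -> submodule (range (jL X)) (mximg (ts_tau F i) (pullback s (ts_F F i) P)).
  by move=> cP; apply: (const_submod cP); apply: mximg_submod; apply: pullback_submod.
have suppPi i P : cl P -> ~ over_oo P -> mximg (ts_Pi F i) (ts_F F i P) = ts_F F (i + 1) P.
  move=> cP nP; apply: (mximg_unit_inj (uQ (i + 1))); rewrite -eF.
  exact: const.
have suppt i P : cl P -> ~ graph_pt eps c P ->
    mximg (ts_tau F i) (pullback s (ts_F F i) P) = ts_F F (i + 1) P.
  move=> cP nP; apply/seteqP; split; first by have [_ _ h _ _] := hF i; apply: h.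
  move=> v hv; have [//|g1] := graph_pt_or eps c cP.
  have [_ kills] := dtau i; have := kills P cP (fun _ => 1) v (fun _ => g1) hv.
  by rewrite prodr_const expr1n scale1r.
have uniqo P P' : cl P -> cl P' -> over_oo P -> over_oo P' -> P = P'.
  exact: over_oo_uniq.
have uniqg P P' : cl P -> cl P' -> graph_pt eps c P -> graph_pt eps c P' -> P = P'.
  by move=> _ _; apply: graph_pt_uniq.
exists m, l, Q; split=> //; split=> //.
- by rewrite unitmx_mul utau unitmx_inv uPi.
- by move=> i P cP; rewrite pb; apply: mximg_mono; have [_ _ h _ _] := hF i; apply: h.
- move=> i P cP oP; rewrite eF; apply/(has_codim_mximg _ (uQ (i + 1))).
  exact: (coker_dim_stalk uniqo (suppPi i) (fsPi i) (dPi i) cP oP).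
- by move=> i P cP nP; rewrite pb suppt.
- move=> i P gP; rewrite pb; apply/(has_codim_mximg _ (uQ (i + 1))); have [cP _ _] := gP.
  exact: (coker_dim_stalk uniqg (suppt i) (fst i) (dtau i).1 cP gP).
- have [->|[P cP oP]] := coker_dim_support (suppPi 0) (fsPi 0) (dPi 0); first by left.
  have [->|[P' cP' gP']] := coker_dim_support (suppt 0) (fst 0) (dtau 0).1; first by left.
  by right; split; [exists P | exists P'].
Qed.

Lemma graph_ideal_submod P : cl P -> submodule (V := X^o) P (graph_ideal eps c P).
Proof.
move=> cP; have sP : subring P by auto.
have [s0 sD sM] := lspan_submod (V := X^o) (@graph_gens _ _ _ X eps c) sP.
split.
- by split; [apply: sr0 | move=> _; apply: s0].
- by move=> u v [Pu hu] [Pv hv]; split; [apply: srD | move=> e; exact: (sD _ _ (hu e) (hv e))].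
- by move=> a v Pa [Pv hv]; split; [apply: srM | move=> e; exact: (sM _ _ Pa (hv e))].
Qed.

(** Annihilation of coker tau by the d-th power of the graph ideal is recovered from the local
    dimension: some power of the maximal ideal annihilates it, and [power_kills_codim] lowers the
    exponent to [d]. *)
Lemma chain_abelian (F : tsheaf X) Q T m l : frames Q T ->
  chain m l (ts_dim F) (@framed F Q) T -> abelian_tsheaf eps c F.
Proof.
move=> fr ch; have uQ i : Q i \in unitmx by case: (fr i).
have pb i P : mximg T (pullback s (framed Q i) P) = mximg (Q (i + 1)) (mximg (ts_tau F i) (pullback s (ts_F F i) P)).
  by rewrite /framed pullback_img !mximg_comp; have [_ _ <-] := fr i.
have eF i P : framed Q i P = mximg (Q (i + 1)) (mximg (ts_Pi F i) (ts_F F i P)).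
  by rewrite /framed mximg_comp; have [_ <- _] := fr i.
have eF' i P : ts_F F i P = mximg (invmx (Q i)) (framed Q i P) by rewrite mximgK.
have uQ' i : invmx (Q i) \in unitmx by rewrite unitmx_inv.
have lf i : locally_free (jL X) (ts_F F i).
  have -> : ts_F F i = fun P => mximg (invmx (Q i)) (framed Q i P).
    by apply/funext => P; apply: eF'.
  by apply: locally_free_img => //; [apply: (ch_lf ch) | rewrite row_full_unit].
have uPi i : ts_Pi F i \in unitmx.
  have := uQ i; have [_ -> _] := fr i; rewrite unitmx_mul => /andP[]; exact.
have utau i : ts_tau F i \in unitmx.
  have : map_mx s (Q i) *m T \in unitmx by rewrite unitmx_mul map_unitmx uQ (ch_T ch).
  by have [_ _ <-] := fr i; rewrite unitmx_mul => /andP[].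
have const P i : cl P -> ~ over_oo P -> framed Q i P = framed Q (i + 1) P.
  move=> cP nP; apply: (chain_const_aux (m := - m%:Z) (ch_l ch) cP nP) => i'.
  - exact: stalk_submod (ch_lf ch _) cP.
  - exact: ch_inc ch _ _ cP.
  - exact: ch_tw ch _ _ cP.
have fsPi i P : cl P -> submodule (range (jL X)) (mximg (ts_Pi F i) (ts_F F i P)).
  by move=> cP; apply: (const_submod cP); apply: mximg_submod; apply: stalk_submod.
have fst i P : cl P -> submodule (range (jL X)) (mximg (ts_tau F i) (pullback s (ts_F F i) P)).
  by move=> cP; apply: (const_submod cP); apply: mximg_submod; apply: pullback_submod.
have suppPi i P : cl P -> ~ over_oo P -> mximg (ts_Pi F i) (ts_F F i P) = ts_F F (i + 1) P.
  by move=> cP nP; apply: (mximg_unit_inj (uQ (i + 1))); rewrite -eF; apply: const.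
have suppt i P : cl P -> ~ graph_pt eps c P ->
    mximg (ts_tau F i) (pullback s (ts_F F i) P) = ts_F F (i + 1) P.
  by move=> cP nP; apply: (mximg_unit_inj (uQ (i + 1))); rewrite -pb; apply: (ch_coT0 ch).
have uniqo P P' : cl P -> cl P' -> over_oo P -> over_oo P' -> P = P'.
  exact: over_oo_uniq.
have uniqg P P' : cl P -> cl P' -> graph_pt eps c P -> graph_pt eps c P' -> P = P'.
  by move=> _ _; apply: graph_pt_uniq.
have cod i P : graph_pt eps c P ->
    has_codim (jL X) (mximg (ts_tau F i) (pullback s (ts_F F i) P)) (ts_F F (i + 1) P) (ts_dim F).
  by move=> gP; apply/(has_codim_mximg _ (uQ (i + 1))); rewrite -pb; apply: (ch_coT ch).
split=> //.
- move=> i; split.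
  + move=> P cP; apply/(mximg_sub (uQ (i + 1))); rewrite -eF; exact: (ch_inc ch).
  + by move=> P cP; apply: row_free_mxinj; rewrite row_free_unit.
  + move=> P cP; apply/(mximg_sub (uQ (i + 1))); rewrite -pb; exact: (ch_tau ch).
  + by move=> P cP; apply: row_free_mxinj; rewrite row_free_unit.
  + apply: (can_inj (mulmxK (uQ (i + 1 + 1)))).
    have [_ e1 e2] := fr i; have [_ e3 e4] := fr (i + 1).
    by rewrite -!mulmxA -e3 e2 e4 e1 map_mxM mulmxA.
- exists m, l; split; [exact: ch_m ch|exact: ch_l ch|exact: ch_ld ch|] => i P cP.
  apply: (mximg_unit_inj (uQ (i + l%:Z))).
  rewrite mximg_comp (frames_Pi_comp i l fr) -[LHS]/(framed Q i P) (ch_tw ch _ cP).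
  by rewrite twist_img //; apply: stalk_submod.
- move=> i; apply: (coker_dim_of_stalk uniqo (suppPi i)).
    move=> P cP oP; apply/(has_codim_mximg _ (uQ (i + 1))); rewrite -eF.
    exact: (ch_coPi ch).
  by case: (ch_ex ch) => [->|[? _]]; [left|right].
- move=> i; split.
    apply: (coker_dim_of_stalk uniqg (suppt i)); first by move=> P _; apply: cod.
    by case: (ch_ex ch) => [->|[_ [P gP]]]; [left|right; exists P => //; case: gP].
  move=> P cP; have sP : subring P by auto.
  have [gP|nP] := pselect (graph_pt eps c P); last first.
    move=> x v gx hv; rewrite suppt //; have [_ _ h] := stalk_submod (lf (i + 1)) cP.
    by apply: h => //; apply: sr_prod => // j _; case: (gx j).
  have [B1 u1 e1] := pullback_stalk_ex (lf i) cP; have [B2 u2 e2] := stalk (lf (i + 1)) cP.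
  have e3 : mximg (ts_tau F i) (pullback s (ts_F F i) P) = rspan P (B1 *m ts_tau F i).
    by rewrite e1 mximg_rspan.
  have uB : B1 *m ts_tau F i \in unitmx by rewrite unitmx_mul u1 utau.
  have [D kD] := lattice_power ff B2 cP uB.
  apply: (@power_kills_codim _ _ (jL X) _ P _ _ _ D) => //.
  + by move=> a; apply: curve_const; auto.
  + by move=> x [].
  + exact: graph_ideal_submod.
  + by rewrite e3; apply: rspan_submod.
  + exact: stalk_submod.
  + rewrite e3 e2 => x v gx; apply: kD => j; exact: graph_pt_mi gP _ (gx j).
  + exact: cod.
Qed.

Definition mkts r d (Lam : int -> sheaf X r) (T : 'M[X]_r) : tsheaf X :=
  TSheaf d Lam (fun _ => 1%:M) (fun _ => T).

Lemma mkts_frames r d (Lam : int -> sheaf X r) T : frames (F := mkts d Lam T) (fun _ => 1%:M) T.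
Proof. by move=> i; rewrite unitmx1 !mulmx1 map_mx1 mul1mx. Qed.

Lemma chain_mkts m l r d (Lam : int -> sheaf X r) T : chain m l d Lam T ->
  abelian_tsheaf eps c (mkts d Lam T).
Proof.
move=> ch; apply: (chain_abelian (@mkts_frames r d Lam T)).
suff -> : @framed (mkts d Lam T) (fun _ => 1%:M) = Lam by exact: ch.
by apply/funext => i; apply/funext => P; apply: mximg1.
Qed.

End TauSheaves.

Lemma flat_has_codim (F E : fieldType) (iota : {rmorphism F -> E}) r (N M : set 'rV[E]_r) :
  r = 0%N -> N 0 -> has_codim iota N M 0.
Proof.
move=> r0 N0; apply: has_codim0 => v _; rewrite (_ : v = 0) //.
by apply/rowP => i; have := ltn_ord i; rewrite [X in (_ < X)%N]r0.
Qed.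

Lemma row_full_mulr (E : fieldType) m n p (A : 'M[E]_(m, n)) (B : 'M[E]_(n, p)) :
  row_full (A *m B) -> row_full B.
Proof. by rewrite -!sub1mx => h; apply: submx_trans h (submxMl _ _). Qed.

Lemma intmulrn (x : int) (n : nat) : x *+ n = x * n%:Z.
Proof. by rewrite -mulr_natr natz. Qed.

(** * Images of tau-sheaves under generic quotients *)

Section Quotient.
Variables (k : finFieldType) (C : curve k) (L : finFieldType) (X : base_curve C L).
Variables (eps : set C) (c : C -> L).
Hypothesis eps_oo : eps <> oo.
Implicit Types (P : set X) (i : int).

Local Notation cl := (closed_point (jL X)).
Local Notation s := (sigma X).
Local Notation gpt := (graph_pt eps c).
Let clc P : cl P -> curve_point (jL X) P := @closed_curve _ _ (jL X) P.
#[local] Hint Resolve clc : core.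
Let ff := base_function_field X.

(** The clauses of [chain] that pass to images directly. The dimensions at the two points, whose
    agreement is the difficulty, are set aside. *)
Record prechain (m l r : nat) (Lam : int -> sheaf X r) (T : 'M[X]_r) : Prop := PreChain {
  pc_m : (0 < m)%N;
  pc_l : (0 < l)%N;
  pc_T : T \in unitmx;
  pc_lf : forall i, locally_free (jL X) (Lam i);
  pc_inc : forall i P, cl P -> Lam i P `<=` Lam (i + 1) P;
  pc_tau : forall i P, cl P -> mximg T (pullback s (Lam i) P) `<=` Lam (i + 1) P;
  pc_tw : forall i P, cl P -> Lam i P = twist (div_oo (- m%:Z)) (Lam (i + l%:Z)) P;
  pc_coT0 : forall i P, cl P -> ~ gpt P ->
    mximg T (pullback s (Lam i) P) = Lam (i + 1) P }.

Lemma chain_prechain m l r d (Lam : int -> sheaf X r) T : chain eps c m l d Lam T ->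
  prechain m l Lam T.
Proof. by case=> *; split. Qed.

Lemma graph_pt_not_oo P : gpt P -> ~ over_oo P.
Proof. by move=> [_ e _]; rewrite /over_oo e. Qed.

Lemma over_oo_closed_rational P : cl P -> over_oo P -> rational_point (jL X) P.
Proof.
move=> cP oP; have [n [b bb]] := ce_basis_ex (ce_base X).
by apply: (rational_over bb (clc cP)); apply: over_oo_rational.
Qed.

Lemma preim_over_oo P : over_oo (s @^-1` P) = over_oo P.
Proof.
rewrite /over_oo; congr (_ = _); apply/funext => x.
by rewrite /= sigma_Q.
Qed.

Lemma preim_oo P : cl P -> over_oo P -> s @^-1` P = P.
Proof.
move=> cP oP; apply: over_oo_uniq => //; first exact: sigma_preim_closed.
by rewrite preim_over_oo.
Qed.

Lemma vl_sigma P x : cl P -> x != 0 -> vl P (s x) = vl (s @^-1` P) x.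
Proof. by have [n [b bb]] := ce_basis_ex (ce_base X); apply: (vl_s bb). Qed.

Lemma unit_det r (A : 'M[X]_r) : A \in unitmx -> \det A != 0.
Proof. by rewrite unitmxE unitfE. Qed.

Section PreChain.
Variables (m l r : nat) (Lam : int -> sheaf X r) (T : 'M[X]_r).
Hypothesis pc : prechain m l Lam T.

Lemma prechain_const P i : cl P -> ~ over_oo P -> Lam i P = Lam 0 P.
Proof.
move=> cP nP; apply: (@int_const _ (fun i => Lam i P)) => {}i.
apply: (chain_const_aux (m := - m%:Z) (pc_l pc) cP nP) => i'.
- exact: stalk_submod (pc_lf pc _) cP.
- exact: pc_inc pc _ _ cP.
- exact: pc_tw pc _ _ cP.
Qed.

(** Infinity is not on the graph, so [tau] is an isomorphism there and each step of the chain
    changes the valuation of the determinant of a basis by that of [\det T]. Periodicity compares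
    [l] such steps with the twist, which contributes [m * r]. *)
Lemma prechain_oo P : cl P -> over_oo P -> exists d,
  [/\ forall i, has_codim (jL X) (Lam i P) (Lam (i + 1) P) d,
      d%:Z = - vl P (\det T) & (l * d = m * r)%N].
Proof.
move=> cP oP; have rP := over_oo_closed_rational cP oP.
have nP : ~ gpt P by move=> /graph_pt_not_oo.
have /choice[B hB] : forall i, exists B, B \in unitmx /\ Lam i P = rspan P B.
  by move=> i; have [B uB e] := stalk (pc_lf pc i) cP; exists B.
have uB i : B i \in unitmx by case: (hB i).
have eB i : Lam i P = rspan P (B i) by case: (hB i).
pose w i := vl P (\det (B i)).
have w1 i : w (i + 1) = w i + vl P (\det T).
  have := pc_coT0 pc i cP nP.
  rewrite (pullback_stalk (B := B i)) ?preim_oo // mximg_rspan eB => e.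
  rewrite /w -(rspan_eq_val ff cP _ _ e) ?unitmx_mul ?map_unitmx ?uB ?(pc_T pc) //.
  rewrite det_mulmx det_map_mx (vlM ff) ?fmorph_eq0 ?unit_det ?(pc_T pc) //.
  by rewrite vl_sigma ?preim_oo // unit_det.
have wn i n : w (i + n%:Z) = w i + vl P (\det T) *+ n.
  elim: n => [|n IH]; first by rewrite !addr0.
  by rewrite -[n.+1]addn1 PoszD addrA w1 IH mulrnDr mulr1n addrA.
have hd i : exists2 d, has_codim (jL X) (Lam i P) (Lam (i + 1) P) d & d%:Z = - vl P (\det T).
  have [d hd ed] : exists2 d, has_codim (jL X) (rspan P (B i)) (rspan P (B (i + 1))) d &
      d%:Z = vl P (\det (B i)) - vl P (\det (B (i + 1))).
    by apply: lattice_index => //; rewrite -!eB; apply: (pc_inc pc).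
  exists d; first by rewrite !eB.
  by rewrite ed -/(w i) -/(w (i + 1)) w1 opprD addrA subrr sub0r.
have [d hd0 ed] := hd 0; exists d; split=> //.
  by move=> i; have [d' hd' ed'] := hd i; have -> // : d = d' by apply/eqP; rewrite -eqz_nat ed ed' eqxx.
have [t ut] := twist_unif cP; have [_ t0 _] := ut.
have := pc_tw pc 0 cP; rewrite (twist_rspan _ cP ut (eB _)) eB => e.
have jt0 : jQ X t != 0 by rewrite fmorph_eq0.
have em : jQ X t ^ (- div_oo (- m%:Z) (jQ X @^-1` P)) = jQ X t ^+ m.
  by rewrite /div_oo; case: asboolP => // _; rewrite opprK.
have [n [b bb]] := ce_basis_ex (ce_base X).
have vt : vl P (jQ X t) = 1.
  apply: (vl_uniformizer cP); apply: (rational_uniformizer bb (clc cP)) => //.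
  exact: over_oo_rational.
have := rspan_eq_val ff cP (uB 0) _ e.
rewrite em unitmxZ ?unitfE ?expf_neq0 // => /(_ (uB _)).
rewrite detZ (vlM ff) ?unit_det ?expf_neq0 // -exprM (vlX ff) // vt -/(w 0) -/(w _) wn.
rewrite natz => h; apply/eqP; rewrite -eqz_nat PoszM ed; apply/eqP.
have -> : (m * r)%N%:Z = w 0 - (w 0 + vl P (\det T) *+ l) by rewrite {1}h addrK.
by rewrite -mulr_natl natz; ring.
Qed.

Lemma pullback_const P i : cl P -> ~ over_oo P -> pullback s (Lam i) P = pullback s (Lam 0) P.
Proof.
move=> cP nP; rewrite /pullback (prechain_const i (P := s @^-1` P)) //.
  exact: sigma_preim_closed.
by rewrite preim_over_oo.
Qed.

Lemma prechain_graph P : gpt P -> exists d, forall i,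
  has_codim (jL X) (mximg T (pullback s (Lam i) P)) (Lam (i + 1) P) d.
Proof.
move=> gP; have [cP _ _] := gP; have nP := graph_pt_not_oo gP.
have [B1 u1 e1] := pullback_stalk_ex (pc_lf pc 0) cP.
have [B2 u2 e2] := stalk (pc_lf pc 0) cP.
have sub : rspan P (B1 *m T) `<=` rspan P B2.
  rewrite -mximg_rspan -e1 -e2 -(prechain_const (0 + 1) cP nP); exact: (pc_tau pc).
have [|d hd _] := lattice_index ff (graph_pt_rational gP) _ u2 sub.
  by rewrite unitmx_mul u1 (pc_T pc).
exists d => i; rewrite pullback_const // prechain_const //.
by rewrite e1 e2 mximg_rspan.
Qed.

Variables (n : nat) (b : 'I_n -> L).
Hypothesis bb : ce_basis (ce_base X) b.

(** The norm down to the function field of C, [n] being the order of [sigma]. It removes the factors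
    sigma(u) / u by which [\det T] varies with the choice of basis. *)
Definition cnorm (x : X) := \prod_(t < n) iter t s x.

Lemma iter_neq0 t (x : X) : x != 0 -> iter t s x != 0.
Proof. by move=> x0; elim: t => //= t IH; rewrite fmorph_eq0. Qed.

Lemma cnorm_neq0 x : x != 0 -> cnorm x != 0.
Proof. by move=> x0; apply/prodf_neq0 => t _; apply: iter_neq0. Qed.

Lemma vl_iter P t x : cl P -> x != 0 -> vl P (iter t s x) = vl (spre (ce_base X) t P) x.
Proof.
move=> cP; elim: t x => [|t IH] x x0; first by [].
rewrite iterSr IH ?fmorph_eq0 // spreS vl_sigma //.
exact: (spre_closed bb).
Qed.

Lemma vl_cnorm P x : cl P -> x != 0 ->
  vl P (cnorm x) = \sum_(t < n) vl (spre (ce_base X) t P) x.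
Proof.
move=> cP x0.
have [_ ->] : cnorm x != 0 /\ vl P (cnorm x) = \sum_(t < n) vl P (iter t s x).
  rewrite /cnorm; elim/big_ind2: _ => //; first by rewrite oner_eq0 (vl1 ff).
    by move=> y a z b' [y0 <-] [z0 <-]; rewrite mulf_neq0 // (vlM ff).
  by move=> t _; rewrite iter_neq0.
by apply: eq_bigr => t _; apply: vl_iter.
Qed.

Lemma over_oo_spre t P : over_oo (spre (ce_base X) t P) = over_oo P.
Proof. by elim: t => [//|t IH]; rewrite spreS preim_over_oo. Qed.

Lemma cnorm_oo P : cl P -> over_oo P -> vl P (cnorm (\det T)) = vl P (\det T) *+ n.
Proof.
move=> cP oP; rewrite vl_cnorm ?unit_det ?(pc_T pc) //.
rewrite (eq_bigr (fun _ => vl P (\det T))) ?sumr_const ?card_ord // => t _.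
congr (vl _ _); apply: over_oo_uniq => //; first exact: (spre_closed bb).
by rewrite over_oo_spre.
Qed.

(** How often the graph point occurs among the conjugates of [P]. This depends on [P] alone, hence
    is the same for a chain and its image. *)
Definition graph_count P := (\sum_(t < n) (`[< gpt (spre (ce_base X) t P) >] : nat))%N.

(** For chosen bases of the stalks, the valuation of [\det T] at [Q] is [d] or 0, according to
    whether [Q] is the graph point, plus the difference between the valuations of the bases at [Q]
    and at its preimage under [sigma]. Over a Frobenius orbit these differences telescope. *)
Lemma cnorm_graph d P : cl P -> ~ over_oo P ->
  (forall P, gpt P -> has_codim (jL X) (mximg T (pullback s (Lam 0) P)) (Lam (0 + 1) P) d) ->
  vl P (cnorm (\det T)) = d%:Z *+ graph_count P.
Proof.
move=> cP nP hd; rewrite vl_cnorm ?unit_det ?(pc_T pc) //.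
have /choice[B hB] : forall Q : set X, exists B : 'M[X]_r, cl Q -> B \in unitmx /\ Lam 0 Q = rspan Q B.
  move=> Q; have [cQ|nQ] := pselect (cl Q); last by exists 0.
  by have [B uB e] := stalk (pc_lf pc 0) cQ; exists B.
pose w Q := vl Q (\det (B Q)).
have key Q : cl Q -> ~ over_oo Q ->
    vl Q (\det T) = d%:Z *+ `[< gpt Q >] + (w Q - w (s @^-1` Q)).
  move=> cQ nQ; have cQ' := sigma_preim_closed cQ.
  have [u1 e1] := hB _ cQ; have [u2 e2] := hB _ cQ'.
  have uT := pc_T pc; have us : map_mx s (B (s @^-1` Q)) \in unitmx by rewrite map_unitmx.
  have uST : map_mx s (B (s @^-1` Q)) *m T \in unitmx by rewrite unitmx_mul us.
  have vd : vl Q (\det (map_mx s (B (s @^-1` Q)) *m T)) = w (s @^-1` Q) + vl Q (\det T).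
    rewrite det_mulmx det_map_mx (vlM ff) ?fmorph_eq0 ?unit_det //.
    by rewrite vl_sigma // unit_det.
  have ep : mximg T (pullback s (Lam 0) Q) = rspan Q (map_mx s (B (s @^-1` Q)) *m T).
    by rewrite (pullback_stalk cQ e2) mximg_rspan.
  have e01 : Lam (0 + 1) Q = rspan Q (B Q) by rewrite prechain_const // e1.
  case: asboolP => gQ.
    have sub : rspan Q (map_mx s (B (s @^-1` Q)) *m T) `<=` rspan Q (B Q).
      by rewrite -ep -e01; apply: (pc_tau pc).
    have := hd _ gQ; rewrite ep e01 => /(lattice_codim ff d (graph_pt_rational gQ) uST u1 sub).1.
    by rewrite vd mulr1n => ->; rewrite /w; ring.
  have := pc_coT0 pc 0 cQ gQ; rewrite ep e01 => /(rspan_eq_val ff cQ uST u1).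
  by rewrite vd mulr0n add0r /w => <-; ring.
rewrite (eq_bigr (fun t : 'I_n => d%:Z *+ `[< gpt (spre (ce_base X) t P) >] +
   (w (spre (ce_base X) t P) - w (spre (ce_base X) t.+1 P)))) => [|t _]; last first.
  by rewrite key ?over_oo_spre //; [rewrite spreS | apply: (spre_closed bb)].
rewrite big_split /= -(big_mkord xpredT (fun t => w (spre (ce_base X) t P) - w (spre (ce_base X) t.+1 P))).
rewrite (eq_bigr (fun t => - (w (spre (ce_base X) t.+1 P) - w (spre (ce_base X) t P)))) => [|t _]; last by rewrite opprB.
rewrite sumrN telescope_sumr // (spre_order bb) subrr oppr0 addr0.
by rewrite /graph_count -sumrMnr.
Qed.

End PreChain.

(* Degrees need not be developed: a quotient of the norms of the two determinants is a unit
   at infinity and has a uniform sign elsewhere, so it is a constant. *)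
Lemma quotient_dim m l r d (Lam : int -> sheaf X r) T r' (G : int -> sheaf X r') T' dd d' (Poo Pc : set X) :
  chain eps c m l d Lam T -> prechain m l G T' -> (0 < d)%N ->
  cl Poo -> over_oo Poo -> gpt Pc ->
  dd%:Z = - vl Poo (\det T') ->
  (forall P, gpt P -> has_codim (jL X) (mximg T' (pullback s (G 0) P)) (G (0 + 1) P) d') ->
  d' = dd.
Proof.
move=> ch pc d0 cPoo oPoo gPc edd hd'.
have pcL := chain_prechain ch.
have [n [b bb]] := ce_basis_ex (ce_base X); have n0 := ce_basis_gt0 bb.
have hd P : gpt P -> has_codim (jL X) (mximg T (pullback s (Lam 0) P)) (Lam (0 + 1) P) d.
  exact: (ch_coT ch).
have ed : d%:Z = - vl Poo (\det T).
  have [d1 [h1 <- _]] := prechain_oo pcL cPoo oPoo.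
  have fs : submodule (range (jL X)) (Lam 0 Poo).
    exact: (const_submod cPoo (stalk_submod (ch_lf ch 0) cPoo)).
  by rewrite (has_codim_uniq fs (ch_coPi ch 0 cPoo oPoo) (h1 0)).
have uT := unit_det (pc_T pcL); have uT' := unit_det (pc_T pc).
(* The exponents are crossed so that both norms have the same valuation at infinity. Elsewhere the
   valuation of [a / a'] is [d' - dd] times a nonnegative integer. *)
pose a := cnorm n (\det T') ^+ d; pose a' := cnorm n (\det T) ^+ dd.
have a0 : a != 0 by rewrite expf_neq0 // cnorm_neq0.
have a'0 : a' != 0 by rewrite expf_neq0 // cnorm_neq0.
have va P : cl P -> vl P (a / a') = vl P (cnorm n (\det T')) *+ d - vl P (cnorm n (\det T)) *+ dd.
  by move=> cP; rewrite (vlM ff) ?invr_eq0 // (vlV ff) // !(vlX ff) ?cnorm_neq0.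
have voo : vl Poo (a / a') = 0.
  rewrite va // (cnorm_oo pc bb) // (cnorm_oo pcL bb) //.
  have -> : vl Poo (\det T') = - dd%:Z by rewrite edd opprK.
  have -> : vl Poo (\det T) = - d%:Z by rewrite ed opprK.
  by rewrite !intmulrn; ring.
have vfin P : cl P -> ~ over_oo P -> vl P (a / a') = (d'%:Z - dd%:Z) * (d * graph_count n P)%N%:Z.
  move=> cP nP; rewrite va // (cnorm_graph pc bb cP nP hd') (cnorm_graph pcL bb cP nP hd).
  by rewrite !intmulrn PoszM; ring.
have y0 : a / a' != 0 by rewrite mulf_neq0 // invr_eq0.
have [cPc _ _] := gPc; have nPc := graph_pt_not_oo gPc.
have reg : (forall P, cl P -> P (a / a')) \/ (forall P, cl P -> P (a / a')^-1).
  have [le|lt] := leqP dd d'; [left|right] => P cP.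
    apply/(vl_ge0 ff cP y0); have [oP|nP] := pselect (over_oo P).
      by rewrite (over_oo_uniq cP cPoo oP oPoo) voo.
    by rewrite vfin //; apply: mulr_ge0 => //; rewrite subr_ge0 lez_nat.
  have yV0 : (a / a')^-1 != 0 by rewrite invr_eq0.
  apply/(vl_ge0 ff cP yV0); rewrite (vlV ff cP y0); have [oP|nP] := pselect (over_oo P).
    by rewrite (over_oo_uniq cP cPoo oP oPoo) voo.
  rewrite vfin // -mulNr; apply: mulr_ge0 => //.
  by rewrite opprB subr_ge0 lez_nat ltnW.
have : vl Pc (a / a') = 0.
  case: reg => reg; first by apply: (vl_isu ff cPc); apply: (regular_isu y0 reg).
  have yV0 : (a / a')^-1 != 0 by rewrite invr_eq0.
  have /(vl_isu ff cPc) := regular_isu yV0 reg cPc.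
  by rewrite (vlV ff cPc y0) => /eqP; rewrite oppr_eq0 => /eqP.
(* The exponent 0 already counts [Pc] itself. *)
have gc : (0 < graph_count n Pc)%N.
  by rewrite /graph_count (bigD1 (Ordinal n0)) //= asboolT ?addn_gt0.
rewrite vfin // => /eqP; rewrite mulf_eq0 subr_eq0 !eqz_nat => /orP[/eqP//|].
by rewrite muln_eq0 !gtn_eqF.
Qed.

(** The image is a prechain by naturality. Its dimension is read off at infinity by [prechain_oo],
    and [quotient_dim] shows that it is the same at the graph point. If [d] is 0, the rank is 0 too
    and all codimensions vanish. *)
Lemma chain_quotient m l r d (Lam : int -> sheaf X r) T r' (p : 'M[X]_(r, r')) T' :
  chain eps c m l d Lam T -> row_full p -> T *m p = map_mx s p *m T' ->
  exists d', chain eps c m l d' (fun i P => mximg p (Lam i P)) T'.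
Proof.
move=> ch fp eT; pose G i P := mximg p (Lam i P).
have pb i P : mximg T' (pullback s (G i) P) = mximg p (mximg T (pullback s (Lam i) P)).
  by rewrite /G pullback_img !mximg_comp eT.
have uT' : T' \in unitmx.
  rewrite -row_full_unit; apply: (@row_full_mulr _ _ _ _ (map_mx s p)); rewrite -eT.
  by apply: row_full_mul => //; rewrite row_full_unit (ch_T ch).
have pc : prechain m l G T'.
  split=> //.
  - exact: ch_m ch.
  - exact: ch_l ch.
  - by move=> i; apply: locally_free_img => //; apply: (ch_lf ch).
  - by move=> i P cP; apply: mximg_mono; apply: (ch_inc ch).
  - by move=> i P cP; rewrite pb; apply: mximg_mono; apply: (ch_tau ch).
  - move=> i P cP; rewrite twist_img //; last exact: stalk_submod (ch_lf ch _) cP.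
    by rewrite /G (ch_tw ch _ cP).
  - by move=> i P cP nP; rewrite pb (ch_coT0 ch).
have subG i P : cl P -> submodule P (G i P) by move=> cP; apply: stalk_submod (pc_lf pc i) cP.
have subG' i P : cl P -> submodule P (mximg T' (pullback s (G i) P)).
  by move=> cP; apply: mximg_submod; apply: pullback_submod (pc_lf pc i) cP.
have fin dd : (l * dd = m * r')%N ->
    (forall i P, cl P -> over_oo P -> has_codim (jL X) (G i P) (G (i + 1) P) dd) ->
    (forall i P, gpt P -> has_codim (jL X) (mximg T' (pullback s (G i) P)) (G (i + 1) P) dd) ->
    dd = 0%N \/ (exists2 P, cl P & over_oo P) /\ (exists P, gpt P) ->
    chain eps c m l dd G T'.
  by case: pc => *; split.
have [d0|d0] := posnP d.
  have r0 : r = 0%N.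
    by have := ch_ld ch; rewrite d0 muln0 => /esym/eqP; rewrite muln_eq0 gtn_eqF ?(ch_m ch) // => /eqP.
  have r'0 : r' = 0%N.
    by apply/eqP; rewrite -leqn0 -r0; move: fp; rewrite /row_full => /eqP <-; apply: rank_leq_row.
  exists 0%N; apply: fin.
  - by rewrite muln0 r'0 muln0.
  - by move=> i P cP _; apply: flat_has_codim => //; case: (subG i P cP).
  - by move=> i P [cP _ _]; apply: flat_has_codim => //; case: (subG' i P cP).
  - by left.
have [/eqP|[[Poo cPoo oPoo] [Pc gPc]]] := ch_ex ch; first by rewrite gtn_eqF.
have [dd [hdd edd ld]] := prechain_oo pc cPoo oPoo.
have [d' hd'] := prechain_graph pc gPc.
have hd'' i P : gpt P -> has_codim (jL X) (mximg T' (pullback s (G i) P)) (G (i + 1) P) d'.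
  by move=> gP; rewrite (graph_pt_uniq gP gPc).
have e := quotient_dim ch pc d0 cPoo oPoo gPc edd (hd'' 0).
exists dd; apply: fin => //.
- by move=> i P cP oP; rewrite (over_oo_uniq cP cPoo oP oPoo).
- by move=> i P gP; rewrite -e; apply: hd''.
- by right; split; [exists Poo | exists Pc].
Qed.

End Quotient.

(** * Base change of points and of tau-sheaves *)

Section BaseChangePoints.
Variables (k : finFieldType) (C : curve k) (L L' : finFieldType).
Variables (X : base_curve C L) (X' : base_curve C L') (e : base_ext X X').
Implicit Types (P : set X').
Local Notation cl := (closed_point (jL X)).
Local Notation cl' := (closed_point (jL X')).
Local Notation phi := (ext_fun e).

Lemma ext_preim_jQ P : jQ X @^-1` (phi @^-1` P) = jQ X' @^-1` P.
Proof. by apply/funext => x; rewrite /= ext_fun_Q. Qed.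

Lemma ext_preim_closed P : cl' P -> cl (phi @^-1` P).
Proof.
have [Y [eY _ _]] := ce_ext_ex e; have [n [b bb]] := ce_basis_ex Y.
by rewrite -eY; apply: (preim_closed bb).
Qed.

Lemma ext_lying_over (Q : set X) : cl Q -> exists2 P, cl' P & phi @^-1` P = Q.
Proof.
have [Y [eY _ _]] := ce_ext_ex e; have [n [b bb]] := ce_basis_ex Y.
by move=> cQ; have [P [cP eP]] := lying_over bb cQ; exists P; rewrite // -eY.
Qed.

Lemma ext_mi P x : max_ideal (phi @^-1` P) x <-> max_ideal P (phi x).
Proof. by have [Y [<- _ _]] := ce_ext_ex e; apply: (mi_preim Y). Qed.

Lemma ext_over_oo P : over_oo (phi @^-1` P) = over_oo P.
Proof. by rewrite /over_oo ext_preim_jQ. Qed.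

Lemma ext_rational P : cl' P -> rational_point (jL X) (phi @^-1` P) -> rational_point (jL X') P.
Proof.
have [Y [eY _ _]] := ce_ext_ex e; have [n [b bb]] := ce_basis_ex Y.
by move=> [cP _]; rewrite -eY; apply: (rational_over bb cP).
Qed.

Lemma ext_vl P x : cl' P -> rational_point (jL X) (phi @^-1` P) -> x != 0 ->
  vl P (phi x) = vl (phi @^-1` P) x.
Proof.
have [Y [eY _ _]] := ce_ext_ex e; have [n [b bb]] := ce_basis_ex Y.
move=> [cP _]; rewrite -eY => rQ x0; apply: (vl_rational bb cP) => //.
exact: base_function_field.
Qed.

Lemma ext_graph_pt eps c P : cl' P ->
  graph_pt eps (ext_L e \o c) P <-> graph_pt eps c (phi @^-1` P).
Proof.
move=> cP; rewrite /graph_pt ext_preim_jQ; split=> -[h1 h2 h3]; split=> //.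
- exact: ext_preim_closed.
- move=> x ex; apply/ext_mi; rewrite rmorphB ext_fun_Q ext_fun_L; exact: h3.
- move=> x ex; rewrite /= -(ext_fun_Q e) -(ext_fun_L e) -rmorphB; apply/ext_mi; exact: h3.
Qed.

Lemma ext_locally_free r (M : sheaf X r) : locally_free (jL X) M ->
  locally_free (jL X') (pullback phi M).
Proof.
have [Y [<- _ _]] := ce_ext_ex e; apply: (locally_free_pullback Y).
exact: base_function_field.
Qed.

Lemma ext_stalk r (M : sheaf X r) P (B : 'M[X]_r) : cl' P ->
  M (phi @^-1` P) = rspan (phi @^-1` P) B -> pullback phi M P = rspan P (map_mx phi B).
Proof.
move=> cP; apply: pullback_rspan; apply: vr_sub; first exact: (closed_valring cP).
exact: (closed_valring (ext_preim_closed cP)).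
Qed.

Lemma rspan_ext_sub P r (A B : 'M[X]_r) : cl' P -> B \in unitmx ->
  rspan (phi @^-1` P) A `<=` rspan (phi @^-1` P) B ->
  rspan P (map_mx phi A) `<=` rspan P (map_mx phi B).
Proof.
move=> cP uB; have sP := vr_sub (closed_valring cP).
have sQ := vr_sub (closed_valring (ext_preim_closed cP)).
move=> /(rspan_subP _ sQ uB) h; apply/(rspan_subP _ sP); first by rewrite map_unitmx.
by rewrite -map_invmx -map_mxM => i j; rewrite mxE; apply: h.
Qed.

Lemma rspan_ext_eq P r (A B : 'M[X]_r) : cl' P -> A \in unitmx -> B \in unitmx ->
  rspan (phi @^-1` P) A = rspan (phi @^-1` P) B ->
  rspan P (map_mx phi A) = rspan P (map_mx phi B).
Proof. by move=> cP uA uB h; apply/seteqP; split; apply: rspan_ext_sub => //; rewrite h. Qed.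

Lemma ext_lattice_codim P r (A B : 'M[X]_r) d : cl' P -> rational_point (jL X) (phi @^-1` P) ->
  A \in unitmx -> B \in unitmx -> rspan (phi @^-1` P) A `<=` rspan (phi @^-1` P) B ->
  has_codim (jL X) (rspan (phi @^-1` P) A) (rspan (phi @^-1` P) B) d ->
  has_codim (jL X') (rspan P (map_mx phi A)) (rspan P (map_mx phi B)) d.
Proof.
move=> cP rQ uA uB sub.
move=> /(lattice_codim (base_function_field X) d rQ uA uB sub).1 ed.
apply/(lattice_codim (base_function_field X') d (ext_rational cP rQ)); rewrite ?map_unitmx //.
  exact: rspan_ext_sub.
by rewrite !det_map_mx !ext_vl -?unitfE -?unitmxE.
Qed.

Lemma ext_sigma_preim P : phi @^-1` (sigma X' @^-1` P) = sigma X @^-1` (phi @^-1` P).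
Proof. by apply/funext => x; rewrite /= ext_sigma. Qed.

Lemma map_ext_sigma r s (A : 'M[X]_(r, s)) :
  map_mx (sigma X') (map_mx phi A) = map_mx phi (map_mx (sigma X) A).
Proof. by apply/matrixP => i j; rewrite !mxE ext_sigma. Qed.

Lemma ext_twist D r (M : sheaf X r) P : cl' P -> locally_free (jL X) M ->
  pullback phi (twist D M) P = twist D (pullback phi M) P.
Proof.
move=> cP lf; have cQ := ext_preim_closed cP.
have [B uB eB] := locally_free_stalk lf cQ.
have [t ut] := twist_unif cQ.
rewrite (ext_stalk cP (twist_rspan D cQ ut eB)).
rewrite (twist_rspan D cP (t := t) _ (ext_stalk cP eB)) -?ext_preim_jQ //.
by rewrite map_mxZ fmorphXz ext_fun_Q.
Qed.

(** The points that carry cokernels are rational, so the dimensions there are valuations of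
    determinants, and these are unchanged by a constant extension. Points over infinity and points
    of the graph lie exactly above those of the smaller curve. *)
Lemma chain_ext eps c m l r d (Lam : int -> sheaf X r) T : chain eps c m l d Lam T ->
  chain eps (ext_L e \o c) m l d (fun i => pullback phi (Lam i)) (map_mx phi T).
Proof.
move=> ch; have uT := ch_T ch.
have st i P : cl' P -> exists B, [/\ B \in unitmx, Lam i (phi @^-1` P) = rspan (phi @^-1` P) B &
    pullback phi (Lam i) P = rspan P (map_mx phi B)].
  move=> cP; have [B uB eB] := locally_free_stalk (ch_lf ch i) (ext_preim_closed cP).
  by exists B; split=> //; apply: ext_stalk.
have pb i P : cl' P -> exists B, [/\ B \in unitmx,
    mximg T (pullback (sigma X) (Lam i) (phi @^-1` P)) = rspan (phi @^-1` P) B &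
    mximg (map_mx phi T) (pullback (sigma X') (pullback phi (Lam i)) P) = rspan P (map_mx phi B)].
  move=> cP; have cP' := sigma_preim_closed cP; have [B [uB eB eB']] := st i _ cP'.
  rewrite ext_sigma_preim in eB.
  exists (map_mx (sigma X) B *m T); split; first by rewrite unitmx_mul map_unitmx uB.
    by rewrite (pullback_stalk (ext_preim_closed cP) eB) mximg_rspan.
  by rewrite (pullback_stalk cP eB') mximg_rspan map_ext_sigma -map_mxM.
split.
- exact: ch_m ch.
- exact: ch_l ch.
- exact: ch_ld ch.
- by rewrite map_unitmx.
- by move=> i; apply: ext_locally_free; apply: (ch_lf ch).
- move=> i P cP; apply: lspan_mono => //; apply: image_subset.
  exact: (ch_inc ch (ext_preim_closed cP)).
- move=> i P cP; have [B1 [u1 e1 ->]] := pb i P cP; have [B2 [u2 e2 ->]] := st (i + 1) P cP.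
  apply: rspan_ext_sub => //; rewrite -e1 -e2.
  exact: (ch_tau ch (ext_preim_closed cP)).
- move=> i P cP; rewrite -ext_twist //; last exact: (ch_lf ch).
  rewrite /pullback (ch_tw ch _ (ext_preim_closed cP)).
  by [].
- move=> i P cP; rewrite -ext_over_oo => oP; have cQ := ext_preim_closed cP.
  have [B1 [u1 e1 ->]] := st i P cP; have [B2 [u2 e2 ->]] := st (i + 1) P cP.
  apply: ext_lattice_codim => //; rewrite -?e1 -?e2.
  + exact: over_oo_closed_rational.
  + exact: (ch_inc ch).
  + exact: (ch_coPi ch).
- move=> i P cP; rewrite ext_graph_pt // => nP; have cQ := ext_preim_closed cP.
  have [B1 [u1 e1 ->]] := pb i P cP; have [B2 [u2 e2 ->]] := st (i + 1) P cP.
  by apply: rspan_ext_eq => //; rewrite -e1 -e2; apply: (ch_coT0 ch).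
- move=> i P gP; have [cP _ _] := gP; have {}gP := (ext_graph_pt eps c cP).1 gP.
  have cQ := ext_preim_closed cP.
  have [B1 [u1 e1 ->]] := pb i P cP; have [B2 [u2 e2 ->]] := st (i + 1) P cP.
  apply: ext_lattice_codim => //; rewrite -?e1 -?e2.
  + exact: graph_pt_rational gP.
  + exact: (ch_tau ch).
  + exact: (ch_coT ch).
- have [->|[[Q cQ oQ] [Q' gQ']]] := ch_ex ch; [by left | right].
  have [P cP eP] := ext_lying_over cQ; have [cQ' _ _] := gQ'.
  have [P' cP' eP'] := ext_lying_over cQ'; split.
    by exists P => //; rewrite -ext_over_oo eP.
  by exists P'; apply/ext_graph_pt; rewrite ?eP'.
Qed.

End BaseChangePoints.

(** * Direct sums of tau-sheaves *)

Section ChainSum.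
Variables (k : finFieldType) (C : curve k) (L : finFieldType) (X : base_curve C L).
Variables (eps : set C) (c : C -> L) (m l : nat).
Local Notation cl := (closed_point (jL X)).
Local Notation s := (sigma X).

Lemma mximg_dsum r1 r2 (A : 'M[X]_r1) (B : 'M[X]_r2) (M : set 'rV[X]_r1) (N : set 'rV[X]_r2) :
  mximg (block_mx A 0 0 B) (dsum M N) = dsum (mximg A M) (mximg B N).
Proof.
apply/seteqP; split.
  move=> _ [v [hM hN] <-]; rewrite -[v]hsubmxK mul_row_block !mulmx0 addr0 add0r.
  by split; rewrite ?row_mxKl ?row_mxKr; [exists (lsubmx v)|exists (rsubmx v)].
move=> v [[a Ma ea] [b Nb eb]]; exists (row_mx a b).
  by split; rewrite ?row_mxKl ?row_mxKr.
by rewrite mul_row_block !mulmx0 addr0 add0r ea eb hsubmxK.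
Qed.

Lemma pullback_dsum r1 r2 (M : sheaf X r1) (N : sheaf X r2) P : locally_free (jL X) M ->
  locally_free (jL X) N -> cl P ->
  pullback s (fun P => dsum (M P) (N P)) P = dsum (pullback s M P) (pullback s N P).
Proof.
move=> lM lN cP; have cQ := sigma_preim_closed cP.
have [A uA eA] := locally_free_stalk lM cQ; have [B uB eB] := locally_free_stalk lN cQ.
rewrite (pullback_stalk cP eA) (pullback_stalk cP eB) -rspan_block.
rewrite (pullback_stalk (B := block_mx A 0 0 B) cP); first by rewrite map_block_mx !raddf0.
by rewrite rspan_block eA eB.
Qed.

Lemma dsum_mono r1 r2 (M M' : set 'rV[X]_r1) (N N' : set 'rV[X]_r2) :
  M `<=` M' -> N `<=` N' -> dsum M N `<=` dsum M' N'.
Proof. by move=> h1 h2 v [/h1 ? /h2 ?]. Qed.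

(** The common [m] and [l] express equality of slopes: with them the periodicity and the relation
    [l * d = m * r] add up. *)
Lemma chain_dsum r1 r2 d1 d2 (M : int -> sheaf X r1) (N : int -> sheaf X r2) S T :
  chain eps c m l d1 M S -> chain eps c m l d2 N T ->
  chain eps c m l (d1 + d2) (fun i P => dsum (M i P) (N i P)) (block_mx S 0 0 T).
Proof.
move=> h1 h2.
have s1 i P : cl P -> submodule P (M i P) by move=> cP; apply: stalk_submod (ch_lf h1 i) cP.
have s2 i P : cl P -> submodule P (N i P) by move=> cP; apply: stalk_submod (ch_lf h2 i) cP.
have p1 i P : cl P -> submodule P (mximg S (pullback s (M i) P)).
  by move=> cP; apply: mximg_submod; apply: pullback_submod (ch_lf h1 i) cP.
have p2 i P : cl P -> submodule P (mximg T (pullback s (N i) P)).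
  by move=> cP; apply: mximg_submod; apply: pullback_submod (ch_lf h2 i) cP.
have z r P (A : set 'rV[X]_r) : submodule P A -> A 0 by case.
have pb i P : cl P ->
    mximg (block_mx S 0 0 T) (pullback s (fun P => dsum (M i P) (N i P)) P) =
    dsum (mximg S (pullback s (M i) P)) (mximg T (pullback s (N i) P)).
  by move=> cP; rewrite pullback_dsum ?mximg_dsum //; [exact: (ch_lf h1)|exact: (ch_lf h2)].
split.
- exact: ch_m h1.
- exact: ch_l h1.
- by rewrite !mulnDr (ch_ld h1) (ch_ld h2).
- by rewrite unitmxE det_ublock unitrM -!unitmxE (ch_T h1) (ch_T h2).
- move=> i; apply: locally_free_dsum; [exact: (ch_lf h1)|exact: (ch_lf h2)].
- by move=> i P cP; apply: dsum_mono; [apply: (ch_inc h1)|apply: (ch_inc h2)].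
- by move=> i P cP; rewrite pb //; apply: dsum_mono; [apply: (ch_tau h1)|apply: (ch_tau h2)].
- move=> i P cP; rewrite twist_dsum //; [|exact: s1|exact: s2].
  by rewrite -(ch_tw h1) // -(ch_tw h2).
- move=> i P cP oP; apply: has_codim_dsum.
  + exact: z (s1 _ _ cP).
  + exact: z (s2 _ _ cP).
  + exact: z (s1 _ _ cP).
  + exact: z (s2 _ _ cP).
  + exact: (ch_coPi h1).
  + exact: (ch_coPi h2).
- by move=> i P cP nP; rewrite pb // (ch_coT0 h1) // (ch_coT0 h2).
- move=> i P gP; have [cP _ _] := gP; rewrite pb //; apply: has_codim_dsum.
  + exact: z (p1 _ _ cP).
  + exact: z (p2 _ _ cP).
  + exact: z (s1 _ _ cP).
  + exact: z (s2 _ _ cP).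
  + exact: (ch_coT h1).
  + exact: (ch_coT h2).
- have [->|h] := ch_ex h1; last by right.
  by have [->|h] := ch_ex h2; [left|right].
Qed.

Lemma flat_set (E : fieldType) (S : set 'rV[E]_0) : S 0 -> S = setT.
Proof. by move=> S0; apply/seteqP; split=> // v _; rewrite (thinmx0 v) -(thinmx0 0). Qed.

Lemma chain_zero : (0 < m)%N -> (0 < l)%N -> chain eps c m l 0 (fun _ _ => setT : set 'rV[X]_0) 1%:M.
Proof.
move=> m0 l0.
have lf : locally_free (jL X) (fun _ => setT : set 'rV[X]_0).
  apply/locally_freeP => P cP; exists setT, 1%:M; split=> //.
  - by rewrite (_ : [set Q | _] = set0) //; apply/seteqP; split=> // Q [_ []].
  - exact: unitmx1.
  - move=> Q cQ _; rewrite [RHS]flat_set //.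
    by case: (rspan_submod (1%:M : 'M[X]_0) (vr_sub (closed_valring cQ))).
have sT P : submodule P (setT : set 'rV[X]_0) by [].
have im P : cl P -> mximg 1%:M (pullback s (fun _ => setT : set 'rV[X]_0) P) = setT.
  move=> cP; apply: flat_set; rewrite mximg1.
  by have [] := lspan_submod (map_mx s @` (setT : set 'rV[X]_0)) (vr_sub (closed_valring cP)).
split=> //.
- by rewrite !muln0.
- exact: unitmx1.
- move=> i P cP; apply/esym/flat_set.
  by case: (lspan_submod [set w : 'rV[X]_0 | exists x v, [/\ O_div (div_oo (- m%:Z)) (jQ X @^-1` P) x, setT v & w = jQ X x *: v]] (vr_sub (closed_valring cP))).
- by move=> i P cP _; apply: has_codim0.
- by move=> i P cP _; apply: im.
- by move=> i P [cP _ _]; rewrite im //; apply: has_codim0.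
- by left.
Qed.

End ChainSum.

Lemma row_full_row_mx (E : fieldType) r s t (A : 'M[E]_(r, s)) (B : 'M[E]_(r, t)) :
  row_full (row_mx A B) -> row_full A /\ row_full B.
Proof.
move=> h; split; apply: surj_row_full => w.
  have [v hv] := row_full_surj (row_mx w 0) h; exists v.
  by move/(congr1 lsubmx): hv; rewrite mul_mx_row !row_mxKl.
have [v hv] := row_full_surj (row_mx 0 w) h; exists v.
by move/(congr1 rsubmx): hv; rewrite mul_mx_row !row_mxKr.
Qed.

Lemma row_full_free_dim (E : fieldType) r s (A : 'M[E]_(r, s)) : row_full A -> row_free A -> r = s.
Proof. by move=> /eqP h1 /eqP h2; rewrite -h2. Qed.

Lemma mx_inverse_dim (E : fieldType) r s (A : 'M[E]_(r, s)) (B : 'M[E]_(s, r)) :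
  A *m B = 1%:M -> B *m A = 1%:M -> r = s.
Proof. by move=> h1 h2; apply/eqP; rewrite eqn_leq (mulmx1_min h1) (mulmx1_min h2). Qed.

Lemma row_full_pinv (E : fieldType) r s (A : 'M[E]_(r, s)) : row_full A -> s = r ->
  A *m pinvmx A = 1%:M /\ pinvmx A *m A = 1%:M.
Proof.
move=> fA e; split; last exact: mulVpmx.
by apply: mulmxVp; rewrite /row_free; move: fA; rewrite /row_full => /eqP ->; apply/eqP.
Qed.

(** * Simple and semisimple tau-sheaves *)

Section TauSheafSimple.
Variables (k : finFieldType) (C : curve k) (L : finFieldType) (X : base_curve C L).
Variables (eps : set C) (c : C -> L).
Hypothesis eps_oo : eps <> oo.
Local Notation s := (sigma X).

(* The semilinear structure on the generic stalk of [F_0]. *)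
Definition ts_gen (F : tsheaf X) : 'M[X]_(ts_rk F) := ts_tau F 0 *m invmx (ts_Pi F 0).

Lemma abelian_Pi_unit (F : tsheaf X) i : abelian_tsheaf eps c F -> ts_Pi F i \in unitmx.
Proof.
move=> /abelian_chain[m [l [Q [fr _ _]]]]; have [uQ e _] := fr i.
by move: uQ; rewrite e unitmx_mul => /andP[].
Qed.

(** A quotient of the generic module is realised by the tau-sheaf of images of the stalks.
    Simplicity of [S] makes this zero or isomorphic to [S], which decides the rank of the
    quotient. *)
Lemma simple_tsimple (S : tsheaf X) : ts_simple eps c S -> tsimple s (ts_gen S).
Proof.
move=> [aS rS simS]; split; first by rewrite lt0n; apply/eqP.
move=> r' p T' fp eT; have [m [l [Q [fr _ ch]]]] := abelian_chain aS.
have [d' ch'] := chain_quotient eps_oo ch fp eT.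
pose H := mkts d' (fun i P => mximg p (framed Q i P)) T'.
have im i P : mximg (Q i *m p) (ts_F S i P) = ts_F H i P.
  by rewrite /H /= /framed mximg_comp.
have [||||[f [g [_ _ fg]]]] := simS H (fun i => Q i *m p).
- exact: chain_mkts ch'.
- move=> i; have [_ e1 e2] := fr i; split.
  + by move=> P cP; rewrite im.
  + by rewrite /= mulmx1 e1 mulmxA.
  + by rewrite /= mulmxA e2 -mulmxA -/(ts_gen S) eT mulmxA map_mxM.
- by move=> i P cP; rewrite im.
- by left.
- by right; have [h1 h2] := fg 0; apply: mx_inverse_dim h1 h2.
Qed.

(** A surjection of tau-sheaves is surjective on generic modules, so its target has rank 0 or the
    map is invertible there; in the latter case surjectivity on stalks says that the inverse maps
    stalks into stalks. *)
Lemma tsimple_simple m l r d (Lam : int -> sheaf X r) T : chain eps c m l d Lam T ->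
  tsimple s T -> ts_simple eps c (mkts d Lam T).
Proof.
move=> ch [r0 simT]; split; first exact: chain_mkts ch.
  by apply/eqP; rewrite -lt0n.
move=> H f aH hf sf; have [m' [l' [Q [fr _ ch']]]] := abelian_chain aH.
have uPi i := abelian_Pi_unit i aH.
have [P cP] := closed_ex X.
have ff i : row_full (f i).
  have lfH : locally_free (jL X) (ts_F H i) by case: aH.
  have [B uB eB] := locally_free_stalk lfH cP.
  apply: (rspan_row_full (P := P) (S := Lam i P) (B := B)) => //.
    exact: (vr_sub (closed_valring cP)).
  by rewrite -eB -(sf i P cP).
have eT : T *m f 0 = map_mx s (f 0) *m ts_gen H.
  have [_ /= e1 e2] := hf 0; rewrite /ts_gen mulmxA -e2 -mulmxA; congr (_ *m _).
  by move: e1; rewrite mul1mx => ->; rewrite mulmxK.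
have [|e] := simT _ _ _ (ff 0) eT; [by left | right].
have pv i := row_full_pinv (ff i) e.
exists (fun i => pinvmx (f i)), f; split=> //; last by move=> i; have [] := pv i.
move=> i; have [_ /= e1 e2] := hf i; have [fg gf] := pv i; have [fg' gf'] := pv (i + 1).
split.
- move=> P' cP'; rewrite -(sf i P' cP') mximg_comp fg mximg1; exact: subset_refl.
- rewrite mulmx1; move: e1; rewrite mul1mx => e1.
  by rewrite -[RHS]mulmx1 -fg' e1 !mulmxA gf mul1mx.
- rewrite -[RHS]mulmx1 -fg' /= mulmxA -[X in _ = X *m _]mulmxA e2 mulmxA -map_mxM gf.
  by rewrite map_mx1 mul1mx.
Qed.

(** Generic semisimplicity as joint injectivity of a family of maps to simple modules. This form
    passes to direct sums and along injective morphisms, and it is the one from which descent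
    starts. *)
Definition gen_dec (H : tsheaf X) := ts_Pi H 0 \in unitmx /\
  exists l : seq (qdata X (ts_rk H)),
    Forall_seq (fun x => tsimple s (qT x) /\ qhom s (ts_gen H) x) l /\
    forall v : 'rV_(ts_rk H), Forall_seq (fun x => v *m qm x = 0) l -> v = 0.

Lemma gen_dec_simple S : ts_simple eps c S -> gen_dec S.
Proof.
move=> sS; have [aS _ _] := sS; split; first exact: abelian_Pi_unit.
exists [:: @QData _ _ _ 1%:M (ts_gen S)]; split.
  split=> //; split; first exact: simple_tsimple.
  by rewrite /qhom /= mulmx1 map_mx1 mul1mx.
by move=> v [] /=; rewrite mulmx1.
Qed.

Lemma gen_dec_add F G : gen_dec F -> gen_dec G -> gen_dec (ts_add F G).
Proof.
move=> [uF [lF [hF iF]]] [uG [lG [hG iG]]].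
have uH : ts_Pi (ts_add F G) 0 \in unitmx.
  by rewrite unitmxE det_ublock unitrM -!unitmxE; apply/andP.
have eH : ts_gen (ts_add F G) = block_mx (ts_gen F) 0 0 (ts_gen G).
  apply: (can_inj (mulmxK uH)); rewrite /ts_gen mulmxKV //=.
  by rewrite mulmx_block !mulmx0 !mul0mx !addr0 !add0r !mulmxKV.
split=> //.
pose A (x : qdata X (ts_rk F)) := @QData X (ts_rk (ts_add F G)) (qr x) (col_mx (qm x) 0) (qT x).
pose B (x : qdata X (ts_rk G)) := @QData X (ts_rk (ts_add F G)) (qr x) (col_mx 0 (qm x)) (qT x).
exists (map A lF ++ map B lG); split.
  apply/Forall_cat; split; apply/Forall_map.
    apply: Forall_imp hF => x [sx hx]; split=> //; rewrite /qhom /= eH.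
    by rewrite mul_block_col mulmx0 mul0mx addr0 mulmx0 addr0 hx map_col_mx raddf0 mul_col_mx mul0mx.
  apply: Forall_imp hG => x [sx hx]; split=> //; rewrite /qhom /= eH.
  by rewrite mul_block_col !mulmx0 mul0mx !add0r hx map_col_mx raddf0 mul_col_mx mul0mx.
move=> v /Forall_cat[/Forall_map h1 /Forall_map h2].
pose v0 : 'rV[X]_(ts_rk F + ts_rk G) := v.
have ev : v0 = row_mx (lsubmx v0) (rsubmx v0) by rewrite hsubmxK.
have l0 : lsubmx v0 = 0.
  apply: iF; apply: Forall_imp h1 => x hx.
  have : v0 *m col_mx (qm x) 0 = 0 by exact: hx.
  by rewrite {1}ev mul_row_col mulmx0 addr0.
have r0 : rsubmx v0 = 0.
  apply: iG; apply: Forall_imp h2 => x hx.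
  have : v0 *m col_mx 0 (qm x) = 0 by exact: hx.
  by rewrite {1}ev mul_row_col mulmx0 add0r.
by apply: etrans ev _; rewrite l0 r0 row_mx0.
Qed.

Lemma gen_dec_zero : gen_dec (ts_zero X).
Proof.
split; first exact: unitmx1.
by exists [::]; split=> // v _; rewrite (thinmx0 v).
Qed.

Lemma gen_dec_sum n (S : 'I_n -> tsheaf X) : (forall j, ts_simple eps c (S j)) -> gen_dec (ts_sum S).
Proof.
move=> sS; rewrite /ts_sum; elim/big_ind: _ => [||j _].
- exact: gen_dec_zero.
- exact: gen_dec_add.
- exact: gen_dec_simple.
Qed.

(** An isogeny to a twist of the sum is injective on the generic stalk, and the twist leaves the
    generic module unchanged. *)
Lemma semisimple_gen_dec F : ts_semisimple eps c F -> gen_dec F.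
Proof.
move=> [aF [n [S [sS aH [D [f [_ _ [hf inf _ _]]]]]]]].
have [uH [l [hl il]]] := gen_dec_sum sS; set H := ts_sum S in uH l hl il f hf inf.
have uF := abelian_Pi_unit 0 aF; split=> //.
have f0 : row_free (f 0).
  apply: sheaf_inj_row_free (inf 0) => P cP; apply: stalk => //; by case: aF.
have eT : ts_gen F *m f 0 = map_mx s (f 0) *m ts_gen H.
  have [_ /= e1 e2] := hf 0; rewrite /ts_gen mulmxA -e2 -!mulmxA; congr (_ *m _).
  apply: (can_inj (mulKmx uF)); rewrite mulKVmx // mulmxA e1 mulmxK //.
exists (map (fun x => @QData X (ts_rk F) (qr x) (f 0 *m qm x) (qT x)) l); split.
  apply/Forall_map; apply: Forall_imp hl => x [sx hx]; split=> //.
  by rewrite /qhom /= mulmxA eT -mulmxA hx mulmxA map_mxM.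
move=> v /Forall_map h; apply: (row_free_inj0 f0); apply: il.
by apply: Forall_imp h => x /=; rewrite mulmxA.
Qed.

Lemma mkts_add r1 r2 d1 d2 (M : int -> sheaf X r1) (N : int -> sheaf X r2) S T :
  ts_add (mkts d1 M S) (mkts d2 N T) =
  mkts (d1 + d2) (fun i P => dsum (M i P) (N i P)) (block_mx S 0 0 T).
Proof.
rewrite /ts_add /mkts /=; congr TSheaf; apply/funext => i.
by rewrite -scalar_mx_block.
Qed.

(** The summands are images of [Lam] itself: they inherit [m] and [l], and their sum contains the
    image of [Lam] under the joint projection. *)
Lemma sum_of_quotients m l r d (Lam : int -> sheaf X r) T q :
  chain eps c m l d Lam T -> Forall_seq (fun x => tsimple s (qT x) /\ qhom s T x) q ->
  row_full (qm (qcomb q)) ->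
  exists n (S : 'I_n -> tsheaf X) d' (G : int -> sheaf X (qr (qcomb q))),
  [/\ forall j, ts_simple eps c (S j), ts_sum S = mkts d' G (qT (qcomb q)),
      chain eps c m l d' G (qT (qcomb q)) &
      forall i P, mximg (qm (qcomb q)) (Lam i P) `<=` G i P].
Proof.
move=> ch; elim: q => [_ _|x q IH /= [[sx hx] hq] /row_full_row_mx[fx fq]].
  exists 0%N, (fun _ => ts_zero X), 0%N, (fun _ _ => setT); split=> //; first by case.
    by rewrite /ts_sum big_ord0.
  by apply: chain_zero; [apply: ch_m ch | apply: ch_l ch].
have [n [S [d1 [G [sS eS chG sub]]]]] := IH hq fq.
have [dx chx] := chain_quotient eps_oo ch fx hx.
exists n.+1, (fun j => if unlift ord0 j is Some j' then S j'
   else mkts dx (fun i P => mximg (qm x) (Lam i P)) (qT x)).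
exists (dx + d1)%N, (fun i P => dsum (mximg (qm x) (Lam i P)) (G i P)); split.
- move=> j; case: unlift => [j'|]; first exact: sS.
  exact: tsimple_simple chx sx.
- rewrite /ts_sum big_ord_recl unlift_none.
  under eq_bigr => j _ do rewrite liftK.
  by rewrite -/(ts_sum S) eS mkts_add.
- exact: chain_dsum.
- move=> i P _ [v Lv <-]; rewrite mul_mx_row; split; rewrite ?row_mxKl ?row_mxKr; first by exists v.
  by apply: sub; exists v.
Qed.

End TauSheafSimple.

Section TauSheafBaseChange.
Variables (k : finFieldType) (C : curve k) (L L' : finFieldType).
Variables (X : base_curve C L) (X' : base_curve C L') (e : base_ext X X').

Theorem ts_semisimple_base_change (eps : set C) (c : C -> L) (F : tsheaf X) : eps <> oo ->
  ts_semisimple eps c F -> ts_semisimple eps (ext_L e \o c) (ts_base_change e F).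
Proof.
move=> eps_oo ssF; have [aF _] := ssF.
have [_ [q [hq iq]]] := semisimple_gen_dec eps_oo ssF.
have [m [l [Q [fr _ ch]]]] := abelian_chain aF.
have ch' := chain_ext e ch.
have [Y [eY _ [N eN]]] := ce_ext_ex e.
have comm x : ce_s Y (sigma X' x) = sigma X' (ce_s Y x).
  by rewrite !eN -iterSr.
have [q' [hq' fq' iq' homq']] : exists q' : seq (qdata X' (ts_rk F)),
  [/\ Forall_seq (fun x => tsimple (sigma X') (qT x) /\
        qhom (sigma X') (map_mx (ext_fun e) (ts_gen F)) x) q',
      row_full (qm (qcomb q')), row_free (qm (qcomb q')) &
      qhom (sigma X') (map_mx (ext_fun e) (ts_gen F)) (qcomb q')].
  rewrite -eY; apply: (semisimple_descent _ comm hq iq) => x.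
  by rewrite eY ext_sigma.
pose F' := ts_base_change e F; pose Q' i : 'M[X']_(ts_rk F') := map_mx (ext_fun e) (Q i).
have fr' : frames (F := F') Q' (map_mx (ext_fun e) (ts_gen F)).
  move=> i; have [uQ e1 e2] := fr i; split.
  - by rewrite map_unitmx.
  - by rewrite /Q' e1 map_mxM.
  - by rewrite /Q' /= -map_mxM e2 map_mxM map_ext_sigma.
have eLam i P : framed Q' i P = pullback (ext_fun e) (framed Q i) P.
  by rewrite /framed pullback_img.
have chF' : chain eps (ext_L e \o c) m l (ts_dim F') (framed Q') (map_mx (ext_fun e) (ts_gen F)).
  suff -> : framed Q' = fun i => pullback (ext_fun e) (framed Q i) by [].
  by apply/funext => i; apply/funext => P; apply: eLam.
have aF' : abelian_tsheaf eps (ext_L e \o c) F' := chain_abelian fr' chF'.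
split=> //.
have [n [S [d' [G [sS eS chG sub]]]]] := sum_of_quotients eps_oo chF' hq' fq'.
exists n, S; rewrite eS; split=> //; first exact: chain_mkts chG.
have rkE : ts_rk F = qr (qcomb q') := row_full_free_dim fq' iq'.
(* The divisor 0 will do, since the sum was built from images of the pulled-back sheaves and the
   joint projection therefore maps stalks into stalks. *)
exists (fun _ => 0), (fun i => Q' i *m qm (qcomb q')); split=> //.
  by rewrite /divisor (_ : [set P | _] = set0) //; apply/seteqP; split=> // P [].
split.
- move=> i; have [uQ e1 e2] := fr' i; split.
  + move=> P cP; rewrite -mximg_comp /= twist0 //; first exact: sub.
    exact: stalk_submod (ch_lf chG i) cP.
  + by rewrite /= mulmx1 mulmxA -e1.
  + by rewrite /= mulmxA e2 -mulmxA homq' mulmxA map_mxM.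
- move=> i P cP; apply: row_free_mxinj.
  apply: inj_row_free => v; rewrite mulmxA => /(row_free_inj0 iq') h.
  apply: (row_free_inj0 _ h); rewrite row_free_unit; by case: (fr' i).
- exact: rkE.
(* The ranks agree, and the rank determines the dimension through [l * d = m * r]. *)
- have : (l * ts_dim F' = l * d')%N by rewrite (ch_ld chF') (ch_ld chG); congr (m * _)%N.
  by move/eqP; rewrite eqn_pmul2l ?(ch_l ch) // => /eqP.
Qed.

End TauSheafBaseChange.

Lemma finite_enum (E : fieldType) (A : set (set E)) : finite_set A ->
  exists n (Q : nat -> set E), (forall i, (i < n)%N -> A (Q i)) /\
    forall P, A P -> exists2 i, (i < n)%N & Q i = P.
Proof.
move=> /finite_seqP[s ->]; exists (size s), (nth set0 s); split=> [i lt|P /=].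
  by rewrite /= mem_nth.
by move=> Ps; exists (index P s); rewrite ?index_mem ?nth_index.
Qed.

(** * The affine curve *)

Section Residue.
Variables (F : finFieldType) (E : fieldType) (iota : {rmorphism F -> E}).
Hypothesis ffE : is_function_field iota.
Implicit Types (P Q : set E) (x y z : E) (f g h : {poly F}).
Local Notation ev f x := (map_poly iota f).[x].
Local Notation cl := (closed_point iota).
Let clv P : cl P -> valring P := @closed_valring _ _ iota P.
Let clc P : cl P -> curve_point iota P := @closed_curve _ _ iota P.
#[local] Hint Resolve clv clc : core.

(** The maximal ideal is prime, so one of the factors in [f = q * gcdp f g] vanishes at [P] and is
    then divisible by [f]. *)
Lemma min_eq_coprime P x f g : cl P -> P x -> min_eq iota P x f -> ~~ (f %| g) -> coprimep f g.
Proof.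
move=> cP Px [sf mf hf] nd; have := dvdp_gcdl f g => /dvdpP[q ef].
have f0 : f != 0 by rewrite -size_poly_gt0 ltnW.
have q0 : q != 0 by apply: contraNneq f0 => q0; rewrite ef q0 mul0r.
have d0 : gcdp f g != 0 by rewrite gcdp_eq0 negb_and f0.
have mqd : max_ideal P (ev q x * ev (gcdp f g) x) by rewrite -evM -ef.
have Pev p : P (ev p x) := ev_point p (clc cP) Px.
case: (miMp (clv cP) mqd (Pev _) (Pev _)) => [/hf fq|/hf fd].
  have := dvdp_leq q0 fq; rewrite {1}ef size_mul // /coprimep.
  have := q0; rewrite -size_poly_gt0; have := d0; rewrite -size_poly_gt0.
  case: (size _) => // [[|a]] // _ sq0.
  by rewrite !addnS /= -ltn_subRL subnn.
by case/negP: nd; apply: dvdp_trans fd (dvdp_gcdr f g).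
Qed.

Lemma min_eq_inv P x f g : cl P -> P x -> min_eq iota P x f -> ~~ (f %| g) ->
  exists h, max_ideal P (ev h x * ev g x - 1).
Proof.
move=> cP Px mf nd; have /Bezout_eq1_coprimepP[[u v] /= e] := min_eq_coprime cP Px mf nd.
exists v; have [_ mfx _] := mf.
have /(congr1 (fun p => ev p x)) := e.
rewrite rmorphD hornerD !evM rmorph1 hornerC => <-.
rewrite opprD addrCA subrr addr0; have [vP Pu] := (clv cP, ev_point u (clc cP) Px).
by apply: miN; [auto|apply: miMl; auto].
Qed.

(* The residue field is finite over that of [F[x]], hence finite. *)
Lemma residue_algebraic P y : cl P -> P y -> exists2 f, f != 0 & max_ideal P (ev f y).
Proof.
move=> cP Py; have vP := clv cP; have sP := vr_sub vP.
have [x [trx dx Px]] := transc_in ffE vP.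
have [f mf] := closed_min_eq cP trx dx Px; have [sf mfx hf] := mf.
have f0 : f != 0 by rewrite -size_poly_gt0 ltnW.
have [N hN] := depdt_first trx dx.
(* The exponents decrease, so that the first coefficient not divisible by [f], which is invertible
   in the residue field, belongs to the highest power that survives, [y ^+ t]. *)
have [g [m [mN gm lm e]]] := hN f sf (fun i => y ^+ (N.-1 - i)).
pose t := (N.-1 - m)%N.
(* Elements whose residue is a combination of the powers of [y] below [t] with coefficients in F[x].
   Once [y ^+ t] belongs to [V], so do all powers. *)
pose V v := exists h : nat -> {poly F}, max_ideal P (v - \sum_(i < t) ev (h i) x * y ^+ i).
have Pev h : P (ev h x) by apply: ev_point; auto.
have V0 v : max_ideal P v -> V v.
  by move=> mv; exists (fun _ => 0); rewrite big1 ?subr0 // => i _; rewrite rmorph0 horner0 mul0r.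
have VD u v : V u -> V v -> V (u + v).
  move=> [h1 m1] [h2 m2]; exists (fun i => h1 i + h2 i).
  under eq_bigr do rewrite rmorphD hornerD mulrDl.
  by rewrite big_split opprD addrACA; apply: miD.
have VM p v : V v -> V (ev p x * v).
  move=> [h1 m1]; exists (fun i => p * h1 i).
  under eq_bigr do rewrite evM -mulrA.
  by rewrite -mulr_sumr -mulrBr; apply: miMl.
have Vsum n (u : 'I_n -> E) : (forall i, V (u i)) -> V (\sum_i u i).
  by move=> h; elim/big_ind: _ => //; apply: V0; apply: mi0.
have Vlt i : (i < t)%N -> V (y ^+ i).
  move=> it; exists (fun j => if j == i then 1 else 0).
  rewrite (bigD1 (Ordinal it)) //= eqxx rmorph1 hornerC mul1r big1 ?addr0 ?subrr; first exact: mi0.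
  by move=> j; rewrite -val_eqE /= => /negPf ->; rewrite rmorph0 horner0 mul0r.
have Vt : V (y ^+ t).
  have [h mh] := min_eq_inv cP Px mf gm.
  have Vg : V (ev (g m) x * y ^+ t).
    move: e; rewrite -(big_mkord xpredT (fun i => ev (g i) x * y ^+ (N.-1 - i))).
    rewrite (big_cat_nat (n := m)) ?(ltnW mN) //= [X in _ + X]big_ltn //.
    rewrite addrCA => /eqP; rewrite addr_eq0 => /eqP ->; rewrite opprD.
    apply: VD.
      apply: V0; apply: miN; auto; rewrite big_nat; apply: mi_sum => // i /andP[_ im].
      apply: miMr; [by []|exact: srX|]; apply/(min_eqP _ _ Px mf); [exact: clc|exact: lm].
    have -> : - \sum_(m.+1 <= i < N) ev (g i) x * y ^+ (N.-1 - i) =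
       \sum_(i < N - m.+1) ev (- g (i + m.+1)%N) x * y ^+ (N.-1 - (i + m.+1)).
      rewrite -{1}[m.+1]add0n big_addn big_mkord -sumrN; apply: eq_bigr => i _.
      by rewrite rmorphN hornerN mulNr.
    apply: Vsum => i; apply: VM; apply: Vlt; rewrite /t.
    move: (nat_of_ord i) (ltn_ord i) => j; case: (N) mN => // N' _; rewrite subSS /= => jlt.
    rewrite ltn_sub2l ?addnS ?ltnS ?leq_addl // -subn_gt0; exact: leq_ltn_trans jlt.
  have -> : y ^+ t = ev h x * (ev (g m) x * y ^+ t) + - (ev h x * ev (g m) x - 1) * y ^+ t.
    by rewrite mulNr mulrBl mul1r opprB mulrA addrCA subrr addr0.
  apply: VD; first exact: VM.
  by apply: V0; apply: miMr; [by []|exact: srX|exact: miN].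
have VS v : V v -> V (y * v).
  move=> [h mh]; have -> : y * v = y * (v - \sum_(i < t) ev (h i) x * y ^+ i) +
      \sum_(i < t) ev (h i) x * y ^+ i.+1.
    rewrite mulrBr -[LHS]addr0 -addrA; congr (_ + _); rewrite mulr_sumr addrC -sumrB big1 // => i _.
    by rewrite exprS mulrCA subrr.
  apply: VD; first by apply: V0; apply: miMl.
  apply: Vsum => i; apply: VM; have := ltn_ord i; rewrite leq_eqVlt => /orP[/eqP->//|]; exact: Vlt.
have Ve n : V (y ^+ n).
  elim: n => [|n IH]; last by rewrite exprS; apply: VS.
  case: (posnP t) => [t0|/Vlt//]; by move: Vt; rewrite t0.
(* Coefficients reduced modulo [f] range over a finite set because [F] is finite, so two powers of
   [y] have the same residue. *)
pose T := {ffun 'I_t * 'I_(size f) -> F}.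
have /choice[c hc] (n : nat) : exists c : T, max_ideal P (y ^+ n -
    \sum_(i < t) (\sum_(j < size f) iota (c (i, j)) * x ^+ j) * y ^+ i).
  have [h mh] := Ve n; exists [ffun ij : 'I_t * 'I_(size f) => (h ij.1 %% f)`_(ij.2)].
  have -> : y ^+ n - \sum_(i < t) (\sum_(j < size f)
       iota ([ffun ij : 'I_t * 'I_(size f) => (h ij.1 %% f)`_ij.2] (i, j)) * x ^+ j) * y ^+ i =
    (y ^+ n - \sum_(i < t) ev (h i) x * y ^+ i) + \sum_(i < t) ev (h i %/ f) x * ev f x * y ^+ i.
    rewrite -addrA; congr (_ + _); rewrite -sumrN -sumrN -big_split; apply: eq_bigr => i _ /=.
    rewrite (eq_bigr (fun j : 'I_(size f) => iota (h i %% f)`_j * x ^+ j)) => [|j _]; last by rewrite ffunE.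
    rewrite -evE; last by apply: ltnW; rewrite ltn_modp.
    rewrite {2}(divp_eq (h i) f) rmorphD hornerD evM mulrDl; ring.
  apply: miD => //; apply: mi_sum => // i _; apply: miMr; [by []|exact: srX|]; exact: miMl.
have /injectivePn[a [b ab eab]] : ~~ injectiveb (fun i : 'I_(#|{: T}|.+1) => c i).
  by apply/negP => /injectiveP/leq_card; rewrite card_ord ltnn.
exists ('X^a - 'X^b).
  apply/eqP => /(congr1 (fun p : {poly F} => p`_a)); rewrite coefB !coefXn eqxx coef0.
  by rewrite val_eqE (negPf ab) subr0 => /eqP; rewrite oner_eq0.
rewrite rmorphB hornerD hornerN /= !map_polyXn !hornerXn.
have := miB vP (hc a) (hc b); rewrite eab opprB addrA subrK; exact.
Qed.

End Residue.

(** * Regularity of coordinates *)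

Section RegularCoordinates.
Variables (k L : finFieldType) (E0 E : fieldType) (j0 : {rmorphism k -> E0}).
Variables (j : {rmorphism L -> E}) (X : const_ext j0 j).
Variables (n : nat) (b : 'I_n -> L).
Hypothesis bb : ce_basis X b.
Local Notation phi := (ce_phi X).

Lemma spre_preim t P : phi @^-1` (spre X t P) = phi @^-1` P.
Proof. by apply/seteqP; split=> x; rewrite /preimage /spre /= ce_iter_phi. Qed.

(** A coordinate is a combination of conjugates of the element by the Moore formula. Their
    regularity at [P] is regularity of the element at the conjugates of [P], all of which lie over
    the same point. *)
Lemma coord_regular (S : set (set E0)) (x : 'I_n -> E0) :
  (forall P, closed_point j P -> S (phi @^-1` P) -> P (\sum_l phi (x l) * j (b l))) ->
  forall Q, closed_point j0 Q -> S Q -> forall l, Q (x l).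
Proof.
move=> hP Q cQ SQ l; have [P [cP eP]] := lying_over bb cQ.
have vP : valring P := closed_valring cP.
have [D hD] := ce_moore bb; rewrite -eP /preimage /= hD.
have sP := vr_sub vP.
apply: sr_sum => // t _; apply: srM => //; last by apply: curve_const; case: cP.
suff : spre X t P (\sum_l phi (x l) * j (b l)) by [].
by apply: hP; [exact: (spre_closed bb) | rewrite spre_preim eP].
Qed.

End RegularCoordinates.

Section AffineCurve.
Variables (k : finFieldType) (C : curve k) (L : finFieldType) (X : base_curve C L).
Implicit Types (P Q : set X).
Local Notation cl := (closed_point (jL X)).
Local Notation AL := (ring_AL X).
Local Notation ev f x := (map_poly (jL X) f).[x].
Let clv P : cl P -> valring P := @closed_valring _ _ (jL X) P.
Let clc P : cl P -> curve_point (jL X) P := @closed_curve _ _ (jL X) P.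
#[local] Hint Resolve clv clc : core.
Let ff := base_function_field X.

Definition affine P := cl P /\ ~ over_oo P.

Lemma affine_closed P : affine P -> cl P. Proof. by case. Qed.
#[local] Hint Resolve affine_closed : core.

Lemma AL_affine w P : AL w -> affine P -> P w.
Proof.
case=> n [a [x [h ->]]] aP; have [cP oP] := aP; have vP := clv cP.
apply: sr_sum; auto => i _; have [[u _ <-] [v vA <-]] := h i.
apply: srM; auto; first by apply: curve_const; auto.
by apply: (vA (jQ X @^-1` P)) => //; apply: jQ_preim_closed.
Qed.

Lemma AL_coord n (b : 'I_n -> L) w : ce_basis (ce_base X) b -> (forall P, affine P -> P w) ->
  exists2 x : 'I_n -> C, forall l, ring_A (x l) & w = \sum_l jQ X (x l) * jL X (b l).
Proof.
move=> bb h; have [x ew] := ce_coord bb w; exists x => // l Q cQ nQ.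
apply: (coord_regular bb (S := [set Q | Q <> oo]) _ cQ nQ).
by move=> P cP nP; have := h P; rewrite ew; apply; split.
Qed.

(** Regularity at the affine points forces the coordinates into A, so the span of A over [L] is the
    full ring of functions on the affine curve. *)
Lemma ring_ALP w : AL w <-> forall P, affine P -> P w.
Proof.
split; first by move=> Aw P; apply: AL_affine.
have [n [b bb]] := ce_basis_ex (ce_base X).
move=> /(AL_coord bb)[x Ax ->]; exists n, (fun l => jL X (b l)), (fun l => jQ X (x l)).
split; first by move=> l; split; [exists (b l) | exists (x l)].
by apply: eq_bigr => l _; rewrite mulrC.
Qed.

Lemma AL_subring : subring AL.
Proof.
split; [|move=> x y|move=> x y]; rewrite !ring_ALP.
- by move=> P aP; apply: sr1; auto.
- by move=> hx hy P aP; apply: srB; [auto | apply: hx | apply: hy].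
- by move=> hx hy P aP; apply: srM; [auto | apply: hx | apply: hy].
Qed.

Lemma AL_const a : AL (jL X a).
Proof. by apply/ring_ALP => P aP; apply: curve_const; auto. Qed.

Lemma AL_jQ x : ring_A x -> AL (jQ X x).
Proof. by move=> Ax; apply/ring_ALP => P [cP oP]; apply: (Ax (jQ X @^-1` P)) => //; apply: jQ_preim_closed. Qed.

Lemma over_oo_ex : exists2 P, cl P & over_oo P.
Proof.
have [n [b bb]] := ce_basis_ex (ce_base X).
have [cO _] := oo_rational C.
by have [P [cP eP]] := lying_over bb cO; exists P.
Qed.

(** A function in A with a pole at infinity. Its image [y] in the function field of C_L tells the
    affine points from the one at infinity, and polynomials in it are used to clear poles. For
    motives it comes from [pure_pole]. *)
Variable (x0 : C).
Hypotheses (Ax0 : ring_A x0) (x0oo : ~ oo x0).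
Local Notation y := (jQ X x0).

Lemma pole_transc : transc (jL X) y.
Proof.
apply: contrapT => nt; have [P cP oP] := over_oo_ex.
by have := algebraic_regular cP nt; rewrite -[P _]/((jQ X @^-1` P) x0) oP.
Qed.

Lemma affine_of_mem P : cl P -> P y -> affine P.
Proof.
by move=> cP Py; split=> // oP; apply: x0oo; rewrite -oP.
Qed.

Lemma affine_y P : affine P -> P y.
Proof. by apply: AL_affine; apply: AL_jQ. Qed.

Lemma affine_ex : exists P, affine P.
Proof.
have [P [cP nP]] := transc_pole (transc_inv pole_transc).
by exists P; apply: affine_of_mem => //; have [_ /(_ y)[]] := clv cP.
Qed.

Lemma affine_min_eq P : affine P -> exists f, min_eq (jL X) P y f.
Proof.
move=> aP; have [f f0 mf] := residue_algebraic ff (affine_closed aP) (affine_y aP).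
exact: min_eq_ex (affine_closed aP) (affine_y aP) f0 mf.
Qed.

(* An approximating element has poles only where [f y] is a unit, [f] being the minimal
   equation of [y] at [P]; these are removed by the minimal equations of [y] there. *)
Lemma affine_separate P (Z : set (set X)) : affine P -> finite_set Z -> ~ Z P ->
  exists s, [/\ AL s, ~ max_ideal P s & forall Q, affine Q -> Z Q -> max_ideal Q s].
Proof.
move=> aP fZ nZ; have cP := affine_closed aP; have vP := clv cP.
have [f mf] := affine_min_eq aP; have [sf mfy hf] := mf.
have f0 : f != 0 by rewrite -size_poly_gt0 ltnW.
have fy0 : ev f y != 0 by apply: contra_neq f0; apply: pole_transc.
have [n [W [cW hW]]] : exists n (W : nat -> set X), (forall i, (i < n)%N -> cl (W i)) /\
    forall Q, cl Q -> Z Q \/ max_ideal Q (ev f y) -> exists2 i, (i < n)%N & W i = Q.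
  have fin : finite_set [set Q | cl Q /\ (Z Q \/ max_ideal Q (ev f y))].
    apply: (@sub_finite_set _ _ (Z `|` [set Q | cl Q /\ ~ Q (ev f y)^-1])).
      by move=> Q [cQ [zQ|mQ]]; [left | right; split=> //; apply: inv_mi].
    by rewrite finite_setU; split=> //; apply: finite_poles.
  have [n [W [h1 h2]]] := finite_enum fin; exists n, W; split; first by move=> i /h1[].
  by move=> Q cQ hQ; apply: h2.
have [z [mz hz]] := approx ff cP cW.
have Pz : P z by rewrite -(subrK 1 z); apply: srD; auto; [apply: mi_sub mz | apply: sr1; auto].
have nz : ~ max_ideal P z.
  by move=> m; apply: (mi1 (vr_sub vP)); rewrite -(subKr z 1); apply: miB.
have [n' [R [hR cR]]] : exists n (R : nat -> set X),
    (forall i, (i < n)%N -> affine (R i) /\ ~ R i z) /\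
    forall Q, affine Q /\ ~ Q z -> exists2 i, (i < n)%N & R i = Q.
  apply: (finite_enum (A := [set Q | affine Q /\ ~ Q z])).
  by apply: sub_finite_set (finite_poles ff z) => Q [[cQ _] nQ].
have /choice[g hg] (i : nat) : exists g, (i < n')%N ->
    [/\ max_ideal (R i) (ev g y), ~ max_ideal P (ev g y) &
        exists N, max_ideal (R i) (ev g y ^+ N * z)].
  have [lt|] := ltnP i n'; last by exists 0.
  have [aR nR] := hR i lt; have cRi := affine_closed aR; have vR := clv cRi.
  have [g mg] := affine_min_eq aR; have [sg mgy hg] := mg; exists g => _; split=> //.
    (* [R i] is a pole of [z], hence not a zero of [f y]. So [g] does not divide [f] and is coprime
       to it, and [g y] cannot vanish at [P]. *)
    move=> /hf fg; have nfR : ~~ (g %| f).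
      apply/negP => /(min_eqP f (clc cRi) (affine_y aR) mg) mfR.
      have [i' lt' eW] := hW _ cRi (or_intror mfR).
      apply: nR; apply: mi_sub; rewrite -eW; apply: hz => //; rewrite eW => eRP.
      by have := hR i lt; rewrite eRP; case.
    have := min_eq_coprime cRi (affine_y aR) mg nfR => /(coprimep_dvdr fg).
    by rewrite coprimepp => /eqP sf1; rewrite sf1 in sf.
  by have [N hN] := rank_one ff z cRi mgy; exists N; apply: hN.
have /choice[N hN] (i : nat) : exists N, (i < n')%N -> max_ideal (R i) (ev (g i) y ^+ N * z).
  have [lt|] := ltnP i n'; last by exists 0%N.
  by have [_ _ [N hN]] := hg i lt; exists N.
have Pg Q i : affine Q -> Q (ev (g i) y) by move=> aQ; apply: ev_point (clc (affine_closed aQ)) (affine_y aQ).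
exists (\prod_(i < n') ev (g i) y ^+ N i * z); split.
- apply/ring_ALP => Q aQ; have vQ := clv (affine_closed aQ).
  have [Qz|nQ] := pselect (Q z).
    by apply: srM; auto; apply: sr_prod; auto => i _; apply: srX; [auto | exact: Pg].
  have [i lt eQ] := cR Q (conj aQ nQ).
  rewrite (bigD1 (Ordinal lt)) //= mulrAC; apply: srM; auto.
    by rewrite -eQ; apply: mi_sub; apply: hN.
  by apply: sr_prod; auto => l _; apply: srX; [auto | exact: Pg].
- apply: isu_nmi; apply: isuM; auto; last exact: nmi_isu.
  apply: big_ind; [by apply: isu1; auto | by move=> u v; apply: isuM; auto |].
  move=> i _; apply: isuX; [auto | apply: nmi_isu; first exact: Pg].
  by have [] := hg i (ltn_ord i).
- move=> Q aQ ZQ; have vQ := clv (affine_closed aQ); apply: miMl; auto.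
    by apply: sr_prod; auto => i _; apply: srX; [auto | exact: Pg].
  have [i lt eW] := hW _ (affine_closed aQ) (or_introl ZQ).
  by rewrite -eW; apply: hz => //; rewrite eW => eQP; apply: nZ; rewrite -eQP.
Qed.

(** If 1 were missing, Chevalley's theorem would give a valuation ring that contains A_L and has [I]
    in its maximal ideal. It is a closed point because [I] contains a nonzero element, and an affine
    one because it contains [y]; so [I] would have a zero. *)
Lemma affine_ideal_one (I : set X) : submodule (V := X^o) AL I -> I `<=` AL ->
  (forall P, affine P -> exists2 a, I a & ~ max_ideal P a) -> I 1.
Proof.
move=> sI IAL h; apply: contrapT => n1.
have n1' : ~ ideal_span AL I 1 by rewrite /ideal_span lspan_id //; apply: sr1 AL_subring.
have [P [vP ALP Im]] := chevalley AL_subring IAL n1'.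
have [P1 aP1] := affine_ex; have [a Ia na] := h P1 aP1.
have a0 : a != 0 by apply: contra_notN na => /eqP ->; apply: mi0; auto.
have cP : cl P by apply: (valring_closed vP _ a0) (Im _ Ia) => c; apply: ALP; apply: AL_const.
have aP : affine P by apply: affine_of_mem => //; apply: ALP; apply: AL_jQ.
by have [u Iu nu] := h P aP; apply: nu; apply: Im.
Qed.

End AffineCurve.

(** * Sections over the affine curve *)

Section Sections.
Variables (k : finFieldType) (C : curve k) (L : finFieldType) (X : base_curve C L).
Implicit Types (P Q : set X).
Local Notation cl := (closed_point (jL X)).
Local Notation AL := (ring_AL X).
Let clv P : cl P -> valring P := @closed_valring _ _ (jL X) P.
Let afc P : @affine k C L X P -> cl P := @affine_closed k C L X P.
#[local] Hint Resolve clv afc : core.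
Let ff := base_function_field X.

Definition Gamma r (N : sheaf X r) : set 'rV[X]_r :=
  [set v | forall P, cl P -> ~ over_oo P -> N P v].

Lemma Gamma_submod r (N : sheaf X r) : locally_free (jL X) N -> submodule AL (Gamma N).
Proof.
move=> lf; split=> [P cP oP|u v hu hv P cP oP|a v Aa hv P cP oP];
  have [s0 sD sZ] := stalk_submod lf cP => //.
  by apply: sD; [apply: hu | apply: hv].
by apply: sZ; [apply: (AL_affine Aa) | apply: hv].
Qed.

Lemma finite_nonsection r (N : sheaf X r) (v : 'rV[X]_r) : locally_free (jL X) N ->
  finite_set [set Q | cl Q /\ ~ N Q v].
Proof.
move=> /locally_freeP lf; have [P0 cP0] := closed_ex X.
have [U [B [_ fU uB hB]]] := lf P0 cP0.
apply: (@sub_finite_set _ _ ([set Q | cl Q /\ ~ U Q] `|` [set Q | cl Q /\ ~ mxover Q (v *m invmx B)])).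
  move=> Q [cQ nQ]; have [UQ|] := pselect (U Q); last by left.
  by right; split=> //; move: nQ; rewrite hB // free_onP.
by rewrite finite_setU; split=> //; apply: finite_mx_poles.
Qed.

(** Only finitely many points obstruct, all of them zeros of [s], and by [rank_one_mx] one power of
    [s] removes every obstruction. *)
Lemma power_section r (N : sheaf X r) (s : X) (v : 'rV[X]_r) : locally_free (jL X) N -> AL s ->
  (forall Q, affine Q -> ~ max_ideal Q s -> N Q v) -> exists M, Gamma N (s ^+ M *: v).
Proof.
move=> lf As h.
have fin : finite_set [set Q | affine Q /\ ~ N Q v].
  by apply: sub_finite_set (finite_nonsection v lf) => Q [[cQ _] nQ].
have [n [R [hR cR]]] := finite_enum fin.
have [M hM] : exists M, forall i, (i < n)%N -> N (R i) (s ^+ M *: v).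
  apply: (max_ev (A := fun i m => N (R i) (s ^+ m *: v))) => i lt.
  have [aR nR] := hR i lt; have cRi := afc aR.
  have ms : max_ideal (R i) s by apply: contrapT => nm; apply: nR; apply: h.
  have [B uB eB] := locally_free_stalk lf cRi.
  have [M hM] := rank_one_mx ff (v *m invmx B) cRi ms.
  exists M => m le; rewrite eB free_onP // -(subnK le) exprD -scalerA -!scalemxAl => i0 l0.
  rewrite mxE; apply: srM; auto; apply: srX; auto; exact: AL_affine aR.
exists M => Q cQ oQ; have aQ : affine Q by split.
have [_ _ sZ] := stalk_submod lf cQ.
have [NQ|nQ] := pselect (N Q v).
  by apply: sZ => //; apply: srX; auto; apply: AL_affine aQ.
by have [i lt <-] := cR Q (conj aQ nQ); apply: hM.
Qed.

Lemma locally_free_free r (B : 'M[X]_r) : B \in unitmx -> locally_free (jL X) (fun P => rspan P B).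
Proof.
move=> uB; apply/locally_freeP => P cP; exists setT, B; split=> //.
by rewrite (_ : [set Q | _] = set0) //; apply/seteqP; split=> // Q [_ []].
Qed.

Lemma Gamma_rspan r (B : 'M[X]_r) : B \in unitmx -> Gamma (fun P => rspan P B) = rspan AL B.
Proof.
move=> uB; apply/seteqP; split=> v.
  move=> h; rewrite free_onP // => i j; apply/ring_ALP => P [cP oP].
  by have := h P cP oP; rewrite free_onP.
by move=> [a Aa ->] P cP oP; exists a => // i j; apply: (AL_affine (Aa i j)).
Qed.

Variable (x0 : C).
Hypotheses (Ax0 : ring_A x0) (x0oo : ~ oo x0).

(** The functions outside whose zeros [N] has one common basis generate the unit ideal, because
    [affine_separate] finds one of them not vanishing at any prescribed point. *)
Lemma Gamma_locally_free r (N : sheaf X r) : locally_free (jL X) N ->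
  locally_free_module AL (Gamma N).
Proof.
move=> lf; split; first exact: Gamma_submod.
pose S : set X := [set s | AL s /\ exists2 B : 'M[X]_r, B \in unitmx &
  forall Q, affine Q -> ~ max_ideal Q s -> N Q = rspan Q B].
have sAL := AL_subring X.
have subAL : submodule (V := X^o) AL AL.
  by split=> [|u v Au Av|u v Au Av]; [exact: sr0|exact: srD|exact: srM].
have [n [a [s [h e1]]]] : ideal_span AL S 1.
  apply: (affine_ideal_one Ax0 x0oo).
  - exact: lspan_submod.
  - by apply: (lspan_min (V := X^o) subAL) => s [].
  move=> P aP; have cP := afc aP.
  have [U [B [UP fU uB hB]]] := (locally_freeP (jL X) N).2 lf P cP.
  have [s [As ns hs]] := affine_separate Ax0 x0oo aP fU (fun h => h.2 UP).
  exists s => //; apply: lspan_mem; [exact: sr1|]; split=> //; exists B => // Q aQ nm.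
  apply: hB; auto; apply: contrapT => nU; apply: nm; apply: hs => //; split; auto.
exists n, s; split.
- by move=> i; have [_ []] := h i.
- by exists a; [move=> i; have [] := h i | rewrite e1].
move=> i; have [_ [As [B uB hB]]] := h i; exists B => // v.
rewrite free_on_rspan -Gamma_rspan //.
split=> -[m hm].
  have [||M hM] := power_section (N := fun P => rspan P B) (v := s i ^+ m *: v) _ As.
  - exact: locally_free_free.
  - by move=> Q aQ nm; rewrite -hB //; apply: hm; case: aQ.
  by exists (M + m)%N; rewrite exprD -scalerA.
have [||M hM] := power_section (N := N) (v := s i ^+ m *: v) _ As => //.
  by move=> Q aQ nm; rewrite hB //; apply: hm; case: aQ.
by exists (M + m)%N; rewrite exprD -scalerA.
Qed.

(** The functions [a] for which [a *: w] lifts to a section form an ideal. A lift at [P], multiplied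
    by a power of a function vanishing at the other points where it fails to be a section, shows
    that [P] is not a zero of the ideal. *)
Lemma Gamma_img r r' (N : sheaf X r) (p : 'M[X]_(r, r')) : locally_free (jL X) N ->
  Gamma (fun P => mximg p (N P)) = mximg p (Gamma N).
Proof.
move=> lf; apply/seteqP; split=> w; last first.
  by move=> [v hv <-] P cP oP; exists v => //; apply: hv.
move=> hw; pose I : set X := [set a | AL a /\ mximg p (Gamma N) (a *: w)].
have sAL := AL_subring X.
have [s0 sD sZ] := mximg_submod p (Gamma_submod lf).
suff [_] : I 1 by rewrite scale1r.
apply: (affine_ideal_one Ax0 x0oo).
- split.
  + by split; [exact: sr0 | rewrite scale0r].
  + by move=> u v [Au hu] [Av hv]; split; [exact: srD | rewrite scalerDl; apply: sD].
  + by move=> u v Au [Av hv]; split; [exact: srM | rewrite -scalerA; apply: sZ].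
- by move=> a [].
move=> P aP; have [cP oP] := aP; have [v Nv ev] := hw P cP oP.
have [s [As ns hs]] := affine_separate Ax0 x0oo aP (finite_nonsection v lf) (fun h => h.2 Nv).
have [M hM] : exists M, Gamma N (s ^+ M *: v).
  apply: power_section => // Q aQ nm; apply: contrapT => nQ; apply: nm; apply: hs => //.
  by split; auto.
exists (s ^+ M); last by move=> h; apply: ns; apply: (miX _ _ h); [auto | apply: AL_affine aP].
split; first exact: srX.
by exists (s ^+ M *: v) => //; rewrite -scalemxAl ev.
Qed.

End Sections.

(** * Pure Anderson motives *)

Section PureMotives.
Variables (k : finFieldType) (C : curve k) (L : finFieldType) (X : base_curve C L).
Implicit Types (P Q : set X).
Local Notation cl := (closed_point (jL X)).
Local Notation AL := (ring_AL X).
Local Notation s := (sigma X).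
Let clv P : cl P -> valring P := @closed_valring _ _ (jL X) P.
#[local] Hint Resolve clv : core.
Let ff := base_function_field X.
Let sAL := AL_subring X.

Fixpoint taup r (T : 'M[X]_r) l : 'M[X]_r :=
  if l is l'.+1 then map_mx s (taup T l') *m T else 1%:M.

Lemma tau_powE (M : motive X) l : tau_pow M l = taup (mo_tau M) l.
Proof. by elim: l => //= l ->. Qed.

Lemma taup_unit r (T : 'M[X]_r) l : T \in unitmx -> taup T l \in unitmx.
Proof. by move=> uT; elim: l => [|l IH] /=; rewrite ?unitmx1 // unitmx_mul map_unitmx IH. Qed.

Lemma taup_unit_inv r (T : 'M[X]_r) l : (0 < l)%N -> taup T l \in unitmx -> T \in unitmx.
Proof. by case: l => //= l _; rewrite unitmx_mul => /andP[]. Qed.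

Lemma taup_hom r r' (p : 'M[X]_(r, r')) T T' l : T *m p = map_mx s p *m T' ->
  taup T l *m p = map_mx (rmorph_iter s l) p *m taup T' l.
Proof.
move=> e; elim: l => [|l IH] /=.
  by rewrite mul1mx mulmx1; apply/matrixP => i j; rewrite mxE.
rewrite -mulmxA e !mulmxA -map_mxM IH map_mxM; congr (_ *m _ *m _).
by apply/matrixP => i j; rewrite !mxE.
Qed.

Lemma taup_block r1 r2 (S : 'M[X]_r1) (T : 'M[X]_r2) l :
  taup (block_mx S 0 0 T) l = block_mx (taup S l) 0 0 (taup T l).
Proof.
elim: l => [|l IH] /=; first by rewrite scalar_mx_block.
by rewrite IH map_block_mx !raddf0 mulmx_block !mulmx0 !mul0mx !addr0 !add0r.
Qed.

(** [sigma] fixes the point over infinity, so iterated pullbacks stay in a single stalk. *)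
Lemma iter_pullback_oo r (N : sheaf X r) P (B : 'M[X]_r) l : cl P -> over_oo P ->
  N P = rspan P B -> iter l (pullback s (r := r)) N P = rspan P (map_mx (rmorph_iter s l) B).
Proof.
move=> cP oP e; elim: l => [|l IH] /=.
  by rewrite e; congr rspan; apply/matrixP => i j; rewrite mxE.
rewrite (pullback_stalk (B := map_mx (rmorph_iter s l) B) cP) ?preim_oo //.
by congr rspan; apply/matrixP => i j; rewrite !mxE.
Qed.

Lemma twist_oo r (N : sheaf X r) P t (B : 'M[X]_r) (m : int) : cl P -> over_oo P ->
  uniformizer (jQ X @^-1` P) t -> N P = rspan P B ->
  twist (div_oo m) N P = rspan P (jQ X t ^ (- m) *: B).
Proof.
by move=> cP oP ut e; rewrite (twist_rspan _ cP ut e) /div_oo asboolT.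
Qed.

Definition tau_image r (T : 'M[X]_r) (M : set 'rV[X]_r) : set 'rV[X]_r :=
  mximg T (extend_scalars s AL M).

(** Normal form of a pure motive: the extension [N] to the projective curve is explicit, and the
    module is recovered as its sections. It is [N] that is carried through quotients, sums and base
    change. *)
Record pmot (c : C -> L) (m l r d : nat) (T : 'M[X]_r) (N : sheaf X r) : Prop := PMot {
  pm_m : (0 < m)%N;
  pm_l : (0 < l)%N;
  pm_T : T \in unitmx;
  pm_lf : locally_free (jL X) N;
  pm_tau : tau_image T (Gamma N) `<=` Gamma N;
  pm_co : has_codim (jL X) (tau_image T (Gamma N)) (Gamma N) d;
  pm_kill : power_kills (motive_ideal (X:=X) c) d (tau_image T (Gamma N)) (Gamma N);
  pm_pure : forall P, cl P -> over_oo P ->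
    mximg (taup T l) (iter l (pullback s (r := r)) N P) = twist (div_oo m%:Z) N P }.

Lemma tau_image_submod r (T : 'M[X]_r) M : submodule AL (tau_image T M).
Proof. exact/mximg_submod/lspan_submod. Qed.

Lemma AL_const_submod r (M : set 'rV[X]_r) : submodule AL M -> submodule (range (jL X)) M.
Proof. by apply: submod_const => a; apply: AL_const. Qed.

(** An iterate of tau is injective on a lattice at infinity, so [mo_tau] is invertible over the
    function field. *)
Lemma pure_pmot c (M : motive X) : pure_motive c M -> exists m l N,
  mo_M M = Gamma N /\ pmot c m l (mo_dim M) (mo_tau M) N.
Proof.
move=> [_ [tM _] co kl [N [lf eM [m [l [m0 l0 pu]]]]]].
exists m, l, N; split=> //; rewrite -[[set _ | _]]/(Gamma N) in eM.
split=> //; rewrite /tau_image -?eM //; last first.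
  by move=> P cP oP; have [_ <-] := pu P cP oP; rewrite tau_powE.
have [P cP oP] := over_oo_ex X; have [inj _] := pu P cP oP.
have [B uB eB] := locally_free_stalk lf cP.
apply: (taup_unit_inv l0); rewrite -tau_powE -row_free_unit.
apply: (mxinj_on_row_free (P := P) (B := map_mx (rmorph_iter s l) B)); auto.
  by rewrite map_unitmx.
by rewrite -(iter_pullback_oo l cP oP eB).
Qed.

Lemma graph_gens_AL (c : C -> L) : graph_gens (X:=X) (@ring_A k C) c `<=` AL.
Proof. by move=> u [x Ax ->]; apply: srB => //; [apply: AL_jQ | apply: AL_const]. Qed.

Lemma motive_ideal_sub c : motive_ideal (X:=X) c `<=` AL.
Proof.
have sub : submodule (V := X^o) AL AL.
  by split=> [|u v|u v]; [exact: sr0 | exact: srD | exact: srM].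
exact: (lspan_min sub (graph_gens_AL (c := c))).
Qed.

(** Sections of the image are images of sections, so the cokernel is a quotient of the old one: it
    is finite and annihilated by the old power of the ideal, which [power_kills_codim] lowers to the
    new dimension. Purity is carried over by [taup_hom]. *)
Lemma pmot_img c m l r d T (N : sheaf X r) r' (p : 'M[X]_(r, r')) T' (x0 : C) :
  ring_A x0 -> ~ oo x0 -> pmot c m l d T N -> row_full p -> T *m p = map_mx s p *m T' ->
  exists d', pmot c m l d' T' (fun P => mximg p (N P)).
Proof.
move=> Ax0 x0oo h fp e; have lf := pm_lf h.
have uT' : T' \in unitmx.
  rewrite -row_full_unit; apply: (row_full_mulr (A := map_mx s p)); rewrite -e.
  by apply: row_full_mul => //; rewrite row_full_unit; apply: pm_T h.
have eG := Gamma_img Ax0 x0oo p lf.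
have eI : tau_image T' (Gamma (fun P => mximg p (N P))) = mximg p (tau_image T (Gamma N)).
  by rewrite eG /tau_image extend_scalars_img !mximg_comp -e.
have sI := tau_image_submod T (Gamma N); have sG := Gamma_submod lf.
have [d' hd'] := has_codim_img p (AL_const_submod sI) (pm_co h).
exists d'; split; rewrite ?eI ?eG //.
- exact: pm_m h.
- exact: pm_l h.
- exact: locally_free_img.
- exact/mximg_mono/(pm_tau h).
- apply: (power_kills_codim sAL _ (motive_ideal_sub (c := c)) _ _ _ _ hd').
  + by move=> a; apply: AL_const.
  + exact: lspan_submod.
  + exact: mximg_submod.
  + exact: mximg_submod.
  + by move=> x _ hx [v Gv <-]; rewrite scalemxAl; exists (\prod_i x i *: v) => //; apply: pm_kill h _ _ hx Gv.
- move=> P cP oP; have [B uB eB] := locally_free_stalk lf cP.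
  rewrite twist_img // -?(pm_pure h) // ?mximg_comp; last by apply: stalk_submod.
  have -> : iter l (pullback s (r := r')) (fun P => mximg p (N P)) P =
     mximg (map_mx (rmorph_iter s l) p) (iter l (pullback s (r := r)) N P).
    elim: {+}l P {cP oP B uB eB} => [|l' IH] P /=.
      by congr mximg; apply/matrixP => i j; rewrite mxE.
    rewrite (_ : iter l' _ _ = fun P => mximg (map_mx (rmorph_iter s l') p) (iter l' (pullback s (r := r)) N P)).
      by rewrite pullback_img; congr mximg; apply/matrixP => i j; rewrite !mxE.
    by apply/funext => Q; apply: IH.
  by rewrite mximg_comp (taup_hom l e).
Qed.

Lemma extend_scalars_dsum (E E' : fieldType) (phi : {rmorphism E -> E'}) (R : set E') r1 r2
    (M : set 'rV[E]_r1) (N : set 'rV[E]_r2) : subring R -> M 0 -> N 0 ->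
  extend_scalars phi R (dsum M N) = dsum (extend_scalars phi R M) (extend_scalars phi R N).
Proof.
move=> sR M0 N0; have sM := lspan_submod (map_mx phi @` M) sR.
have sN := lspan_submod (map_mx phi @` N) sR.
have sMN := lspan_submod (map_mx phi @` (dsum M N)) sR.
apply/seteqP; split.
  apply: lspan_min; first exact: dsum_submod.
  move=> _ [v [Mv Nv] <-]; split.
    by rewrite -map_lsubmx; apply: lspan_mem; [exact: sr1 | exists (lsubmx v)].
  by rewrite -map_rsubmx; apply: lspan_mem; [exact: sr1 | exists (rsubmx v)].
have hl : extend_scalars phi R M `<=` [set v | extend_scalars phi R (dsum M N) (row_mx v 0)].
  apply: lspan_min.
    have [z a sc] := sMN; split => [|u v hu hv|x v Rx hv] /=; first by rewrite row_mx0.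
      by have := a _ _ hu hv; rewrite add_row_mx addr0.
    by have := sc x _ Rx hv; rewrite scale_row_mx scaler0.
  move=> _ [v Mv <-] /=; apply: lspan_mem; first exact: sr1.
  by exists (row_mx v 0); [split; rewrite ?row_mxKl ?row_mxKr | rewrite map_row_mx raddf0].
have hr : extend_scalars phi R N `<=` [set v | extend_scalars phi R (dsum M N) (row_mx 0 v)].
  apply: lspan_min.
    have [z a sc] := sMN; split => [|u v hu hv|x v Rx hv] /=; first by rewrite row_mx0.
      by have := a _ _ hu hv; rewrite add_row_mx addr0.
    by have := sc x _ Rx hv; rewrite scale_row_mx scaler0.
  move=> _ [v Mv <-] /=; apply: lspan_mem; first exact: sr1.
  by exists (row_mx 0 v); [split; rewrite ?row_mxKl ?row_mxKr | rewrite map_row_mx raddf0].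
move=> v [/hl h1 /hr h2]; have [_ a _] := sMN; have := a _ _ h1 h2.
by rewrite add_row_mx addr0 add0r hsubmxK.
Qed.

Lemma Gamma_dsum r1 r2 (M : sheaf X r1) (N : sheaf X r2) :
  Gamma (fun P => dsum (M P) (N P)) = dsum (Gamma M) (Gamma N).
Proof.
apply/seteqP; split=> v; first by move=> h; split=> P cP oP; case: (h P cP oP).
by move=> [h1 h2] P cP oP; split; [apply: h1 | apply: h2].
Qed.

Lemma pmot_dsum c m l r1 r2 d1 d2 S T (M : sheaf X r1) (N : sheaf X r2) :
  pmot c m l d1 S M -> pmot c m l d2 T N ->
  pmot c m l (d1 + d2) (block_mx S 0 0 T) (fun P => dsum (M P) (N P)).
Proof.
move=> h1 h2; have [lM lN] := (pm_lf h1, pm_lf h2).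
have sM := Gamma_submod lM; have sN := Gamma_submod lN.
have [M0 _ _] := sM; have [N0 _ _] := sN.
have sI1 := tau_image_submod S (Gamma M); have sI2 := tau_image_submod T (Gamma N).
have eI : tau_image (block_mx S 0 0 T) (Gamma (fun P => dsum (M P) (N P))) =
    dsum (tau_image S (Gamma M)) (tau_image T (Gamma N)).
  by rewrite Gamma_dsum /tau_image extend_scalars_dsum // mximg_dsum.
split; rewrite ?eI ?Gamma_dsum.
- exact: pm_m h1.
- exact: pm_l h1.
- by rewrite unitmxE det_ublock unitrM -!unitmxE (pm_T h1) (pm_T h2).
- exact: locally_free_dsum.
- exact: dsum_mono (pm_tau h1) (pm_tau h2).
- by apply: has_codim_dsum (pm_co h1) (pm_co h2) => //; [case: sI1 | case: sI2].
- have k1 : power_kills (motive_ideal (X:=X) c) (d1 + d2) (tau_image S (Gamma M)) (Gamma M).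
    apply: power_killsS (pm_kill h1); have [z a sc] := sM; split=> // x v /motive_ideal_sub; exact: sc.
  have k2 : power_kills (motive_ideal (X:=X) c) (d1 + d2) (tau_image T (Gamma N)) (Gamma N).
    rewrite addnC; apply: power_killsS (pm_kill h2).
    by have [z a sc] := sN; split=> // x v /motive_ideal_sub; exact: sc.
  move=> x v hx [hl hr]; split; rewrite linearZ /=; [exact: k1 | exact: k2].
- move=> P cP oP; have [A uA eA] := locally_free_stalk lM cP.
  have [B uB eB] := locally_free_stalk lN cP; have [t ut] := twist_unif cP.
  have eAB : dsum (M P) (N P) = rspan P (block_mx A 0 0 B) by rewrite rspan_block eA eB.
  rewrite (iter_pullback_oo l cP oP eAB) twist_dsum -?(pm_pure h1) -?(pm_pure h2) //.
  + rewrite (iter_pullback_oo l cP oP eA) (iter_pullback_oo l cP oP eB).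
    by rewrite map_block_mx !raddf0 rspan_block taup_block mximg_dsum.
  + by apply: stalk_submod.
  + by apply: stalk_submod.
Qed.

End PureMotives.

(** * From normal forms back to pure motives *)

Section PmotPure.
Variables (k : finFieldType) (C : curve k) (L : finFieldType) (X : base_curve C L).
Implicit Types (P Q : set X).
Local Notation cl := (closed_point (jL X)).
Local Notation AL := (ring_AL X).
Local Notation s := (sigma X).
Let clv P : cl P -> valring P := @closed_valring _ _ (jL X) P.
Let clc P : cl P -> curve_point (jL X) P := @closed_curve _ _ (jL X) P.
#[local] Hint Resolve clv clc : core.
Let ff := base_function_field X.
Let sAL := AL_subring X.

Definition mkmo r (d : nat) (T : 'M[X]_r) (N : sheaf X r) : motive X := Motive d (Gamma N) T.

Lemma pmot_pure c m l r d T (N : sheaf X r) (x0 : C) : ring_A x0 -> ~ oo x0 ->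
  pmot c m l d T N -> pure_motive c (mkmo d T N).
Proof.
move=> Ax0 x0oo h; have uT := pm_T h; split.
- exact: Gamma_locally_free Ax0 x0oo _ _ (pm_lf h).
- split; first exact: pm_tau h.
  by apply: row_free_mxinj; rewrite row_free_unit.
- exact: pm_co h.
- exact: pm_kill h.
exists N; split=> //; first exact: pm_lf h.
exists m, l; split; [exact: pm_m h | exact: pm_l h |] => P cP oP; split.
  by apply: row_free_mxinj; rewrite row_free_unit tau_powE taup_unit.
by rewrite tau_powE; apply: pm_pure h P cP oP.
Qed.

Lemma pmot_zero c m l : (0 < m)%N -> (0 < l)%N ->
  pmot (X := X) c m l 0 (1%:M : 'M_0) (fun _ => setT).
Proof.
move=> m0 l0; have e0 (S : set 'rV[X]_0) : S 0 -> S = setT by apply: flat_set.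
have er P (A : 'M[X]_0) : cl P -> rspan P A = setT.
  by move=> cP; apply: e0; have [] := rspan_submod A (vr_sub (clv cP)).
have sI := tau_image_submod (1%:M : 'M[X]_0) (Gamma (fun _ => setT)).
have eI : tau_image (1%:M : 'M[X]_0) (Gamma (fun _ => setT)) = setT.
  by apply: e0; case: sI.
have eG : Gamma (fun _ : set X => setT : set 'rV[X]_0) = setT by apply/seteqP.
split=> //; rewrite ?eI ?eG //.
- exact: unitmx1.
- apply/locally_freeP => P cP; exists setT, 1%:M; split=> //.
  + by rewrite (_ : [set Q | _] = set0) //; apply/seteqP; split=> // Q [_ []].
  + exact: unitmx1.
  + by move=> Q cQ _; rewrite er.
- exact: has_codim0.
move=> P cP oP; have eP : (setT : set 'rV[X]_0) = rspan P 1%:M by rewrite er.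
have [t ut] := twist_unif cP.
rewrite (iter_pullback_oo (N := fun _ => setT) l cP oP eP).
rewrite (twist_oo (N := fun _ => setT) m cP oP ut eP) mximg_rspan.
by rewrite !er.
Qed.

Lemma mkmo_eq r1 r2 d1 d2 (M : sheaf X r1) (N : sheaf X r2) S T :
  mo_add (mkmo d1 S M) (mkmo d2 T N) =
  mkmo (d1 + d2) (block_mx S 0 0 T) (fun P => dsum (M P) (N P)).
Proof. by rewrite /mo_add /mkmo /=; congr Motive; rewrite Gamma_dsum. Qed.

(** Treated directly, since a motive of rank 0 does not provide a function with a pole at
    infinity. *)
Lemma rank0_pure c (M : motive X) : mo_rk M = 0%N -> mo_dim M = 0%N -> mo_M M 0 ->
  pure_motive c M.
Proof.
case: M => r d M T /= r0 d0; move: M T; rewrite r0 d0 => M T M0.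
have -> : M = Gamma (fun _ => setT) by rewrite (flat_set M0); apply/esym/seteqP.
have -> : T = 1%:M by rewrite (flatmx0 T) (flatmx0 1%:M).
have h := pmot_zero c (ltn0Sn 0) (ltn0Sn 0).
split.
- split; first exact: Gamma_submod (pm_lf h).
  exists 1%N, (fun _ => 1); split; first by move=> _; apply: sr1.
    by exists (fun _ => 1); [move=> _; apply: sr1 | rewrite big_ord1 mul1r].
  move=> _; exists 1%:M; first exact: unitmx1.
  move=> v; rewrite (thinmx0 v); split=> _; exists 0%N; rewrite scaler0 //.
  by exists 0; [move=> j; rewrite mxE; apply: sr0 | rewrite mul0mx].
- split; first exact: pm_tau h.
  by move=> v _ _; rewrite (thinmx0 v).
- exact: pm_co h.
- exact: pm_kill h.
exists (fun _ => setT); split=> //; first exact: pm_lf h.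
exists 1%N, 1%N; split=> // P cP oP; split; first by move=> v _ _; rewrite (thinmx0 v).
by rewrite tau_powE; apply: pm_pure h P cP oP.
Qed.

Lemma rank0_dim c (M : motive X) : pure_motive c M -> mo_rk M = 0%N -> mo_dim M = 0%N.
Proof.
move=> /pure_pmot[m [l [N [_ h]]]] r0.
have sI := AL_const_submod (tau_image_submod (mo_tau M) (Gamma N)).
apply: (has_codim_uniq sI (pm_co h)); apply: flat_has_codim => //; by case: sI.
Qed.

(* Otherwise [det T] would be regular everywhere, up to [sigma]-coboundaries, against
   purity. *)
Lemma pure_pole c (M : motive X) : pure_motive c M -> mo_rk M <> 0%N ->
  exists2 x0 : C, ring_A x0 & ~ oo x0.
Proof.
move=> pM rM; apply: contrapT => no.
have Aoo (x : C) : ring_A x -> oo x by move=> Ax; apply: contrapT => nx; apply: no; exists x.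
have [n [b bb]] := ce_basis_ex (ce_base X).
(* Without such a function the elements of A_L would be regular at infinity as well, so by
   [regular_isu] the nonzero ones would be units everywhere. *)
have reg w : AL w -> forall P, cl P -> P w.
  move=> Aw P cP; have [oP|oP] := pselect (over_oo P); last exact: AL_affine Aw _.
  have [x Ax ->] := AL_coord bb ((ring_ALP w).1 Aw).
  have sP := vr_sub (clv cP).
  apply: sr_sum => // l _; apply: srM => //; last by apply: curve_const; auto.
  by rewrite -[P _]/((jQ X @^-1` P) (x l)) oP; apply: Aoo.
have [[_ [n' [f [Af [a Aa e1] hf]]]] [tM _] _ _ _] := pM.
have [i fi0] : exists i, f i != 0.
  apply: contrapT => nf; have := oner_neq0 X; rewrite -e1 big1 ?eqxx // => i _.
  by apply/eqP; rewrite mulf_eq0; apply/orP; right; apply: contraT => h; case: nf; exists i.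
have [B uB hB] := hf i.
have fV : AL (f i)^-1.
  by apply/ring_ALP => P [cP _]; have [] := regular_isu fi0 (reg _ (Af i)) cP.
have fK m (v : 'rV[X]_(mo_rk M)) : (f i)^-1 ^+ m *: (f i ^+ m *: v) = v.
  by rewrite scalerA -exprMn mulVf // expr1n scale1r.
(* A nonzero localising function [f i] is invertible in A_L, so the local basis [B] is a global one,
   and [W] below is the matrix of tau in it. *)
have eM : mo_M M = rspan AL B.
  have [sM _ _ _ _] := pM; have [[_ _ sc] _] := sM.
  have [_ _ sc'] := rspan_submod B sAL.
  apply/seteqP; split=> v hv.
    have [m] := (hB v).1 (ex_intro _ 0%N (eq_ind_r (mo_M M) hv (scale1r v))).
    by rewrite free_on_rspan -{2}(fK m v) => hm; apply: sc' => //; apply: srX.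
  have [|m hm] := (hB v).2; first by exists 0%N; rewrite scale1r free_on_rspan.
  by rewrite -(fK m v); apply: sc => //; apply: srX.
pose T := mo_tau M; pose W := map_mx s B *m T *m invmx B.
have [m [l [N [eN h]]]] := pure_pmot pM; have uT : T \in unitmx := pm_T h.
have AW : mxover AL W.
  move=> i1 j1; have : mo_M M (row i1 (map_mx s B *m T)).
    apply: tM; exists (row i1 (map_mx s B)); last by rewrite row_mul.
    rewrite -map_row; apply: lspan_mem; first exact: sr1.
    by exists (row i1 B) => //; rewrite eM; apply: rspan_row.
  rewrite eM free_onP // -row_mul => /(_ 0 j1); by rewrite mxE.
have [P cP oP] := over_oo_ex X; have [t ut] := twist_unif cP.
have [A uA eA] := locally_free_stalk (pm_lf h) cP.
have rP := over_oo_closed_rational cP oP.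
have vs x : x != 0 -> vl P (s x) = vl P x by move=> x0; rewrite vl_sigma // preim_oo.
have Bs0 : \det B != 0 by apply: unit_det.
have As0 : \det A != 0 by apply: unit_det.
have T0 : \det T != 0 by apply: unit_det.
have W0 : \det W != 0 by rewrite !det_mulmx det_map_mx det_inv !mulf_neq0 ?invr_eq0 ?fmorph_eq0.
(* [sigma] preserves valuations at infinity, so [\det T] and [\det W] have the same valuation there,
   and [\det W] is regular. *)
have Tge : 0 <= vl P (\det T).
  have : P (\det W) by apply: reg => //; apply: mxover_det.
  rewrite (vl_ge0 ff cP W0) !det_mulmx det_map_mx det_inv !(vlM ff) ?(vlV ff) ?invr_eq0 ?mulf_neq0 ?fmorph_eq0 //.
  by rewrite vs // addrAC subrr add0r.
have vit l' x : x != 0 -> vl P (rmorph_iter s l' x) = vl P x.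
  move=> x0; elim: l' => // l' IH; rewrite -[rmorph_iter _ _ _]/(s (rmorph_iter s l' x)).
  by rewrite vs ?IH // fmorph_eq0.
have vtau l' : vl P (\det (taup T l')) = vl P (\det T) *+ l'.
  elim: l' => [|l' IH] /=; first by rewrite det1 (vl1 ff cP).
  have u0 : \det (taup T l') != 0 by apply: unit_det; apply: taup_unit.
  by rewrite det_mulmx det_map_mx (vlM ff) ?fmorph_eq0 // vs // IH mulrSr.
(* Comparing determinants in the purity condition gives [- m * r] as [l] times the valuation of
   [\det T]: a negative number. *)
have := pm_pure h cP oP; rewrite (iter_pullback_oo l cP oP eA) (twist_oo m cP oP ut eA) mximg_rspan.
have jt0 : jQ X t != 0 by rewrite fmorph_eq0; case: ut.
have ujt : jQ X t ^ (- m%:Z) *: A \in unitmx.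
  by rewrite unitmxZ // unitfE expfz_neq0.
have utau : map_mx (rmorph_iter s l) A *m taup T l \in unitmx.
  by rewrite unitmx_mul map_unitmx uA taup_unit.
move=> /(rspan_eq_val ff cP utau ujt).
rewrite det_mulmx det_map_mx detZ (vlM ff) // ?fmorph_eq0 //; last first.
  by apply: unit_det; apply: taup_unit.
rewrite (vlM ff) // ?expf_neq0 ?expfz_neq0 // vit // vtau addrC => /addIr.
have -> : jQ X t ^ (- m%:Z) = jQ X t ^- m by rewrite exprnN.
rewrite (vlX ff) ?invr_eq0 ?expf_neq0 // (vlV ff) ?expf_neq0 // (vlX ff) // => e.
have : 0 <= vl P (\det T) *+ l by apply: mulrn_wge0.
rewrite e mulNrn oppr_ge0 -mulrnA pmulrn_lle0; last by rewrite muln_gt0 (pm_m h) lt0n; apply/eqP.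
have [cP' _] := rP.
rewrite (vl_rational bb (closed_curve cP) (over_oo_rational oP)) //; last 2 first.
- exact: (curve_function_field C).
- by case: ut.
by rewrite (vl_uniformizer (jQ_preim_closed cP) ut).
Qed.

End PmotPure.

Lemma extend_scalars_trans (E0 E E' : fieldType) (f : {rmorphism E0 -> E}) (g : {rmorphism E -> E'})
    (R : set E) (R' : set E') r (M : set 'rV[E0]_r) : R 1 -> subring R' ->
  (forall x, R x -> R' (g x)) ->
  extend_scalars g R' (extend_scalars f R M) = lspan R' ((fun v => map_mx g (map_mx f v)) @` M).
Proof.
move=> R1 sR' gR; have sp := lspan_submod ((fun v => map_mx g (map_mx f v)) @` M) sR'.
apply/seteqP; split.
  apply: (lspan_min sp) => _ [w [n [a [v [h ->]]]] <-]; rewrite raddf_sum.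
  apply: (submod_sum sp) => i _; have [Ra [u Mu eu]] := h i; have [_ _ sc] := sp.
  rewrite /= map_mxZ -eu; apply: sc; first exact: gR.
  by apply: lspan_mem; [exact: sr1 | exists u].
apply: lspan_mono => // _ [v Mv <-]; exists (map_mx f v) => //.
by apply: lspan_mem => //; exists v.
Qed.

(** * Base change of motives *)

Section PmotExt.
Variables (k : finFieldType) (C : curve k) (L L' : finFieldType).
Variables (X : base_curve C L) (X' : base_curve C L') (e : base_ext X X').
Implicit Types (P : set X').
Local Notation cl' := (closed_point (jL X')).
Local Notation phi := (ext_fun e).
Let clv P : cl' P -> valring P := @closed_valring _ _ (jL X') P.
Let clc P : cl' P -> curve_point (jL X') P := @closed_curve _ _ (jL X') P.
#[local] Hint Resolve clv clc : core.
Let sAL := AL_subring X.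
Let sAL' := AL_subring X'.

Lemma ext_affine P : affine P -> affine (phi @^-1` P).
Proof. by move=> [cP oP]; split; [apply: ext_preim_closed | rewrite ext_over_oo]. Qed.

Lemma ext_AL x : ring_AL X x -> ring_AL X' (phi x).
Proof. by move=> /ring_ALP h; apply/ring_ALP => P aP; apply: (h _ (ext_affine aP)). Qed.

Lemma ext_tau_image r (T : 'M[X]_r) M :
  tau_image (map_mx phi T) (extend_scalars phi (ring_AL X') M) =
  extend_scalars phi (ring_AL X') (tau_image T M).
Proof.
rewrite /tau_image extend_scalars_img; congr mximg.
rewrite !extend_scalars_trans //; try exact: sr1; try exact: ext_AL.
  congr lspan; apply/seteqP; split=> _ [v Mv <-]; exists v => //; by rewrite map_ext_sigma.
move=> x /ring_ALP h; apply/ring_ALP => P [cP oP].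
by apply: (h (sigma X' @^-1` P)); split; [apply: sigma_preim_closed | rewrite preim_over_oo].
Qed.

Lemma ext_graph_gens (c : C -> L) y : graph_gens (X:=X') (@ring_A k C) (ext_L e \o c) y ->
  exists2 x, graph_gens (X:=X) (@ring_A k C) c x & y = phi x.
Proof.
move=> [u Au ->]; exists (jQ X u - jL X (c u)); first by exists u.
by rewrite rmorphB ext_fun_Q ext_fun_L.
Qed.

Section Basis.
Variables (Y : const_ext (jL X) (jL X')) (n : nat) (b : 'I_n -> L').
Hypotheses (eY : ce_phi Y = phi) (bb : ce_basis Y b).

Lemma ext_bcset r (M : set 'rV[X]_r) : submodule (ring_AL X) M ->
  extend_scalars phi (ring_AL X') M = bcset Y b M.
Proof.
move=> sM; rewrite /extend_scalars -eY; apply: lspan_bcset (sAL) _ _ _ _ _ _ => //.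
- by move=> a; apply: AL_const.
- by move=> a; apply: AL_const.
- by rewrite eY; apply: ext_AL.
move=> y /ring_ALP hy; have [x ey] := ce_coord bb y; exists x => // l.
apply/ring_ALP => Q [cQ oQ].
apply: (coord_regular bb (S := [set Q | ~ over_oo Q]) _ cQ oQ) => P cP oP.
by rewrite -ey; apply: hy; split=> //; rewrite -(ext_over_oo e) -eY.
Qed.

(** The coordinates of a section are combinations of its conjugates, which lie in the pulled-back
    stalk because the conjugate points all lie over the same [Q]. Membership of a coordinate in the
    stalk at [Q] can be tested at one point above. *)
Lemma Gamma_bcset r (N : sheaf X r) : locally_free (jL X) N ->
  Gamma (pullback phi N) = bcset Y b (Gamma N).
Proof.
move=> lf; apply/seteqP; split=> v.
  have [u ->] := ce_coord_rv bb v => hv; exists u => // m Q cQ oQ.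
  have [P [cP eP]] := lying_over bb cQ; rewrite eY in eP.
  have [D hD] := ce_moore_rv bb.
  have [B uB eB] := locally_free_stalk lf cQ; rewrite eB free_onP // => i j.
  suff : rspan P (map_mx phi B) (map_mx phi (u m)).
    rewrite free_onP ?map_unitmx // -map_invmx -map_mxM => /(_ i j).
    by rewrite mxE -eP.
  have sP := vr_sub (clv cP).
  rewrite -eY hD; apply: (submod_sum (rspan_submod _ sP)) => t _.
  have [_ _ sc] := rspan_submod (map_mx (ce_phi Y) B) sP.
  apply: sc; first by apply: curve_const; auto.
  set w := \sum_l _ in hv *.
  have cPt : cl' (spre Y t P) by apply: (spre_closed bb).
  have ePt : phi @^-1` (spre Y t P) = Q by rewrite -eY spre_preim eY.
  have := hv _ cPt; rewrite -(ext_over_oo e) ePt => /(_ oQ).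
  rewrite (ext_stalk (B := B) cPt) ?ePt // => -[a ha ->].
  exists (map_mx (rmorph_iter (ce_s Y) t) a).
    by move=> i' j'; rewrite mxE rmorph_iterE; apply: ha.
  have -> : map_mx (iter t (ce_s Y)) (a *m map_mx phi B) = map_mx (rmorph_iter (ce_s Y) t) (a *m map_mx phi B).
    by apply/matrixP => i' j'; rewrite !mxE rmorph_iterE.
  rewrite map_mxM; congr (_ *m _); apply/matrixP => i' j'.
  by rewrite !mxE rmorph_iterE -eY ce_iter_phi.
move=> [u hu ->] P cP oP.
have lf' := ext_locally_free e lf.
have sN := stalk_submod lf' cP.
apply: (submod_sum sN) => l _; have [_ _ sc] := sN; apply: sc; first by apply: curve_const; auto.
rewrite eY; apply: lspan_mem; first by apply: sr1; auto.
exists (u l) => //; apply: hu; first exact: ext_preim_closed.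
by rewrite ext_over_oo.
Qed.

End Basis.

Lemma Gamma_pullback r (N : sheaf X r) : locally_free (jL X) N ->
  Gamma (pullback phi N) = extend_scalars phi (ring_AL X') (Gamma N).
Proof.
move=> lf; have [Y [eY _ _]] := ce_ext_ex e; have [n [b bb]] := ce_basis_ex Y.
by rewrite (Gamma_bcset eY bb lf) (ext_bcset eY bb) //; apply: Gamma_submod.
Qed.

(** The dimension of the cokernel is preserved in coordinates by [has_codim_bc]. Annihilation is
    checked on the generators of the new ideal, which come from the old one, and purity is an
    equality of lattices at infinity. *)
Lemma pmot_ext c m l r d T (N : sheaf X r) : pmot c m l d T N ->
  pmot (ext_L e \o c) m l d (map_mx phi T) (pullback phi N).
Proof.
move=> h; have lf := pm_lf h; have sG := Gamma_submod lf.
have sI := tau_image_submod T (Gamma N).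
have eG := Gamma_pullback lf.
split; rewrite ?eG ?ext_tau_image.
- exact: pm_m h.
- exact: pm_l h.
- by rewrite map_unitmx; apply: pm_T h.
- exact: ext_locally_free.
- by apply: lspan_mono => // _ [v hv <-]; exists v => //; apply: pm_tau h _ hv.
- have [Y [eY _ _]] := ce_ext_ex e; have [n [b bb]] := ce_basis_ex Y.
  rewrite !(ext_bcset eY bb) //; apply: has_codim_bc => //; last exact: pm_co h.
  + exact: AL_const_submod.
  + exact: AL_const_submod.
- apply: (power_kills_span sAL') => //.
  + exact: lspan_submod.
  + exact: lspan_submod.
  + exact: graph_gens_AL.
  move=> x v hx; have /choice[y hy] i : exists y, graph_gens (X:=X) (@ring_A k C) c y /\ x i = phi y.
    by have [y] := ext_graph_gens (hx i); exists y.
  have -> : \prod_i x i = phi (\prod_i y i).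
    by rewrite rmorph_prod; apply: eq_bigr => i _; have [] := hy i.
  set z := \prod_i y i; have sI' := lspan_submod (map_mx phi @` tau_image T (Gamma N)) sAL'.
  have hz u : Gamma N u -> tau_image T (Gamma N) (z *: u).
    move=> Gu; apply: pm_kill h _ _ _ Gu => i; have [gy _] := hy i.
    by apply: lspan_mem => //; apply: sr1.
  suff : extend_scalars phi (ring_AL X') (Gamma N) `<=`
    [set v | extend_scalars phi (ring_AL X') (tau_image T (Gamma N)) (phi z *: v)] by apply.
  have [s0 sD sZ] := sI'; apply: lspan_min.
    split=> [|u w hu hw|a w Aa hw] /=; first by rewrite scaler0.
      by rewrite scalerDr; apply: sD.
    by rewrite scalerA mulrC -scalerA; apply: sZ.
  move=> _ [u Gu <-] /=; rewrite -map_mxZ; apply: lspan_mem; first exact: sr1.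
  by exists (z *: u) => //; apply: hz.
- move=> P cP oP; have cQ := ext_preim_closed e cP.
  have oQ : over_oo (phi @^-1` P) by rewrite ext_over_oo.
  have [B uB eB] := locally_free_stalk lf cQ; have [t ut] := twist_unif cQ.
  have eB' := ext_stalk (e := e) cP eB; have ut' : uniformizer (jQ X' @^-1` P) t by rewrite -(ext_preim_jQ e).
  rewrite (iter_pullback_oo l cP oP eB') (twist_oo m cP oP ut' eB') mximg_rspan.
  have := pm_pure h cQ oQ; rewrite (iter_pullback_oo l cQ oQ eB) (twist_oo m cQ oQ ut eB) mximg_rspan.
  have jt0 : jQ X t != 0 by rewrite fmorph_eq0; case: ut.
  move=> /(rspan_ext_eq (e := e) cP) hr.
  have -> : map_mx (rmorph_iter (sigma X') l) (map_mx phi B) *m taup (map_mx phi T) l =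
      map_mx phi (map_mx (rmorph_iter (sigma X) l) B *m taup T l).
    rewrite map_mxM; congr (_ *m _).
      apply/matrixP => i j; rewrite !mxE !rmorph_iterE.
      by elim: l {hr h} => //= l' ->; rewrite ext_sigma.
    by elim: l {hr h} => [|l' IH] /=; rewrite ?map_mx1 // map_mxM -map_ext_sigma IH.
  rewrite -(ext_fun_Q e) -fmorphXz -map_mxZ; apply: hr.
    by rewrite unitmx_mul map_unitmx uB taup_unit ?(pm_T h).
  by rewrite unitmxZ // unitfE expfz_neq0.
Qed.

End PmotExt.

Lemma mx_rows0 (E : Type) m n (A B : 'M[E]_(m, n)) : m = 0%N -> A = B.
Proof. by move=> m0; apply/matrixP => -[i lt]; exfalso; move: lt; rewrite m0. Qed.

(** * Simple and semisimple motives *)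

Section MotiveSimple.
Variables (k : finFieldType) (C : curve k) (L : finFieldType) (X : base_curve C L).
Variables (c : C -> L).
Local Notation cl := (closed_point (jL X)).
Local Notation AL := (ring_AL X).
Local Notation s := (sigma X).
Let clv P : cl P -> valring P := @closed_valring _ _ (jL X) P.
#[local] Hint Resolve clv : core.
Let ff := base_function_field X.

Lemma locally_free_row_full r r' (f : 'M[X]_(r, r')) S M : locally_free_module AL M ->
  M `<=` mximg f S -> row_full f.
Proof.
move=> [_ [n [g [Ag [a Aa e1] hg]]]] sub.
have [i gi0] : exists i, g i != 0.
  apply: contrapT => nf; have := oner_neq0 X; rewrite -e1 big1 ?eqxx // => i _.
  by apply/eqP; rewrite mulf_eq0; apply/orP; right; apply: contraT => h; case: nf; exists i.
have [B uB hB] := hg i.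
have sB : (B <= f)%MS.
  apply/row_subP => j; have [|m /sub[v _ ev]] := (hB (row j B)).2.
    by exists 0%N; rewrite scale1r free_on_rspan; apply: rspan_row; apply: AL_subring.
  rewrite -[row j B]scale1r -(mulVf (expf_neq0 m gi0)) -scalerA -ev.
  by apply: scalemx_sub; apply: submxMl.
by rewrite -sub1mx -(mulVmx uB); apply: submx_trans (submxMl _ _) sB.
Qed.

(** Applied to [S] itself, [pure_pole] supplies the function by which images of [S] are again pure
    motives; every generic quotient is then realised by such an image. *)
Lemma mo_simple_tsimple (S : motive X) : mo_simple c S -> tsimple s (mo_tau S).
Proof.
move=> [pS rS simS]; split; first by rewrite lt0n; apply/eqP.
move=> r' p T' fp eT; have [x0 Ax0 x0oo] := pure_pole pS rS.
have [m [l [N [eN h]]]] := pure_pmot pS.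
have [d' h'] := pmot_img Ax0 x0oo h fp eT.
have im : mximg p (mo_M S) = mo_M (mkmo d' T' (fun P => mximg p (N P))).
  by rewrite /= (Gamma_img Ax0 x0oo _ (pm_lf h)) eN.
have [||||[f [g [_ _ fg gf]]]] := simS (mkmo d' T' (fun P => mximg p (N P))) p.
- exact: pmot_pure Ax0 x0oo h'.
- by split; rewrite ?im.
- exact: im.
- by left.
- by right; apply: mx_inverse_dim fg gf.
Qed.

Lemma tsimple_mo_simple m l r d T (N : sheaf X r) (x0 : C) : ring_A x0 -> ~ oo x0 ->
  pmot c m l d T N -> tsimple s T -> mo_simple c (mkmo d T N).
Proof.
move=> Ax0 x0oo h [r0 simT]; split; first exact: pmot_pure Ax0 x0oo h.
  by apply/eqP; rewrite -lt0n.
move=> H f pH [hf eT] sf.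
have fp : row_full f.
  have [lfH _ _ _ _] := pH; apply: (locally_free_row_full (S := Gamma N) lfH).
  by rewrite -sf.
have [|e] := simT _ _ _ fp eT; [by left | right].
have [fg gf] := row_full_pinv fp e.
exists (pinvmx f), f; split=> //; split.
  by rewrite -sf mximg_comp fg mximg1.
move: (pinvmx f) fg gf => g fg gf.
by rewrite -[RHS]mulmx1 -fg /= mulmxA -[X in _ = X *m _]mulmxA eT mulmxA -map_mxM gf map_mx1 mul1mx.
Qed.

Definition mo_dec (H : motive X) := exists l : seq (qdata X (mo_rk H)),
  Forall_seq (fun x => tsimple s (qT x) /\ qhom s (mo_tau H) x) l /\
  forall v : 'rV_(mo_rk H), Forall_seq (fun x => v *m qm x = 0) l -> v = 0.

Lemma mo_dec_simple S : mo_simple c S -> mo_dec S.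
Proof.
move=> sS; exists [:: @QData _ _ _ 1%:M (mo_tau S)]; split.
  split=> //; split; first exact: mo_simple_tsimple.
  by rewrite /qhom /= mulmx1 map_mx1 mul1mx.
by move=> v [] /=; rewrite mulmx1.
Qed.

Lemma mo_dec_add F G : mo_dec F -> mo_dec G -> mo_dec (mo_add F G).
Proof.
move=> [lF [hF iF]] [lG [hG iG]].
pose A (x : qdata X (mo_rk F)) := @QData X (mo_rk (mo_add F G)) (qr x) (col_mx (qm x) 0) (qT x).
pose B (x : qdata X (mo_rk G)) := @QData X (mo_rk (mo_add F G)) (qr x) (col_mx 0 (qm x)) (qT x).
exists (map A lF ++ map B lG); split.
  apply/Forall_cat; split; apply/Forall_map.
    apply: Forall_imp hF => x [sx hx]; split=> //; rewrite /qhom /=.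
    by rewrite mul_block_col mulmx0 mul0mx addr0 mulmx0 addr0 hx map_col_mx raddf0 mul_col_mx mul0mx.
  apply: Forall_imp hG => x [sx hx]; split=> //; rewrite /qhom /=.
  by rewrite mul_block_col !mulmx0 mul0mx !add0r hx map_col_mx raddf0 mul_col_mx mul0mx.
move=> v /Forall_cat[/Forall_map h1 /Forall_map h2].
pose v0 : 'rV[X]_(mo_rk F + mo_rk G) := v.
have ev : v0 = row_mx (lsubmx v0) (rsubmx v0) by rewrite hsubmxK.
have l0 : lsubmx v0 = 0.
  apply: iF; apply: Forall_imp h1 => x hx.
  have : v0 *m col_mx (qm x) 0 = 0 by exact: hx.
  by rewrite {1}ev mul_row_col mulmx0 addr0.
have r0 : rsubmx v0 = 0.
  apply: iG; apply: Forall_imp h2 => x hx.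
  have : v0 *m col_mx 0 (qm x) = 0 by exact: hx.
  by rewrite {1}ev mul_row_col mulmx0 add0r.
by apply: etrans ev _; rewrite l0 r0 row_mx0.
Qed.

Lemma mo_dec_sum n (S : 'I_n -> motive X) : (forall j, mo_simple c (S j)) -> mo_dec (mo_sum S).
Proof.
move=> sS; rewrite /mo_sum; elim/big_ind: _ => [||j _].
- by exists [::]; split=> // v _; rewrite (thinmx0 v).
- exact: mo_dec_add.
- exact: mo_dec_simple.
Qed.

Lemma qhom_comm (M N : motive X) (f : 'M[X]_(mo_rk M, mo_rk N)) : mo_qhom f ->
  mo_tau M *m f = map_mx s f *m mo_tau N.
Proof.
move=> [a [_ a0 [_ e]]]; move: e; rewrite map_mxZ sigma_Q -scalemxAr -scalemxAl.
by apply: scalerI; rewrite fmorph_eq0.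
Qed.

Lemma semisimple_mo_dec F : mo_semisimple c F -> mo_dec F.
Proof.
move=> [_ [n [S [sS _ [f [g [qf _ fg _]]]]]]].
have [l [hl il]] := mo_dec_sum sS; set H := mo_sum S in l hl il f g qf fg.
have eT := qhom_comm qf.
exists (map (fun x => @QData X (mo_rk F) (qr x) (f *m qm x) (qT x)) l); split.
  apply/Forall_map; apply: Forall_imp hl => x [sx hx]; split=> //.
  by rewrite /qhom /= mulmxA eT -mulmxA hx mulmxA map_mxM.
move=> v /Forall_map h; have vf : v *m f = 0.
  by apply: il; apply: Forall_imp h => x /=; rewrite mulmxA.
by rewrite -[v]mulmx1 -fg mulmxA vf mul0mx.
Qed.

Lemma motive_sum_of_quotients m l r d T (N : sheaf X r) q (x0 : C) : ring_A x0 -> ~ oo x0 ->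
  pmot c m l d T N -> Forall_seq (fun x => tsimple s (qT x) /\ qhom s T x) q ->
  row_full (qm (qcomb q)) ->
  exists n (S : 'I_n -> motive X) d' (G : sheaf X (qr (qcomb q))),
  [/\ forall j, mo_simple c (S j), mo_sum S = mkmo d' (qT (qcomb q)) G,
      pmot c m l d' (qT (qcomb q)) G &
      forall P, mximg (qm (qcomb q)) (N P) `<=` G P].
Proof.
move=> Ax0 x0oo h; elim: q => [_ _|x q IH /= [[sx hx] hq] /row_full_row_mx[fx fq]].
  exists 0%N, (fun _ => mo_zero X), 0%N, (fun _ => setT); split=> //; first by case.
    by rewrite /mo_sum big_ord0 /mo_zero /mkmo; congr Motive; apply/esym/seteqP.
  by apply: pmot_zero; [apply: pm_m h | apply: pm_l h].
have [n [S [d1 [G [sS eS hG sub]]]]] := IH hq fq.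
have [dx h'] := pmot_img Ax0 x0oo h fx hx.
exists n.+1, (fun j => if unlift ord0 j is Some j' then S j'
   else mkmo dx (qT x) (fun P => mximg (qm x) (N P))).
exists (dx + d1)%N, (fun P => dsum (mximg (qm x) (N P)) (G P)); split.
- move=> j; case: unlift => [j'|]; first exact: sS.
  exact: tsimple_mo_simple Ax0 x0oo h' sx.
- rewrite /mo_sum big_ord_recl unlift_none.
  under eq_bigr => j _ do rewrite liftK.
  by rewrite -/(mo_sum S) eS mkmo_eq.
- exact: pmot_dsum.
- move=> P _ [v Lv <-]; rewrite mul_mx_row; split; rewrite ?row_mxKl ?row_mxKr; first by exists v.
  by apply: sub; exists v.
Qed.

(** Only finitely many affine points obstruct. The denominator has to lie in A rather than in A_L;
    as the residues of [x0] are algebraic over [k], a product of polynomials in [x0] vanishes at all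
    points of C below the obstructing ones, and a power of it suffices. *)
Lemma bounded_denominator r r' (N : sheaf X r) (H : sheaf X r') (g : 'M[X]_(r', r)) (x0 : C) :
  ring_A x0 -> ~ oo x0 -> locally_free (jL X) N -> locally_free (jL X) H ->
  exists a : C, [/\ ring_A a, a != 0 & mximg (jQ X a *: g) (Gamma H) `<=` Gamma N].
Proof.
move=> Ax0 x0oo lN lH; have ffC := curve_function_field C.
have fin : finite_set [set Q | affine Q /\ ~ mximg g (H Q) `<=` N Q].
  have [P0 cP0] := closed_ex X.
  have [U [B [_ fU uB hB]]] := (locally_freeP (jL X) H).2 lH P0 cP0.
  have [V [A [_ fV uA hA]]] := (locally_freeP (jL X) N).2 lN P0 cP0.
  apply: (@sub_finite_set _ _ ([set Q | cl Q /\ ~ U Q] `|` ([set Q | cl Q /\ ~ V Q] `|`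
    [set Q | cl Q /\ ~ mxover Q (B *m g *m invmx A)]))).
    move=> Q [[cQ _] nQ]; have [UQ|] := pselect (U Q); last by left.
    have [VQ|] := pselect (V Q); last by right; left.
    right; right; split=> // h; apply: nQ; rewrite hB // hA // mximg_rspan.
    by apply/rspan_subP; auto.
  by rewrite !finite_setU; do 2!split=> //; apply: finite_mx_poles.
have [n [R [hR cR]]] := finite_enum fin.
have tr : transc (@const k C) x0.
  apply: contrapT => nt; apply: x0oo; apply: algebraic_regular nt.
  by case: (oo_rational C).
have cQ (P : set X) : cl P -> closed_point (@const k C) (jQ X @^-1` P) by apply: jQ_preim_closed.
have x0P P : affine P -> (jQ X @^-1` P) x0 by move=> aP; apply: (AL_affine (AL_jQ X Ax0) aP).
have /choice[p hp] (i : nat) : exists p : {poly k}, p != 0 /\ ((i < n)%N ->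
    max_ideal (jQ X @^-1` (R i)) (map_poly const p).[x0]).
  have [lt|] := ltnP i n; last by exists 1; rewrite oner_eq0.
  have [aR _] := hR i lt.
  have [p p0 mp] := residue_algebraic ffC (cQ _ (affine_closed aR)) (x0P _ aR).
  by exists p.
pose u := (map_poly const (\prod_(i < n) p i)).[x0].
have u0 : u != 0.
  apply/eqP => /tr/eqP; apply/negP; apply/prodf_neq0 => i _; by have [] := hp i.
have Au : ring_A u.
  move=> P cP nP; apply: ev_point; first by case: cP.
  exact: Ax0.
have mu i : (i < n)%N -> max_ideal (R i) (jQ X u).
  move=> lt; have [aR _] := hR i lt; have cRi := cQ _ (affine_closed aR).
  apply/(mi_preim (ce_base X)); rewrite /u (bigD1 (Ordinal lt)) //= evM.
  apply: miMr; [exact/vr_sub/closed_valring/cRi | | exact: (hp i).2].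
  by apply: ev_point (x0P _ aR); case: cRi.
have [M hM] : exists M, forall i, (i < n)%N -> mximg (jQ X u ^+ M *: g) (H (R i)) `<=` N (R i).
  apply: (max_ev (A := fun i m => mximg (jQ X u ^+ m *: g) (H (R i)) `<=` N (R i))) => i lt.
  have [aR _] := hR i lt; have cRi := affine_closed aR.
  have [B uB eB] := locally_free_stalk lH cRi; have [A uA eA] := locally_free_stalk lN cRi.
  have [M hM] := rank_one_mx ff (B *m g *m invmx A) cRi (mu i lt).
  exists M => m le; rewrite eB eA mximg_rspan; apply/rspan_subP; auto.
  rewrite -scalemxAr -scalemxAl -(subnK le) exprD -scalerA => i0 l0.
  rewrite mxE; apply: srM; auto; apply: srX; auto; exact: mi_sub (mu i lt).
have sA : subring (@ring_A k C).
  split=> [P cP nP|x y hx hy P cP nP|x y hx hy P cP nP]; have sP := vr_sub (closed_valring cP).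
  - exact: sr1.
  - by apply: srB; [|apply: hx|apply: hy].
  - by apply: srM; [|apply: hx|apply: hy].
exists (u ^+ M); split; [exact: (srX M sA Au) | exact: expf_neq0 |].
move=> _ [v Hv <-] P cP oP; have aP : affine P by split.
have HP := Hv P cP oP; rewrite rmorphXn.
have [sub|ns] := pselect (mximg g (H P) `<=` N P); last first.
  by have [i lt eP] := cR P (conj aP ns); rewrite -eP; apply: hM => //; exists v; rewrite ?eP.
have [_ _ sc] := stalk_submod lN cP; rewrite -scalemxAr; apply: sc; last by apply: sub; exists v.
apply: srX; auto; exact: (AL_affine (AL_jQ X Au)).
Qed.

Lemma rank0_semisimple (M : motive X) : mo_rk M = 0%N -> mo_dim M = 0%N ->
  mo_M M 0 -> mo_semisimple c M.
Proof.
move=> r0 d0 M0; split; first exact: rank0_pure.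
exists 0%N, (fun _ => mo_zero X); rewrite /mo_sum big_ord0; split; [by case | exact: rank0_pure |].
have A1 : ring_A (1 : C) by move=> P /closed_valring/vr_sub sP _; apply: (sr1 sP).
exists 0, 0; split; last 2 first.
- exact: mx_rows0.
- exact: mx_rows0.
- exists 1; rewrite oner_neq0; split=> //; split=> //; exact: mx_rows0.
- exists 1; rewrite oner_neq0; split=> //; split; last exact: mx_rows0.
  by move=> _ [v _ <-]; rewrite scaler0 mulmx0.
Qed.

End MotiveSimple.

Section MotiveBaseChange.
Variables (k : finFieldType) (C : curve k) (L L' : finFieldType).
Variables (X : base_curve C L) (X' : base_curve C L') (e : base_ext X X').

Theorem mo_semisimple_base_change (c : C -> L) (M : motive X) :
  mo_semisimple c M -> mo_semisimple (ext_L e \o c) (mo_base_change e M).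
Proof.
move=> ssM; have [pM _] := ssM.
(* Rank 0 is split off because [pure_pole] draws its function from a motive of positive rank. *)
have [r0|r0] := pselect (mo_rk M = 0%N).
  apply: rank0_semisimple => //; first exact: (rank0_dim pM).
  by have [] := lspan_submod (map_mx (ext_fun e) @` mo_M M) (AL_subring X').
have [x0 Ax0 x0oo] := pure_pole pM r0.
have [q [hq iq]] := semisimple_mo_dec ssM.
have [m [l [N [eN h]]]] := pure_pmot pM; have h' := pmot_ext e h.
pose T' := map_mx (ext_fun e) (mo_tau M).
have eM' : mo_base_change e M = mkmo (mo_dim M) T' (pullback (ext_fun e) N).
  by rewrite /mo_base_change /mkmo Gamma_pullback ?eN //; apply: pm_lf h.
have [Y [eY _ [n0 eN0]]] := ce_ext_ex e.
have comm x : ce_s Y (sigma X' x) = sigma X' (ce_s Y x).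
  by rewrite !eN0 -iterSr.
have [q' [hq' fq' iq' homq']] : exists q' : seq (qdata X' (mo_rk M)),
  [/\ Forall_seq (fun x => tsimple (sigma X') (qT x) /\ qhom (sigma X') T' x) q',
      row_full (qm (qcomb q')), row_free (qm (qcomb q')) &
      qhom (sigma X') T' (qcomb q')].
  rewrite /T' -eY; apply: (semisimple_descent _ comm hq iq) => x.
  by rewrite eY ext_sigma.
rewrite eM'; split; first exact: pmot_pure Ax0 x0oo h'.
have [n [S [d' [G [sS eS hG sub]]]]] := motive_sum_of_quotients Ax0 x0oo h' hq' fq'.
exists n, S; rewrite eS; split=> //; first exact: pmot_pure Ax0 x0oo hG.
have rkE : mo_rk M = qr (qcomb q') := row_full_free_dim fq' iq'.
pose f := qm (qcomb q'); have [fg gf] := row_full_pinv fq' (esym rkE).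
(* The joint projection maps sections to sections as it stands; its inverse over the function field
   is the map that requires a denominator. *)
have [a [Aa a0 ha]] := bounded_denominator (pinvmx f) Ax0 x0oo (pm_lf h') (pm_lf hG).
exists f, (pinvmx f); split=> //.
  exists 1; rewrite oner_neq0 rmorph1 scale1r; split=> //.
    by move=> P /closed_valring/vr_sub sP _; apply: (sr1 sP).
  by split=> // _ [v hv <-] P cP oP; apply: sub; exists v => //; apply: hv.
exists a; split=> //; split=> //=; rewrite map_mxZ sigma_Q -scalemxAr -scalemxAl; congr (_ *: _).
rewrite -[LHS]mul1mx -(map_mx1 (sigma X')) -gf map_mxM -!mulmxA; congr (_ *m _).
by rewrite mulmxA -homq' -mulmxA fg mulmx1.
Qed.

End MotiveBaseChange.

Theorem corollary6p16 (k : finFieldType) (C : curve k) (L L' : finFieldType)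
  (X : base_curve C L) (X' : base_curve C L') (e : base_ext X X') :
  (forall (eps : set C) (c : C -> L) (F : tsheaf X),
      sheaf_char X eps c -> eps <> oo ->
      abelian_tsheaf eps c F ->
      ts_semisimple eps c F ->
      ts_semisimple eps (ext_L e \o c) (ts_base_change e F)) /\
  (forall (c : C -> L) (M : motive X),
      motive_char X c ->
      pure_motive c M ->
      mo_semisimple c M ->
      mo_semisimple (ext_L e \o c) (mo_base_change e M)).
Proof.
split=> [eps c F _ eps_oo _ | c M _ _]; first exact: ts_semisimple_base_change.
exact: mo_semisimple_base_change.
Qed.
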